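(* Let $G=\mathrm{G}_2(F)$ and $\mathfrak{s}=[T,\chi\otimes\chi]_G$ with $\chi$ a ramified quadratic character of $F^\times$, so that $W^{\mathfrak{s}}=\{e,a,r^3,ar^3\}\cong\mathbb{Z}/2\mathbb{Z}\times\mathbb{Z}/2\mathbb{Z}$. Then $$T^\vee/\!/W^{\mathfrak{s}}=(pt_1\sqcup pt_2)\sqcup\mathbb{A}^1\sqcup\mathbb{A}^1\sqcup(T^\vee/W^{\mathfrak{s}}\sqcup pt_* ),$$ $$E^{\mathfrak{s}}/\!/W^{\mathfrak{s}}=(pt_1\sqcup pt_2)\sqcup\mathbb{I}\sqcup\mathbb{I}\sqcup(E^{\mathfrak{s}}/W^{\mathfrak{s}}\sqcup pt_* ).$$ Moreover, there is a ring isomorphism $\mathbb{C}[T^\vee/W^{\mathfrak{s}}]\cong\mathbb{C}[X,Y]_0$, where $\mathbb{C}[X,Y]_0$ denotes the coordinate ring of the quotient of $\mathbb{A}^2$ by the action of $\mathbb{Z}/2\mathbb{Z}$ which reverses each vector. Finally, $J^{\mathfrak{s}}\asymp\mathcal{O}(T^\vee/\!/W^{\mathfrak{s}})$, where $$J^{\mathfrak{s}}_{\mathbf{e}_e}\sim_{morita}\mathcal{O}((T^\vee/\!/W^{\mathfrak{s}})_{\mathbf{e}_e}),\quad J^{\mathfrak{s}}_{\mathbf{e}_1}\sim_{morita}\mathcal{O}((T^\vee/\!/W^{\mathfrak{s}})_{\mathbf{e}_1}),\quad J^{\mathfrak{s}}_{\mathbf{e}_1'}\sim_{morita}\mathcal{O}((T^\vee/\!/W^{\mathfrak{s}})_{\mathbf{e}_1'}),$$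 $$J^{\mathfrak{s}}_{\mathbf{e}_0}\asymp\mathcal{O}((T^\vee/\!/W^{\mathfrak{s}})_{\mathbf{e}_0}).$$
   Context: **Setting.** $F$ is a nonarchimedean local field of residue characteristic $p\neq2,3,5$. $\mathrm{G}_2$ has simple roots $\alpha$ (short), $\beta$ (long), and $T\cong F^\times\times F^\times$ via $(2\alpha+\beta,\alpha+\beta)$. $T^\vee\cong(\mathbb{C}^\times)^2$ is the dual torus (unramified characters of $T$), with maximal compact subgroup $E^{\mathfrak{s}}$. The Weyl group $W$ is generated by $a=s_\alpha$, $b=s_\beta$, acting on $T^\vee$ by $a(z_1,z_2)=(z_2,z_1)$, $b(z_1,z_2)=(z_1z_2,z_2^{-1})$; $r=ba$, and $r^3(z_1,z_2)=(z_1^{-1},z_2^{-1})$. $W^{\mathfrak{s}}$ is the subgroup of $w\in W$ with $w\cdot(\chi\otimes\chi)$ an unramified twist of $\chi\otimes\chi$. **Extended quotient.** For a group $\Gamma$ acting on $X$, $X/\!/\Gamma=\{(w,t):wt=t\}/\Gamma$ with $\Gamma$ acting by $v(w,t)=(vwv^{-1},vt)$; $X^w/Z(w)$ is the part coming from the class of $w$, $Z(w)$ the centralizer of $w$. $\mathbb{I}$ is the unit interval. $\mathbb{A}^1$ is the complex affine line. **Group $H^{\mathfrak{s}}$ and cells.** $H^{\mathfrak{s}}\cong\mathrm{SO}(4,\mathbb{C})\cong(\mathrm{SL}(2,\mathbb{C})\times\mathrm{SL}(2,\mathbb{C}))/\langle(-I,-I)\rangle$ is the complex reductive group with maximal torus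 $T^\vee$, Weyl group $W^{\mathfrak{s}}$ and roots $\Phi^{\mathfrak{s}}=\{\pm\alpha^\vee,\pm(3\alpha+2\beta)^\vee\}\subset X(T^\vee)$. $\widetilde W^{\mathfrak{s}}_{\mathrm a}=W^{\mathfrak{s}}\ltimes X(T^\vee)$ has four two-sided cells: the highest $\mathbf{e}_e$ (elements of length $0$), two intermediate ones $\mathbf{e}_1,\mathbf{e}_1'$, and the lowest $\mathbf{e}_0$; they correspond to the four unipotent classes of $H^{\mathfrak{s}}$. The partition of $T^\vee/\!/W^{\mathfrak{s}}$ is defined by $(T^\vee/\!/W^{\mathfrak{s}})_{\mathbf{e}_e}=pt_1\sqcup pt_2$, $(T^\vee/\!/W^{\mathfrak{s}})_{\mathbf{e}_1}=(T^\vee)^a/Z(a)$, $(T^\vee/\!/W^{\mathfrak{s}})_{\mathbf{e}_1'}=(T^\vee)^{ar^3}/Z(ar^3)$, $(T^\vee/\!/W^{\mathfrak{s}})_{\mathbf{e}_0}=T^\vee/W^{\mathfrak{s}}\sqcup pt_*$, where $pt_1=(1,1)$, $pt_2=(-1,-1)$, $pt_*=(1,-1)\sim(-1,1)$ are the three points of $(T^\vee)^{r^3}/Z(r^3)$. **Asymptotic algebra.** Write $\widetilde W^{\mathfrak{s}}_{\mathrm a}=W^{\mathfrak{s}}_{\mathrm a}\ltimes C$, with $W^{\mathfrak{s}}_{\mathrm a}=W^{\mathfrak{s}}\ltimes\mathbb{Z}\Phi^{\mathfrak{s}}$ a Coxeter group with simple reflections $S$ and $C$ the length-zero elements (length extended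 by $\ell(wc)=\ell(w)$). Its generic Hecke algebra over $\mathbb{C}[\boldsymbol\tau^{\pm1}]$ has basis $T_w$, with $T_wT_{w'}=T_{ww'}$ if lengths add and $(T_s-\boldsymbol\tau)(T_s+\boldsymbol\tau^{-1})=0$ for $s\in S$. Let $C_w=\sum_yP_{y,w}T_y$ ($P_{w,w}=1$, $P_{y,w}\in\boldsymbol\tau^{-1}\mathbb{Z}[\boldsymbol\tau^{-1}]$ for $y\neq w$) be the bar-invariant Kazhdan–Lusztig basis, $C_xC_y=\sum_wh_{x,y,w}C_w$; $a(w)$ is the least integer $\ge 0$ with $h_{x,y,w}\in\boldsymbol\tau^{a(w)}\mathbb{Z}[\boldsymbol\tau^{-1}]$ for all $x,y$; $\gamma_{x,y,w^{-1}}$ is the coefficient of $\boldsymbol\tau^{a(w)}$ in $h_{x,y,w}$. $J^{\mathfrak{s}}$ is the $\mathbb{C}$-algebra with basis $(t_w)$ and product $t_xt_y=\sum_w\gamma_{x,y,w^{-1}}t_w$; its unit is $\sum_{d\in\mathcal{D}}t_d$ for a finite set $\mathcal{D}$. For a two-sided cell $\mathbf{c}$, $J^{\mathfrak{s}}_{\mathbf{c}}$ is the two-sided ideal spanned by $t_w$, $w\in\mathbf{c}$, and $J^{\mathfrak{s}}=\bigoplus_{\mathbf{c}}J^{\mathfrak{s}}_{\mathbf{c}}$. Let $k=\mathcal{O}(T^\vee/W^{\mathfrak{s}})=\mathbb{C}[X(T^\vee)]^{W^{\mathfrak{s}}}$, the centre of $\mathbb{C}[\widetilde W^{\mathfrak{s}}_{\mathrm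 a}]$ (the Hecke algebra at $\boldsymbol\tau=1$). $J^{\mathfrak{s}}$ and $J^{\mathfrak{s}}_{\mathbf{c}}$ are $k$-algebras via Lusztig's homomorphism $\phi_1\colon\mathbb{C}[\widetilde W^{\mathfrak{s}}_{\mathrm a}]\to J^{\mathfrak{s}}$, $C_w\mapsto\sum_{d\in\mathcal{D},\,a(z)=a(d)}h_{w,d,z}|_{\boldsymbol\tau=1}t_z$. Coordinate algebras of (pieces of) $T^\vee/\!/W^{\mathfrak{s}}$ are $k$-algebras via $(w,t)\mapsto t$. **Equivalences.** $\sim_{morita}$ is Morita equivalence of $\mathbb{C}$-algebras. $\asymp$ (geometrical equivalence) is the equivalence relation on finite type $k$-algebras ($k$-algebras finitely generated as $k$-modules) generated by: (i) Morita equivalence of $k$-algebras; (ii) $k$-algebra morphisms $f\colon A\to B$ that are spectrum-preserving with respect to filtrations, i.e. there are filtrations by two-sided ideals $0=I_0\subset\dots\subset I_r=A$, $0=J_0\subset\dots\subset J_r=B$ with $f(I_j)\subset J_j$ and each $I_j/I_{j-1}\to J_j/J_{j-1}$ spectrum-preserving (each primitive ideal $P$ of the target has a unique primitive ideal of the source containing its preimage, and the resulting map of primitive ideal spaces is bijective); (iii) deformation of central character: for a unital algebra $A$ and unital $\Psi\colon k\to\text{centre}(A[t,t^{-1}])$, passing between two of the finite type $k$-algebras $A_\zeta$ ($\zeta\in\mathbb{C}^\times$), where $A_\zeta=A$ with $\omega\cdot a=\Psi(\omega)|_{t=\zeta}a$. *)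

(* Defs.v *)
From HB Require Import structures.
From mathcomp Require Import all_boot all_order all_algebra all_fingroup.
From mathcomp Require Import complex.
From mathcomp Require Import all_classical all_reals topology.
From Stdlib Require Import Relation_Operators.

Set Implicit Arguments.
Unset Strict Implicit.
Unset Printing Implicit Defensive.

Import Order.TTheory GRing.Theory Num.Theory.
Import numFieldTopology.Exports.

Local Open Scope classical_set_scope.
Local Open Scope ring_scope.
Local Open Scope quotient_scope.

Definition finsupp (I : Type) (A : pzRingType) (f : I -> A) :=
  finite_set [set i | f i != 0].

Section FinitelySupported.
Variables (I : choiceType) (A : pzRingType).

Definition finsuppb : pred (I -> A^o) := fun f => `[< @finsupp I A f >].

Lemma finsupp_submod : subsemimod_closed finsuppb.
Proof.
split; first split.
- apply/asboolP; rewrite /finsupp (_ : mkset _ = set0) //.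
  by apply/seteqP; split => i //=; rewrite eqxx.
- move=> f g /asboolP hf /asboolP hg; apply/asboolP.
  have hfg : finite_set ([set i | (f i : A) != 0] `|` [set i | (g i : A) != 0]).
    by rewrite finite_setU.
  apply: sub_finite_set hfg => i /= hi.
  apply/orP; apply: contraNT hi; rewrite negb_or !negbK => /andP[/eqP fi /eqP gi].
  by apply/eqP; rewrite /GRing.add /= fi gi addr0.
- move=> a f /asboolP hf; apply/asboolP; apply: sub_finite_set hf => i /=.
  apply: contraNN => /eqP fi; apply/eqP.
  by rewrite /GRing.scale /= fi; apply: mulr0.
Qed.

Definition fsfunc := {f : I -> A^o | finsuppb f}.
HB.instance Definition _ := [isSub of fsfunc for sval].
HB.instance Definition _ := [Choice of fsfunc by <:].
HB.instance Definition _ :=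
  GRing.SubChoice_isSubLmodule.Build A (I -> A^o) finsuppb fsfunc finsupp_submod.

Definition coeff (f : fsfunc) (i : I) : A := val f i.

Lemma coeffP (f : fsfunc) : finsupp (coeff f).
Proof. exact/asboolP/(valP f). Qed.

Definition mk_fsfunc (f : I -> A) (hf : finsupp f) : fsfunc :=
  Sub (f : I -> A^o) (asboolT hf).

Lemma mk_fsfuncE f (hf : finsupp f) : coeff (mk_fsfunc hf) = f.
Proof. by rewrite /coeff SubK. Qed.

Lemma coeff_inj : injective coeff.
Proof. by move=> f g h; apply: val_inj. Qed.

Lemma coeffD (f g : fsfunc) i : coeff (f + g) i = coeff f i + coeff g i.
Proof. by []. Qed.
End FinitelySupported.

Section Laurent.
Variable A : pzRingType.

Definition laurent := fsfunc int A.
HB.instance Definition _ := GRing.Lmodule.on laurent.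

Implicit Types f g h : laurent.

Definition conv (f g : int -> A) (n : int) : A :=
  \sum_(i \in setT) f i * g (n - i).

Let covers (s : seq int) (f : int -> A) := uniq s /\ forall i, i \notin s -> f i = 0.

Let cover f : exists s, covers s (coeff f).
Proof.
have /finite_seqP[s hs] := coeffP f.
exists (undup s); split; first exact: undup_uniq.
move=> i; rewrite mem_undup => his; apply/eqP; apply: contraNT his => fi.
by have : [set i | coeff f i != 0] i by []; rewrite hs.
Qed.

Let fsum_seq (s : seq int) (F : int -> A) :
  uniq s -> (forall i, i \notin s -> F i = 0) ->
  \sum_(i \in setT) F i = \sum_(i <- s) F i.
Proof.
move=> us h; rewrite (fsbigE s) //=; last by move=> i _; exact: h.
by apply: eq_bigl => i; rewrite in_setT.
Qed.

Let convE s f (g : int -> A) n : covers s (coeff f) ->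
  conv (coeff f) g n = \sum_(i <- s) coeff f i * g (n - i).
Proof. by case=> us h; apply: fsum_seq => // i /h ->; rewrite mul0r. Qed.

Let conv_supp sf sg f g k : covers sf (coeff f) -> covers sg (coeff g) ->
  k \notin [seq i + j | i <- sf, j <- sg] -> conv (coeff f) (coeff g) k = 0.
Proof.
move=> cf cg hk; rewrite (convE _ _ cf) big_seq big1 // => i hi.
rewrite (proj2 cg) ?mulr0 //; apply: contra hk => hj.
by apply/allpairsP; exists (i, k - i); split=> //=; rewrite addrC subrK.
Qed.

Let conv_finsupp f g : finsupp (conv (coeff f) (coeff g)).
Proof.
have [sf cf] := cover f; have [sg cg] := cover g.
apply: (@sub_finite_set _ _ [set` [seq i + j | i <- sf, j <- sg]]); last first.
  exact: finite_seq.
move=> k /=; apply: contraNT => hk; apply/eqP; exact: conv_supp cf cg hk.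
Qed.

Definition lmul f g : laurent := mk_fsfunc (@conv_finsupp f g).

Let lmulE f g n : coeff (lmul f g) n = conv (coeff f) (coeff g) n.
Proof. by rewrite /lmul mk_fsfuncE. Qed.

Definition monom_fun (a : A) (m n : int) : A := if n == m then a else 0.

Let monom_finsupp a m : finsupp (monom_fun a m).
Proof.
apply: (@sub_finite_set _ _ [set m]); last exact: finite_set1.
by by move=> n /=; rewrite /monom_fun; have [->|_] := eqVneq n m; rewrite ?eqxx.
Qed.

(* [lmonom a m] is [a * t ^ m]. *)
Definition lmonom (a : A) (m : int) : laurent := mk_fsfunc (monom_finsupp a m).

Let lmonomE a m n : coeff (lmonom a m) n = if n == m then a else 0.
Proof. by rewrite /lmonom mk_fsfuncE. Qed.

Let lmonom_cover a m : covers [:: m] (coeff (lmonom a m)).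
Proof.
split=> // i; rewrite inE lmonomE => /negPf ->; by [].
Qed.

Let lmulA : associative lmul.
Proof.
move=> f g h; apply: coeff_inj; apply/funext => n; rewrite !lmulE.
have [sf cf] := cover f; have [sg cg] := cover g.
pose U := undup [seq i + j | i <- sf, j <- sg].
have cU : covers U (coeff (lmul f g)).
  split; first exact: undup_uniq.
  move=> k; rewrite mem_undup lmulE; exact: conv_supp cf cg.
rewrite (convE _ _ cf) (convE _ _ cU).
transitivity (\sum_(i <- sf) \sum_(k <- U)
    coeff f i * (coeff g (k - i) * coeff h (n - k))); last first.
  rewrite exchange_big /=; apply: eq_bigr => k _.
  rewrite lmulE (convE _ _ cf) mulr_suml.
  by apply: eq_bigr => i _; rewrite mulrA.
rewrite big_seq [RHS]big_seq; apply: eq_bigr => i hi.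
rewrite -mulr_sumr; congr (_ * _); rewrite lmulE /conv.
rewrite -(@fsum_seq U) ?undup_uniq //; last first.
  move=> k hk; rewrite (proj2 cg) ?mul0r //; apply: contra hk => hki.
  rewrite mem_undup; apply/allpairsP; exists (i, k - i); split=> //=.
  by rewrite addrC subrK.
rewrite [RHS](reindex_fsbigT (fun j : int => i + j)) /=; last first.
  exists (fun k => k - i) => k; first by rewrite addrC addKr.
  by rewrite addrC subrK.
apply: eq_fsbigr => j _.
by rewrite [i + j]addrC addrK opprD [- j - i]addrC addrA.
Qed.

Let lmul1l : left_id (lmonom 1 0) lmul.
Proof.
move=> f; apply: coeff_inj; apply/funext => n.
by rewrite lmulE (convE _ _ (lmonom_cover 1 0)) big_seq1 lmonomE eqxx mul1r subr0.
Qed.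

Let lmul1r : right_id (lmonom 1 0) lmul.
Proof.
move=> f; apply: coeff_inj; apply/funext => n; rewrite lmulE.
rewrite /conv (@fsum_seq [:: n]) //; first by rewrite big_seq1 lmonomE subrr eqxx mulr1.
by move=> i; rewrite inE lmonomE subr_eq0 eq_sym => /negPf ->; rewrite mulr0.
Qed.

Let lmulDl : left_distributive lmul +%R.
Proof.
move=> f g h; apply: coeff_inj; apply/funext => n; rewrite coeffD !lmulE.
have [sf cf] := cover f; have [sg cg] := cover g.
pose U := undup (sf ++ sg).
have uU : uniq U by exact: undup_uniq.
have cfU : covers U (coeff f).
  by split=> // i; rewrite mem_undup mem_cat negb_or => /andP[hi _]; exact: (proj2 cf).
have cgU : covers U (coeff g).
  by split=> // i; rewrite mem_undup mem_cat negb_or => /andP[_ hi]; exact: (proj2 cg).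
have cfgU : covers U (coeff (f + g)).
  by split=> // i hi; rewrite coeffD (proj2 cfU) // (proj2 cgU) // addr0.
rewrite (convE _ _ cfU) (convE _ _ cgU) (convE _ _ cfgU) -big_split /=.
by apply: eq_bigr => i _; rewrite coeffD mulrDl.
Qed.

Let lmulDr : right_distributive lmul +%R.
Proof.
move=> f g h; apply: coeff_inj; apply/funext => n; rewrite coeffD !lmulE.
have [sf cf] := cover f.
rewrite !(convE _ _ cf) -big_split /=.
by apply: eq_bigr => i _; rewrite coeffD mulrDr.
Qed.

HB.instance Definition _ := GRing.Zmodule_isPzRing.Build laurent
  lmulA lmul1l lmul1r lmulDl lmulDr.
End Laurent.

Section ComLaurent.
Variable A : comPzRingType.

Let lmulC : commutative (@GRing.mul (laurent A)).
Proof.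
move=> f g; apply: coeff_inj; apply/funext => n.
rewrite /GRing.mul /= /lmul !mk_fsfuncE /conv.
rewrite (reindex_fsbigT (fun j : int => n - j)) /=; last first.
  by exists (fun j => n - j) => j; rewrite subKr.
by apply: eq_fsbigr => i _; rewrite subKr mulrC.
Qed.

HB.instance Definition _ := GRing.PzRing_hasCommutativeMul.Build (laurent A) lmulC.
End ComLaurent.

(* An associative algebra over k which need not be unital. *)
Record kalg (k : comPzRingType) := Kalg {
  kcar :> lmodType k;
  kmul : kcar -> kcar -> kcar;
  kmulA : associative kmul;
  kmulDl : left_distributive kmul +%R;
  kmulDr : right_distributive kmul +%R;
  kmulZl : forall (c : k) x y, kmul (c *: x) y = c *: kmul x y;
  kmulZr : forall (c : k) x y, kmul x (c *: y) = c *: kmul x y }.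

Notation "x ** y" := (kmul x y) (at level 40, left associativity).

Section Algebras.
Variable k : comPzRingType.
Implicit Types A B : kalg k.

Definition is_kunit A (e : A) := forall x : A, e ** x = x /\ x ** e = x.

Definition unital A := exists e : A, is_kunit e.

Definition finite_type A :=
  exists s : seq A, forall x, exists c : A -> k, x = \sum_(y <- s) c y *: y.

Definition kalg_morph A B (f : A -> B) :=
  [/\ forall x y, f (x + y) = f x + f y,
      forall (c : k) x, f (c *: x) = c *: f x &
      forall x y, f (x ** y) = f x ** f y].

Record ideal A := Ideal {
  iset :> A -> Prop;
  ideal0 : iset 0;
  idealD : forall x y, iset x -> iset y -> iset (x + y);
  idealZ : forall (c : k) x, iset x -> iset (c *: x);
  idealMl : forall x y, iset y -> iset (x ** y);
  idealMr : forall x y, iset x -> iset (x ** y) }.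

Definition ideal_pred A (I : ideal A) : pred A := fun x => x \in (iset I : set A).

Lemma ideal_submod A (I : ideal A) : subsemimod_closed (ideal_pred I).
Proof.
split; first split.
- by apply/mem_set; exact: ideal0.
- by move=> x y /set_mem hx /set_mem hy; apply/mem_set; exact: idealD.
- by move=> c x /set_mem hx; apply/mem_set; exact: idealZ.
Qed.

Section IdealAlgebra.
Variables (A : kalg k) (I : ideal A).

Definition ideal_car := {x : A | ideal_pred I x}.
HB.instance Definition _ := [isSub of ideal_car for sval].
HB.instance Definition _ := [Choice of ideal_car by <:].
HB.instance Definition _ := GRing.SubChoice_isSubLmodule.Build
  k A (ideal_pred I) ideal_car (ideal_submod I).

Definition ideal_mul (x y : ideal_car) : ideal_car :=
  Sub (val x ** val y) (mem_set (idealMl (val x) (set_mem (valP y)))).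

Lemma ideal_mulE x y : val (ideal_mul x y) = val x ** val y.
Proof. by []. Qed.

Lemma ideal_mulA : associative ideal_mul.
Proof. by move=> x y z; apply: val_inj; rewrite !ideal_mulE kmulA. Qed.
Lemma ideal_mulDl : left_distributive ideal_mul +%R.
Proof. by move=> x y z; apply: val_inj; rewrite raddfD !ideal_mulE raddfD kmulDl. Qed.
Lemma ideal_mulDr : right_distributive ideal_mul +%R.
Proof. by move=> x y z; apply: val_inj; rewrite raddfD !ideal_mulE raddfD kmulDr. Qed.
Lemma ideal_mulZl (c : k) x y : ideal_mul (c *: x) y = c *: ideal_mul x y.
Proof. by apply: val_inj; rewrite linearZ !ideal_mulE linearZ /= kmulZl. Qed.
Lemma ideal_mulZr (c : k) x y : ideal_mul x (c *: y) = c *: ideal_mul x y.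
Proof. by apply: val_inj; rewrite linearZ !ideal_mulE linearZ /= kmulZr. Qed.

Definition kalg_of_ideal : kalg k :=
  Kalg ideal_mulA ideal_mulDl ideal_mulDr ideal_mulZl ideal_mulZr.
End IdealAlgebra.

(* An A-B-bimodule P and a B-A-bimodule Q with compatible surjective pairings
   P (x)_B Q -> A and Q (x)_A P -> B, which are then isomorphisms when A and B
   are unital.  Both actions on P are linear over the same k-module structure,
   so that k acts on P (and on Q) equally from the left and from the right. *)
Record morita_context A B (P Q : lmodType k) := MoritaContext {
  actAP : A -> P -> P;  actPB : P -> B -> P;
  actBQ : B -> Q -> Q;  actQA : Q -> A -> Q;
  pairPQ : P -> Q -> A; pairQP : Q -> P -> B;
  actAP_lin : forall a (c : k) p p', actAP a (c *: p + p') = c *: actAP a p + actAP a p';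
  actAP_linl : forall (c : k) a a' p, actAP (c *: a + a') p = c *: actAP a p + actAP a' p;
  actAPM : forall a a' p, actAP (a ** a') p = actAP a (actAP a' p);
  actAP1 : forall e, is_kunit e -> forall p, actAP e p = p;
  actPB_lin : forall b (c : k) p p', actPB (c *: p + p') b = c *: actPB p b + actPB p' b;
  actPB_linr : forall (c : k) b b' p, actPB p (c *: b + b') = c *: actPB p b + actPB p b';
  actPBM : forall b b' p, actPB p (b ** b') = actPB (actPB p b) b';
  actPB1 : forall e, is_kunit e -> forall p, actPB p e = p;
  actAPB : forall a p b, actPB (actAP a p) b = actAP a (actPB p b);
  actBQ_lin : forall b (c : k) q q', actBQ b (c *: q + q') = c *: actBQ b q + actBQ b q';
  actBQ_linl : forall (c : k) b b' q, actBQ (c *: b + b') q = c *: actBQ b q + actBQ b' q;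
  actBQM : forall b b' q, actBQ (b ** b') q = actBQ b (actBQ b' q);
  actBQ1 : forall e, is_kunit e -> forall q, actBQ e q = q;
  actQA_lin : forall a (c : k) q q', actQA (c *: q + q') a = c *: actQA q a + actQA q' a;
  actQA_linr : forall (c : k) a a' q, actQA q (c *: a + a') = c *: actQA q a + actQA q a';
  actQAM : forall a a' q, actQA q (a ** a') = actQA (actQA q a) a';
  actQA1 : forall e, is_kunit e -> forall q, actQA q e = q;
  actBQA : forall b q a, actQA (actBQ b q) a = actBQ b (actQA q a);
  pairPQ_lin : forall (c : k) p p' q, pairPQ (c *: p + p') q = c *: pairPQ p q + pairPQ p' q;
  pairPQ_linr : forall (c : k) p q q', pairPQ p (c *: q + q') = c *: pairPQ p q + pairPQ p q';
  pairPQ_actl : forall a p q, pairPQ (actAP a p) q = a ** pairPQ p q;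
  pairPQ_actr : forall a p q, pairPQ p (actQA q a) = pairPQ p q ** a;
  pairPQ_bal : forall p b q, pairPQ (actPB p b) q = pairPQ p (actBQ b q);
  pairQP_lin : forall (c : k) q q' p, pairQP (c *: q + q') p = c *: pairQP q p + pairQP q' p;
  pairQP_linr : forall (c : k) q p p', pairQP q (c *: p + p') = c *: pairQP q p + pairQP q p';
  pairQP_actl : forall b q p, pairQP (actBQ b q) p = b ** pairQP q p;
  pairQP_actr : forall b q p, pairQP q (actPB p b) = pairQP q p ** b;
  pairQP_bal : forall q a p, pairQP (actQA q a) p = pairQP q (actAP a p);
  pair_assocP : forall p q p', actAP (pairPQ p q) p' = actPB p (pairQP q p');
  pair_assocQ : forall q p q', actBQ (pairQP q p) q' = actQA q (pairPQ p q');
  pairPQ_surj : forall a, exists s : seq (P * Q), a = \sum_(x <- s) pairPQ x.1 x.2;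
  pairQP_surj : forall b, exists s : seq (Q * P), b = \sum_(x <- s) pairQP x.1 x.2 }.

Definition morita A B :=
  [/\ unital A, unital B &
      exists P Q : lmodType k, inhabited (morita_context A B P Q)].
End Algebras.

Definition restr (k0 k : comPzRingType) (iota : {rmorphism k0 -> k})
  (V : lmodType k) : Type := V.

Section Restriction.
Variables (k0 k : comPzRingType) (iota : {rmorphism k0 -> k}).

Section Module.
Variable V : lmodType k.
Local Notation restr := (restr iota V).
HB.instance Definition _ := GRing.Zmodule.copy restr V.
Definition restr_scale (c : k0) (x : restr) : restr := iota c *: (x : V).
Lemma restr_scaleA a b x : restr_scale a (restr_scale b x) = restr_scale (a * b) x.
Proof. by rewrite /restr_scale scalerA rmorphM. Qed.
Lemma restr_scale1 : left_id 1 restr_scale.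
Proof. by move=> x; rewrite /restr_scale rmorph1 scale1r. Qed.
Lemma restr_scaleDr : right_distributive restr_scale +%R.
Proof. by move=> c x y; rewrite /restr_scale scalerDr. Qed.
Lemma restr_scaleDl x : {morph restr_scale^~ x : a b / a + b}.
Proof. by move=> a b; rewrite /restr_scale rmorphD scalerDl. Qed.
HB.instance Definition _ := GRing.Zmodule_isLmodule.Build k0 restr
  restr_scaleA restr_scale1 restr_scaleDr restr_scaleDl.
End Module.

Variable A : kalg k.
Definition restr_mul (x y : restr iota A) : restr iota A := (x : A) ** (y : A).
Lemma restr_mulZl (c : k0) (x y : restr iota A) :
  restr_mul (c *: x) y = c *: restr_mul x y.
Proof. exact: kmulZl. Qed.
Lemma restr_mulZr (c : k0) (x y : restr iota A) :
  restr_mul x (c *: y) = c *: restr_mul x y.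
Proof. exact: kmulZr. Qed.
Definition restr_kalg : kalg k0 :=
  @Kalg k0 (restr iota A) restr_mul (@kmulA k A) (@kmulDl k A) (@kmulDr k A)
    restr_mulZl restr_mulZr.
End Restriction.

Definition via (k B : comPzRingType) (phi : {rmorphism k -> B}) : Type := B.

Section OfMorphism.
Variables (k B : comPzRingType) (phi : {rmorphism k -> B}).
Local Notation via := (via phi).
HB.instance Definition _ := GRing.ComPzRing.copy via B.
Definition via_scale (c : k) (x : via) : via := phi c * (x : B).
Lemma via_scaleA a b x : via_scale a (via_scale b x) = via_scale (a * b) x.
Proof. by rewrite /via_scale mulrA rmorphM. Qed.
Lemma via_scale1 : left_id 1 via_scale.
Proof. by move=> x; rewrite /via_scale rmorph1 mul1r. Qed.
Lemma via_scaleDr : right_distributive via_scale +%R.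
Proof. by move=> c x y; rewrite /via_scale mulrDr. Qed.
Lemma via_scaleDl x : {morph via_scale^~ x : a b / a + b}.
Proof. by move=> a b; rewrite /via_scale rmorphD mulrDl. Qed.
HB.instance Definition _ := GRing.Zmodule_isLmodule.Build k via
  via_scaleA via_scale1 via_scaleDr via_scaleDl.
Lemma via_mulZl (c : k) (x y : via) : (c *: x) * y = c *: (x * y).
Proof. by rewrite /GRing.scale /= /via_scale mulrA. Qed.
Lemma via_mulZr (c : k) (x y : via) : x * (c *: y) = c *: (x * y).
Proof. by rewrite /GRing.scale /= /via_scale mulrCA. Qed.
Definition kalg_via : kalg k :=
  @Kalg k via *%R (@mulrA via) (@mulrDl via) (@mulrDr via) via_mulZl via_mulZr.
End OfMorphism.

Section GeometricEquivalence.
(* k is an algebra over the field C via iota. *)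
Variables (C : fieldType) (k : comPzRingType) (iota : {rmorphism C -> k}).
Implicit Types A B : kalg k.

Definition vsubspace (V : lmodType C) (U : set V) :=
  [/\ U 0, forall x y, U x -> U y -> U (x + y) &
      forall (c : C) x, U x -> U (c *: x)].

(* act is a simple module V (over C) of the subquotient I / I', where I' is
   contained in I.  Since algebras need not be unital, simplicity includes that
   the action is not zero. *)
Definition simple_module A (I I' : ideal A) (V : lmodType C) (act : A -> V -> V) :=
  [/\ forall x y v, I x -> I y -> act (x + y) v = act x v + act y v,
      forall c x v, I x -> act (iota c *: x) v = c *: act x v,
      forall x c v v', I x -> act x (c *: v + v') = c *: act x v + act x v',
      forall x y v, I x -> I y -> act (x ** y) v = act x (act y v) &
  [/\ forall x v, I' x -> act x v = 0,
      exists x v, I x /\ act x v != 0 &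
      forall U : set V, vsubspace U ->
        (forall x v, I x -> U v -> U (act x v)) -> U = [set 0] \/ U = setT]].

(* The set P is the inverse image in I of a primitive ideal of I / I'. *)
Definition primitive A (I I' : ideal A) (P : set A) :=
  exists (V : lmodType C) (act : A -> V -> V),
    simple_module I I' act /\ P = [set x | I x /\ forall v, act x v = 0].

(* The morphism I / I' -> J / J' induced by f is spectrum-preserving. *)
Definition spectrum_preserving A B (f : A -> B)
    (I I' : ideal A) (J J' : ideal B) :=
  (forall P, primitive J J' P -> exists! Q,
     primitive I I' Q /\ (forall x, I x -> P (f x) -> Q x)) /\
  (forall Q, primitive I I' Q -> exists! P,
     primitive J J' P /\ (forall x, I x -> P (f x) -> Q x)).

Definition filtration A (r : nat) (I : nat -> ideal A) :=
  [/\ iset (I 0%N) = [set 0], iset (I r) = setT &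
      forall j x, (j < r)%N -> I j x -> I j.+1 x].

Definition filtered_spectrum_preserving A B (f : A -> B) :=
  kalg_morph f /\
  exists (r : nat) (I : nat -> ideal A) (J : nat -> ideal B),
  [/\ filtration r I, filtration r J,
      forall j x, (j <= r)%N -> I j x -> J j (f x) &
      forall j, (j < r)%N -> spectrum_preserving f (I j.+1) (I j) (J j.+1) (J j)].

Definition laurent_eval (D : algType C) (zeta : C) (f : laurent D) : D :=
  \sum_(n \in setT) zeta ^ n *: coeff f n.

Definition is_specialization (D : algType C) (Psi : k -> laurent D) (zeta : C)
    B (f : D -> B) :=
  [/\ bijective f,
      forall x y, f (x + y) = f x + f y,
      forall x y, f (x * y) = f x ** f y &
      forall (w : k) x, f (laurent_eval zeta (Psi w) * x) = w *: f x].

Definition central_deformation A B :=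
  exists (D : algType C) (Psi : {rmorphism k -> laurent D}),
  [/\ forall c, Psi (iota c) = lmonom c%:A 0,
      forall w x, Psi w * x = x * Psi w &
      exists (zeta zeta' : C) (f : D -> A) (g : D -> B),
      [/\ zeta != 0, zeta' != 0,
          is_specialization Psi zeta f & is_specialization Psi zeta' g]].

(* The geometrical equivalence of finite type k-algebras. *)
Inductive geom_equiv : kalg k -> kalg k -> Prop :=
| geom_morita A B : finite_type A -> finite_type B ->
    morita A B -> geom_equiv A B
| geom_spectrum A B (f : A -> B) : finite_type A -> finite_type B ->
    filtered_spectrum_preserving f -> geom_equiv A B
| geom_deformation A B : finite_type A -> finite_type B ->
    central_deformation A B -> geom_equiv A B
| geom_refl A : finite_type A -> geom_equiv A A
| geom_sym A B : geom_equiv A B -> geom_equiv B A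
| geom_trans A B D : geom_equiv A B -> geom_equiv B D -> geom_equiv A D.
End GeometricEquivalence.

Section Spaces.
Variable C : fieldType.

(* A (reduced affine) variety is handled as its set of points together with
   its C-algebra of regular functions. *)
Record variety := Variety {
  points :> Type;
  regular : (points -> C) -> Prop;
  regular_cst : forall c, regular (fun _ => c);
  regularD : forall f g, regular f -> regular g -> regular (fun x => f x + g x);
  regularM : forall f g, regular f -> regular g -> regular (fun x => f x * g x) }.

Definition regular_map (X Y : variety) (f : X -> Y) :=
  forall g : Y -> C, regular g -> regular (g \o f).

Definition variety_iso (X Y : variety) (f : X -> Y) :=
  exists g : Y -> X, [/\ cancel f g, cancel g f, regular_map f & regular_map g].

Section CoordinateRing.
Variable X : variety.

Definition regularb : pred (X -> C) := fun f => `[< @regular X f >].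

Lemma regular_subring : subring_closed regularb.
Proof.
split.
- by apply/asboolP; exact: regular_cst.
- move=> f g /asboolP hf /asboolP hg; apply/asboolP.
  have -> : f - g = fun x => f x + (fun=> -1) x * g x.
    by apply/funext => x; rewrite /GRing.add /GRing.opp /= mulN1r.
  by apply: regularD => //; apply: regularM => //; exact: regular_cst.
- by move=> f g /asboolP hf /asboolP hg; apply/asboolP; exact: regularM.
Qed.

Definition coordring := {f : X -> C | regularb f}.
HB.instance Definition _ := [isSub of coordring for sval].
HB.instance Definition _ := [Choice of coordring by <:].
HB.instance Definition _ := GRing.SubChoice_isSubComPzRing.Build
  (X -> C) regularb coordring regular_subring.

Lemma coordringP (f : coordring) : regular (val f).
Proof. exact/asboolP/(valP f). Qed.

Definition cst_coord (c : C) : coordring := Sub (fun _ => c) (asboolT (regular_cst X c)).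

Lemma cst_coord_is_additive : additive cst_coord.
Proof. by move=> c d; apply: val_inj. Qed.
Lemma cst_coord_is_monoid_morphism : monoid_morphism cst_coord.
Proof. by split=> [|c d]; apply: val_inj. Qed.
HB.instance Definition _ := GRing.isAdditive.Build C coordring cst_coord
  cst_coord_is_additive.
HB.instance Definition _ := GRing.isMonoidMorphism.Build C coordring cst_coord
  cst_coord_is_monoid_morphism.

Definition cst_morph : {rmorphism C -> coordring} := cst_coord.
End CoordinateRing.

Section Pullback.
Variables (X Y : variety) (p : X -> Y) (hp : regular_map p).

Definition pullback (f : coordring Y) : coordring X :=
  Sub (val f \o p) (asboolT (hp (coordringP f))).

Lemma pullback_is_additive : additive pullback.
Proof. by move=> f g; apply: val_inj. Qed.
Lemma pullback_is_monoid_morphism : monoid_morphism pullback.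
Proof. by split=> [|f g]; apply: val_inj. Qed.
HB.instance Definition _ := GRing.isAdditive.Build (coordring Y) (coordring X)
  pullback pullback_is_additive.
HB.instance Definition _ := GRing.isMonoidMorphism.Build (coordring Y) (coordring X)
  pullback pullback_is_monoid_morphism.

Definition coord_kalg : kalg (coordring Y) := kalg_via (pullback : {rmorphism coordring Y -> coordring X}).
End Pullback.

Definition push_variety (X : variety) (Y : Type) (q : X -> Y) : variety.
Proof.
apply: (@Variety Y (fun f => regular (f \o q))).
- by move=> c; exact: regular_cst.
- by move=> f g; exact: regularD.
- by move=> f g; exact: regularM.
Defined.

Definition sub_variety (X : variety) (A : set X) : variety.
Proof.
apply: (@Variety (set_type A)
  (fun f => exists g : X -> C, regular g /\ forall x, f x = g (set_val x))).
- by move=> c; exists (fun=> c); split=> //; exact: regular_cst.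
- move=> f g [f' [hf ef]] [g' [hg eg]]; exists (fun x => f' x + g' x).
  by split=> [|x]; [exact: regularD | rewrite ef eg].
- move=> f g [f' [hf ef]] [g' [hg eg]]; exists (fun x => f' x * g' x).
  by split=> [|x]; [exact: regularM | rewrite ef eg].
Defined.

Definition sum_variety (I : finType) (X : I -> variety) : variety.
Proof.
apply: (@Variety {i : I & X i}
  (fun f => forall i, @regular (X i) (fun x => f (existT _ i x)))).
- by move=> c i; exact: regular_cst.
- by move=> f g hf hg i; apply: (regularD (hf i) (hg i)).
- by move=> f g hf hg i; apply: (regularM (hf i) (hg i)).
Defined.

Definition point_variety : variety.
Proof. by apply: (@Variety unit (fun=> True)). Defined.

Definition affine_line : variety.
Proof.
apply: (@Variety C (fun f => exists p : {poly C}, forall x, f x = p.[x])).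
- by move=> c; exists c%:P => x; rewrite hornerC.
- by move=> f g [p hp] [q hq]; exists (p + q) => x; rewrite hornerD hp hq.
- by move=> f g [p hp] [q hq]; exists (p * q) => x; rewrite hornerM hp hq.
Defined.

Definition affine_plane : variety.
Proof.
apply: (@Variety (C * C)%type
  (fun f => exists p : {poly {poly C}}, forall z, f z = p.[z.2%:P].[z.1])).
- by move=> c; exists c%:P%:P => x; rewrite !hornerC.
- by move=> f g [p hp] [q hq]; exists (p + q) => z; rewrite !hornerD hp hq.
- by move=> f g [p hp] [q hq]; exists (p * q) => z; rewrite !hornerM hp hq.
Defined.
End Spaces.

(* The quotient of the affine plane by v |-> - v; its coordinate ring is
   C[X, Y]_0. *)
Section PlaneModSign.
Variable C : fieldType.

Definition sign_equiv (z z' : C * C) : bool := (z' == z) || (z' == - z).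

Lemma sign_equiv_is_equiv : equiv_class_of sign_equiv.
Proof.
split.
- by move=> z; rewrite /sign_equiv eqxx.
- move=> z z'; rewrite /sign_equiv [z' == z]eq_sym; congr (_ || _).
  by rewrite -eqr_oppLR eq_sym.
- move=> y x z /orP[] /eqP -> //; rewrite /sign_equiv.
  by rewrite opprK orbC.
Qed.
Canonical sign_equiv_rel := EquivRelPack sign_equiv_is_equiv.

Definition plane_mod_sign : variety C :=
  push_variety (X := affine_plane C) (\pi_{eq_quot sign_equiv_rel}%qT).
End PlaneModSign.

(* Integral 2 x 2 matrices, by rows; unlike 'M[int]_2 this encoding computes. *)
Definition mat2 := ((int * int) * (int * int))%type.

Definition mat2_mul (m n : mat2) : mat2 :=
  ((m.1.1 * n.1.1 + m.1.2 * n.2.1, m.1.1 * n.1.2 + m.1.2 * n.2.2),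
   (m.2.1 * n.1.1 + m.2.2 * n.2.1, m.2.1 * n.1.2 + m.2.2 * n.2.2)).

Definition mat2_one : mat2 := ((1, 0), (0, 1)).

(* The inverse of a matrix of determinant 1 or -1. *)
Definition mat2_inv (m : mat2) : mat2 :=
  let d := m.1.1 * m.2.2 - m.1.2 * m.2.1 in
  ((d * m.2.2, - d * m.1.2), (- d * m.2.1, d * m.1.1)).

Lemma mat2_mulA : associative mat2_mul.
Proof.
move=> [[a b] [c d]] [[a' b'] [c' d']] [[a'' b''] [c'' d'']].
rewrite /mat2_mul /=; congr (_, _); congr (_, _);
  by rewrite !(mulrDl, mulrDr, mulrA) -!addrA; congr (_ + _); rewrite addrCA.
Qed.

Lemma mat2_mul1l : left_id mat2_one mat2_mul.
Proof.
by move=> [[a b] [c d]]; rewrite /mat2_mul /= !mul1r !mul0r !addr0 !add0r.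
Qed.

(* The matrices of the exponents of a(z1,z2) = (z2,z1) and
   b(z1,z2) = (z1 z2, z2^-1). *)
Definition mat2_a : mat2 := ((0, 1), (1, 0)).
Definition mat2_b : mat2 := ((1, 1), (0, -1)).
Definition mat2_r : mat2 := mat2_mul mat2_b mat2_a.

(* The dihedral group of order 12 generated by a and b (see weylG2_gen). *)
Definition weyl_mats : seq mat2 :=
  [seq mat2_mul (iter i (mat2_mul mat2_a) mat2_one)
                (iter j (mat2_mul mat2_r) mat2_one)
  | i <- iota 0 2, j <- iota 0 6].

Definition weylG2 := seq_sub weyl_mats.
HB.instance Definition _ := Finite.on weylG2.

Lemma weyl_mul_subproof (x y : weylG2) : mat2_mul (val x) (val y) \in weyl_mats.
Proof.
have /allP h : all (fun m => all (fun n => mat2_mul m n \in weyl_mats) weyl_mats)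
  weyl_mats by vm_compute.
exact: (allP (h _ (valP x)) _ (valP y)).
Qed.

Lemma weyl_inv_subproof (x : weylG2) : mat2_inv (val x) \in weyl_mats.
Proof.
have /allP h : all (fun m => mat2_inv m \in weyl_mats) weyl_mats by vm_compute.
exact: h _ (valP x).
Qed.

Lemma weyl_one_subproof : mat2_one \in weyl_mats.
Proof. by vm_compute. Qed.

Definition weyl_mul (x y : weylG2) : weylG2 := SeqSub (weyl_mul_subproof x y).
Definition weyl_inv (x : weylG2) : weylG2 := SeqSub (weyl_inv_subproof x).
Definition weyl_one : weylG2 := SeqSub weyl_one_subproof.

Lemma weyl_mulA : associative weyl_mul.
Proof. by move=> x y z; apply: val_inj; apply: mat2_mulA. Qed.
Lemma weyl_mul1l : left_id weyl_one weyl_mul.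
Proof. by move=> x; apply: val_inj; apply: mat2_mul1l. Qed.
Lemma weyl_mulVl : left_inverse weyl_one weyl_inv weyl_mul.
Proof.
move=> x; apply: val_inj => /=.
have /allP h : all (fun m => mat2_mul (mat2_inv m) m == mat2_one) weyl_mats
  by vm_compute.
exact/eqP/(h _ (valP x)).
Qed.

HB.instance Definition _ := Finite_isGroup.Build weylG2
  weyl_mulA weyl_mul1l weyl_mulVl.

Definition weyl_a : weylG2 := SeqSub (isT : mat2_a \in weyl_mats).
Definition weyl_b : weylG2 := SeqSub (isT : mat2_b \in weyl_mats).
Definition weyl_r : weylG2 := (weyl_b * weyl_a)%g.

Lemma weylG2_gen : (<<[set weyl_a; weyl_b]%SET>> = [set: weylG2]%SET)%g.
Proof.
apply/eqP; rewrite finset.eqEsubset finset.subsetT /=; apply/fintype.subsetP => x _.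
have ha : weyl_a \in <<[set weyl_a; weyl_b]%SET>>%g by rewrite mem_gen // !inE eqxx.
have hb : weyl_b \in <<[set weyl_a; weyl_b]%SET>>%g by rewrite mem_gen // !inE eqxx orbT.
have hr : weyl_r \in <<[set weyl_a; weyl_b]%SET>>%g by rewrite groupM.
have vX (y : weylG2) n : val (y ^+ n)%g = iter n (mat2_mul (val y)) mat2_one.
  by elim: n => // n IH; rewrite expgS /= -IH.
have /allpairsP[[i j] [_ _ hx]] := valP x.
suff -> : x = (weyl_a ^+ i * weyl_r ^+ j)%g by rewrite groupM // groupX.
apply: val_inj; rewrite [LHS]hx.
by rewrite -[RHS]/(mat2_mul (val (weyl_a ^+ i)%g) (val (weyl_r ^+ j)%g)) !vX.
Qed.

Section MonomialAction.
Variable C : fieldType.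

Definition mat2_act (m : mat2) (z : C * C) : C * C :=
  (z.1 ^ m.1.1 * z.2 ^ m.1.2, z.1 ^ m.2.1 * z.2 ^ m.2.2).

Definition nonzero2 : set (C * C) := [set z | z.1 != 0 /\ z.2 != 0].

Lemma mat2_act_nz m z : nonzero2 z -> nonzero2 (mat2_act m z).
Proof. by case=> h1 h2; split; rewrite mulf_neq0 // expfz_neq0. Qed.

Lemma mat2_act_mul m n z : nonzero2 z ->
  mat2_act (mat2_mul m n) z = mat2_act m (mat2_act n z).
Proof.
move=> [h1 h2]; congr (_, _) => /=;
  by rewrite !expfzMl !exprz_exp !expfzDr // mulrACA ![n.1.1 * _]mulrC
     ![n.1.2 * _]mulrC ![n.2.1 * _]mulrC ![n.2.2 * _]mulrC.
Qed.

Lemma mat2_act1 z : mat2_act mat2_one z = z.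
Proof. by case: z => x y; rewrite /mat2_act /= !expr1z !expr0z mulr1 mul1r. Qed.

Lemma mat2_act_a z : mat2_act mat2_a z = (z.2, z.1).
Proof. by rewrite /mat2_act /= !expr1z !expr0z mulr1 mul1r. Qed.
Lemma mat2_act_b z : mat2_act mat2_b z = (z.1 * z.2, z.2^-1).
Proof. by rewrite /mat2_act /= !expr1z expr0z mul1r. Qed.
End MonomialAction.

Section Torus.
Variable C : numClosedFieldType.

Definition torus := set_type (@nonzero2 C).
HB.instance Definition _ := Choice.on torus.
HB.instance Definition _ := Topological.copy torus (set_type (@nonzero2 C)).

Definition coords (t : torus) : C * C := set_val t.

Definition torus_act (w : weylG2) (t : torus) : torus :=
  exist (fun z => z \in @nonzero2 C) (mat2_act (val w) (coords t))
    (mem_set (mat2_act_nz (val w) (set_mem (valP t)))).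

Lemma torus_act1 t : torus_act 1%g t = t.
Proof. by apply: val_inj => /=; rewrite mat2_act1. Qed.

Lemma torus_actM v w t : torus_act (v * w)%g t = torus_act v (torus_act w t).
Proof. by apply: val_inj => /=; rewrite mat2_act_mul //; exact: set_mem (valP t). Qed.

Lemma torus_actK w t : torus_act w^-1%g (torus_act w t) = t.
Proof. by rewrite -torus_actM mulVg torus_act1. Qed.

Definition compact_torus : set torus :=
  [set t | `|(coords t).1| = 1 /\ `|(coords t).2| = 1].

(* The character z1^l.1 z2^l.2 of the torus. *)
Definition torus_char (l : int * int) (t : torus) : C :=
  (coords t).1 ^ l.1 * (coords t).2 ^ l.2.

Lemma torus_charD l m t : torus_char (l + m) t = torus_char l t * torus_char m t.
Proof.
have [h1 h2] := set_mem (valP t).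
by rewrite /torus_char /= !expfzDr // mulrACA.
Qed.

Lemma torus_char0 t : torus_char 0 t = 1.
Proof. by rewrite /torus_char /= !expr0z mulr1. Qed.

Definition torus_variety : variety C.
Proof.
apply: (@Variety C torus (fun f => exists s : seq (C * (int * int)),
  forall t, f t = \sum_(x <- s) x.1 * torus_char x.2 t)).
- by move=> c; exists [:: (c, 0)] => t; rewrite big_seq1 torus_char0 mulr1.
- by move=> f g [s hs] [s' hs']; exists (s ++ s') => t; rewrite big_cat hs hs'.
- move=> f g [s hs] [s' hs'].
  exists [seq (x.1 * y.1, x.2 + y.2) | x <- s, y <- s'] => t.
  rewrite hs hs' big_distrlr /= big_allpairs_dep /=.
  by apply: eq_bigr => x _; apply: eq_bigr => y _; rewrite torus_charD mulrACA.
Defined.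

Section Quotients.
(* G acts on a subset X of the torus, in practice the torus itself or its
   maximal compact subgroup. *)
Variables (X : set torus) (G : {group weylG2}).

Definition orbit_equiv (t t' : set_type X) : bool :=
  `[< exists v, v \in G /\ set_val t' = torus_act v (set_val t) >].

Lemma orbit_equiv_is_equiv : equiv_class_of orbit_equiv.
Proof.
have sym t t' : orbit_equiv t t' -> orbit_equiv t' t.
  move=> /asboolP[v [hv e]]; apply/asboolP; exists v^-1%g.
  by rewrite groupV e torus_actK.
split.
- by move=> t; apply/asboolP; exists 1%g; rewrite group1 torus_act1.
- by move=> t t'; apply/idP/idP; exact: sym.
- move=> y x z /asboolP[v [hv e]] /asboolP[w [hw e']]; apply/asboolP.
  by exists (w * v)%g; rewrite groupM // torus_actM -e.
Qed.
Canonical orbit_equiv_rel := EquivRelPack orbit_equiv_is_equiv.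

(* X / G *)
Definition orbit_quot := {eq_quot orbit_equiv_rel}.
Definition orbit_space : topologicalType := quotient_topology orbit_quot.

(* X^w *)
Definition fixed_points (w : weylG2) := set_type [set t | X t /\ torus_act w t = t].

(* The pairs (w, t) with t in X^w. *)
Definition fixed_pairs := {w : subg_of G & fixed_points (sgval w)}.
HB.instance Definition _ := Choice.on fixed_pairs.
HB.instance Definition _ := Topological.copy fixed_pairs
  {w : subg_of G & fixed_points (sgval w)}.

Definition pair_elt (p : fixed_pairs) : weylG2 := sgval (tag p).
Definition pair_pt (p : fixed_pairs) : torus := set_val (tagged p).

Definition pair_equiv (p q : fixed_pairs) : bool :=
  `[< exists v, [/\ v \in G, pair_elt q = (v * pair_elt p * v^-1)%g &
                    pair_pt q = torus_act v (pair_pt p)] >].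

Lemma pair_equiv_is_equiv : equiv_class_of pair_equiv.
Proof.
have sym p q : pair_equiv p q -> pair_equiv q p.
  move=> /asboolP[v [hv e e']]; apply/asboolP; exists v^-1%g.
  split; first by rewrite groupV.
  - by rewrite e invgK !mulgA mulVg mul1g mulgKV.
  - by rewrite e' torus_actK.
split.
- move=> p; apply/asboolP; exists 1%g.
  by rewrite group1 torus_act1 mul1g invg1 mulg1.
- by move=> p q; apply/idP/idP; exact: sym.
- move=> q p r /asboolP[v [hv e1 e2]] /asboolP[w [hw e3 e4]]; apply/asboolP.
  exists (w * v)%g; rewrite groupM // torus_actM -e2; split=> //.
  by rewrite e3 e1 invMg !mulgA.
Qed.
Canonical pair_equiv_rel := EquivRelPack pair_equiv_is_equiv.

(* X // G *)
Definition ext_quot := {eq_quot pair_equiv_rel}.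
Definition ext_space : topologicalType := quotient_topology ext_quot.

(* y is the class of a pair (w, t) where t has coordinates z. *)
Definition is_class (y : ext_quot) (w : weylG2) (z : C * C) :=
  exists p : fixed_pairs, [/\ y = \pi_ext_quot p, pair_elt p = w & coords (pair_pt p) = z].

Lemma pair_pt_in (p : fixed_pairs) : pair_pt p \in X.
Proof. by have [h _] := set_mem (valP (tagged p)); apply/mem_set. Qed.

Definition ext_proj (y : ext_quot) : orbit_quot :=
  \pi_orbit_quot (exist (fun t => t \in X) (pair_pt (generic_quotient.repr y)) (pair_pt_in (generic_quotient.repr y))).

Lemma ext_projE p : ext_proj (\pi p) = \pi_orbit_quot (exist (fun t => t \in X) (pair_pt p) (pair_pt_in p)).
Proof.
rewrite /ext_proj; apply/eqmodP.
have /asboolP[v [hv _ e]] : pair_equiv (generic_quotient.repr (\pi_ext_quot p)) p.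
  by apply/eqmodP; rewrite reprK.
by apply/asboolP; exists v.
Qed.
End Quotients.

Section QuotientVarieties.
Variable G : {group weylG2}.

Definition fixed_variety (w : subg_of G) : variety C :=
  @sub_variety C torus_variety
    [set t | [set: torus] t /\ torus_act (sgval w) t = t].

(* T // G *)
Definition ext_variety : variety C :=
  push_variety (X := sum_variety fixed_variety)
    (\pi_(ext_quot [set: torus] G) : fixed_pairs [set: torus] G -> _).

(* T / G *)
Definition orbit_variety : variety C :=
  push_variety (X := @sub_variety C torus_variety [set: torus])
    (\pi_(orbit_quot [set: torus] G)).

Lemma ext_proj_regular :
  @regular_map C ext_variety orbit_variety (@ext_proj [set: torus] G).
Proof.
move=> g [g' [hg e]] w /=; exists g'; split=> // t.
rewrite ext_projE; exact: e.
Qed.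

Lemma piece_proj_regular (A : set ext_variety) :
  @regular_map C (sub_variety A) orbit_variety
    (fun y => ext_proj (set_val y : ext_quot [set: torus] G)).
Proof.
move=> g hg; exists (g \o @ext_proj [set: torus] G).
by split; first exact: ext_proj_regular hg.
Qed.
End QuotientVarieties.
End Torus.

Section LocalField.
Variables (F : fieldType) (v : F -> int).

(* The n-th power of the maximal ideal; the value of v at 0 is irrelevant. *)
Definition vpow (n : int) : set F := [set x | x = 0 \/ n <= v x].

(* v is the normalized valuation of a nonarchimedean local field. *)
Record local_field := LocalField {
  valM : forall x y, x != 0 -> y != 0 -> v (x * y) = v x + v y;
  valD : forall n x y, vpow n x -> vpow n y -> vpow n (x + y);
  val_uniformizer : exists x, x != 0 /\ v x = 1;
  val_complete : forall u : nat -> F,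
    (forall n : int, exists N, forall i j, (N <= i)%N -> (N <= j)%N -> vpow n (u i - u j)) ->
    exists l, forall n : int, exists N, forall i, (N <= i)%N -> vpow n (u i - l);
  val_residue_finite : exists s : seq F, forall x, vpow 0 x ->
    exists y, y \in s /\ vpow 1 (x - y) }.

Definition residue_char (p : nat) := prime p /\ vpow 1 p%:R.

Variable C : fieldType.

(* Smooth characters of the multiplicative group of F, as functions on F whose
   value at 0 is irrelevant. *)
Definition smooth_char (chi : F -> C) :=
  [/\ forall x, x != 0 -> chi x != 0,
      forall x y, x != 0 -> y != 0 -> chi (x * y) = chi x * chi y &
      exists n : nat, forall x, vpow n.+1 x -> chi (1 + x) = 1].

Definition unramified (chi : F -> C) :=
  smooth_char chi /\ forall x, x != 0 -> v x = 0 -> chi x = 1.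

Definition quadratic_char (chi : F -> C) :=
  [/\ smooth_char chi, forall x, x != 0 -> chi x ^+ 2 = 1 &
      exists x, x != 0 /\ chi x != 1].

(* A pair (chi1, chi2) of characters of F^* is the character chi1 (x) chi2 of
   the torus T = F^* x F^*, on which the Weyl group acts by the same formulas as
   on the unramified ones. *)
Definition char_act (w : weylG2) (psi : F -> C * C) : F -> C * C :=
  fun x => mat2_act (val w) (psi x).

Definition unramified_twist (psi psi' : F -> C * C) :=
  exists theta1 theta2 : F -> C, [/\ unramified theta1, unramified theta2 &
    forall x, x != 0 ->
      psi x = ((psi' x).1 * theta1 x, (psi' x).2 * theta2 x)].

Lemma unramified_prod (t1 t2 : F -> C) (m n : int) :
  unramified t1 -> unramified t2 -> unramified (fun x => t1 x ^ m * t2 x ^ n).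
Proof.
move=> [[n1 m1 [k1 s1]] u1] [[n2 m2 [k2 s2]] u2]; split; last first.
  by move=> x hx vx; rewrite u1 // u2 // !exp1rz mulr1.
split.
- by move=> x hx; rewrite mulf_neq0 // expfz_neq0 // ?n1 ?n2.
- by move=> x y hx hy; rewrite m1 // m2 // !expfzMl mulrACA.
- exists (k1 + k2)%N => x [->|hx]; first by rewrite s1 ?s2 ?exp1rz ?mulr1; [|left|left].
  rewrite s1 ?s2 ?exp1rz ?mulr1 //; right; apply: le_trans hx;
    by rewrite lez_nat ltnS ?leq_addr ?leq_addl.
Qed.

Variable chi : F -> C.

Definition inertial_set : {set weylG2} :=
  [set w | `[< unramified_twist (char_act w (fun x => (chi x, chi x)))
                                (fun x => (chi x, chi x)) >]]%SET.

Lemma char_nz (t : F -> C) x : smooth_char t -> x != 0 -> t x != 0.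
Proof. by case=> h _ _; exact: h. Qed.

Hypothesis chi_smooth : smooth_char chi.

Lemma inertial_group_set : group_set inertial_set.
Proof.
apply/group_setP; split.
  rewrite finset.in_set; apply/asboolP; exists (fun=> 1), (fun=> 1).
  have u1 : unramified (fun _ : F => 1 : C).
    split=> //; split; first by move=> x _; rewrite oner_eq0.
      by move=> x y _ _; rewrite mulr1.
    by exists 0%N.
  by split=> // x hx; rewrite /char_act mat2_act1 /= !mulr1.
move=> w w'; rewrite !finset.in_set => /asboolP[t1 [t2 [u1 u2 e]]] /asboolP[s1 [s2 [v1 v2 e']]].
apply/(@asboolP (unramified_twist _ _)).
pose m := val w.
exists (fun x => t1 x ^ 1 * (s1 x ^ m.1.1 * s2 x ^ m.1.2) ^ 1).
exists (fun x => t2 x ^ 1 * (s1 x ^ m.2.1 * s2 x ^ m.2.2) ^ 1).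
split.
- by apply: unramified_prod => //; exact: unramified_prod.
- by apply: unramified_prod => //; exact: unramified_prod.
move=> x hx; have c0 : nonzero2 (chi x, chi x) by split; exact: char_nz hx.
have e'x := e' x hx; rewrite /char_act in e'x.
rewrite /char_act mat2_act_mul // e'x {e'x} /mat2_act /=.
have := e x hx; rewrite /char_act /mat2_act /= -/m => -[e1 e2].
rewrite !expr1z !expfzMl; congr (_, _).
- by rewrite mulrACA e1 -!mulrA.
- by rewrite mulrACA e2 -!mulrA.
Qed.
End LocalField.

(* W^s for s = [T, chi (x) chi] *)
Definition inertial_group (F : fieldType) (v : F -> int) (C : fieldType)
    (chi : F -> C) (h : smooth_char v chi) : {group weylG2} :=
  Group (inertial_group_set h).

(* The G2 root m alpha + n beta is the pair (m, n); g2_form is the invariant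
   form with (alpha, alpha) = 2, (beta, beta) = 6, (alpha, beta) = -3. *)
Definition g2_form (x y : int * int) : int :=
  2 * x.1 * y.1 - 3 * (x.1 * y.2 + x.2 * y.1) + 6 * x.2 * y.2.

(* <x, y^vee> *)
Definition g2_pairing (x y : int * int) : int :=
  ((2 * g2_form x y) %/ g2_form y y)%Z.

(* X(T^vee) is the cocharacter lattice of T; a cocharacter l has coordinates
   (<2 alpha + beta, l>, <alpha + beta, l>). *)
Definition g2_coroot (y : int * int) : int * int :=
  (g2_pairing (2, 1) y, g2_pairing (1, 1) y).

(* The value <m alpha + n beta, l>, as m alpha + n beta =
   (m - n) (2 alpha + beta) + (2 n - m) (alpha + beta). *)
Definition g2_eval (x l : int * int) : int :=
  (x.1 - x.2) * l.1 + (2 * x.2 - x.1) * l.2.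

(* alpha and 3 alpha + 2 beta; their coroots are the positive roots of H^s. *)
Definition pos_roots : seq (int * int) := [:: (1, 0); (3, 2)].

Lemma g2_coroot_alpha : g2_coroot (1, 0) = (1, -1). Proof. by []. Qed.
Lemma g2_coroot_3alpha2beta : g2_coroot (3, 2) = (1, 1). Proof. by []. Qed.

(* The action (w l)(t) = l (w^-1 t) on characters of the torus. *)
Definition latt_act (w : weylG2) (l : int * int) : int * int :=
  let m := val (w^-1)%g in
  (l.1 * m.1.1 + l.2 * m.2.1, l.1 * m.1.2 + l.2 * m.2.2).

Lemma torus_char_act (C : numClosedFieldType) w l (t : torus C) :
  torus_char (latt_act w l) t = torus_char l (torus_act w^-1%g t).
Proof.
have [h1 h2] := set_mem (valP t).
rewrite /torus_char /= /latt_act /=.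
rewrite !expfzMl !exprz_exp !expfzDr // [RHS]mulrACA.
by rewrite ![l.1 * _]mulrC ![l.2 * _]mulrC.
Qed.

Lemma latt_actM v w l : latt_act (v * w)%g l = latt_act v (latt_act w l).
Proof.
rewrite /latt_act invMg.
have -> : val (w^-1 * v^-1)%g = mat2_mul (val w^-1%g) (val v^-1%g) by [].
move: (val w^-1%g) (val v^-1%g) => m n; rewrite /mat2_mul /=.
by congr (_, _); rewrite !mulrDl !mulrDr !mulrA addrACA.
Qed.

Lemma latt_act1 l : latt_act 1%g l = l.
Proof.
by case: l => x y; rewrite /latt_act invg1 /= !mulr1 !mulr0 addr0 add0r.
Qed.
Lemma latt_actD w l m : latt_act w (l + m) = latt_act w l + latt_act w m.
Proof.
by rewrite /latt_act /GRing.add /=; congr (_, _); rewrite !mulrDl addrACA.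
Qed.

Section ExtendedAffineWeyl.
Variable G : {group weylG2}.

(* The semidirect product of G and X(T^vee); the pair (l, w) is e^l w. *)
Definition ext_affine := ((int * int) * subg_of G)%type.
HB.instance Definition _ := Choice.on ext_affine.

Definition ea_mul (x y : ext_affine) : ext_affine :=
  (x.1 + latt_act (sgval x.2) y.1, (x.2 * y.2)%g).
Definition ea_one : ext_affine := (0, 1%g).
Definition ea_inv (x : ext_affine) : ext_affine :=
  (- latt_act (sgval x.2^-1%g) x.1, x.2^-1%g).

Lemma ea_mulA : associative ea_mul.
Proof.
move=> [l v] [m w] [n u]; rewrite /ea_mul /=; congr (_, _); last exact: mulgA.
by rewrite latt_actM latt_actD addrA.
Qed.
Lemma ea_mul1l : left_id ea_one ea_mul.
Proof. by move=> [l w]; rewrite /ea_mul /= latt_act1 add0r mul1g. Qed.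
Lemma ea_mul1r : right_id ea_one ea_mul.
Proof.
move=> [l w]; rewrite /ea_mul /= mulg1; congr (_, _).
by rewrite -[RHS]addr0; congr (_ + _); rewrite /latt_act /= !mul0r addr0.
Qed.
Lemma ea_mulVl : left_inverse ea_one ea_inv ea_mul.
Proof. by move=> [l w]; rewrite /ea_mul /= addNr mulVg. Qed.
Lemma ea_mulVr : right_inverse ea_one ea_inv ea_mul.
Proof.
move=> x; rewrite -{1}[x]ea_mul1l -{1}(ea_mulVl (ea_inv x)) -(ea_mulA _ (ea_inv x) x).
by rewrite ea_mulVl -ea_mulA ea_mul1l ea_mulVl.
Qed.

HB.instance Definition _ := isGroup.Build ext_affine
  ea_mulA ea_mul1l ea_mul1r ea_mulVl ea_mulVr.

(* The number of hyperplanes <., gamma> = n (gamma in pos_roots, n integral)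
   which separate the fundamental alcove 0 < <., gamma> < 1 from its image
   under x |-> w x + l (Iwahori-Matsumoto). *)
Definition ea_length (x : ext_affine) : nat :=
  (\sum_(g <- pos_roots)
     `|(g2_eval g x.1 -
        (latt_act (sgval x.2)^-1%g (g2_coroot g) \notin
           [seq g2_coroot g' | g' <- pos_roots])%:Z)%R|)%N.

Definition affine_weyl (x : ext_affine) :=
  exists m n : int, x.1 = g2_coroot (1, 0) *~ m + g2_coroot (3, 2) *~ n.

Definition simple_reflections : set ext_affine :=
  [set s | affine_weyl s /\ ea_length s = 1%N].
End ExtendedAffineWeyl.

Definition is_basis (R : pzRingType) (V : lmodType R) (I : choiceType) (b : I -> V) :=
  forall x : V, exists! c : fsfunc I R, x = \sum_(i \in setT) coeff c i *: b i.

Section KazhdanLusztig.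
Variables (C : numClosedFieldType) (G : {group weylG2}).
Local Notation W := (ext_affine G).
Local Notation L := (laurent C).

Definition tau_pow (n : int) : L := lmonom 1 n.

(* f belongs to tau^n Z[tau^-1]. *)
Definition in_tauZ (n : int) (f : L) :=
  (forall i, exists m : int, coeff f i = m%:~R) /\ (forall i, n < i -> coeff f i = 0).

Definition is_laurent_bar (f g : L) := forall i, coeff g i = coeff f (- i).

Definition at_one (f : L) : C := \sum_(i \in setT) coeff f i.

Record generic_hecke (H : algType L) (T : W -> H) := GenericHecke {
  hecke_basis : is_basis T;
  hecke_mul : forall x y : W, ea_length (x * y)%g = (ea_length x + ea_length y)%N ->
    T x * T y = T (x * y)%g;
  hecke_quad : forall s : W, simple_reflections s ->
    (T s - (tau_pow 1)%:A) * (T s + (tau_pow (-1))%:A) = 0 }.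

Record bar_involution (H : algType L) (T : W -> H) (bar : H -> H) := BarInvolution {
  bar_add : forall x y, bar (x + y) = bar x + bar y;
  bar_mul : forall x y, bar (x * y) = bar x * bar y;
  bar_scale : forall f g x, is_laurent_bar f g -> bar (f *: x) = g *: bar x;
  bar_T : forall w : W, bar (T w) * T w^-1%g = 1 /\ T w^-1%g * bar (T w) = 1 }.

(* KL w is the element C_w, with coefficients P_{y,w} = coeff (P w) y. *)
Record kl_basis (H : algType L) (T : W -> H) (bar : H -> H)
    (P : W -> fsfunc W L) (KL : W -> H) := KLBasis {
  kl_expand : forall w, KL w = \sum_(y \in setT) coeff (P w) y *: T y;
  kl_diag : forall w, coeff (P w) w = 1;
  kl_offdiag : forall y w, y != w -> in_tauZ (-1) (coeff (P w) y);
  kl_bar : forall w, bar (KL w) = KL w }.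

(* h_{x,y,w} = coeff (h x y) w *)
Definition structure_constants (H : algType L) (KL : W -> H)
    (h : W -> W -> fsfunc W L) :=
  forall x y, KL x * KL y = \sum_(w \in setT) coeff (h x y) w *: KL w.

Definition is_afunction (h : W -> W -> fsfunc W L) (a : W -> nat) :=
  forall w, (forall x y, in_tauZ (a w) (coeff (h x y) w)) /\
    forall n : nat, (forall x y, in_tauZ n (coeff (h x y) w)) -> (a w <= n)%N.

(* gamma_{x,y,w^-1} *)
Definition gamma (h : W -> W -> fsfunc W L) (a : W -> nat) (x y w : W) : C :=
  coeff (coeff (h x y) w) (a w).

Section Cells.
Variable h : W -> W -> fsfunc W L.

Definition lr_step (w w' : W) :=
  exists x, coeff (h x w') w != 0 \/ coeff (h w' x) w != 0.

Definition le_lr : W -> W -> Prop := clos_refl_trans W lr_step.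

Definition two_sided_cell (c : set W) :=
  exists w, c = [set w' | le_lr w' w /\ le_lr w w'].
End Cells.

Record kl_datum := KLDatum {
  dH : algType L;
  dT : W -> dH;
  dT_hecke : generic_hecke dT;
  dbar : dH -> dH;
  dbar_bar : bar_involution dT dbar;
  dP : W -> fsfunc W L;
  dKL : W -> dH;
  dKL_basis : kl_basis dT dbar dP dKL;
  dh : W -> W -> fsfunc W L;
  dh_h : structure_constants dKL dh;
  da : W -> nat;
  da_a : is_afunction dh da }.

Section Asymptotic.
Variable D : kl_datum.

(* k is the coordinate ring of T^vee / W^s. *)
Local Notation k := (coordring (orbit_variety C G)).
Local Notation iota := (cst_morph (orbit_variety C G)).

(* The element C_w of the Hecke algebra at tau = 1, i.e. of the group algebra of
   W, whose elements are the finitely supported functions on W. *)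
Definition is_kl_at_one (w : W) (u : fsfunc W C) :=
  forall y, coeff u y = at_one (coeff (dP D w) y).

(* J is the asymptotic algebra, with basis t, distinguished set Dist, and
   k-algebra structure coming from Lusztig's homomorphism phi. *)
Record asymptotic_algebra (J : kalg k) (t : W -> restr iota J)
    (Dist : set W) (phi : {linear fsfunc W C -> restr iota J}) := AsymptoticAlgebra {
  asym_basis : is_basis t;
  asym_mul : forall x y, restr_mul (t x) (t y) =
    \sum_(w \in setT) gamma (dh D) (da D) x y w *: t w;
  asym_finite : finite_set Dist;
  asym_unit : @is_kunit _ J (\sum_(d \in Dist) t d);
  asym_phi : forall w u, is_kl_at_one w u -> phi u =
    \sum_(z \in setT)
      (\sum_(d \in Dist) (if da D z == da D d then at_one (coeff (dh D w d) z) else 0))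
      *: t z;
  (* u is an element of C[X(T^vee)], and f its restriction to T^vee / W^s *)
  asym_scale : forall (f : k) (u : fsfunc W C),
    (forall x : W, coeff u x != 0 -> x.2 = 1%g) ->
    (forall s : set_type [set: torus C],
       val f (\pi_(orbit_quot [set: torus C] G) s) = \sum_(x \in setT) coeff u x * torus_char x.1 (set_val s)) ->
    forall j : J, f *: j = kmul (phi u : J) j }.

(* The ideal spanned by the t_w with w in the cell c. *)
Definition is_cell_ideal (J : kalg k) (t : W -> restr iota J) (c : set W)
    (I : ideal J) :=
  forall x : J, I x <-> exists u : fsfunc W C,
    (forall w, coeff u w != 0 -> c w) /\
    (x : restr iota J) = \sum_(w \in setT) coeff u w *: t w.
End Asymptotic.
End KazhdanLusztig.

Section CellLabels.
Variables (C : numClosedFieldType) (G : {group weylG2}) (D : kl_datum C G).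

(* e1 and e1' may be the two intermediate cells in either order: the statements
   about them (Morita equivalences of C-algebras with two copies of the affine
   line) do not depend on the labelling. *)
Record cell_labels (ee e1 e1' e0 : set (ext_affine G)) := CellLabels {
  cell_highest : ee = [set w | ea_length w = 0%N];
  cell_ee : two_sided_cell (dh D) ee;
  cell_e1 : two_sided_cell (dh D) e1;
  cell_e1' : two_sided_cell (dh D) e1';
  cell_e0 : two_sided_cell (dh D) e0;
  cell_lowest : forall w w', e0 w -> le_lr (dh D) w w';
  cell_distinct : [/\ ee <> e1, ee <> e1', e1 <> e1', e1 <> e0 & e1' <> e0] }.
End CellLabels.

Section Decomposition.
Variable C : numClosedFieldType.

Definition weyl_r3 : weylG2 := (weyl_r ^+ 3)%g.

(* The pieces pt_1, pt_2, (T^vee)^a, (T^vee)^{a r^3}, T^vee and pt_* are numbered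
   from 0 to 5; this is the piece of the class of (w, z), for w in
   {e, a, r^3, a r^3}. *)
Definition piece_index (w : weylG2) (z : C * C) : nat :=
  if w == 1%g then 4
  else if w == weyl_a then 2
  else if w == (weyl_a * weyl_r3)%g then 3
  else if z == (1, 1) then 0
  else if z == (-1, -1) then 1
  else 5.

Variable G : {group weylG2}.

Definition dual_component (i : 'I_6) : variety C :=
  match val i with
  | 2 | 3 => affine_line C
  | 4 => orbit_variety C G
  | _ => point_variety C
  end.

Definition pieces (s : seq nat) : set (ext_variety C G) :=
  [set y | exists w z, is_class y w z /\ piece_index w z \in s].

Definition ext_coord : kalg (coordring (orbit_variety C G)) :=
  coord_kalg (@ext_proj_regular C G).

Definition piece_coord (s : seq nat) : kalg (coordring (orbit_variety C G)) :=
  coord_kalg (@piece_proj_regular C G (pieces s)).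
End Decomposition.

Definition homeomorphism (X Y : topologicalType) (f : X -> Y) :=
  exists g : Y -> X, [/\ cancel f g, cancel g f, continuous f & continuous g].

Section CompactDecomposition.
Variables (R : realType) (G : {group weylG2}).

Definition compact_component (i : 'I_6) : topologicalType :=
  match val i with
  | 2 | 3 => set_type (`[0, 1]%classic : set R)
  | 4 => orbit_space (@compact_torus R[i]) G
  | _ => discrete_topology unit
  end.
End CompactDecomposition.

Notation "'iota_' G" := (cst_morph (orbit_variety _ G)) (at level 10, G at next level).

(* Main.v *)
From HB Require Import structures.
Require Import Defs.
From mathcomp Require Import all_boot all_order all_algebra all_fingroup abelian.
From mathcomp Require Import complex ring lra zify.
From mathcomp Require Import all_classical all_reals topology normedtype realfun.
From mathcomp Require Import ereal measure lebesgue_measure.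
From Stdlib Require Import Relation_Operators.

Set Implicit Arguments.
Unset Strict Implicit.
Unset Printing Implicit Defensive.

Import Order.TTheory GRing.Theory Num.Theory.
Import numFieldTopology.Exports.
Local Open Scope classical_set_scope.
Local Open Scope ring_scope.
Local Open Scope quotient_scope.

(* In coordinates (z1, z2) = (s u, s / u) the four-group W^s is generated by s -> 1/s
   and u -> 1/u, so that T^vee / W^s is the plane of the points (s + 1/s, u + 1/u)
   modulo sign; the fixed points of its elements are computed directly.

   The extended affine Weyl group is a product of two infinite dihedral groups
   extended by an involution.  There the Kazhdan-Lusztig basis multiplies like
   Chebyshev polynomials, which gives the structure constants, the a-function, the
   cells and J explicitly.  J has matrix representations indexed by the extended
   quotient: of dimension 4 over the plane (lowest cell), where the one at the origin
   splits into two of dimension 2, the second of which is attached to pt_*; of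
   dimension 2 over the two lines; and of dimension 1 at the two points.  They are
   jointly faithful, and k acts on them through its values at the central characters.

   O(T^vee // W^s), whose representations are all of dimension 1, and J both map to an
   algebra of matrix functions on the extended quotient.  Filtering by the vanishing
   on the pieces, each layer of these algebras is a matrix algebra over the functions
   on a piece, up to the splitting at the origin, and its primitive ideals are the
   zero loci of its representations: the algebras have countable dimension and C is
   uncountable, so that Schur's lemma provides central characters (Dixmier).  Hence
   both morphisms are spectrum-preserving with respect to these filtrations. *)

(** * Simple modules of algebras of countable dimension *)

(** The obstacle is pt_*. In J it belongs to a summand of the representation at the origin, hence is
    a limit of the plane; in O(T^vee // W^s) it is isolated. So O has no morphism to J through the
    scalar matrices f(s): for f equal to 1 on T^vee / W^s and 0 at pt_* they are the identity away
    from the origin, hence also at the origin, where the summand of pt_* should be 0. The algebra of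
    matrix functions receives both because in it the values at the origin and at pt_* are unrelated.

    Its size 8 = 2 * 4 comes from parity. In X = s + 1/s and Y = u + 1/u the functions in k are
    even, but the 4 x 4 matrices of J also have odd entries. These vanish at the origin, which alone
    would leave two blocks of size 2 and two primitive ideals. In two copies with a separate parity
    bit the origin carries two blocks of size 4, which can be required to be equal.

    The constant -2 in the central characters of the lines comes from the sign character: there C_s
    acts by 0, so that at tau = 1 both simple reflections of a factor act by -1 and their sum by
    -2. *)

Section SimpleModules.
Variables (C : numClosedFieldType) (k : comPzRingType) (iota : {rmorphism C -> k}).
Variables (A : kalg k) (I I' : ideal A) (V : lmodType C) (act : A -> V -> V).
Hypothesis hV : simple_module iota I I' act.

Lemma smD x y v : I x -> I y -> act (x + y) v = act x v + act y v.
Proof. by case: hV => h _ _ _ _; exact: h. Qed.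
Lemma smZ c x v : I x -> act (iota c *: x) v = c *: act x v.
Proof. by case: hV => _ h _ _ _; exact: h. Qed.
Lemma smL x c v v' : I x -> act x (c *: v + v') = c *: act x v + act x v'.
Proof. by case: hV => _ _ h _ _; exact: h. Qed.
Lemma smM x y v : I x -> I y -> act (x ** y) v = act x (act y v).
Proof. by case: hV => _ _ _ h _; exact: h. Qed.
Lemma sm_bot x v : I' x -> act x v = 0.
Proof. by case: hV => _ _ _ _ [h _ _]; exact: h. Qed.
Lemma sm_act_neq0 : exists x v, I x /\ act x v != 0.
Proof. by case: hV => _ _ _ _ [_ h _]. Qed.
Lemma sm_simple (U : set V) : vsubspace U ->
  (forall x v, I x -> U v -> U (act x v)) -> U = [set 0] \/ U = setT.
Proof. by case: hV => _ _ _ _ [_ _ h]; exact: h. Qed.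

Lemma sm0 v : act 0 v = 0.
Proof.
by apply: (addrI (act 0 v)); rewrite -smD ?addr0; [|exact: ideal0|exact: ideal0].
Qed.
Lemma sm_v0 x : I x -> act x 0 = 0.
Proof.
move=> hx; apply: (addrI (act x 0)).
by rewrite addr0 -{3}[0](addr0 0) -{3}[0](scale1r 0) smL // scale1r.
Qed.

Lemma sm_vD x v v' : I x -> act x (v + v') = act x v + act x v'.
Proof. by move=> hx; have := smL 1 v v' hx; rewrite !scale1r. Qed.

Lemma sm_vZ x c v : I x -> act x (c *: v) = c *: act x v.
Proof. by move=> hx; rewrite -[c *: v]addr0 smL // sm_v0 // addr0. Qed.

Lemma sm_sum (J : Type) (s : seq J) (F : J -> A) v : (forall j, I (F j)) ->
  act (\sum_(j <- s) F j) v = \sum_(j <- s) act (F j) v.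
Proof.
move=> hF; elim: s => [|j s IH]; first by rewrite !big_nil sm0.
rewrite !big_cons smD ?IH //.
by elim: s {IH} => [|l s IHs]; rewrite ?big_nil ?big_cons;
  [exact: ideal0 | apply: idealD].
Qed.

(** The vectors killed by [I] form a submodule, which is not all of [V] because the action of [I] is
    not zero. *)
Lemma sm_null v : (forall x, I x -> act x v = 0) -> v = 0.
Proof.
move=> hv; pose U := [set v | forall x, I x -> act x v = 0].
have [||e|e] := @sm_simple U.
- split=> [x hx|u w hu hw x hx|c u hu x hx]; first by rewrite sm_v0.
    by rewrite sm_vD // hu // hw // addr0.
  by rewrite sm_vZ // hu // scaler0.
- move=> x u hx hu y hy; rewrite -smM //.
  exact/hu/Defs.idealMr.
- by have : U v := hv; rewrite e.
- have [x [u [hx /eqP[]]]] := sm_act_neq0.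
  have hu : U u by rewrite e.
  by rewrite hu.
Qed.

(* A nilpotent ideal kills a simple module, as the vectors it kills form a submodule. *)
Lemma sm_nilpotent (N : set A) (n : nat) : N `<=` I ->
  (forall x y, N x -> I y -> N (x ** y)) ->
  (forall s : seq A, size s = n -> (forall x, x \in s -> N x) ->
     forall v, foldr act v s = 0) ->
  forall x v, N x -> act x v = 0.
Proof.
move=> NI NM; elim: n => [|n IH] h.
  by move=> x v /NI hx; have -> : v = 0 by [exact: (h [::])]; rewrite sm_v0.
pose U := [set v | forall x, N x -> act x v = 0].
have [||e|e] := @sm_simple U.
- split=> [x /NI hx|u w hu hw x hx|c u hu x hx]; first by rewrite sm_v0.
    by rewrite sm_vD; [rewrite hu // hw // addr0 | exact: NI].
  by rewrite sm_vZ; [rewrite hu // scaler0 | exact: NI].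
- move=> x u hx hu y hy; rewrite -smM //; last exact: NI.
  by apply: hu; exact: NM.
- apply: IH => s ss hs v.
  have : U (foldr act v s).
    move=> x hx; rewrite -[LHS]/(foldr act v (x :: s)); apply: h; first by rewrite /= ss.
    by move=> y; rewrite inE => /orP[/eqP ->|/hs].
  by rewrite e.
- by move=> x v hx; have hv : U v by [rewrite e]; apply: hv.
Qed.
End SimpleModules.

(* k may be the zero ring, over which polynomials are not available. *)
Section PolynomialEvaluation.
Variables (C : numClosedFieldType) (k : comPzRingType) (iota : {rmorphism C -> k}).
Variable z : k.

Definition pzeval (p : {poly C}) : k := \sum_(i < size p) iota p`_i * z ^+ i.

Lemma pzeval_widen n (p : {poly C}) : (size p <= n)%N -> pzeval p = \sum_(i < n) iota p`_i * z ^+ i.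
Proof.
move=> h; rewrite /pzeval (big_ord_widen n (fun i => iota p`_i * z ^+ i)) // big_mkcond.
by apply: eq_bigr => i _; case: ltnP => // hi; rewrite nth_default // rmorph0 mul0r.
Qed.

Lemma pzevalD p q : pzeval (p + q) = pzeval p + pzeval q.
Proof.
have [hp hq] := (leq_maxl (size p) (size q), leq_maxr (size p) (size q)).
rewrite (pzeval_widen hp) (pzeval_widen hq) (pzeval_widen (size_polyD p q)) -big_split.
by apply: eq_bigr => i _; rewrite coefD rmorphD mulrDl.
Qed.

Lemma pzevalZ c p : pzeval (c *: p) = iota c * pzeval p.
Proof.
rewrite (pzeval_widen (size_scale_leq c p)) mulr_sumr.
by apply: eq_bigr => i _; rewrite coefZ rmorphM mulrA.
Qed.

Lemma pzevalMX p : pzeval (p * 'X) = z * pzeval p.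
Proof.
have h : (size (p * 'X)%R <= (size p).+1)%N.
  by apply: leq_trans (size_polyMleq _ _) _; rewrite size_polyX addn2.
rewrite (pzeval_widen h) big_ord_recl coefMX /= rmorph0 mul0r add0r mulr_sumr.
by apply: eq_bigr => i _; rewrite coefMX /= exprS mulrCA.
Qed.

Lemma pzevalMXsubC p c : pzeval (p * ('X - c%:P)) = pzeval p * (z - iota c).
Proof.
rewrite mulrBr -mulNr mulrC [_ * c%:P]mulrC mul_polyC mulrC.
by rewrite pzevalD pzevalMX scalerN -scaleNr pzevalZ rmorphN mulrBr mulNr mulrC [iota c * _]mulrC.
Qed.

Lemma pzeval_sum (J : Type) (s : seq J) P (F : J -> {poly C}) :
  pzeval (\sum_(j <- s | P j) F j) = \sum_(j <- s | P j) pzeval (F j).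
Proof.
apply: (big_morph pzeval pzevalD).
by rewrite /pzeval size_poly0 big_ord0.
Qed.

Lemma pzeval_prod (J : Type) (s : seq J) P (F : J -> C) :
  pzeval (\prod_(j <- s | P j) ('X - (F j)%:P)) = \prod_(j <- s | P j) (z - iota (F j)).
Proof.
elim: s => [|j s IH].
  by rewrite !big_nil /pzeval size_polyC oner_eq0 big_ord1 coef1 rmorph1 mulr1.
rewrite !big_cons; case: ifP => // _.
by rewrite mulrC pzevalMXsubC IH mulrC.
Qed.
End PolynomialEvaluation.

(** * Dixmier's form of Schur's lemma for algebras of countable dimension *)

Section Dixmier.
Variables (C : numClosedFieldType) (k : comPzRingType) (iota : {rmorphism C -> k}).
Hypothesis C_uncountable : ~ countable [set: C].

Definition countably_spanned (A : kalg k) := exists a : nat -> A,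
  forall x, exists (n : nat) (c : nat -> C), x = \sum_(i < n) iota (c i) *: a i.

(** [V] is a vector space over [C] only through [iota]; the relation comes from the left kernel of
    the coefficient matrix, which has more rows than columns. *)
Lemma linear_dependence (V : lmodType k) (a : nat -> V) (m : nat) (x : 'I_m.+1 -> V) :
  (forall i, exists c : nat -> C, x i = \sum_(j < m) iota (c j) *: a j) ->
  exists l : 'I_m.+1 -> C, (exists i, l i != 0) /\ \sum_i iota (l i) *: x i = 0.
Proof.
move=> /choice[c hc]; pose M := \matrix_(i < m.+1, j < m) c i j.
have : kermx M != 0.
  by rewrite -mxrank_eq0 mxrank_ker subn_eq0 -ltnNge ltnS rank_leq_col.
move=> /rowV0Pn[u /sub_kermxP uM u0].
exists (fun i => u 0 i); split.
  by have [i hi] := elimT (rV0Pn _) u0; exists i.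
under eq_bigr do rewrite hc scaler_sumr.
rewrite exchange_big /=; apply: big1 => j _.
under eq_bigr do rewrite scalerA -rmorphM.
rewrite -scaler_suml -rmorph_sum.
have := congr1 (fun N : 'rV_m => N 0 j) uM; rewrite !mxE => e.
rewrite [X in iota X](_ : _ = 0) ?rmorph0 ?scale0r // -[RHS]e.
by apply: eq_bigr => i _; rewrite mxE.
Qed.

(** Otherwise [C] would be a countable union of finite sets. *)
Lemma uncountable_fiber (f : C -> nat) : exists n, infinite_set [set c | (f c <= n)%N].
Proof.
apply: contrapT => /forallNP h; apply: C_uncountable.
have -> : [set: C] = \bigcup_(n in [set: nat]) [set c | (f c <= n)%N].
  apply/seteqP; split=> // c _; exists (f c) => //; exact: leqnn.
apply: bigcup_countable; first exact: countableP.
by move=> n _; apply: finite_set_countable; apply: contrapT; exact: h.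
Qed.

Lemma infinite_injection (T : choiceType) (S : set T) n : infinite_set S ->
  exists s : 'I_n -> T, injective s /\ forall i, S (s i).
Proof.
move=> /(infinite_set_fset n)[X hX Xn].
have lt (i : 'I_n) : (i < size (finmap.enum_fset X))%N by apply: leq_trans Xn.
exists (fun i : 'I_n => tnth (in_tuple (finmap.enum_fset X)) (Ordinal (lt i))); split.
  have U : uniq (in_tuple (finmap.enum_fset X)) by exact: finmap.fset_uniq.
  move=> i j /(elimT (tuple_uniqP _) U) /(congr1 val) /= ij.
  exact: val_inj.
by move=> i; apply: hX; apply: mem_tnth.
Qed.

(** If z acts by no scalar, every z - c is invertible on [V], and uncountably many vectors (z -
    c)^-1 v0 live in a space of countable dimension. A linear relation between finitely many of them
    gives a non-zero polynomial in z that kills v0, although all its linear factors are invertible.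
    As [A] need not be unital, z acts only through the elements [z *: x] with x in [I]. *)
Lemma dixmier (A : kalg k) (I I' : ideal A) (V : lmodType C) (act : A -> V -> V) :
  countably_spanned A -> simple_module iota I I' act ->
  forall z : k, exists c, forall x v, I x -> act (z *: x) v = c *: act x v.
Proof.
move=> [a ha] hV z; apply: contrapT => /forallNP hz.
(* The kernel of z - c is a submodule; were it everything, z would act by c. *)
have N0 c v : (forall x, I x -> act ((z - iota c) *: x) v = 0) -> v = 0.
  pose U := [set v | forall x, I x -> act ((z - iota c) *: x) v = 0] => hv.
  have [||e|e] := sm_simple hV (U := U).
  - split=> [x hx|u w hu hw x hx|d u hu x hx].
    + by rewrite (sm_v0 hV) //; exact: Defs.idealZ.
    + by rewrite (sm_vD hV); [rewrite hu // hw // addr0 | exact: Defs.idealZ].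
    + by rewrite (sm_vZ hV); [rewrite hu // scaler0 | exact: Defs.idealZ].
  - move=> x u hx hu y hy; rewrite -(smM hV) //; last exact: Defs.idealZ.
    by rewrite kmulZl; apply: hu; exact: Defs.idealMr.
  - by have : U v := hv; rewrite e.
  - case: (hz c) => x w hx; have hw : U w by rewrite e.
    rewrite -(smZ hV) // -[z](subrK (iota c)) scalerDl (smD hV); try exact: Defs.idealZ.
    by rewrite hw // add0r.
have [x0 [v0 [hx0 v0P]]] := sm_act_neq0 hV.
have v00 : v0 != 0 by apply: contraNneq v0P => ->; rewrite (sm_v0 hV).
(* The image of z - c on [I] v0 is a non-zero submodule, so it contains v0: [xs c] applied to v0 is
   (z - c)^-1 v0. *)
have /choice[xs hxs] c : exists x, I x /\ act ((z - iota c) *: x) v0 = v0.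
  pose U := [set u | exists x, I x /\ act ((z - iota c) *: x) v0 = u].
  have [||e|e] := sm_simple hV (U := U).
  - split=> [|u u' [x [hx <-]] [y [hy <-]]|d u [x [hx <-]]].
    + by exists 0; rewrite scaler0 (sm0 hV); split=> //; exact: Defs.ideal0.
    + exists (x + y); split; first exact: Defs.idealD.
      by rewrite scalerDr (smD hV) //; exact: Defs.idealZ.
    + exists (iota d *: x); split; first exact: Defs.idealZ.
      by rewrite scalerA mulrC -scalerA (smZ hV) //; exact: Defs.idealZ.
  - move=> x u hx [y [hy <-]]; exists (x ** y); split; first exact: Defs.idealMr.
    by rewrite -kmulZr (smM hV) //; exact: Defs.idealZ.
  - case/eqP: v00; apply: (N0 c) => x hx.
    have hU : U (act ((z - iota c) *: x) v0) by exists x.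
    by rewrite e in hU.
  - by have : U v0 by rewrite e.
have {ha} /choice[N /choice[cf hN]] c := ha (xs c).
(* For infinitely many c the element [xs c] lies in the span of the same n vectors; n + 1 of these
   are dependent. *)
have [n /(infinite_injection n.+1)[s [sI sn]]] := uncountable_fiber N.
have [|l [[i0 li0] l0]] := @linear_dependence A a n (fun i => xs (s i)).
  move=> i; exists (fun j => if (j < N (s i))%N then cf (s i) j else 0).
  rewrite {1}hN (big_ord_widen n (fun j => iota (cf (s i) j) *: a j)) ?sn //=.
  by rewrite big_mkcond; apply: eq_bigr => j _; case: ifP => // _; rewrite rmorph0 scale0r.
pose Z i := z - iota (s i); pose q i := \prod_(j | j != i) Z j.
(* The numerator of the sum of l_i / (X - s_i). Its value at [s i0] is a single non-zero product. *)
pose Qp := \sum_i l i *: \prod_(j | j != i) ('X - (s j)%:P).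
have Qp0 : Qp != 0.
  apply/eqP => /(congr1 (fun p => p.[s i0])) /eqP; rewrite horner0 horner_sum.
  rewrite (bigD1 i0) //= [X in _ + X]big1 ?addr0 => [|i ii0]; last first.
    rewrite hornerZ horner_prod (bigD1 i0) 1?eq_sym //=.
    by rewrite hornerXsubC subrr mul0r mulr0.
  rewrite hornerZ horner_prod mulf_eq0 (negPf li0) /=; apply/negP/prodf_neq0 => j ji.
  by rewrite !hornerE subr_eq0; apply: contraNneq ji => /sI ->.
have hQ y : I y -> act (pzeval iota z Qp *: y) v0 = 0.
  move=> hy; have <- : act (y ** ((\prod_j Z j) *: \sum_i iota (l i) *: xs (s i))) v0 = 0.
    rewrite l0 scaler0.
    have -> : y ** 0 = 0 :> A.
      by apply: (addrI (y ** 0)); rewrite -kmulDr !addr0.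
    exact: (sm0 hV).
  have F i : y ** ((\prod_j Z j) *: (iota (l i) *: xs (s i))) =
      iota (l i) *: ((q i *: y) ** (Z i *: xs (s i))).
    by rewrite !kmulZr !kmulZl !scalerA (bigD1 i) //= /q mulrC mulrA mulrAC.
  rewrite scaler_sumr.
  have -> (G : 'I_n.+1 -> A) : y ** (\sum_i G i) = \sum_i y ** G i.
    elim/big_rec2: _ => [|i u w _ <-]; last by rewrite kmulDr.
    by apply: (addrI (y ** 0)); rewrite -kmulDr !addr0.
  have Iq i : I (q i *: y) by exact: Defs.idealZ.
  have Ix i : I (Z i *: xs (s i)) by apply: Defs.idealZ; case: (hxs (s i)).
  rewrite (eq_bigr _ (fun i _ => F i)) (sm_sum hV) => [|i]; last first.
    by apply: Defs.idealZ; apply: Defs.idealMr.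
  rewrite (eq_bigr (fun i => act ((iota (l i) * q i) *: y) v0)) => [|i _]; last first.
    rewrite (smZ hV); last exact: Defs.idealMr.
    by rewrite (smM hV) // (proj2 (hxs (s i))) -(smZ hV) // scalerA.
  rewrite -(sm_sum hV) => [|i]; last exact: Defs.idealZ.
  congr (act _ _).
  rewrite -scaler_suml pzeval_sum; congr (_ *: _).
  by apply: eq_bigr => i _; rewrite pzevalZ pzeval_prod.
have [r Qr] := closed_field_poly_normal Qp.
suff H (c : C) (t : seq C) : c != 0 ->
    (forall y, I y -> act ((iota c * \prod_(d <- t) (z - iota d)) *: y) v0 = 0) -> v0 = 0.
  case/eqP: v00; apply: (H (lead_coef Qp) r); first by rewrite lead_coef_eq0.
  move=> y hy; rewrite -[RHS](hQ y hy); congr (act (_ *: _) _).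
  by rewrite [in RHS]Qr pzevalZ pzeval_prod.
move=> c0; elim: t => [|d t IH] h.
  apply: (sm_null hV) => y hy; have := h y hy.
  rewrite big_nil mulr1 (smZ hV) // => /eqP.
  by rewrite scaler_eq0 (negPf c0) /= => /eqP.
(* Replacing v0 by (z - d) x_d v0 supplies the missing factor z - d. *)
apply: IH => y hy; have [xI xE] := hxs d; rewrite -[X in act _ X]xE.
rewrite -(smM hV); try exact: Defs.idealZ.
rewrite kmulZl kmulZr scalerA -mulrA [_ * (z - _)]mulrC.
by have := h (y ** xs d) (Defs.idealMr _ hy); rewrite big_cons.
Qed.
End Dixmier.

(** * Primitive ideals of matrix families *)

Section MatrixRepresentations.
Variables (C : numClosedFieldType) (k : comPzRingType) (iota : {rmorphism C -> k}).
Variables (A : kalg k).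

Definition mx_morph (T : finType) (rho : A -> T -> T -> C) :=
  [/\ forall x y i j, rho (x + y) i j = rho x i j + rho y i j,
      forall c x i j, rho (iota c *: x) i j = c * rho x i j &
      forall x y i j, rho (x ** y) i j = \sum_l rho x i l * rho y l j].

Definition zero_locus (I : ideal A) (T : Type) (rho : A -> T -> T -> C) : set A :=
  [set x | I x /\ forall i j, rho x i j = 0].

(** Surjectivity is asked of the restriction to [I]: the matrix units lie in [I], so the column
    vectors form a simple module of I / I' itself. *)
Record full_rep (I I' : ideal A) (T : finType) (rho : A -> T -> T -> C) : Prop := FullRep {
  rep_morph : mx_morph rho;
  rep_neq0 : inhabited T;
  rep_bot : forall x, I' x -> forall i j, rho x i j = 0;
  rep_surj : forall M : T -> T -> C, exists x, I x /\ forall i j, rho x i j = M i j }.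

Lemma mx_morph_sum (T : finType) (rho : A -> T -> T -> C) (U : Type) (s : seq U) F i j :
  mx_morph rho -> rho (\sum_(u <- s) F u) i j = \sum_(u <- s) rho (F u) i j.
Proof.
case=> hD hZ _; elim: s => [|u s IH]; last by rewrite !big_cons hD IH.
by rewrite !big_nil -(scaler0 _ (iota 0)) hZ mul0r.
Qed.

Variables (I I' : ideal A).

Section OneRep.
Variables (T : finType) (rho : A -> T -> T -> C) (h : full_rep I I' rho).

Definition mx_act (x : A) (v : T -> C^o) : T -> C^o := fun i => \sum_j rho x i j * v j.

Let unit_mx_ex (i j : T) : exists x, I x /\
  forall a b, rho x a b = ((a == i) && (b == j))%:R.
Proof. by have [x hx] := rep_surj h (fun a b => ((a == i) && (b == j))%:R); exists x. Qed.

Lemma mx_act_unit (x : A) i j v : (forall a b, rho x a b = ((a == i) && (b == j))%:R) ->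
  mx_act x v = fun a => (a == i)%:R * v j.
Proof.
move=> hx; apply/funext => a; rewrite /mx_act (bigD1 j) //= big1 => [|b bj]; last first.
  by rewrite hx (negPf bj) andbF mul0r.
by rewrite hx eqxx andbT addr0.
Qed.

Lemma primitive_zero_locus : primitive iota I I' (zero_locus I rho).
Proof.
have [hD hZ hM] := rep_morph h.
exists (T -> C^o), mx_act; split; last first.
  apply/seteqP; split=> x [hx hr]; split=> //.
    move=> v; apply/funext => i; rewrite /mx_act big1 // => j _.
    by rewrite hr mul0r.
  move=> i j; have := congr1 (fun f => f i) (hr (fun l => (l == j)%:R)).
  rewrite /mx_act (bigD1 j) //= big1 => [|l lj]; last by rewrite (negPf lj) mulr0.
  by rewrite eqxx mulr1 addr0.
split.
- move=> x y v _ _; apply/funext => i; rewrite /mx_act [RHS]/GRing.add /= -big_split /=.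
  by apply: eq_bigr => j _; rewrite hD mulrDl.
- move=> c x v _; apply/funext => i; rewrite -[RHS]/(c * \sum_j rho x i j * v j) mulr_sumr.
  by apply: eq_bigr => j _; rewrite hZ mulrA.
- move=> x c v v' _; apply/funext => i; 
  rewrite -[RHS]/(c * (\sum_j rho x i j * v j) + \sum_j rho x i j * v' j) mulr_sumr.
  rewrite -big_split /=.
  by apply: eq_bigr => j _; rewrite mulrDr mulrCA.
- move=> x y v _ _; apply/funext => i; rewrite /mx_act.
  under eq_bigr do rewrite hM mulr_suml.
  rewrite exchange_big /=; apply: eq_bigr => j _; rewrite mulr_sumr.
  by apply: eq_bigr => l _; rewrite mulrA.
- split.
  + move=> x v hx; apply/funext => i; rewrite /mx_act big1 // => j _.
    by rewrite (rep_bot h hx) mul0r.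
  + have [i0] := rep_neq0 h; have [x [hx ex]] := unit_mx_ex i0 i0.
    exists x, (fun=> 1); split=> //; rewrite (mx_act_unit _ ex).
    apply/eqP => /(congr1 (fun f => f i0)); rewrite eqxx mulr1 => /eqP.
    by rewrite oner_eq0.
  + move=> U [U0 UD UZ] UI.
    have [[u [Uu u0]]|nU] := pselect (exists u, U u /\ u != 0); last first.
      left; apply/seteqP; split=> [u Uu|_ -> //] /=.
      by apply/eqP; apply: contra_notT nU => u0; exists u.
    right; apply/seteqP; split=> // w _.
    have [j uj] : exists j, u j != 0.
      by apply: contra_neqP u0 => /forallNP h0; apply/funext => j; apply/eqP/negPn/negP/h0.
    (* A matrix unit moves the non-zero coordinate [u j] to any place. *)
    have Ui i c : U (fun a => (a == i)%:R * c : C^o).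
      have [x [hx ex]] := unit_mx_ex i j.
      have := UZ (c / u j) _ (UI x u hx Uu); rewrite (mx_act_unit _ ex).
      rewrite (_ : _ *: _ = (fun a => (a == i)%:R * c : C^o)) //.
      apply/funext => a; rewrite -[LHS]/(c / u j * ((a == i)%:R * u j)) mulrCA.
      by rewrite mulfVK.
    have -> : w = \sum_i (fun a => (a == i)%:R * w i : C^o).
      apply/funext => a; rewrite fct_sumE (bigD1 a) //= big1 => [|b ba].
        by rewrite eqxx mul1r addr0.
      by rewrite eq_sym (negPf ba) mul0r.
    by elim/big_ind: _ => // *.
Qed.

(* The image of rho is a simple ring, so the annihilator of a module factoring
   through rho is the kernel of rho. *)
Lemma annihilator_zero_locus (V : lmodType C) (act : A -> V -> V) :
  simple_module iota I I' act ->
  (forall x, I x -> (forall i j, rho x i j = 0) -> forall v, act x v = 0) ->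
  [set x | I x /\ forall v, act x v = 0] = zero_locus I rho.
Proof.
move=> hV hk; have [hD hZ hM] := rep_morph h.
apply/seteqP; split=> x [hx hv]; split=> //; last exact: hk.
move=> a b; apply: contrapT => /eqP xab.
have [y [v [hy /eqP[]]]] := sm_act_neq0 hV.
have /choice[e he] (p : T * T) := unit_mx_ex p.1 p.2.
have Ie p : I (e p) by case: (he p).
have hE p i j : rho (e p) i j = ((i == p.1) && (j == p.2))%:R by case: (he p).
(* E_(p1,a) x E_(b,p2) = x_ab E_(p1,p2), so the sum of the [F p] has the same matrix as y, and each
   term acts by 0 because x does. *)
pose F (p : T * T) := iota (rho y p.1 p.2 / rho x a b) *: (e (p.1, a) ** (x ** e (b, p.2))).
have IF p : I (F p) by apply: Defs.idealZ; apply: Defs.idealMr.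
have {}IFs : I (\sum_p F p).
  by elim/big_ind: _ => // *; [exact: Defs.ideal0 | exact: Defs.idealD].
have INF : I ((-1) *: \sum_p F p) by exact: Defs.idealZ.
have -> : y = \sum_p F p + (y + (-1) *: \sum_p F p) by rewrite scaleN1r addrC subrK.
rewrite (smD hV) //; last exact: Defs.idealD.
rewrite (sm_sum hV) // big1 ?add0r => [|p _]; last first.
  rewrite /F (smZ hV); last by apply: Defs.idealMr.
  rewrite (smM hV) //; last by apply: Defs.idealMr.
  by rewrite (smM hV) // hv (sm_v0 hV) // scaler0.
apply: hk => [|i j]; first exact: Defs.idealD.
rewrite hD -(rmorphN1 iota) hZ (mx_morph_sum _ _ _ _ (rep_morph h)).
rewrite (bigD1 (i, j)) //= big1 ?addr0 => [|p pij].
  rewrite /F hZ hM (bigD1 a) //= big1 ?addr0 => [|l la]; last by rewrite hE (negPf la) andbF mul0r.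
  rewrite hE !eqxx mul1r hM (bigD1 b) //= big1 ?addr0 => [|l lb]; last first.
    by rewrite hE (negPf lb) mulr0.
  by rewrite hE !eqxx mulr1 mulfVK // mulN1r subrr.
rewrite /F hZ hM big1 ?mulr0 // => l _; rewrite hE /=.
have [il|] := eqVneq i p.1; last by rewrite mul0r.
rewrite hM big1 ?mulr0 // => m _; rewrite hE /=.
have [jp|] := eqVneq j p.2; last by rewrite andbF mulr0.
by case/eqP: pij; rewrite il jp; case: (p).
Qed.
End OneRep.

(** The index type may depend on s because the representation over the origin of the plane is
    smaller than the others. *)
Lemma primitive_class (S : Type) (T : S -> finType) (rho : forall s, A -> T s -> T s -> C) :
  (forall s, full_rep I I' (rho s)) ->
  (forall (V : lmodType C) (act : A -> V -> V), simple_module iota I I' act ->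
     exists s, forall x, I x -> (forall i j, rho s x i j = 0) -> forall v, act x v = 0) ->
  forall P, primitive iota I I' P <-> exists s, P = zero_locus I (rho s).
Proof.
move=> hr hs P; split=> [[V [act [hV ->]]]|[s ->]]; last exact: primitive_zero_locus.
by have [s h] := hs V act hV; exists s; exact: annihilator_zero_locus.
Qed.

Lemma primitive_class1 (T : finType) (rho : A -> T -> T -> C) : full_rep I I' rho ->
  (forall x, I x -> (forall i j, rho x i j = 0) -> I' x) ->
  forall P, primitive iota I I' P <-> P = zero_locus I rho.
Proof.
move=> hr hk P.
have := @primitive_class unit (fun=> T) (fun=> rho) (fun=> hr).
move=> /(_ _ P)-> => [|V act hV]; last first.
  by exists tt => x hx /hk-/(_ hx) hx' v; exact: (sm_bot hV).
by split=> [[_ ->]|->] //; exists tt.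
Qed.
End MatrixRepresentations.

Section SpectrumCriterion.
Variables (C : numClosedFieldType) (k : comPzRingType) (iota : {rmorphism C -> k}).
Variables (A B : kalg k) (f : A -> B) (I I' : ideal A) (J J' : ideal B).

(** The parametrization by [S] may repeat itself, as p and -p do on the plane; hence the last
    hypothesis concludes with equality of the ideals and not of the parameters. *)
Lemma spectrum_preservingP (S : Type) (Q : S -> set A) (P : S -> set B) :
  (forall Q', primitive iota I I' Q' <-> exists s, Q' = Q s) ->
  (forall P', primitive iota J J' P' <-> exists s, P' = P s) ->
  (forall s x, I x -> P s (f x) -> Q s x) ->
  (forall s s', (forall x, I x -> P s (f x) -> Q s' x) -> P s = P s' /\ Q s = Q s') ->
  spectrum_preserving iota f I I' J J'.
Proof.
move=> hQ hP PQ inj; split.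
  move=> P' hP'; have /hP[s Ps] := hP'; subst P'.
  exists (Q s); split; first by split; [apply/hQ; exists s | exact: PQ].
  by move=> Q' [/hQ[s' ->] /inj[]].
move=> Q' hQ'; have /hQ[s Qs] := hQ'; subst Q'.
exists (P s); split; first by split; [apply/hP; exists s | exact: PQ].
by move=> P' [/hP[s' ->] /inj[]].
Qed.
End SpectrumCriterion.

(** * Even and odd polynomial functions on the plane *)

Section Parity.
Variable C : numClosedFieldType.
Implicit Types f g : C * C -> C.

(* The monomials XY, X^2 and Y^2, indexed by None, Some true and Some false. *)
Definition quad (u : option bool) (z : C * C) : C :=
  match u with None => z.1 * z.2 | Some true => z.1 * z.1 | Some false => z.2 * z.2 end.

Definition coordinate (s : bool) (z : C * C) : C := if s then z.1 else z.2.

Lemma quad_coordinate s z : quad (Some s) z = coordinate s z * coordinate s z.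
Proof. by case: s. Qed.

(** The algebra C[X, Y]_0 in terms of its generators, so that facts about functions on T^vee / W^s
    can be proved by induction on them. *)
Inductive even_fun : (C * C -> C) -> Prop :=
| even_cst c : even_fun (fun=> c)
| even_quad u : even_fun (quad u)
| evenD f g : even_fun f -> even_fun g -> even_fun (fun z => f z + g z)
| evenM f g : even_fun f -> even_fun g -> even_fun (fun z => f z * g z).

(** The odd functions as the module over the even ones generated by the two coordinates. *)
Definition odd_fun f := exists g h, [/\ even_fun g, even_fun h &
  forall z, f z = z.1 * g z + z.2 * h z].

Definition par (b : bool) f := if b then odd_fun f else even_fun f.

Lemma par_ext b f g : f =1 g -> par b f -> par b g.
Proof. by move=> /funext ->. Qed.

Lemma par_cst c : par false (fun=> c).
Proof. exact: even_cst. Qed.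

Lemma par0 b : par b (fun=> 0).
Proof.
case: b; last exact: even_cst.
exists (fun=> 0), (fun=> 0); split; try exact: even_cst.
by move=> z; rewrite !mulr0 addr0.
Qed.

Lemma parD b f g : par b f -> par b g -> par b (fun z => f z + g z).
Proof.
case: b => /=; last exact: evenD.
move=> [f1 [f2 [h1 h2 e]]] [g1 [g2 [h3 h4 e']]].
exists (fun z => f1 z + g1 z), (fun z => f2 z + g2 z); split; try exact: evenD.
by move=> z; rewrite e e' !mulrDr addrACA.
Qed.

Lemma par_coordinate s : par true (coordinate s).
Proof.
case: s; [exists (fun=> 1), (fun=> 0) | exists (fun=> 0), (fun=> 1)];
  by split; try exact: even_cst; move=> z; rewrite /= mulr1 mulr0 ?addr0 ?add0r.
Qed.

Lemma parM b b' f g : par b f -> par b' g -> par (b (+) b') (fun z => f z * g z).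
Proof.
case: b; case: b' => /=.
- move=> [f1 [f2 [h1 h2 e]]] [g1 [g2 [h3 h4 e']]].
  apply: (@par_ext false (fun z => (quad (Some true) z * (f1 z * g1 z) +
    quad (Some false) z * (f2 z * g2 z)) + quad None z * (f1 z * g2 z + f2 z * g1 z))).
    by move=> z; rewrite e e' /=; ring.
  have Q u h : even_fun h -> even_fun (fun z => quad u z * h z).
    by move=> hh; apply: evenM => //; exact: even_quad.
  apply: evenD; first by apply: evenD; apply: Q; exact: evenM.
  by apply: Q; apply: evenD; exact: evenM.
- move=> [f1 [f2 [h1 h2 e]]] hg; exists (fun z => f1 z * g z), (fun z => f2 z * g z).
  by split; try exact: evenM; move=> z; rewrite e mulrDl !mulrA.
- move=> hf [f1 [f2 [h1 h2 e]]]; exists (fun z => f z * f1 z), (fun z => f z * f2 z).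
  by split; try exact: evenM; move=> z; rewrite e mulrDr !(mulrCA (f z)).
- exact: evenM.
Qed.

Lemma par_sum b (J : Type) (s : seq J) (P : pred J) (F : J -> C * C -> C) :
  (forall j, P j -> par b (F j)) -> par b (fun z => \sum_(j <- s | P j) F j z).
Proof.
move=> hF; elim: s => [|j s IH].
  by apply: (par_ext _ (par0 b)) => z; rewrite big_nil.
case hj : (P j); last by apply: (par_ext _ IH) => z; rewrite big_cons hj.
by apply: (par_ext _ (parD (hF j hj) IH)) => z; rewrite big_cons hj.
Qed.

Lemma par_scale b c f : par b f -> par b (fun z => c * f z).
Proof. exact: (parM (par_cst c)). Qed.

Lemma par_quadM b u f : par b f -> par b (fun z => quad u z * f z).
Proof. exact: (@parM false _ (quad u) _ (even_quad u)). Qed.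

Lemma par_opp b f z : par b f -> f (- z) = (-1) ^+ b * f z.
Proof.
have ev h : even_fun h -> h (- z) = h z.
  elim=> // [|h1 h2 _ e1 _ e2|h1 h2 _ e1 _ e2]; last 2 first.
  - by rewrite e1 e2.
  - by rewrite e1 e2.
  - by move=> [[]|] /=; rewrite mulrNN.
case: b => /=; last by move=> /ev ->; rewrite mul1r.
move=> [g [h [/ev eg /ev eh e]]]; rewrite !e eg eh expr1 /=.
by rewrite !mulNr mul1r opprD.
Qed.

Lemma odd0 f : par true f -> f 0 = 0.
Proof. by move=> [g [h [_ _ ->]]]; rewrite /= !mul0r addr0. Qed.

(** Induction on the generators; for a product, f g - f(p) g(p) = (f - f(p)) g + f(p) (g - g(p)). *)
Lemma even_vanish f p : even_fun f -> exists F : option bool -> C * C -> C,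
  (forall u, even_fun (F u)) /\
  forall z, f z = f p + \sum_u (quad u z - quad u p) * F u z.
Proof.
elim=> {f} [c|u0|f g _ [F [hF eF]] _ [G [hG eG]]|f g hf [F [hF eF]] hg [G [hG eG]]].
- exists (fun _ => fun=> 0); split=> [u|z]; first exact: even_cst.
  by rewrite big1 ?addr0 // => u _; rewrite mulr0.
- exists (fun u => fun=> (u == u0)%:R); split=> [u|z]; first exact: even_cst.
  rewrite (bigD1 u0) //= big1 => [|u uu0]; last by rewrite (negPf uu0) mulr0.
  by rewrite eqxx mulr1 addr0 addrCA subrr addr0.
- exists (fun u z => F u z + G u z); split=> [u|z]; first exact: evenD.
  under eq_bigr do rewrite mulrDr.
  by rewrite big_split /= addrACA -eF -eG.
- exists (fun u z => F u z * g z + f p * G u z); split=> [u|z].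
    by apply: evenD; apply: evenM => //; exact: even_cst.
  under eq_bigr do rewrite mulrDr mulrA mulrCA.
  rewrite big_split /= -mulr_suml -mulr_sumr.
  have -> : \sum_u (quad u z - quad u p) * F u z = f z - f p by rewrite eF addrC addKr.
  have -> : \sum_u (quad u z - quad u p) * G u z = g z - g p by rewrite eG addrC addKr.
  by ring.
Qed.

Lemma even_vanish0 f : even_fun f -> f 0 = 0 -> exists F : option bool -> C * C -> C,
  (forall u, even_fun (F u)) /\ forall z, f z = \sum_u quad u z * F u z.
Proof.
move=> /(even_vanish 0)[F [hF eF]] f0; exists F; split=> // z.
by rewrite eF f0 add0r; apply: eq_bigr => u _; case: u => [[]|]; rewrite /= mulr0 subr0.
Qed.

(* For odd f the factor makes [f] even, so that the previous lemma applies. *)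
Lemma par_vanish b s f p : par b f -> f p = 0 -> exists F : option bool -> C * C -> C,
  (forall u, par b (F u)) /\
  forall z, quad (Some s) z * f z = \sum_u (quad u z - quad u p) * F u z.
Proof.
case: b => hf f0.
  have /(even_vanish p)[F [hF eF]] := parM (par_coordinate s) hf.
  exists (fun u z => coordinate s z * F u z); split=> [u|z].
    exact: (@parM true false _ _ (par_coordinate s) (hF u)).
  rewrite quad_coordinate -mulrA eF f0 mulr0 add0r mulr_sumr.
  by apply: eq_bigr => u _; rewrite mulrCA.
have [F [hF eF]] := even_vanish p hf.
exists (fun u z => quad (Some s) z * F u z); split=> [u|z].
  exact: par_quadM.
rewrite eF f0 add0r mulr_sumr.
by apply: eq_bigr => u _; rewrite mulrCA.
Qed.

Lemma par_neq0 b p : p != 0 -> exists f, par b f /\ f p = 1.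
Proof.
move=> p0; case: b; last by exists (fun=> 1); split=> //; exact: even_cst.
have [s hs] : exists s, coordinate s p != 0.
  case: (eqVneq p.1 0) => h; last by exists true.
  exists false => /=; apply: contra_neq p0 => h'.
  by rewrite (surjective_pairing p) h h'.
exists (fun z => (coordinate s p)^-1 * coordinate s z).
by split; [apply: par_scale; exact: par_coordinate | rewrite mulVf].
Qed.

Lemma quad_inj p q : (forall u, quad u p = quad u q) -> q = p \/ q = - p.
Proof.
case: p q => [x y] [a b] h.
have h1 := h (Some true); have h2 := h (Some false); have h3 := h None.
rewrite /= in h1 h2 h3.
have : (a - x) * (a + x) = 0 by rewrite -[RHS](subrr (x * x)) {1}h1; ring.
have : (b - y) * (b + y) = 0 by rewrite -[RHS](subrr (y * y)) {1}h2; ring.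
move=> /eqP; rewrite mulf_eq0 subr_eq0 addr_eq0 => hb.
move=> /eqP; rewrite mulf_eq0 subr_eq0 addr_eq0 => ha.
have [x0|x0] := eqVneq x 0.
  have -> : a = 0 by case/orP: ha => /eqP ->; rewrite x0 ?oppr0.
  by rewrite x0; case/orP: hb => /eqP ->; [left|right; congr (_, _); rewrite oppr0].
case/orP: ha => /eqP ha; [left | right]; rewrite ha; congr (_, _).
  by apply: (mulfI x0); rewrite h3 ha.
by apply: (mulfI x0); rewrite mulrN h3 ha mulNr opprK.
Qed.

(** The plane modulo sign is the whole quadric cone: x is a square root of the value of X^2 and y
    the value of XY divided by x. If x = 0, the cone equation makes the value of XY vanish. *)
Lemma quad_surj (q : option bool -> C) :
  q (Some true) * q (Some false) = q None * q None -> exists p, forall u, quad u p = q u.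
Proof.
move=> h; pose x := sqrtC (q (Some true)).
have xx : x * x = q (Some true) by rewrite -expr2 sqrtCK.
have [x0|x0] := eqVneq x 0.
  exists (0, sqrtC (q (Some false))) => -[[]|] /=.
  - by rewrite mul0r -xx x0 mul0r.
  - by rewrite -expr2 sqrtCK.
  - move: h; rewrite -xx x0 !mul0r => /esym/eqP.
    by rewrite mulf_eq0 orbb => /eqP ->.
exists (x, q None / x) => -[[]|] //=; last by rewrite mulrC mulfVK.
by rewrite mulrACA -h -xx -invfM mulrAC mulfV ?mul1r // mulf_neq0.
Qed.
End Parity.
Arguments par : simpl never.

(** * Primitive ideals of matrix algebras over a line *)

Section LinePrimitives.
Variables (C : numClosedFieldType) (k : comPzRingType) (iota : {rmorphism C -> k}).
Hypothesis C_uncountable : ~ countable [set: C].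
Variables (A : kalg k) (I I' : ideal A).

(** I / I' is the full matrix algebra over the polynomial functions on a line, and z is an element
    of [k] acting as the coordinate. *)
Record line_rep (T : finType) (ev : A -> C -> T -> T -> C) (z : k) : Prop := LineRep {
  line_morph : forall c, mx_morph iota (fun x => ev x c);
  line_index : inhabited T;
  line_scale : forall x c i j, ev (z *: x) c i j = c * ev x c i j;
  line_poly : forall x, I x -> forall i j, exists p : {poly C}, forall c, ev x c i j = p.[c];
  line_surj : forall P : T -> T -> {poly C}, exists x, I x /\
    forall c i j, ev x c i j = (P i j).[c];
  line_ker : forall x, I x -> (forall c i j, ev x c i j = 0) -> I' x;
  line_bot : forall x, I' x -> forall c i j, ev x c i j = 0 }.

(** By [dixmier] z acts by a scalar c. The matrix of an element vanishing at c is divisible by the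
    coordinate minus c, so modulo [I'] the element is (z - c) y with y in [I], and it acts by 0. *)
Lemma line_primitive (T : finType) (ev : A -> C -> T -> T -> C) z :
  countably_spanned iota A -> line_rep ev z -> forall P,
  primitive iota I I' P <-> exists c, P = zero_locus I (fun x => ev x c).
Proof.
move=> hA h.
apply: (@primitive_class _ _ _ _ _ _ C (fun=> T) (fun c x => ev x c)) => [c|V act hV].
  split; [exact: line_morph h c | exact: line_index h | |].
    by move=> x hx i j; exact: line_bot h x hx c i j.
  move=> M; have [x [hx ex]] := line_surj h (fun i j => (M i j)%:P).
  by exists x; split=> // i j; rewrite ex hornerC.
have [c hc] := dixmier C_uncountable hA hV z; exists c => x hx x0 v.
have /choice[p hp] (ij : T * T) : exists p : {poly C}, forall c, ev x c ij.1 ij.2 = p.[c].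
  exact: line_poly h x hx _ _.
have /choice[q hq] ij : exists q, p ij = q * ('X - c%:P).
  by apply/factor_theorem; rewrite /root -hp x0.
have [y [hy ey]] := line_surj h (fun i j => q (i, j)).
have hy' c0 : I (iota c0 *: y) by exact: Defs.idealZ.
have hy'' : I (z *: y) by exact: Defs.idealZ.
have hw : I (z *: y + iota (- c) *: y) by exact: Defs.idealD.
have hw' : I (iota (-1) *: (z *: y + iota (- c) *: y)) by exact: Defs.idealZ.
rewrite -[x](subrK (z *: y + iota (- c) *: y)) (smD hV) //; last first.
  by rewrite -scaleN1r -(rmorphN1 iota); exact: Defs.idealD.
rewrite [act (z *: y + _) _](smD hV) // hc // (smZ hV) // scaleNr subrr addr0.
apply: (sm_bot hV); apply: (line_ker h).
  by rewrite -scaleN1r -(rmorphN1 iota); exact: Defs.idealD.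
move=> d i j; have [hD hZ _] := line_morph h d.
rewrite -scaleN1r -(rmorphN1 iota) hD hZ hD hZ (line_scale h) ey (hp (i, j)) hq.
by rewrite hornerM hornerXsubC; ring.
Qed.

(** The element (z - c) x, where all entries of x are 1, vanishes at c and nowhere else. *)
Lemma line_separated (T : finType) (ev : A -> C -> T -> T -> C) z c d : line_rep ev z ->
  zero_locus I (fun x => ev x c) `<=` zero_locus I (fun x => ev x d) -> c = d.
Proof.
move=> h sub; apply: contrapT => /eqP cd.
have [hD hZ _] := line_morph h c; have [hD' hZ' _] := line_morph h d.
have [x [hx ex]] := line_surj h (fun=> fun=> 1).
have [|_] := sub (z *: x + iota (- c) *: x).
  split=> [|i j]; first by apply: Defs.idealD; exact: Defs.idealZ.
  by rewrite hD hZ (line_scale h) mulNr subrr.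
have [i0] := line_index h; move=> /(_ i0 i0)/eqP.
rewrite hD' hZ' (line_scale h) ex hornerC !mulr1 subr_eq0 => /eqP dc.
by rewrite dc eqxx in cd.
Qed.
End LinePrimitives.

(** * Primitive ideals of graded matrix algebras over the plane modulo sign *)

Section PlanePrimitives.
Variables (C : numClosedFieldType) (k : comPzRingType) (iota : {rmorphism C -> k}).
Hypothesis C_uncountable : ~ countable [set: C].
Variables (A : kalg k) (I I' : ideal A).
Variables (T : finType) (d : T -> bool) (ev : A -> C * C -> T -> T -> C).
Variable zq : option bool -> k.

(** The entry (i, j) has the parity [d i (+) d j]. [plane_surj] prescribes matrices only up to a
    quadratic factor, so it says nothing at the origin; there [plane_zero] provides a full
    representation, possibly of smaller size, with the same kernel on [I] as the evaluation. *)
Record plane_rep : Prop := PlaneRep {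
  plane_morph : forall p, mx_morph iota (fun x => ev x p);
  plane_index : inhabited T;
  plane_scale : forall u x p i j, ev (zq u *: x) p i j = quad u p * ev x p i j;
  plane_zq : zq (Some true) * zq (Some false) = zq None * zq None;
  plane_par : forall x, I x -> forall i j, par (d i (+) d j) (fun p => ev x p i j);
  plane_surj : forall M : T -> T -> C * C -> C,
    (forall i j, par (d i (+) d j) (M i j)) ->
    forall u, exists x, I x /\ forall p i j, ev x p i j = quad u p * M i j p;
  plane_ker : forall x, I x -> (forall p i j, ev x p i j = 0) -> I' x;
  plane_bot : forall x, I' x -> forall p i j, ev x p i j = 0;
  plane_zero : exists (T0 : finType) (rho0 : A -> T0 -> T0 -> C),
    full_rep iota I I' rho0 /\ forall x, I x ->
      (forall i j, rho0 x i j = 0) <-> (forall i j, ev x 0 i j = 0) }.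

Hypothesis h : plane_rep.

Lemma plane_full p : p != 0 -> full_rep iota I I' (fun x => ev x p).
Proof.
move=> p0; split; [exact: plane_morph h p | exact: plane_index h | |].
  by move=> x hx i j; exact: plane_bot h x hx p i j.
move=> M.
have [s hs] : exists s, quad (Some s) p != 0.
  have [s [hs hs']] := par_neq0 false p0.
  case: (eqVneq p.1 0) => e; last by exists true; rewrite /= mulf_neq0.
  exists false => /=; rewrite mulf_neq0 //; apply: contra_neq p0 => e';
    by rewrite (surjective_pairing p) e e'.
have /choice[f hf] b := par_neq0 b p0.
have [|x [hx ex]] := plane_surj h (M := fun i j z =>
    (M i j / quad (Some s) p) * f (d i (+) d j) z) _ (Some s).
  by move=> i j; apply: par_scale; case: (hf (d i (+) d j)).
exists x; split=> // i j; rewrite ex; case: (hf (d i (+) d j)) => _ ->.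
by rewrite mulr1 mulrC mulfVK.
Qed.

Lemma act_plane_lift (V : lmodType C) (act : A -> V -> V) x y v :
  simple_module iota I I' act -> I x -> I y ->
  (forall p i j, ev x p i j = ev y p i j) -> act x v = act y v.
Proof.
move=> hV hx hy e.
have hy' : I (iota (-1) *: y) by exact: Defs.idealZ.
have hxy : I (x + iota (-1) *: y) by exact: Defs.idealD.
have {1}-> : x = y + (x + iota (-1) *: y) by rewrite rmorphN1 scaleN1r addrC subrK.
rewrite (smD hV) // (sm_bot hV (x := x + _)) ?addr0 //.
apply: (plane_ker h) => // p i j; have [hD hZ _] := plane_morph h p.
by rewrite hD hZ e mulN1r subrr.
Qed.

(** Some square of a coordinate is non-zero at p. After multiplication by it, entries vanishing at p
    lie in the ideal generated by the functions quad u - quad u (p), and these act by 0. *)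
Lemma plane_annihilated_neq0 (V : lmodType C) (act : A -> V -> V) p : p != 0 ->
  simple_module iota I I' act ->
  (forall u x v, I x -> act (zq u *: x) v = quad u p *: act x v) ->
  forall x, I x -> (forall i j, ev x p i j = 0) -> forall v, act x v = 0.
Proof.
move=> p0 hV hz x hx x0 v.
have [s hs] : exists s, quad (Some s) p != 0.
  case: (eqVneq p.1 0) => e; last by exists true; rewrite /= mulf_neq0.
  exists false => /=; rewrite mulf_neq0 //; apply: contra_neq p0 => e';
    by rewrite (surjective_pairing p) e e'.
have /choice[F hF] (ij : T * T) := par_vanish s (plane_par h hx ij.1 ij.2) (x0 ij.1 ij.2).
have /choice[y hy] u := plane_surj h (M := fun i j => F (i, j) u)
   (fun i j => proj1 (hF (i, j)) u) (Some s).
have Iy u : I (y u) by case: (hy u).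
have Iqx u w : I w -> I (zq u *: w) by exact: Defs.idealZ.
have Icx c w : I w -> I (iota c *: w) by exact: Defs.idealZ.
pose t u := zq u *: y u + iota (- quad u p) *: y u.
have It u : I (t u) by apply: Defs.idealD; auto.
(* The square is used twice: [par_vanish] consumes one factor and [plane_surj] the other. *)
have E : act (zq (Some s) *: (zq (Some s) *: x)) v = act (\sum_u t u) v.
  apply: act_plane_lift; auto.
    by elim/big_ind: _ => // *; [exact: Defs.ideal0 | exact: Defs.idealD].
  move=> q i j; rewrite (mx_morph_sum _ _ _ _ (plane_morph h q)).
  rewrite !(plane_scale h); have [_ ->] := hF (i, j).
  rewrite mulr_sumr; apply: eq_bigr => u _.
  have [hD hZ _] := plane_morph h q; rewrite /t hD hZ (plane_scale h).
  have [_ ->] := hy u; ring.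
apply/eqP; move/eqP: E; rewrite !hz; auto.
rewrite (sm_sum hV) // big1 => [|u _]; last first.
  by rewrite /t (smD hV); auto; rewrite hz // (smZ hV) // scaleNr subrr.
by rewrite !scaler_eq0 (negPf hs).
Qed.

(** Odd entries vanish at the origin without being divisible by a quadratic monomial, so a single
    element of the kernel [N] need not act by 0 for an evident reason. But products of two elements
    of [N] have entries in the ideal of the quadratic monomials, products of four have two quadratic
    factors, and [sm_nilpotent] concludes. *)
Lemma plane_annihilated0 (V : lmodType C) (act : A -> V -> V) :
  simple_module iota I I' act ->
  (forall u x v, I x -> act (zq u *: x) v = 0) ->
  forall x, I x -> (forall i j, ev x 0 i j = 0) -> forall v, act x v = 0.
Proof.
move=> hV hz x hx x0 v; have [hD hZ hM] := plane_morph h 0.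
pose N := [set x | I x /\ forall i j, ev x 0 i j = 0].
have order2 y w : N y -> N w -> exists F : option bool -> T -> T -> C * C -> C,
    (forall u i j, par (d i (+) d j) (F u i j)) /\
    forall p i j, ev (y ** w) p i j = \sum_u quad u p * F u i j p.
  move=> [hy y0] [hw w0].
  suff /choice[F hF] (ij : T * T) : exists F : option bool -> C * C -> C,
      (forall u, par (d ij.1 (+) d ij.2) (F u)) /\
      forall p, ev (y ** w) p ij.1 ij.2 = \sum_u quad u p * F u p.
    exists (fun u i j => F (i, j) u); split=> [u i j|p i j].
      by case: (hF (i, j)) => + _; apply.
    by case: (hF (i, j)) => _ ->.
  (* An even entry of the product vanishes at the origin and is expanded directly. In each term of
     an odd entry exactly one factor is even; that factor vanishes at the origin and is expanded. *)
  case: ij => i j /=; have [dij|dij] := boolP (d i (+) d j); last first.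
    have [||F [hF eF]] := @even_vanish0 C (fun p => ev (y ** w) p i j).
    - have := plane_par h (Defs.idealMr w hy) i j.
      by rewrite (negPf dij).
    - by rewrite hM big1 // => l _; rewrite y0 mul0r.
    - by exists F.
  have /choice[F hF] l : exists F : option bool -> C * C -> C, (forall u, par true (F u)) /\
      forall p, ev y p i l * ev w p l j = \sum_u quad u p * F u p.
    have hil := plane_par h hy i l; have hlj := plane_par h hw l j.
    have [dil|dil] := boolP (d i (+) d l); last first.
      have dlj : d l (+) d j by move: dij dil; case: (d i); case: (d l).
      rewrite (negPf dil) dlj in hil hlj.
      have [F [hF eF]] := even_vanish0 hil (y0 i l).
      exists (fun u p => F u p * ev w p l j); split=> [u|p].
        exact: (@parM _ false true).
      by rewrite eF mulr_suml; apply: eq_bigr => u _; rewrite mulrA.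
    have dlj : d l (+) d j = false by move: dij dil; case: (d i); case: (d l); case: (d j).
    rewrite dil dlj in hil hlj.
    have [F [hF eF]] := even_vanish0 hlj (w0 l j).
    exists (fun u p => ev y p i l * F u p); split=> [u|p].
      exact: (@parM _ true false).
    by rewrite eF mulr_sumr; apply: eq_bigr => u _; rewrite mulrCA.
  exists (fun u p => \sum_l F l u p); split=> [u|p].
    by apply: par_sum => l _; case: (hF l).
  have [_ _ ->] := plane_morph h p.
  rewrite (eq_bigr _ (fun l _ => proj2 (hF l) p)).
  by rewrite exchange_big /=; apply: eq_bigr => u _; rewrite mulr_sumr.
(* One quadratic factor serves to lift the matrices to [I] by [plane_surj]; the other acts by 0 by
   [hz]. *)
have prod4 a b c e : N a -> N b -> N c -> N e -> forall v, act ((a ** b) ** (c ** e)) v = 0.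
  move=> Na Nb Nc Ne w.
  have [F [hF eF]] := order2 a b Na Nb; have [G [hG eG]] := order2 c e Nc Ne.
  pose M u t i j p := \sum_l F u i l p * G t l j p.
  have hM' u t i j : par (d i (+) d j) (M u t i j).
    apply: par_sum => l _; rewrite (_ : d i (+) d j = (d i (+) d l) (+) (d l (+) d j)).
      exact: parM.
    by case: (d i); case: (d l); case: (d j).
  have /choice[y hy] (ut : option bool * option bool) := plane_surj h (hM' ut.1 ut.2) ut.2.
  have Iy ut : I (y ut) by case: (hy ut).
  have Izy ut : I (zq ut.1 *: y ut) by exact: Defs.idealZ.
  have Ia : I a by case: Na.
  rewrite (@act_plane_lift V act _ (\sum_ut zq ut.1 *: y ut)) //; first last.
  - move=> p i j; rewrite (mx_morph_sum _ _ _ _ (plane_morph h p)).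
    have [_ _ ->] := plane_morph h p.
    transitivity (\sum_u \sum_t ev (zq u *: y (u, t)) p i j); last first.
      by rewrite pair_bigA; apply: eq_bigr => -[].
    under eq_bigr do rewrite eF eG mulr_suml.
    rewrite exchange_big /=; apply: eq_bigr => u _.
    under eq_bigr do rewrite mulr_sumr.
    rewrite exchange_big /=; apply: eq_bigr => t _.
    rewrite (plane_scale h); have [_ ->] := hy (u, t); rewrite /M /= !mulr_sumr.
    by apply: eq_bigr => l _; ring.
  - by elim/big_ind: _ => // *; [exact: Defs.ideal0 | exact: Defs.idealD].
  - by apply: Defs.idealMr; exact: Defs.idealMr.
  by rewrite (sm_sum hV) // big1 // => ut _; rewrite hz.
apply: (sm_nilpotent hV (N := N) (n := 4)); last by split.
- by move=> y [].
- move=> y w [hy y0] hw; split=> [|i j]; first exact: Defs.idealMr.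
  by rewrite hM big1 // => l _; rewrite y0 mul0r.
- move=> [|a [|b [|c [|e [|? ?]]]]] // _ hs w.
  have Ns : [/\ N a, N b, N c & N e] by split; apply: hs; rewrite !inE eqxx ?orbT.
  have [Na Nb Nc Ne] := Ns; have := prod4 a b c e Na Nb Nc Ne w.
  have [Ia _] := Na; have [Ib _] := Nb; have [Ic _] := Nc; have [Ie _] := Ne.
  rewrite (smM hV); try exact: Defs.idealMr.
  by rewrite (smM hV) // (smM hV).
Qed.

(** By [dixmier] the three quadratic monomials act by scalars; these are the coordinates of a point
    of the cone, hence come from a point p of the plane. *)
Lemma plane_primitive : countably_spanned iota A -> forall P,
  primitive iota I I' P <-> exists p, P = zero_locus I (fun x => ev x p).
Proof.
move=> hA P; have [T0 [rho0 [h0 e0]]] := plane_zero h.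
have Z0 : zero_locus I rho0 = zero_locus I (fun x => ev x 0).
  by apply/seteqP; split=> x [hx] => [/(e0 x hx)|/(e0 x hx)]; split.
(* Over the origin the evaluation need not be surjective and is replaced by [rho0]. *)
have hrep (p : C * C) : exists U : {T' : finType & A -> T' -> T' -> C},
    full_rep iota I I' (tagged U) /\
    forall x, I x -> (forall i j, tagged U x i j = 0) <-> (forall i j, ev x p i j = 0).
  have [->|p0] := eqVneq p 0; first by exists (Tagged (fun T' : finType => A -> T' -> T' -> C) rho0).
  by exists (Tagged (fun T' : finType => A -> T' -> T' -> C) (fun x => ev x p)); split=> //; exact: plane_full.
have {hrep} /choice[U hU] := hrep.
have := @primitive_class _ _ iota A I I' (C * C)%type (fun p => tag (U p))
  (fun p => tagged (U p)) (fun p => proj1 (hU p)).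
move=> /(_ _ P) ->.
  have ZU p : zero_locus I (tagged (U p)) = zero_locus I (fun x => ev x p).
    by apply/seteqP; split=> x [hx] hh; split=> //; apply/(proj2 (hU p)).
  by split=> -[p ->]; exists p; rewrite ZU.
move=> V act hV.
have /choice[q hq] u := dixmier C_uncountable hA hV (zq u).
have [x0 [v0 [hx0 xv0]]] := sm_act_neq0 hV.
(* The scalars satisfy the equation of the cone because [zq] does and the action is not zero. *)
have [|p hp] := @quad_surj C q.
  have Iz u w : I w -> I (zq u *: w) by exact: Defs.idealZ.
  apply/eqP; rewrite -subr_eq0; apply: contraNT xv0 => qq.
  have : (q (Some true) * q (Some false) - q None * q None) *: act x0 v0 = 0.
    rewrite scalerBl -!scalerA -!hq; auto.
    by rewrite !scalerA (plane_zq h) subrr.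
  by move=> /eqP; rewrite scaler_eq0 (negPf qq).
exists p => x hx /(proj2 (hU p) x hx).
have [p0|p0] := eqVneq p 0.
  rewrite p0 => x1; apply: plane_annihilated0 => // u y w hy.
  rewrite hq // -hp p0; case: u => [[]|]; by rewrite /= mul0r scale0r.
by apply: plane_annihilated_neq0 => // u y w hy; rewrite hq // hp.
Qed.

Lemma plane_separated p q :
  zero_locus I (fun x => ev x p) `<=` zero_locus I (fun x => ev x q) -> q = p \/ q = - p.
Proof.
move=> sub; apply: quad_inj => u; apply: contrapT => /eqP pq.
have [x [hx [i [j xij]]]] : exists x, I x /\ exists i j, ev x q i j != 0.
  have [q0|q0] := eqVneq q 0.
    have [T0 [rho0 [h0 e0]]] := plane_zero h; rewrite q0.
    have [x [hx ex]] := rep_surj h0 (fun=> fun=> 1); exists x; split=> //.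
    apply: contrapT => /forallNP hn.
    have /(e0 x hx) : forall i j, ev x 0 i j = 0.
      by move=> i j; apply/eqP/negPn/negP => hij; apply: (hn i); exists j.
    have [i0] := rep_neq0 h0; move=> /(_ i0 i0); rewrite ex => /eqP.
    by rewrite oner_eq0.
  have hf := plane_full q0; have [x [hx ex]] := rep_surj hf (fun=> fun=> 1).
  exists x; split=> //; have [i0] := rep_neq0 hf; exists i0, i0.
  by rewrite ex oner_eq0.
have [hD hZ _] := plane_morph h p; have [hD' hZ' _] := plane_morph h q.
have [|_] := sub (zq u *: x + iota (- quad u p) *: x).
  split=> [|a b]; first by apply: Defs.idealD; exact: Defs.idealZ.
  by rewrite hD hZ (plane_scale h) mulNr subrr.
move=> /(_ i j)/eqP; rewrite hD' hZ' (plane_scale h) -mulrDl mulf_eq0 (negPf xij) orbF.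
by rewrite subr_eq0 eq_sym (negPf pq).
Qed.
End PlanePrimitives.

(** * Full corners *)

Section KalgLemmas.
Variables (k : comPzRingType) (A : kalg k).

Lemma kmul0l (x : A) : 0 ** x = 0.
Proof. by apply: (addrI (0 ** x)); rewrite -kmulDl !addr0. Qed.
Lemma kmul0r (x : A) : x ** 0 = 0.
Proof. by apply: (addrI (x ** 0)); rewrite -kmulDr !addr0. Qed.
Lemma kmul_suml (I : Type) (s : seq I) (F : I -> A) x :
  (\sum_(i <- s) F i) ** x = \sum_(i <- s) F i ** x.
Proof. by elim: s => [|i s IH]; rewrite ?big_nil ?kmul0l // !big_cons kmulDl IH. Qed.
Lemma kunit_unique (e e' : A) : is_kunit e -> is_kunit e' -> e = e'.
Proof. by move=> he he'; rewrite -[LHS](proj2 (he' e)) (proj1 (he e')). Qed.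
End KalgLemmas.

Section Corner.
Variables (k : comPzRingType) (A : kalg k) (e : A).

(** [left_corner] cuts out A e and [right_corner] cuts out e A: for an idempotent e these are the
    fixed points of multiplication by e. *)
Definition left_corner : pred A := fun x => x ** e == x.
Definition right_corner : pred A := fun x => e ** x == x.

Lemma left_corner_submod : subsemimod_closed left_corner.
Proof.
split; first split.
- by rewrite /in_mem /= /left_corner kmul0l.
- by move=> x y /eqP hx /eqP hy; apply/eqP; rewrite kmulDl hx hy.
- by move=> c x /eqP hx; apply/eqP; rewrite kmulZl hx.
Qed.

Lemma right_corner_submod : subsemimod_closed right_corner.
Proof.
split; first split.
- by rewrite /in_mem /= /right_corner kmul0r.
- by move=> x y /eqP hx /eqP hy; apply/eqP; rewrite kmulDr hx hy.
- by move=> c x /eqP hx; apply/eqP; rewrite kmulZr hx.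
Qed.

Definition left_module := {x : A | left_corner x}.
HB.instance Definition _ := [isSub of left_module for sval].
HB.instance Definition _ := [Choice of left_module by <:].
HB.instance Definition _ := GRing.SubChoice_isSubLmodule.Build
  k A left_corner left_module left_corner_submod.

Definition right_module := {x : A | right_corner x}.
HB.instance Definition _ := [isSub of right_module for sval].
HB.instance Definition _ := [Choice of right_module by <:].
HB.instance Definition _ := GRing.SubChoice_isSubLmodule.Build
  k A right_corner right_module right_corner_submod.
End Corner.

Section FullCorner.
Variables (k : comPzRingType) (A B : kalg k) (j : B -> A) (oneA : A) (oneB : B).
Hypotheses (j_morph : kalg_morph j) (j_inj : injective j).
Hypotheses (oneAP : is_kunit oneA) (oneBP : is_kunit oneB).
Local Notation e := (j oneB).
Hypothesis j_corner : forall x, e ** x ** e = x -> exists b, j b = x.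
Hypothesis full : exists s : seq (A * A), oneA = \sum_(x <- s) x.1 ** e ** x.2.
Local Notation P := (left_module e).
Local Notation Q := (right_module e).

Let jD x y : j (x + y) = j x + j y. Proof. by case: j_morph. Qed.
Let jZ c x : j (c *: x) = c *: j x. Proof. by case: j_morph. Qed.
Let jM x y : j (x ** y) = j x ** j y. Proof. by case: j_morph. Qed.
Let ej b : e ** j b = j b. Proof. by rewrite -jM; congr j; case: (oneBP b). Qed.
Let je b : j b ** e = j b. Proof. by rewrite -jM; congr j; case: (oneBP b). Qed.
Let Pe (p : P) : val p ** e = val p. Proof. exact/eqP/(valP p). Qed.
Let eQ (q : Q) : e ** val q = val q. Proof. exact/eqP/(valP q). Qed.

Let AP_subproof (a : A) (p : P) : left_corner e (a ** val p).
Proof. by apply/eqP; rewrite -kmulA Pe. Qed.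
Let PB_subproof (p : P) (b : B) : left_corner e (val p ** j b).
Proof. by apply/eqP; rewrite -kmulA je. Qed.
Let BQ_subproof (b : B) (q : Q) : right_corner e (j b ** val q).
Proof. by apply/eqP; rewrite kmulA ej. Qed.
Let QA_subproof (q : Q) (a : A) : right_corner e (val q ** a).
Proof. by apply/eqP; rewrite kmulA eQ. Qed.

Let AP a p : P := Sub (a ** val p) (AP_subproof a p).
Let PB p b : P := Sub (val p ** j b) (PB_subproof p b).
Let BQ b q : Q := Sub (j b ** val q) (BQ_subproof b q).
Let QA q a : Q := Sub (val q ** a) (QA_subproof q a).
Let PQ (p : P) (q : Q) : A := val p ** val q.

(** Outside the corner e A e the inverse of [j] takes a junk value. *)
Let jinv_ex (x : A) : exists b, e ** x ** e = x -> j b = x.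
Proof.
have [h|h] := pselect (e ** x ** e = x); last by exists oneB.
by have [b hb] := j_corner h; exists b.
Qed.
Let jinv x := sval (cid (jinv_ex x)).
Let jinvK x : e ** x ** e = x -> j (jinv x) = x.
Proof. exact: (svalP (cid (jinv_ex x))). Qed.
Let QP (q : Q) (p : P) : B := jinv (val q ** val p).
Let jQP q p : j (QP q p) = val q ** val p.
Proof. by apply: jinvK; rewrite kmulA eQ -kmulA Pe. Qed.

(** The bimodules are A e and e A, paired by multiplication. The products in e A e are carried to
    [B] by the inverse of [j], and the pairing onto [A] is surjective because A e A contains the
    unit. *)
Lemma morita_full_corner : morita A B.
Proof.
split; [by exists oneA | by exists oneB | exists P, Q; constructor].
have oneAE u : is_kunit u -> u = oneA by move=> /kunit_unique; apply.
have oneBE u : is_kunit u -> u = oneB by move=> /kunit_unique; apply.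
have eP : left_corner e e by apply/eqP; rewrite ej.
have eQ' : right_corner e e by apply/eqP; rewrite ej.
apply: (@MoritaContext k A B P Q AP PB BQ QA PQ QP).
- by move=> a c p p'; apply: val_inj; rewrite -[LHS]/(a ** (c *: val p + val p')) kmulDr kmulZr.
- by move=> c a a' p; apply: val_inj; rewrite -[LHS]/((c *: a + a') ** val p) kmulDl kmulZl.
- by move=> a a' p; apply: val_inj; rewrite /= kmulA.
- by move=> u /oneAE -> p; apply: val_inj; rewrite /=; case: (oneAP (val p)).
- by move=> b c p p'; apply: val_inj; rewrite -[LHS]/((c *: val p + val p') ** j b) kmulDl kmulZl.
- by move=> c b b' p; apply: val_inj; rewrite -[LHS]/(val p ** j (c *: b + b')) jD jZ kmulDr kmulZr.
- by move=> b b' p; apply: val_inj; rewrite /= jM kmulA.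
- by move=> u /oneBE -> p; apply: val_inj; rewrite /= Pe.
- by move=> a p b; apply: val_inj; rewrite /= kmulA.
- by move=> b c q q'; apply: val_inj; rewrite -[LHS]/(j b ** (c *: val q + val q')) kmulDr kmulZr.
- by move=> c b b' q; apply: val_inj; rewrite -[LHS]/(j (c *: b + b') ** val q) jD jZ kmulDl kmulZl.
- by move=> b b' q; apply: val_inj; rewrite /= jM kmulA.
- by move=> u /oneBE -> q; apply: val_inj; rewrite /= eQ.
- by move=> a c q q'; apply: val_inj; rewrite -[LHS]/((c *: val q + val q') ** a) kmulDl kmulZl.
- by move=> c a a' q; apply: val_inj; rewrite -[LHS]/(val q ** (c *: a + a')) kmulDr kmulZr.
- by move=> a a' q; apply: val_inj; rewrite /= kmulA.
- by move=> u /oneAE -> q; apply: val_inj; rewrite /=; case: (oneAP (val q)).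
- by move=> b q a; apply: val_inj; rewrite /= kmulA.
- by move=> c p p' q; rewrite -[LHS]/((c *: val p + val p') ** val q) kmulDl kmulZl.
- by move=> c p q q'; rewrite -[LHS]/(val p ** (c *: val q + val q')) kmulDr kmulZr.
- by move=> a p q; rewrite /PQ /= kmulA.
- by move=> a p q; rewrite /PQ /= kmulA.
- by move=> p b q; rewrite /PQ /= kmulA.
- by move=> c q q' p; apply: j_inj; rewrite jD jZ !jQP -[LHS]/((c *: val q + val q') ** val p) kmulDl kmulZl.
- by move=> c q p p'; apply: j_inj; rewrite jD jZ !jQP -[LHS]/(val q ** (c *: val p + val p')) kmulDr kmulZr.
- by move=> b q p; apply: j_inj; rewrite jM !jQP /= kmulA.
- by move=> b q p; apply: j_inj; rewrite jM !jQP /= kmulA.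
- by move=> q a p; apply: j_inj; rewrite !jQP /= kmulA.
- by move=> p q p'; apply: val_inj; rewrite /= jQP kmulA.
- by move=> q p q'; apply: val_inj; rewrite /= jQP kmulA.
- move=> a; have [s hs] := full.
  have hl x : left_corner e (x ** e) by apply/eqP; rewrite -kmulA ej.
  have hr x : right_corner e (e ** x) by apply/eqP; rewrite kmulA ej.
  exists [seq (Sub (x.1 ** e) (hl x.1) : P, Sub (e ** (x.2 ** a)) (hr _) : Q) | x <- s].
  rewrite big_map -[LHS](proj1 (oneAP a)) hs kmul_suml; apply: eq_bigr => x _.
  by rewrite /PQ /= !kmulA -[_ ** e ** e]kmulA ej.
- move=> b; exists [:: (BQ b (Sub e eQ'), Sub e eP)].
  by rewrite big_seq1; apply: j_inj; rewrite jQP /= -kmulA ej je.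
Qed.
End FullCorner.

(** * Chebyshev polynomials *)

Section Chebyshev.
Variable R : comNzRingType.

(* Chebyshev polynomials of the second kind in x = s + 1/s; cheb n is the
   character of the representation of SL(2) of dimension n + 1. *)
Fixpoint cheb (n : nat) : {poly R} :=
  match n with
  | 0 => 1
  | m.+1 => if m is m'.+1 then 'X * cheb m - cheb m' else 'X
  end.

Lemma cheb0 : cheb 0 = 1. Proof. by []. Qed.
Lemma cheb1 : cheb 1 = 'X. Proof. by []. Qed.
Lemma chebSS n : cheb n.+2 = 'X * cheb n.+1 - cheb n. Proof. by []. Qed.

(* Coordinates in the basis cheb, with multiplication by 'X acting by shift. *)
Definition cheb_shift (c : nat -> R) (n : nat) : R :=
  (if n is m.+1 then c m else 0) + c n.+1.

Definition cheb_monom (n : nat) : nat -> R := iter n cheb_shift (fun m => (m == 0%N)%:R).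

Definition cheb_coef (p : {poly R}) (m : nat) : R :=
  \sum_(i < size p) p`_i * cheb_monom i m.

Lemma cheb_coef_widen n (p : {poly R}) m : (size p <= n)%N ->
  cheb_coef p m = \sum_(i < n) p`_i * cheb_monom i m.
Proof.
move=> h; rewrite /cheb_coef (big_ord_widen n (fun i => p`_i * cheb_monom i m)) // big_mkcond.
by apply: eq_bigr => i _; case: ltnP => // hi; rewrite nth_default // mul0r.
Qed.

Lemma cheb_coefD (p q : {poly R}) m : cheb_coef (p + q) m = cheb_coef p m + cheb_coef q m.
Proof.
have [hp hq] := (leq_maxl (size p) (size q), leq_maxr (size p) (size q)).
rewrite (cheb_coef_widen _ hp) (cheb_coef_widen _ hq) (cheb_coef_widen _ (size_polyD p q)).
by rewrite -big_split; apply: eq_bigr => i _; rewrite coefD mulrDl.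
Qed.

Lemma cheb_coefZ c (p : {poly R}) m : cheb_coef (c *: p) m = c * cheb_coef p m.
Proof.
rewrite (cheb_coef_widen _ (size_scale_leq c p)) mulr_sumr.
by apply: eq_bigr => i _; rewrite coefZ mulrA.
Qed.

Lemma cheb_coefN (p : {poly R}) m : cheb_coef (- p) m = - cheb_coef p m.
Proof. by rewrite -scaleN1r cheb_coefZ mulN1r. Qed.

Lemma cheb_coef0 m : cheb_coef 0 m = 0.
Proof. by rewrite /cheb_coef size_poly0 big_ord0. Qed.

Lemma cheb_coefC c m : cheb_coef c%:P m = c * (m == 0%N)%:R.
Proof.
by rewrite (@cheb_coef_widen 1) ?size_polyC ?leq_b1 // big_ord1 coefC.
Qed.

Lemma cheb_coefMX (p : {poly R}) m : cheb_coef (p * 'X) m = cheb_shift (cheb_coef p) m.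
Proof.
have h : (size (p * 'X)%R <= (size p).+1)%N.
  by apply: leq_trans (size_polyMleq _ _) _; rewrite size_polyX addn2.
rewrite (cheb_coef_widen _ h) big_ord_recl coefMX /= mul0r add0r /cheb_shift /=.
under eq_bigr do rewrite coefMX /= /cheb_shift mulrDr.
rewrite big_split /=; congr (_ + _).
by case: m => // ; rewrite big1 // => i _; rewrite mulr0.
Qed.

Lemma cheb_coef_small (p : {poly R}) m : (size p <= m)%N -> cheb_coef p m = 0.
Proof.
have mon n l : (n < l)%N -> cheb_monom n l = 0.
  elim: n l => [|n IH] [|l] //= h.
  have hl : (n < l)%N := h; rewrite /cheb_shift !IH ?addr0 //.
  exact: leq_trans hl (leqW (leqnSn l)).
move=> h; rewrite /cheb_coef big1 // => i _.
by rewrite mon ?mulr0 //; apply: leq_trans (ltn_ord i) h.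
Qed.

Lemma cheb_coef_cheb n m : cheb_coef (cheb n) m = (m == n)%:R.
Proof.
suff : (cheb_coef (cheb n) m = (m == n)%:R) /\ (cheb_coef (cheb n.+1) m = (m == n.+1)%:R).
  by case.
elim: n m => [|n IH] m.
  rewrite cheb0 cheb1 -['X]mul1r cheb_coefMX /cheb_shift -[1]/(1%:P).
  rewrite !cheb_coefC !mul1r; split=> //.
  by case: m => [|[|m]] /=; rewrite ?cheb_coefC ?mul1r ?addr0 ?add0r.
split; first by case: (IH m).
rewrite chebSS mulrC cheb_coefD cheb_coefN cheb_coefMX /cheb_shift.
case: m => [|m]; rewrite !(proj1 (IH _)) !(proj2 (IH _)) ?eqSS ?add0r.
  by case: n {IH} => [|n]; rewrite ?subrr ?subr0.
by rewrite addrK.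
Qed.

(** Horner induction: X cheb_m is the sum of the two neighbours of cheb_m, so multiplication by X is
    [cheb_shift]. The terms at the upper end vanish by [cheb_coef_small]. *)
Lemma cheb_expand_widen n (p : {poly R}) : (size p <= n)%N -> p = \sum_(m < n) cheb_coef p m *: cheb m.
Proof.
elim/poly_ind: p n => [|p c IH] n hn.
  by rewrite big1 // => i _; rewrite cheb_coef0 scale0r.
have [n0|n0] := posnP n.
  by rewrite n0 big_ord0; apply/eqP; rewrite -size_poly_leq0 -n0.
case: n n0 hn => // n _ hn.
have hp : (size p <= n)%N.
  rewrite size_MXaddC in hn; case: ifP hn => // /andP[/eqP -> _].
  by rewrite size_poly0.
under eq_bigr => m _.
  rewrite cheb_coefD cheb_coefMX cheb_coefC /cheb_shift !scalerDl.
  over.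
rewrite !big_split /= [X in _ = _ + X]big_ord_recl eqxx mulr1 /=.
rewrite [X in _ = _ + (_ + X)]big1 ?addr0 => [|i _]; last by rewrite mulr0 scale0r.
rewrite alg_polyC; congr (_ + _).
rewrite [in LHS](IH n hp) mulr_suml.
rewrite [X in _ = X + _]big_ord_recl scale0r add0r /=.
rewrite [X in _ = _ + X](_ : _ = \sum_(i < n) cheb_coef p i *: (if val i is j.+1 then cheb j else 0)).
  rewrite -big_split /=; apply: eq_bigr => i _; rewrite -scalerAl -scalerDr.
  rewrite /= add0n; congr (_ *: _).
  by case: (nat_of_ord i) => [|j]; rewrite ?mul1r ?addr0 // mulrC -chebSS chebSS subrK.
case: n hp {hn} => [|n] hp.
  by rewrite big_ord0 big_ord1 cheb_coef_small ?scale0r // (leq_trans hp).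
rewrite 2!big_ord_recr /= [RHS]big_ord_recl scaler0 add0r.
rewrite !(cheb_coef_small (p := p)) ?scale0r ?addr0 //; last by apply: leq_trans hp _.
Qed.

Lemma cheb_expand (p : {poly R}) : p = \sum_(m < size p) cheb_coef p m *: cheb m.
Proof. exact: cheb_expand_widen. Qed.

Lemma size_cheb n : size (cheb n) = n.+1.
Proof.
suff : size (cheb n) = n.+1 /\ size (cheb n.+1) = n.+2 by case.
elim: n => [|n [h1 h2]]; first by rewrite cheb0 cheb1 size_poly1 size_polyX.
split=> //; rewrite chebSS size_polyDl mulrC size_mulX -?size_poly_gt0 ?h2 //.
by rewrite size_polyN h1.
Qed.
End Chebyshev.

Lemma map_cheb (R S : comNzRingType) (f : {rmorphism R -> S}) n :
  map_poly f (cheb R n) = cheb S n.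
Proof.
suff : map_poly f (cheb R n) = cheb S n /\ map_poly f (cheb R n.+1) = cheb S n.+1 by case.
elim: n => [|n [h1 h2]]; first by rewrite /= rmorph1 map_polyX.
by split=> //; rewrite !chebSS rmorphB rmorphM /= map_polyX h1 h2.
Qed.

Definition cheb_val (C : numClosedFieldType) (x : C) n := (cheb C n).[x].

Lemma cheb_val0 (C : numClosedFieldType) (x : C) : cheb_val x 0 = 1.
Proof. exact: hornerC. Qed.
Lemma cheb_val1 (C : numClosedFieldType) (x : C) : cheb_val x 1 = x.
Proof. exact: hornerX. Qed.
Lemma cheb_valSS (C : numClosedFieldType) (x : C) n :
  cheb_val x n.+2 = x * cheb_val x n.+1 - cheb_val x n.
Proof. by rewrite /cheb_val chebSS !hornerE. Qed.

(* s^n + s^-n is a polynomial in s + 1/s *)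
Definition dickson (C : numClosedFieldType) (x : C) n : C :=
  if n is m.+1 then (if m is l.+1 then cheb_val x n - cheb_val x l else x) else 2.

(** From (s - s^-1) cheb_n = s^(n+1) - s^-(n+1), where cheb is taken at s + s^-1, together with
    [dickson] n = cheb_n - cheb_(n-2). *)
Lemma dicksonE (C : numClosedFieldType) (s : C) n : s != 0 ->
  dickson (s + s^-1) n = s ^+ n + s ^- n.
Proof.
move=> s0.
have chebE m : (s - s^-1) * cheb_val (s + s^-1) m = s ^+ m.+1 - s ^- m.+1.
  suff : (s - s^-1) * cheb_val (s + s^-1) m = s ^+ m.+1 - s ^- m.+1 /\
         (s - s^-1) * cheb_val (s + s^-1) m.+1 = s ^+ m.+2 - s ^- m.+2 by case.
  elim: m => [|m [h1 h2]].
    by rewrite cheb_val0 cheb_val1 mulr1 !expr1 -!exprVn -subr_sqr.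
  split=> //; rewrite cheb_valSS mulrBr mulrCA h1 h2 -!exprVn.
  rewrite !(exprS _ m.+2) !(exprS _ m.+1).
  have e : s * s^-1 = 1 by rewrite mulfV.
  rewrite mulrDl !mulrBr ![s^-1 * (s * _)]mulrA ![s * (s^-1 * _)]mulrA [s^-1 * s]mulrC e !mul1r.
  by rewrite addrACA; ring.
case: n => [|[|n]] /=; first by rewrite !expr0 invr1.
  by rewrite !expr1.
(* For s = s^-1 the factor s - s^-1 cannot be cancelled; there s^2 = 1 and cheb_n (2 s) = (n + 1)
   s^n. *)
have [e|ne] := eqVneq (s - s^-1) 0; last first.
  apply: (mulfI ne); rewrite mulrBr !chebE -!exprVn !(exprS _ n.+2) !(exprS _ n.+1).
  have e : s * s^-1 = 1 by rewrite mulfV.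
  have e2 : s * (s * s ^+ n.+1) * 1 = 0 + s * (s * s ^+ n.+1) by ring.
  rewrite mulrDr !mulrBl ![s^-1 * (s * _)]mulrA ![s * (s^-1 * _)]mulrA [s^-1 * s]mulrC e !mul1r.
  by ring.
have ss : s * s = 1.
  by move/eqP: e; rewrite subr_eq0 => /eqP {1}->; rewrite mulVf.
have sV : s^-1 = s by apply/eqP; rewrite eq_sym -subr_eq0 e.
have h m : cheb_val (s + s) m = m.+1%:R * s ^+ m.
  suff : cheb_val (s + s) m = m.+1%:R * s ^+ m /\
         cheb_val (s + s) m.+1 = m.+2%:R * s ^+ m.+1 by case.
  elim: m => [|m [h1 h2]].
    by rewrite cheb_val0 cheb_val1 expr0 expr1 mulr1 mulr_natl.
  split=> //; rewrite cheb_valSS h1 h2 !exprS; set t := s ^+ m.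
  have -> : (s + s) * (m.+2%:R * (s * t)) = 2 * m.+2%:R * (s * s) * t by ring.
  have -> : s * (s * t) = (s * s) * t by ring.
  by rewrite ss -!natr1; ring.
rewrite sV !h -exprVn sV !exprS; set t := s ^+ n.
have -> : s * (s * t) = (s * s) * t by ring.
by rewrite ss -!natr1; ring.
Qed.

(** * The torus and its orbits *)

Definition klein : {set weylG2} := [set 1; weyl_a; weyl_r3; weyl_a * weyl_r3]%SET%g.

Lemma val_weyl_r3 : val weyl_r3 = ((-1, 0), (0, -1)).
Proof. by vm_compute. Qed.

Lemma kleinP w : w \in klein ->
  [\/ w = 1%g, w = weyl_a, w = weyl_r3 | w = (weyl_a * weyl_r3)%g].
Proof.
by rewrite !inE -!orbA => /or4P[] /eqP ->; [constructor 1|constructor 2|constructor 3|constructor 4].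
Qed.

Lemma weyl_a_r3C : commute weyl_a weyl_r3.
Proof. by apply/val_inj; vm_compute. Qed.

Lemma klein_commute v w : v \in klein -> w \in klein -> commute v w.
Proof.
have ar3 := weyl_a_r3C.
have c1 : commute weyl_a (weyl_a * weyl_r3)%g by apply: commuteM.
have c2 : commute weyl_r3 (weyl_a * weyl_r3)%g by apply: commuteM => //; exact: commute_sym.
move=> /kleinP[]-> /kleinP[]-> //;
  by [exact: commute1|exact/commute_sym/commute1|apply: commute_sym].
Qed.

Lemma klein_distinct :
  [/\ weyl_a != 1%g, weyl_r3 != 1%g & (weyl_a * weyl_r3)%g != 1%g] /\
  [/\ weyl_r3 != weyl_a, (weyl_a * weyl_r3)%g != weyl_a & weyl_r3 != (weyl_a * weyl_r3)%g].
Proof. by split; split; rewrite -val_eqE; vm_compute. Qed.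

Section TorusActions.
Variable C : numClosedFieldType.
Implicit Types t : torus C.

Lemma coords_neq0 t : (coords t).1 != 0 /\ (coords t).2 != 0.
Proof. exact: set_mem (valP t). Qed.

Lemma coords_inj : injective (@coords C).
Proof. exact: val_inj. Qed.

Lemma act_a t : coords (torus_act weyl_a t) = ((coords t).2, (coords t).1).
Proof. exact: mat2_act_a. Qed.

Lemma act_r3 t : coords (torus_act weyl_r3 t) = ((coords t).1^-1, (coords t).2^-1).
Proof.
rewrite -[LHS]/(mat2_act (val weyl_r3) (coords t)) val_weyl_r3 /mat2_act /=.
by rewrite !expr0z mulr1 mul1r !exprN1.
Qed.

Lemma act_ar3 t :
  coords (torus_act (weyl_a * weyl_r3)%g t) = ((coords t).2^-1, (coords t).1^-1).
Proof. by rewrite torus_actM act_a act_r3. Qed.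

Lemma torus1_subproof : ((1, 1) : C * C) \in @nonzero2 C.
Proof. by apply/mem_set; split; rewrite oner_eq0. Qed.
Definition torus1 : torus C := exist (fun z => z \in @nonzero2 C) (1, 1) torus1_subproof.

(* The point with coordinates (x, y), or a junk value when x = 0 or y = 0. *)
Definition mkt (x y : C) : torus C :=
  match pselect ((x, y) \in @nonzero2 C) with
  | left h => exist (fun z => z \in @nonzero2 C) (x, y) h
  | right _ => torus1
  end.

Lemma coords_mkt x y : x != 0 -> y != 0 -> coords (mkt x y) = (x, y).
Proof. by move=> x0 y0; rewrite /mkt; case: pselect => // -[]; apply/mem_set. Qed.

Lemma mkt_coords t : t = mkt (coords t).1 (coords t).2.
Proof.
have [h1 h2] := coords_neq0 t; apply: coords_inj.
by rewrite coords_mkt //; case: (coords t).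
Qed.

(** A root of s^2 - x s + 1. The choice of the root is harmless since s -> s^-1 is realized in
    W^s. *)
Definition sroot (x : C) : C := (x + sqrtC (x ^+ 2 - 4)) / 2.

Lemma sroot_quad x : sroot x * (x - sroot x) = 1.
Proof.
have h2 : (2 : C) != 0 by rewrite pnatr_eq0.
rewrite /sroot; set d := sqrtC _; have dd : d ^+ 2 = x ^+ 2 - 4 by rewrite sqrtCK.
have -> : (x + d) / 2 * (x - (x + d) / 2) = (x ^+ 2 - d ^+ 2) / 4 by field.
by rewrite dd opprB addrCA subrr addr0 mulfV // ?pnatr_eq0.
Qed.

Lemma sroot_neq0 x : sroot x != 0.
Proof. by apply/eqP => h; have /eqP := sroot_quad x; rewrite h mul0r eq_sym oner_eq0. Qed.

Lemma srootE x : sroot x + (sroot x)^-1 = x.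
Proof.
have h := sroot_neq0 x.
by apply: (mulfI h); rewrite mulrDr mulfV // -[1](sroot_quad x) mulrBr addrC subrK.
Qed.

Lemma sumV_inj (s s' : C) : s != 0 -> s' != 0 -> s + s^-1 = s' + s'^-1 ->
  s' = s \/ s' = s^-1.
Proof.
move=> s0 s'0 e.
have : (s' - s) * (s' - s^-1) = 0.
  have -> : (s' - s) * (s' - s^-1) = s' * s' + s * s^-1 - s' * (s + s^-1) by ring.
  by rewrite e; field; rewrite s0 s'0.
move=> /eqP; rewrite mulf_eq0 !subr_eq0.
by case/orP=> /eqP ->; [left|right].
Qed.

(** A point (s u, s / u) with s + 1/s = p.1 and u + 1/u = p.2. *)
Definition tpt (p : C * C) : torus C := mkt (sroot p.1 * sroot p.2) (sroot p.1 / sroot p.2).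

Lemma coords_tpt p : coords (tpt p) = (sroot p.1 * sroot p.2, sroot p.1 / sroot p.2).
Proof.
by rewrite /tpt coords_mkt // mulf_neq0 ?invr_eq0 ?sroot_neq0.
Qed.

(* Square roots s of z1 z2 and z1/s turn the coordinates into (s u, s / u). *)
Lemma torus_st t : exists s u, [/\ s != 0, u != 0 & t = mkt (s * u) (s / u)].
Proof.
have [h1 h2] := coords_neq0 t.
pose s := sqrtC ((coords t).1 * (coords t).2).
have ss : s * s = (coords t).1 * (coords t).2 by rewrite -expr2 sqrtCK.
have s0 : s != 0.
  by apply/eqP => s0; move/eqP: ss; rewrite s0 mul0r eq_sym mulf_eq0 (negPf h1) (negPf h2).
exists s, ((coords t).1 / s); split=> //; first by rewrite mulf_neq0 ?invr_eq0.
rewrite [LHS]mkt_coords; congr mkt; first by rewrite mulrC mulfVK.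
by rewrite invf_div mulrA ss mulrAC mulfV // mul1r.
Qed.
End TorusActions.

Section Orbits.
Variables (C : numClosedFieldType) (G : {group weylG2}).
Hypothesis hG : G = klein :> {set weylG2}.

Definition totX (t : torus C) : set_type [set: torus C] :=
  exist (fun x => x \in [set: torus C]) t (mem_set I).

Lemma totXE (s : set_type [set: torus C]) : s = totX (set_val s).
Proof. exact: val_inj. Qed.

Definition orb (t : torus C) : orbit_quot [set: torus C] G := \pi_(orbit_quot [set: torus C] G) (totX t).

Lemma orb_surj (y : orbit_quot [set: torus C] G) : exists t, y = orb t.
Proof.
exists (set_val (generic_quotient.repr y)); rewrite /orb -totXE.
by rewrite reprK.
Qed.

Lemma orb_eqP t t' : orb t = orb t' <-> exists v, v \in klein /\ t' = torus_act v t.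
Proof.
split=> [/eqmodP/asboolP[v [hv e]]|[v [hv e]]]; first by exists v; rewrite -hG.
by apply/eqmodP/asboolP; exists v; rewrite hG.
Qed.

Lemma orb_act v t : v \in klein -> orb (torus_act v t) = orb t.
Proof. by move=> hv; apply/esym/orb_eqP; exists v. Qed.

Definition orbpt (p : C * C) := orb (tpt p).

(** The roots chosen by [sroot] are s or s^-1 and u or u^-1; the four cases are the four elements of
    [klein]: [weyl_a] inverts u, [weyl_a * weyl_r3] inverts s, [weyl_r3] inverts both. *)
Lemma orb_st (s u : C) : s != 0 -> u != 0 ->
  orb (mkt (s * u) (s / u)) = orbpt (s + s^-1, u + u^-1).
Proof.
move=> s0 u0; rewrite /orbpt; set p := (_, _).
have ct : coords (mkt (s * u) (s / u)) = (s * u, s / u).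
  by rewrite coords_mkt // mulf_neq0 ?invr_eq0.
have [es|es] := sumV_inj s0 (sroot_neq0 p.1) (esym (srootE p.1));
  have [eu|eu] := sumV_inj u0 (sroot_neq0 p.2) (esym (srootE p.2)).
- congr orb; apply: coords_inj; by rewrite ct coords_tpt es eu.
- rewrite -(@orb_act weyl_a); last by rewrite !inE eqxx ?orbT.
  by congr orb; apply: coords_inj; rewrite act_a coords_tpt ct es eu invrK.
- rewrite -(@orb_act (weyl_a * weyl_r3)%g); last by rewrite !inE eqxx ?orbT.
  by congr orb; apply: coords_inj; rewrite act_ar3 coords_tpt ct es eu invfM invrK mulrC -invfM mulrC.
- rewrite -(@orb_act weyl_r3); last by rewrite !inE eqxx ?orbT.
  by congr orb; apply: coords_inj; rewrite act_r3 coords_tpt ct es eu !invfM !invrK.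
Qed.

Lemma orbpt_surj y : exists p, y = orbpt p.
Proof.
have [t ->] := orb_surj y; have [s [u [s0 u0 ->]]] := torus_st t.
by rewrite orb_st //; exists (s + s^-1, u + u^-1).
Qed.

(** In the coordinates s, u the character l is s^(l1+l2) u^(l1-l2), and the group inverts s and u
    independently. *)
Lemma torus_char_sym l (s u : C) : s != 0 -> u != 0 -> let t := mkt (s * u) (s / u) in
  \sum_(v in klein) torus_char l (torus_act v t) =
  dickson (s + s^-1) `|(l.1 + l.2)%R|%N * dickson (u + u^-1) `|(l.1 - l.2)%R|%N :> C.
Proof.
move=> s0 u0 t.
have dz (x : C) (n : int) : x != 0 -> dickson (x + x^-1) `|n|%N = x ^ n + x ^ (- n) :> C.
  move=> x0; rewrite dicksonE //; case: n => n; rewrite ?NegzE ?opprK ?abszN absz_nat.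
    by rewrite -exprnP -exprnN.
  by rewrite -exprnP -exprnN addrC.
have ct : coords t = (s * u, s / u) by rewrite coords_mkt ?mulf_neq0 ?invr_eq0.
rewrite /klein /= -!finset.setUA.
do 3![rewrite big_setU1 /=; last by rewrite !inE; vm_compute].
rewrite big_set1 torus_act1 /torus_char act_a act_r3 act_ar3 ct /=.
rewrite !dz // !opprD !opprK.
have su : s * u != 0 by rewrite mulf_neq0.
have sV : s^-1 != 0 by rewrite invr_eq0.
have uV : u^-1 != 0 by rewrite invr_eq0.
rewrite !invfM !invrK !expfzMl !exprz_inv !expfzDr //.
by ring.
Qed.

Lemma dickson_par n b : par (odd n) (fun z : C * C => dickson (coordinate b z) n).
Proof.
have pc m : par (odd m) (fun z : C * C => cheb_val (coordinate b z) m).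
  suff : par (odd m) (fun z : C * C => cheb_val (coordinate b z) m) /\
         par (~~ odd m) (fun z : C * C => cheb_val (coordinate b z) m.+1) by case.
  elim: m => [|m [h1 h2]]; split=> //=.
  - by apply: (par_ext _ (par_cst (1 : C))) => z; rewrite cheb_val0.
  - by apply: (par_ext _ (par_coordinate C b)) => z; rewrite cheb_val1.
  rewrite negbK.
  have h3 := parM (par_coordinate C b) h2; rewrite addTb negbK in h3.
  by apply: (par_ext _ (parD h3 (par_scale (-1) h1))) => z; rewrite cheb_valSS mulN1r.
case: n => [|[|n]] /=; first exact: (par_cst 2).
  exact: (par_coordinate C b).
rewrite negbK; have h := pc n.+2; rewrite /= negbK in h.
by apply: (par_ext _ (parD h (par_scale (-1) (pc n)))) => z; rewrite mulN1r.
Qed.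

Lemma dickson_even l : even_fun (fun z : C * C =>
  dickson z.1 `|(l.1 + l.2)%R|%N * dickson z.2 `|(l.1 - l.2)%R|%N).
Proof.
have := parM (dickson_par `|(l.1 + l.2)%R|%N true) (dickson_par `|(l.1 - l.2)%R|%N false).
suff -> : odd `|(l.1 + l.2)%R|%N (+) odd `|(l.1 - l.2)%R|%N = false by [].
rewrite -oddD.
have : exists m : nat, (`|(l.1 + l.2)%R|%N + `|(l.1 - l.2)%R|%N = m.*2)%N.
  have h (x y : int) : (exists m : nat, (`|(x + y)%R|%N + `|(x - y)%R|%N = m.*2)%N).
    (* |x + y| + |x - y| is twice the larger of |x| and |y|. *)
    exists (maxn `|x| `|y|); lia.
  exact: h.
by move=> [m ->]; rewrite odd_double.
Qed.

(** An invariant function is its own average over the group, and the average of a character is a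
    product of two [dickson] polynomials of the same parity. *)
Lemma regular_invariant_even (f : torus C -> C) : @regular C (torus_variety C) f ->
  (forall v t, v \in klein -> f (torus_act v t) = f t) -> even_fun (f \o @tpt C).
Proof.
move=> [c hc] fI.
suff -> : f \o @tpt C = fun z => 4^-1 * \sum_(x <- c) x.1 *
    (dickson z.1 `|(x.2.1 + x.2.2)%R|%N * dickson z.2 `|(x.2.1 - x.2.2)%R|%N).
  apply: (@par_scale C false); apply: (@par_sum C false) => x _.
  by apply: (@par_scale C false); exact: dickson_even.
apply/funext => z /=.
have -> : f (tpt z) = 4^-1 * \sum_(v in klein) f (torus_act v (tpt z)).
  rewrite (eq_bigr (fun=> f (tpt z))) => [|v hv]; last exact: fI.
  rewrite big_const iter_addr_0 (_ : #|klein| = 4%N).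
    by rewrite -[f _ *+ 4]mulr_natl mulrA mulVf ?mul1r // pnatr_eq0.
  by rewrite /klein -!finset.setUA !cardsU1 cards1 !inE; vm_compute.
congr (_ * _); rewrite (eq_bigr _ (fun v _ => hc (torus_act v (tpt z)))).
rewrite exchange_big /=; apply: eq_bigr => x _; rewrite -mulr_sumr; congr (_ * _).
by rewrite torus_char_sym ?sroot_neq0 // !srootE.
Qed.

Lemma orbit_regular_even (f : coordring (orbit_variety C G)) : even_fun (val f \o orbpt).
Proof.
have [g [hg eg]] := coordringP f.
have e t : val f (orb t) = g t by have /= := eg (totX t).
have -> : val f \o orbpt = g \o @tpt C by apply/funext => z /=; rewrite -e.
apply: regular_invariant_even => // v t hv.
by rewrite -!e orb_act.
Qed.

Lemma orbit_descend (g : torus C -> C) : @regular C (torus_variety C) g ->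
  (forall v t, v \in klein -> g (torus_act v t) = g t) ->
  exists f : coordring (orbit_variety C G), forall t, val f (orb t) = g t.
Proof.
move=> hg gI.
pose f (y : orbit_variety C G) : C := g (set_val (generic_quotient.repr (y : orbit_quot [set: torus C] G))).
have fE t : f (orb t) = g t.
  have /orb_eqP[v [hv e]] : orb (set_val (generic_quotient.repr (orb t))) = orb t.
    by rewrite /orb -totXE reprK.
  by rewrite /f [in RHS]e gI.
have hf : @regular C (orbit_variety C G) f.
  by exists g; split=> // s; rewrite [s]totXE; exact: fE.
by exists (Sub f (asboolT hf)) => t; rewrite SubK fE.
Qed.

Lemma orbit_even_regular (f : C * C -> C) : even_fun f ->
  exists g : coordring (orbit_variety C G), forall p, val g (orbpt p) = f p.
Proof.
elim=> {f} [c|u|f g _ [f' hf] _ [g' hg]|f g _ [f' hf] _ [g' hg]].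
- by exists (cst_coord _ c).
- pose mon (l : int * int) t := torus_char l t : C.
  have pc l : @regular C (torus_variety C) (torus_char l).
    by exists [:: (1, l)] => t; rewrite big_seq1 mul1r.
  have hD := @regularD C (torus_variety C); have hC := @regular_cst C (torus_variety C).
  have E l t : torus_char l t = (coords t).1 ^ l.1 * (coords t).2 ^ l.2 :> C by [].
  (* The origin of the formulas: (s + 1/s)(u + 1/u) = z1 + 1/z1 + z2 + 1/z2, s^2 = z1 z2 and u^2 =
     z1 / z2. *)
  pose F (t : torus C) : C := match u with
    | None => (torus_char (1, 0) t + torus_char (-1, 0) t) + (torus_char (0, 1) t + torus_char (0, -1) t)
    | Some true => (torus_char (1, 1) t + torus_char (-1, -1) t) + 2
    | Some false => (torus_char (1, -1) t + torus_char (-1, 1) t) + 2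
    end.
  have [||g hg] := @orbit_descend F.
  + by rewrite /F; case: u {F} => [[]|]; apply: (hD); do ?[apply: hD]; try exact: hC; exact: pc.
  + move=> v t /kleinP[]->; rewrite ?torus_act1 // /F !E ?act_a ?act_r3 ?act_ar3 /=;
      case: u {F} => [[]|]; rewrite ?expr0z ?expr1z ?exprN1 ?invrK ?mulr1 ?mul1r; ring.
  exists g => p; rewrite hg /F !E coords_tpt.
  have -> : quad u p = quad u (sroot p.1 + (sroot p.1)^-1, sroot p.2 + (sroot p.2)^-1).
    by rewrite !srootE -surjective_pairing.
  have h1 := sroot_neq0 p.1; have h2 := sroot_neq0 p.2.
  by case: u {F g hg} => [[]|]; rewrite /= ?expr0z ?expr1z ?exprN1 ?mulr1 ?mul1r; field; rewrite h1 h2.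
- by exists (f' + g') => p; rewrite -hf -hg.
- by exists (f' * g') => p; rewrite -hf -hg.
Qed.

Lemma coordring_orbit_inj (f g : coordring (orbit_variety C G)) :
  (forall p, val f (orbpt p) = val g (orbpt p)) -> f = g.
Proof.
move=> e; apply: val_inj; apply/funext => y.
by have [p ->] := orbpt_surj y.
Qed.

(** An induction principle for k, generated by the three quadratic monomials; it reduces the
    identification of a k-action to these generators. *)
Lemma coordring_orbit_ind (P : coordring (orbit_variety C G) -> Prop) :
  (forall c, P (cst_coord _ c)) ->
  (forall u f, (forall p, val f (orbpt p) = quad u p) -> P f) ->
  (forall f g, P f -> P g -> P (f + g)) -> (forall f g, P f -> P g -> P (f * g)) ->
  forall f, P f.
Proof.
move=> Pc Pq PD PM f.
suff H e : even_fun e -> forall f : coordring (orbit_variety C G),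
    (forall p, val f (orbpt p) = e p) -> P f.
  exact: (H _ (orbit_regular_even f)).
elim=> {e f} [c|u|e1 e2 h1 IH1 h2 IH2|e1 e2 h1 IH1 h2 IH2] f hf.
- by have -> : f = cst_coord _ c by apply: coordring_orbit_inj.
- exact: Pq hf.
- have [f1 e1f] := orbit_even_regular h1; have [f2 e2f] := orbit_even_regular h2.
  have -> : f = f1 + f2.
    by apply: coordring_orbit_inj => p; rewrite hf -e1f -e2f.
  by apply: PD; [exact: IH1 | exact: IH2].
- have [f1 e1f] := orbit_even_regular h1; have [f2 e2f] := orbit_even_regular h2.
  have -> : f = f1 * f2.
    by apply: coordring_orbit_inj => p; rewrite hf -e1f -e2f.
  by apply: PM; [exact: IH1 | exact: IH2].
Qed.
End Orbits.

(** * The extended quotient *)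

Lemma weyl_aa : (weyl_a * weyl_a = 1)%g.
Proof. by apply: val_inj; vm_compute. Qed.

Section ExtendedQuotient.
Variables (C : numClosedFieldType) (G : {group weylG2}).
Hypothesis hG : G = klein :> {set weylG2}.
Variable X : set (torus C).
Implicit Types p q : fixed_pairs X G.

Lemma pair_fixed p : torus_act (pair_elt p) (pair_pt p) = pair_pt p.
Proof. by have [_ h] := set_mem (valP (tagged p)). Qed.

Lemma pair_elt_in p : pair_elt p \in klein.
Proof. by rewrite -hG; exact: subgP. Qed.

Definition mkpair w (hw : w \in G) t (hX : X t) (ht : torus_act w t = t) : fixed_pairs X G :=
  existT _ (Subg hw) (exist (fun s => s \in [set s | X s /\ torus_act w s = s]) t
                       (mem_set (conj hX ht))).

Lemma pair_class_eqP p q : \pi_(ext_quot X G) p = \pi_(ext_quot X G) q <->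
  pair_elt p = pair_elt q /\ exists v, v \in klein /\ pair_pt q = torus_act v (pair_pt p).
Proof.
split=> [/eqmodP/asboolP[v [hv e e']]|[e [v [hv e']]]].
  have hv' : v \in klein by rewrite -hG.
  split; last by exists v.
  by rewrite e (klein_commute hv' (pair_elt_in p)) mulgK.
apply/eqmodP/asboolP; exists v; split=> //; first by rewrite hG.
by rewrite -e (klein_commute hv (pair_elt_in p)) mulgK.
Qed.

Section Strata.
Variables (S : Type) (A4 : orbit_quot X G -> S) (A2 A3 : torus C -> S) (P0 P1 P5 : S).
Hypotheses (A2V : forall t : torus C, X t -> A2 (torus_act weyl_r3 t) = A2 t)
           (A3V : forall t : torus C, X t -> A3 (torus_act weyl_r3 t) = A3 t).

(** A map out of the extended quotient, given on each stratum. [X] and [S] are general because it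
    produces functions, the map to the six varieties and, on the compact torus, the map to the six
    spaces. *)
Definition pair_stratum p : S :=
  if pair_elt p == 1%g then A4 (ext_proj (\pi_(ext_quot X G) p))
  else if pair_elt p == weyl_a then A2 (pair_pt p)
  else if pair_elt p == (weyl_a * weyl_r3)%g then A3 (pair_pt p)
  else if coords (pair_pt p) == (1, 1) then P0
  else if coords (pair_pt p) == (-1, -1) then P1 else P5.

Definition stratum (y : ext_quot X G) : S := pair_stratum (generic_quotient.repr y).

(** The group is commutative, so a class determines its element w. On the points fixed by [weyl_a]
    or by [weyl_a * weyl_r3] the whole group acts through [weyl_r3], which leaves [A2] and [A3]
    unchanged. *)
Lemma stratumE p : stratum (\pi_(ext_quot X G) p) = pair_stratum p.
Proof.
rewrite /stratum; set q := generic_quotient.repr _.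
have eqp : \pi_(ext_quot X G) q = \pi_(ext_quot X G) p by rewrite reprK.
have [e [v [hv e']]] := (proj1 (pair_class_eqP q p)) eqp.
rewrite /pair_stratum -e; have [w1|w1] := eqVneq (pair_elt q) 1%g; first by rewrite eqp.
have fq := pair_fixed q; have Xq := set_mem (pair_pt_in q); have [wa|wa] := eqVneq (pair_elt q) weyl_a.
  rewrite wa in fq; rewrite e'; case/kleinP: hv => ->; rewrite ?torus_act1 ?fq ?A2V //.
  by rewrite weyl_a_r3C torus_actM fq A2V.
have [war|war] := eqVneq (pair_elt q) (weyl_a * weyl_r3)%g.
  rewrite war in fq; rewrite e'; case/kleinP: hv => ->; rewrite ?torus_act1 ?fq ?A3V //.
  by rewrite -{2}fq -torus_actM mulgA weyl_aa mul1g A3V.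
have wr : pair_elt q = weyl_r3.
  by case/kleinP: (pair_elt_in q) => h //; rewrite h eqxx in w1 wa war.
rewrite wr in fq.
have h : coords (pair_pt p) = coords (pair_pt q) \/
         coords (pair_pt p) = ((coords (pair_pt q)).2, (coords (pair_pt q)).1).
  rewrite e' -(act_a (pair_pt q)); case/kleinP: hv => ->.
  - by left; rewrite torus_act1.
  - by right.
  - by left; rewrite fq.
  - by right; rewrite torus_actM fq.
case: h => ->; first by [].
by case: (coords _) => x y /=; rewrite !xpair_eqE [(y == 1) && _]andbC [(y == -1) && _]andbC.
Qed.
End Strata.
End ExtendedQuotient.

Section ExtendedTorus.
Variables (C : numClosedFieldType) (G : {group weylG2}).
Hypothesis hG : G = klein :> {set weylG2}.
Local Notation T := [set: torus C].
Local Notation ext := (ext_quot T G).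

Lemma klein_a : weyl_a \in klein. Proof. by rewrite !inE eqxx ?orbT. Qed.
Lemma klein_r3 : weyl_r3 \in klein. Proof. by rewrite !inE eqxx ?orbT. Qed.
Lemma klein_ar3 : (weyl_a * weyl_r3)%g \in klein. Proof. by rewrite !inE eqxx ?orbT. Qed.
Lemma klein1 : 1%g \in klein. Proof. by rewrite !inE eqxx ?orbT. Qed.

(* The class of (w, t); a junk value unless w t = t. *)
Definition cls (w : weylG2) (t : torus C) : ext :=
  \pi_ext (match pselect (w \in G), pselect (torus_act w t = t) with
           | left hw, left ht => mkpair hw (I : T t) ht
           | _, _ => mkpair (group1 G) (I : T t) (torus_act1 t)
           end).

Lemma clsE w t : w \in klein -> torus_act w t = t ->
  exists p : fixed_pairs T G, [/\ cls w t = \pi_ext p, pair_elt p = w & pair_pt p = t].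
Proof.
move=> hw ht; rewrite -hG in hw; exists (mkpair hw (I : T t) ht); split=> //.
rewrite /cls; case: pselect => // hw'; case: pselect => // ht'.
by rewrite (Prop_irrelevance hw' hw) (Prop_irrelevance ht' ht).
Qed.

Lemma cls_pair (p : fixed_pairs T G) : \pi_ext p = cls (pair_elt p) (pair_pt p).
Proof.
have [q [-> eq1 eq2]] := clsE (pair_elt_in hG p) (pair_fixed p).
apply/(pair_class_eqP hG); rewrite eq1 eq2; split=> //.
by exists 1%g; rewrite klein1 torus_act1.
Qed.

Lemma cls_eqP w t w' t' : w \in klein -> torus_act w t = t ->
  w' \in klein -> torus_act w' t' = t' ->
  cls w t = cls w' t' <-> w = w' /\ exists v, v \in klein /\ t' = torus_act v t.
Proof.
move=> hw ht hw' ht'; have [p [-> <- <-]] := clsE hw ht; have [q [-> <- <-]] := clsE hw' ht'.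
exact: (pair_class_eqP hG).
Qed.

Lemma cls_act v w t : v \in klein -> w \in klein -> torus_act w t = t ->
  cls w (torus_act v t) = cls w t.
Proof.
move=> hv hw ht; apply/esym/cls_eqP => //; last by split=> //; exists v.
by rewrite -torus_actM -(klein_commute hv hw) torus_actM ht.
Qed.

Lemma fixed_a (t : torus C) : torus_act weyl_a t = t <-> (coords t).2 = (coords t).1.
Proof.
split=> [h|h]; first by have := congr1 (@coords C) h; rewrite act_a; case: (coords t) => x y [].
by apply: coords_inj; rewrite act_a h; move: h; case: (coords t) => x y /= ->.
Qed.

Lemma fixed_ar3 (t : torus C) : torus_act (weyl_a * weyl_r3)%g t = t <-> (coords t).2 = (coords t).1^-1.
Proof.
split=> [h|h].
  by have := congr1 (@coords C) h; rewrite act_ar3; case: (coords t) => x y [].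
by apply: coords_inj; rewrite act_ar3 h invrK; move: h; case: (coords t) => x y /= ->.
Qed.

Lemma sqr_eq1 (x : C) : x != 0 -> x^-1 = x -> x = 1 \/ x = -1.
Proof.
move=> x0 h; have : x ^+ 2 == 1 by rewrite expr2 -{1}h mulVf.
by rewrite sqrf_eq1 => /orP[] /eqP; [left|right].
Qed.

Lemma fixed_r3 (t : torus C) : torus_act weyl_r3 t = t ->
  ((coords t).1 = 1 \/ (coords t).1 = -1) /\ ((coords t).2 = 1 \/ (coords t).2 = -1).
Proof.
have [h1 h2] := coords_neq0 t.
move=> /(congr1 (@coords C)); rewrite act_r3 => h.
by split; apply: sqr_eq1 => //; [rewrite -[RHS](congr1 fst h)|rewrite -[RHS](congr1 snd h)].
Qed.

(** These are the points (s u, s / u) with u = -1, respectively, after renaming s, with first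
    parameter -1. The choice of -1 instead of 1 makes the constant coordinate in T^vee / W^s equal
    to -2, the value of the sign character on the side of J. *)
Definition line_torus (b : bool) (s : C) : torus C := mkt (- s) (if b then - s else - s^-1).
Definition line_elt (b : bool) : weylG2 := if b then weyl_a else (weyl_a * weyl_r3)%g.

Lemma coords_line_torus b s : s != 0 ->
  coords (line_torus b s) = (- s, if b then - s else - s^-1).
Proof. by move=> s0; rewrite coords_mkt // ?oppr_eq0 //; case: b; rewrite oppr_eq0 ?invr_eq0. Qed.

Lemma line_elt_in b : line_elt b \in klein.
Proof. by case: b; [exact: klein_a | exact: klein_ar3]. Qed.

Lemma line_torus_fixed b s : s != 0 -> torus_act (line_elt b) (line_torus b s) = line_torus b s.
Proof.
by case: b => s0; [apply/fixed_a|apply/fixed_ar3]; rewrite coords_line_torus //= invrN.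
Qed.

Definition sign_torus (e1 e2 : bool) : torus C := mkt ((-1) ^+ e1) ((-1) ^+ e2).

Lemma coords_sign_torus e1 e2 : coords (sign_torus e1 e2) = ((-1) ^+ e1, (-1) ^+ e2).
Proof. by rewrite coords_mkt ?signr_eq0. Qed.

Lemma sign_torus_fixed e1 e2 : torus_act weyl_r3 (sign_torus e1 e2) = sign_torus e1 e2.
Proof.
apply: coords_inj; rewrite act_r3 coords_sign_torus /=.
by congr (_, _); rewrite -exprVn invrN1.
Qed.

Definition ext_plane (p : C * C) : ext := cls 1%g (tpt p).
Definition ext_line (b : bool) (x : C) : ext := cls (line_elt b) (line_torus b (sroot x)).
Definition ext_point (b : bool) : ext := cls weyl_r3 (sign_torus b b).
Definition ext_star : ext := cls weyl_r3 (sign_torus false true).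

Lemma cls1_plane t : exists p, orb G t = orbpt G p /\ cls 1%g t = ext_plane p.
Proof.
have [p hp] := orbpt_surj hG (orb G t); exists p; split=> //.
have /(orb_eqP hG)[v [hv e]] := hp.
by rewrite /ext_plane e cls_act //; [exact: klein1 | exact: torus_act1].
Qed.

Lemma line_torus_ext b s : s != 0 -> cls (line_elt b) (line_torus b s) = ext_line b (s + s^-1).
Proof.
move=> s0; apply/esym; have [h|h] := sumV_inj s0 (sroot_neq0 _) (esym (srootE (s + s^-1))).
  by rewrite /ext_line h.
rewrite /ext_line h -(@cls_act weyl_r3 _ (line_torus b s)); last exact: line_torus_fixed.
- congr cls; apply: coords_inj; rewrite act_r3 !coords_line_torus ?invr_eq0 //=.
  by congr (_, _); case: b; rewrite !invrN ?invrK.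
- exact: klein_r3.
- exact: line_elt_in.
Qed.

Lemma fixed_line_torus b t : torus_act (line_elt b) t = t ->
  t = line_torus b (- (coords t).1).
Proof.
have [h1 h2] := coords_neq0 t.
move=> h; apply: coords_inj; rewrite coords_line_torus ?oppr_eq0 // opprK.
rewrite [LHS]surjective_pairing.
by case: b h => [/fixed_a|/fixed_ar3] ->; rewrite ?invrN ?opprK.
Qed.

Lemma cls_line b t : torus_act (line_elt b) t = t ->
  cls (line_elt b) t = ext_line b (- ((coords t).1 + (coords t).1^-1)).
Proof.
have [h1 h2] := coords_neq0 t.
move=> h; rewrite {1}(fixed_line_torus h) line_torus_ext ?oppr_eq0 //.
by rewrite invrN opprD.
Qed.

Lemma cls_r3 t : torus_act weyl_r3 t = t ->
  cls weyl_r3 t = if coords t == (1, 1) then ext_point false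
                  else if coords t == (-1, -1) then ext_point true else ext_star.
Proof.
move=> h; have n11 : (-1 == 1 :> C) = false by rewrite eq_sym -subr_eq0 opprK -[_ == 0]/(2%:R == 0) pnatr_eq0.
have E (e1 e2 : bool) : coords t = ((-1) ^+ e1, (-1) ^+ e2) -> t = sign_torus e1 e2.
  by move=> e; apply: coords_inj; rewrite coords_sign_torus.
have [[h1|h1] [h2|h2]] := fixed_r3 h; have e := surjective_pairing (coords t);
  rewrite h1 h2 in e; rewrite e !xpair_eqE ?eqxx ?n11 ?[1 == -1]eq_sym ?n11 /=.
- by rewrite (E false false).
- by rewrite (E false true).
- rewrite (E true false) //= /ext_star -(@cls_act weyl_a) //; last exact: sign_torus_fixed.
  + by congr cls; apply: coords_inj; rewrite act_a !coords_sign_torus.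
  + exact: klein_a.
  + exact: klein_r3.
- by rewrite (E true true).
Qed.

Lemma ext_cases (y : ext) : [\/ exists p, y = ext_plane p, exists b x, y = ext_line b x,
  exists b, y = ext_point b | y = ext_star].
Proof.
have [p ->] : exists p : fixed_pairs T G, y = \pi_ext p.
  by exists (generic_quotient.repr y); rewrite reprK.
rewrite cls_pair; have f := pair_fixed p.
case/kleinP: (pair_elt_in hG p) f => -> f.
- by have [q [_ ->]] := cls1_plane (pair_pt p); constructor 1; exists q.
- by rewrite (@cls_line true) //; constructor 2; eexists; eexists.
- rewrite cls_r3 //; case: ifP => _; first by constructor 3; exists false.
  by case: ifP => _; [constructor 3; exists true | constructor 4].
- by rewrite (@cls_line false) //; constructor 2; eexists; eexists.
Qed.

Lemma ext_proj_cls w t : w \in klein -> torus_act w t = t -> ext_proj (cls w t) = orb G t.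
Proof.
move=> hw ht; have [p [-> _ <-]] := clsE hw ht; rewrite ext_projE /orb.
by congr (\pi_(orbit_quot T G) _); apply: val_inj.
Qed.

Lemma ext_proj_plane p : ext_proj (ext_plane p) = orbpt G p.
Proof. by rewrite ext_proj_cls ?klein1 ?torus_act1. Qed.

(* With (z1, z2) = (s u, s / u), the two lines are u = -1 and s = -1. *)
Lemma ext_proj_line b x :
  ext_proj (ext_line b x) = orbpt G (if b then (x, -2) else (-2, x)).
Proof.
have s0 := sroot_neq0 x; have N1 : (-1 : C) != 0 by rewrite oppr_eq0 oner_eq0.
have e2 : (-1 : C) + (-1)^-1 = -2 by rewrite invrN1 -opprD.
rewrite ext_proj_cls ?line_elt_in ?line_torus_fixed // -{2 3}(srootE x) -e2.
by case: b; rewrite -(orb_st hG) //; congr orb; rewrite /line_torus; congr mkt;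
  rewrite ?mulrN1 ?invrN1 ?mulrN1 ?mulN1r.
Qed.

Lemma ext_proj_point b : ext_proj (ext_point b) = orbpt G (2, (-1) ^+ b * 2).
Proof.
rewrite ext_proj_cls ?klein_r3 ?sign_torus_fixed //.
have e2 : (-1 : C) ^+ b * 2 = (-1) ^+ b + ((-1) ^+ b)^-1.
  by rewrite -exprVn invrN1 mulr_natr.
have e1 : (2 : C) = 1 + 1^-1 by rewrite invr1.
rewrite e2 {1}e1 -(orb_st hG) ?oner_eq0 ?signr_eq0 //; congr orb; congr mkt.
  by rewrite mul1r.
by rewrite div1r -exprVn invrN1.
Qed.

(** (1, -1) = (s u, s / u) for s = i and u = -i, where s + 1/s = u + 1/u = 0. Thus pt_* lies over
    the singular point of T^vee / W^s. *)
Lemma ext_proj_star : ext_proj ext_star = orbpt G (0, 0).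
Proof.
rewrite ext_proj_cls ?klein_r3 ?sign_torus_fixed //.
have i0 : 'i != 0 :> C by rewrite neq0Ci.
have e : 'i + 'i^-1 = 0 :> C by rewrite invCi subrr.
have e' : - 'i + (- 'i)^-1 = 0 :> C by rewrite invrN -opprD e oppr0.
rewrite -{1}e -e' -(orb_st hG) ?oppr_eq0 //; congr orb; congr mkt.
  by rewrite mulrN -expr2 sqrCi opprK.
by rewrite invrN mulrN mulfV.
Qed.
End ExtendedTorus.

Lemma halve (C : numClosedFieldType) (x : C) : x = 2^-1 * (x + x).
Proof. by field. Qed.

Section ExtendedRegular.
Variables (C : numClosedFieldType) (G : {group weylG2}).
Hypothesis hG : G = klein :> {set weylG2}.
Local Notation T := [set: torus C].
Local Notation ext := (ext_quot T G).

Lemma orbit_regular_evenP (f : orbit_quot T G -> C) :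
  @regular C (orbit_variety C G) f -> even_fun (f \o orbpt G).
Proof.
move=> hf; have := @orbit_regular_even C G hG (Sub (f : orbit_variety C G -> C) (asboolT hf)).
by rewrite SubK.
Qed.

Lemma torus_regular_horner (g : torus C -> C) (P : {poly C}) :
  @regular C (torus_variety C) g -> @regular C (torus_variety C) (fun t => P.[g t]).
Proof.
move=> hg; elim/poly_ind: P => [|P c IH].
  have := @regular_cst C (torus_variety C) 0.
  by congr regular; apply/funext => t; rewrite horner0.
have := regularD (regularM IH hg) (@regular_cst C (torus_variety C) c).
by congr regular; apply/funext => t; rewrite hornerMXaddC.
Qed.

Lemma torus_regular_char l : @regular C (torus_variety C) (torus_char l).
Proof. by exists [:: (1, l)] => t; rewrite big_seq1 mul1r. Qed.

Lemma cls_mkpair w (hw : w \in G) t (ht : torus_act w t = t) :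
  cls G w t = \pi_ext (mkpair hw (I : T t) ht).
Proof.
rewrite /cls; case: pselect => // hw'; case: pselect => // ht'.
by rewrite (Prop_irrelevance hw' hw) (Prop_irrelevance ht' ht).
Qed.

Lemma ext_regularP (h : ext -> C) : @regular C (ext_variety C G) h <->
  forall w, w \in klein -> exists g, @regular C (torus_variety C) g /\
    forall t, torus_act w t = t -> h (cls G w t) = g t.
Proof.
split=> [H w hw|H w].
  rewrite -hG in hw; have [g [hg eg]] := H (Subg hw); exists g; split=> // t ht.
  by rewrite (cls_mkpair hw ht); exact: eg.
have hw : sgval w \in klein by rewrite -hG; exact: subgP.
have [g [hg eg]] := H _ hw; exists g; split=> // x.
have ht : torus_act (sgval w) (set_val x) = set_val x by have [_] := set_mem (valP x).
by rewrite -eg // -[LHS]/(h (\pi_ext (existT _ w x : fixed_pairs T G))) cls_pair.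
Qed.

Lemma dicksonz (u : C) (n : int) : u != 0 ->
  dickson (u + u^-1) `|n|%N = u ^ n + u ^ (- n).
Proof.
move=> u0; rewrite dicksonE //; case: n => n; rewrite ?NegzE ?opprK ?abszN absz_nat.
  by rewrite -exprnP -exprnN.
by rewrite -exprnP -exprnN addrC.
Qed.

Lemma dickson_poly n : exists P : {poly C}, forall x, dickson x n = P.[x].
Proof.
case: n => [|[|n]] /=.
- by exists 2%:P => x; rewrite hornerC.
- by exists 'X => x; rewrite hornerX.
- by exists (cheb C n.+2 - cheb C n) => x; rewrite hornerD hornerN.
Qed.

(** Averaging over [weyl_r3] turns a character into a [dickson] polynomial. It is composed with -X
    because the torus coordinate is -s while the coordinate of the line is s + 1/s. *)
Lemma ext_regular_line (h : ext -> C) b : @regular C (ext_variety C G) h ->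
  exists P : {poly C}, forall x, h (ext_line G b x) = P.[x].
Proof.
move=> /ext_regularP/(_ _ (line_elt_in b))[g [[c gc] hg]].
pose e (l : int * int) : int := if b then l.1 + l.2 else l.1 - l.2.
have /choice[D hD] := dickson_poly.
pose P := 2^-1 *: \sum_(x <- c) x.1 *: (D `|e x.2|%N \Po - 'X).
exists P => x; set s := sroot x.
have s0 : s != 0 := sroot_neq0 x.
have ht := line_torus_fixed b s0.
have hr : torus_act (line_elt b) (torus_act weyl_r3 (line_torus b s)) =
          torus_act weyl_r3 (line_torus b s).
  by rewrite -torus_actM (klein_commute (line_elt_in b) klein_r3) torus_actM ht.
have E l : torus_char l (line_torus b s) + torus_char l (torus_act weyl_r3 (line_torus b s)) =
           dickson (- x) `|e l|%N.
  have -> : - x = - s + (- s)^-1 by rewrite invrN -opprD srootE.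
  have ns0 : - s != 0 by rewrite oppr_eq0.
  rewrite dicksonz // /torus_char act_r3 coords_line_torus //= /e.
  case: (b); first by rewrite !exprz_inv opprD !expfzDr.
  by rewrite -invrN !exprz_inv ?opprK opprB !expfzDr // [X in _ + X]mulrC.
have -> : h (ext_line G b x) = 2^-1 * (g (line_torus b s) + g (torus_act weyl_r3 (line_torus b s))).
  rewrite -!hg // (cls_act hG klein_r3 (line_elt_in b)) //.
  exact: halve.
rewrite hornerZ horner_sum !gc -big_split /=; congr (_ * _); apply: eq_bigr => y _.
by rewrite hornerZ horner_comp hornerN hornerX -hD -E mulrDr.
Qed.

Lemma ext_regular_plane (h : ext -> C) : @regular C (ext_variety C G) h ->
  even_fun (h \o @ext_plane C G).
Proof.
move=> /ext_regularP/(_ _ klein1)[g [rg hg]].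
have -> : h \o @ext_plane C G = g \o @tpt C.
  by apply/funext => p /=; rewrite -hg // torus_act1.
apply: regular_invariant_even => // v t hv.
by rewrite -!hg ?torus_act1 // (cls_act hG hv klein1) // torus_act1.
Qed.

Lemma ext_regular_components (h : ext -> C) : @regular C (ext_variety C G) h <->
  even_fun (h \o @ext_plane C G) /\
  forall b, exists P : {poly C}, forall x, h (ext_line G b x) = P.[x].
Proof.
split=> [H|[H1 H2]].
  by split=> [|b]; [exact: ext_regular_plane | exact: ext_regular_line].
have rc := torus_regular_char; have hC := @regular_cst C (torus_variety C).
have hD := @regularD C (torus_variety C); have hM := @regularM C (torus_variety C).
have line b : exists g, @regular C (torus_variety C) g /\
    forall t, torus_act (line_elt b) t = t -> h (cls G (line_elt b) t) = g t.
  have [P hP] := H2 b.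
  exists (fun t => (P \Po - 'X).[torus_char (1, 0) t + torus_char (-1, 0) t]); split.
    by apply: torus_regular_horner; apply: (hD); exact: rc.
  move=> t ht; rewrite cls_line // hP horner_comp !hornerE /torus_char /=.
  by rewrite !expr0z !mulr1 expr1z exprN1.
apply/ext_regularP => w /kleinP[]->.
- have [z hz] := orbit_even_regular hG H1.
  have [g [rg hg]] := coordringP z; exists g; split=> // t _.
  have [p [e1 e2]] := cls1_plane hG t.
  rewrite e2 -[LHS]/((h \o @ext_plane C G) p) -hz -e1.
  exact: (hg (totX t)).
- exact: (line true).
- pose c1 := h (ext_point C G false); pose c2 := h (ext_point C G true); pose c3 := h (ext_star C G).
  pose z1 (t : torus C) := torus_char (1, 0) t; pose z2 (t : torus C) := torus_char (0, 1) t.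
  (* Interpolation at the points (1, 1), (-1, -1) and (1, -1) ~ (-1, 1) by the symmetric functions
     1, z1 + z2 and z1 z2. *)
  exists (fun t => (c1 + c2 + 2 * c3) / 4 + (c1 - c2) / 4 * (z1 t + z2 t) +
                   (c1 + c2 - 2 * c3) / 4 * (z1 t * z2 t)); split.
    by apply: (hD); [apply: (hD) => //; apply: (hM) => //; apply: (hD) |
      apply: (hM) => //; apply: (hM)]; exact: rc.
  have n11 : (-1 == 1 :> C) = false.
    by rewrite eq_sym -subr_eq0 opprK -[_ == 0]/(2%:R == 0) pnatr_eq0.
  move=> t ht; rewrite cls_r3 // /z1 /z2 /torus_char /= !expr0z !expr1z mulr1 mul1r.
  have h4 : (4 : C) != 0 by rewrite pnatr_eq0.
  have [[h1|h1] [h2|h2]] := fixed_r3 ht; have e := surjective_pairing (coords t);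
    rewrite h1 h2 in e; rewrite e !xpair_eqE ?eqxx ?n11 ?[1 == -1]eq_sym ?n11 /= -/c1 -/c2 -/c3;
    by field.
- exact: (line false).
Qed.

Section StratumValues.
Variables (S : Type) (A4 : orbit_quot T G -> S) (A2 A3 : torus C -> S) (P0 P1 P5 : S).
Hypotheses (A2V : forall t : torus C, T t -> A2 (torus_act weyl_r3 t) = A2 t)
           (A3V : forall t : torus C, T t -> A3 (torus_act weyl_r3 t) = A3 t).
Local Notation st := (stratum A4 A2 A3 P0 P1 P5).

Lemma stratum_cls w t : w \in klein -> torus_act w t = t -> st (cls G w t) =
  if w == 1%g then A4 (orb G t) else if w == weyl_a then A2 t
  else if w == (weyl_a * weyl_r3)%g then A3 t
  else if coords t == (1, 1) then P0 else if coords t == (-1, -1) then P1 else P5.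
Proof.
move=> hw ht; have := ext_proj_cls hG hw ht; have [p [-> <- <-]] := clsE hG hw ht.
by rewrite (stratumE hG A4 P0 P1 P5 A2V A3V) /pair_stratum => ->.
Qed.

Lemma stratum_plane p : st (ext_plane G p) = A4 (orbpt G p).
Proof. by rewrite stratum_cls ?klein1 ?torus_act1 // eqxx. Qed.

Lemma stratum_line b x : st (ext_line G b x) = (if b then A2 else A3) (line_torus b (sroot x)).
Proof.
have [[d1 d2 d3] [d4 d5 d6]] := klein_distinct.
rewrite stratum_cls ?line_elt_in ?line_torus_fixed ?sroot_neq0 //.
by case: b; rewrite /line_elt ?(negPf d1) ?(negPf d3) ?(negPf d5) !eqxx.
Qed.

Lemma stratum_point b : st (ext_point C G b) = if b then P1 else P0.
Proof.
have [[d1 d2 d3] [d4 d5 d6]] := klein_distinct.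
have n11 : (-1 == 1 :> C) = false.
  by rewrite eq_sym -subr_eq0 opprK -[_ == 0]/(2%:R == 0) pnatr_eq0.
rewrite stratum_cls ?klein_r3 ?sign_torus_fixed // (negPf d2) (negPf d4) (negPf d6).
by rewrite coords_sign_torus !xpair_eqE; case: b; rewrite ?expr1 ?expr0 ?eqxx ?n11.
Qed.

Lemma stratum_star : st (ext_star C G) = P5.
Proof.
have [[d1 d2 d3] [d4 d5 d6]] := klein_distinct.
have n11 : (-1 == 1 :> C) = false.
  by rewrite eq_sym -subr_eq0 opprK -[_ == 0]/(2%:R == 0) pnatr_eq0.
rewrite stratum_cls ?klein_r3 ?sign_torus_fixed // (negPf d2) (negPf d4) (negPf d6).
by rewrite coords_sign_torus !xpair_eqE ?expr1 ?expr0 ?eqxx [1 == -1]eq_sym ?n11.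
Qed.
End StratumValues.

Definition line_coord (t : torus C) : C := - ((coords t).1 + (coords t).1^-1).

Lemma line_coordV t : line_coord (torus_act weyl_r3 t) = line_coord t.
Proof. by rewrite /line_coord act_r3 /= invrK addrC. Qed.

Lemma line_coord_torus b x : line_coord (line_torus b (sroot x)) = x.
Proof.
by rewrite /line_coord coords_line_torus ?sroot_neq0 //= invrN -opprD opprK srootE.
Qed.

Lemma ext_function (e : C * C -> C) (P : bool -> {poly C}) (vE : bool -> C) (vS : C) :
  even_fun e -> exists h : ext -> C, [/\ @regular C (ext_variety C G) h,
    forall p, h (ext_plane G p) = e p, forall b x, h (ext_line G b x) = (P b).[x],
    forall b, h (ext_point C G b) = vE b & h (ext_star C G) = vS].
Proof.
move=> he; have [z hz] := orbit_even_regular hG he.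
pose A b t := (P b).[line_coord t].
have AV b t (_ : T t) : A b (torus_act weyl_r3 t) = A b t by rewrite /A line_coordV.
pose h := stratum (val z : orbit_quot T G -> C) (A true) (A false) (vE false) (vE true) vS.
have hp p : h (ext_plane G p) = e p by rewrite /h (stratum_plane _ _ _ _ (AV true) (AV false)).
have hl b x : h (ext_line G b x) = (P b).[x].
  by rewrite /h (stratum_line _ _ _ _ (AV true) (AV false)) //; case: b; rewrite /A line_coord_torus.
exists h; split=> //.
- apply/ext_regular_components; split; last by move=> b; exists (P b).
  by have -> : h \o @ext_plane C G = e by apply/funext => p; exact: hp.
- by move=> b; rewrite /h (stratum_point _ _ _ _ (AV true) (AV false)) //; case: b.
- by rewrite /h (stratum_star _ _ _ _ (AV true) (AV false)).
Qed.

(** [dual_component] on natural numbers, so that [component_to_ext] can be defined by matching on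
    the number. *)
Definition component (n : nat) : variety C :=
  match n with
  | 2 | 3 => affine_line C
  | 4 => orbit_variety C G
  | _ => point_variety C
  end.

Local Notation sum := (sum_variety (@dual_component C G)).

Definition in_component n (hn : (n < 6)%N) (x : component n) : sum :=
  existT (fun i => points (dual_component C G i)) (Ordinal hn) x.

Lemma in_component2V t (_ : T t) : @in_component 2 isT (line_coord (torus_act weyl_r3 t)) =
  @in_component 2 isT (line_coord t).
Proof. by rewrite line_coordV. Qed.

Lemma in_component3V t (_ : T t) : @in_component 3 isT (line_coord (torus_act weyl_r3 t)) =
  @in_component 3 isT (line_coord t).
Proof. by rewrite line_coordV. Qed.

Definition ext_to_sum : ext -> sum :=
  stratum (fun y : orbit_quot T G => @in_component 4 isT y)
    (fun t => @in_component 2 isT (line_coord t)) (fun t => @in_component 3 isT (line_coord t))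
    (@in_component 0 isT tt) (@in_component 1 isT tt) (@in_component 5 isT tt).

Definition component_to_ext n : component n -> ext :=
  match n return component n -> ext with
  | 0 => fun=> ext_point C G false
  | 1 => fun=> ext_point C G true
  | 2 => ext_line G true
  | 3 => ext_line G false
  | 4 => fun y => cls G 1%g (set_val (generic_quotient.repr (y : orbit_quot T G)))
  | _ => fun=> ext_star C G
  end.

Definition sum_to_ext (s : sum) : ext := component_to_ext (n := val (tag s)) (tagged s).

Lemma component4 t : component_to_ext (n := 4) (orb G t) = cls G 1%g t.
Proof.
have /(orb_eqP hG)[v [hv e]] : orb G t = orb G (set_val (generic_quotient.repr (orb G t))).
  by rewrite {2}/orb -totXE reprK.
by rewrite /component_to_ext e cls_act ?klein1 ?torus_act1.
Qed.

Lemma ext_to_sumK : cancel ext_to_sum sum_to_ext.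
Proof.
have [L2 L3] := (in_component2V, in_component3V).
move=> y; case: (ext_cases hG y) => [[p ->]|[b [x ->]]|[b ->]|->].
- by rewrite /ext_to_sum stratum_plane // /sum_to_ext; exact: component4.
- by rewrite /ext_to_sum stratum_line //; case: b; rewrite line_coord_torus.
- by rewrite /ext_to_sum stratum_point //; case: b.
- by rewrite /ext_to_sum stratum_star.
Qed.

Lemma sum_to_extK : cancel sum_to_ext ext_to_sum.
Proof.
have [L2 L3] := (in_component2V, in_component3V).
move=> [[[|[|[|[|[|[|n]]]]]] hn] x] //; rewrite /sum_to_ext /=.
- by rewrite /ext_to_sum (stratum_point _ _ _ _ L2 L3) (bool_irrelevance hn isT); case: x.
- by rewrite /ext_to_sum (stratum_point _ _ _ _ L2 L3) (bool_irrelevance hn isT); case: x.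
- by rewrite /ext_to_sum (stratum_line _ _ _ _ L2 L3) (bool_irrelevance hn isT) line_coord_torus.
- by rewrite /ext_to_sum (stratum_line _ _ _ _ L2 L3) (bool_irrelevance hn isT) line_coord_torus.
- rewrite /ext_to_sum (stratum_cls _ _ _ _ L2 L3) ?klein1 ?torus_act1 // eqxx.
  by rewrite /orb -totXE reprK (bool_irrelevance hn isT).
- by rewrite /ext_to_sum (stratum_star _ _ _ _ L2 L3) (bool_irrelevance hn isT); case: x.
Qed.

Lemma ext_to_sum_piece (y : ext) w z : is_class y w z -> piece_index w z = tag (ext_to_sum y).
Proof.
have [L2 L3] := (in_component2V, in_component3V).
move=> [p [-> <- <-]]; rewrite /ext_to_sum (stratumE hG _ _ _ _ L2 L3) /pair_stratum /piece_index.
by do ![case: ifP => _].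
Qed.

Lemma ext_to_sum_identity (y : ext) z : is_class y 1%g z ->
  ext_to_sum y = @in_component 4 isT (ext_proj y).
Proof.
have [L2 L3] := (in_component2V, in_component3V).
move=> [p [-> e _]]; rewrite /ext_to_sum (stratumE hG _ _ _ _ L2 L3) /pair_stratum.
by rewrite e eqxx.
Qed.

Lemma ext_to_sum_iso : @variety_iso C (ext_variety C G) sum ext_to_sum.
Proof.
have [L2 L3] := (in_component2V, in_component3V).
exists sum_to_ext; split; [exact: ext_to_sumK | exact: sum_to_extK | |].
- move=> f hf; apply/ext_regular_components; split.
    have := orbit_regular_evenP (hf (Ordinal (isT : (4 < 6)%N))).
    congr even_fun; apply/funext => p.
    by rewrite /= /ext_to_sum (stratum_plane _ _ _ _ L2 L3).
  case; [have [P hP] := hf (Ordinal (isT : (2 < 6)%N)) | have [P hP] := hf (Ordinal (isT : (3 < 6)%N))];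
    by exists P => x; rewrite /= /ext_to_sum (stratum_line _ _ _ _ L2 L3) line_coord_torus; exact: hP.
- move=> h hh [[|[|[|[|[|[|n]]]]]] hn] //=.
  + exact: (ext_regular_line true hh).
  + exact: (ext_regular_line false hh).
  + have [g [rg hg]] := (proj1 (ext_regularP h)) hh _ klein1.
    exists g; split=> // s; rewrite -hg ?torus_act1 // -component4.
    by rewrite [s]totXE.
Qed.
End ExtendedRegular.

(** * The coordinate ring of T^vee / W^s *)

Section PlaneModSign.
Variables (C : numClosedFieldType) (G : {group weylG2}).
Hypothesis hG : G = klein :> {set weylG2}.

Lemma even_fun_poly (f : C * C -> C) : even_fun f -> @regular C (affine_plane C) f.
Proof.
elim=> {f} [c|u|f g _ hf _ hg|f g _ hf _ hg].
- exact: (@regular_cst C (affine_plane C)).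
- have h1 : @regular C (affine_plane C) fst by exists ('X%:P) => z; rewrite hornerC hornerX.
  have h2 : @regular C (affine_plane C) snd by exists 'X => z; rewrite hornerX hornerC.
  by case: u => [[]|]; exact: (@regularM C (affine_plane C)).
- exact: (@regularD C (affine_plane C)).
- exact: (@regularM C (affine_plane C)).
Qed.

(** The average of f(z) and f(-z) is f itself and loses the monomials of odd total degree. *)
Lemma even_poly_fun (f : C * C -> C) : @regular C (affine_plane C) f ->
  (forall z, f (- z) = f z) -> even_fun f.
Proof.
move=> [p hp] fN.
have mon i j : par (odd i (+) odd j) (fun z : C * C => z.1 ^+ i * z.2 ^+ j).
  have X n s : par (odd n) (fun z : C * C => coordinate s z ^+ n).
    elim: n => [|n IH]; first exact: (par_cst (1 : C)).
    by apply: (par_ext _ (parM (par_coordinate C s) IH)) => z; rewrite exprS.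
  exact: (parM (X i true) (X j false)).
have F z : f z = \sum_(j < size p) \sum_(i < size p`_j) p`_j`_i * (z.1 ^+ i * z.2 ^+ j).
  rewrite hp (horner_coef p) horner_sum; apply: eq_bigr => j _.
  rewrite -polyC_exp hornerM hornerC horner_coef mulr_suml.
  by apply: eq_bigr => i _; rewrite mulrA.
suff -> : f = fun z => \sum_(j < size p) \sum_(i < size p`_j)
    (if odd i (+) odd j then 0 else p`_j`_i) * (z.1 ^+ i * z.2 ^+ j).
  apply: (@par_sum C false) => j _; apply: (@par_sum C false) => i _.
  case e: (odd i (+) odd j); last by apply: (@par_scale C false); rewrite -e; exact: mon.
  by apply: (par_ext _ (par0 C false)) => z; rewrite mul0r.
apply/funext => z.
have -> : f z = 2^-1 * (f z + f (- z)).
  by rewrite fN; exact: halve.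
rewrite !F -big_split mulr_sumr; apply: eq_bigr => j _ /=.
rewrite -big_split mulr_sumr; apply: eq_bigr => i _ /=.
rewrite (par_opp z (mon i j)); case: (odd i (+) odd j) => /=; first by rewrite mul0r; ring.
by rewrite mul1r; field.
Qed.

Local Notation plane := {eq_quot (sign_equiv_rel C)}.

Lemma sign_repr (z : C * C) :
  generic_quotient.repr (\pi_plane z) = z \/ generic_quotient.repr (\pi_plane z) = - z.
Proof.
have /eqmodP/orP[] : z = generic_quotient.repr (\pi_plane z) %[mod plane] by rewrite reprK.
  by move=> /eqP ->; left.
by move=> /eqP ->; right.
Qed.

Definition plane_to_orbit (q : plane_mod_sign C) : orbit_variety C G :=
  orbpt G (generic_quotient.repr (q : plane)).

Lemma plane_to_orbit_pi (f : coordring (orbit_variety C G)) (z : C * C) :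
  val f (plane_to_orbit (\pi_plane z)) = val f (orbpt G z).
Proof.
rewrite /plane_to_orbit; case: (sign_repr z) => -> //.
by have := par_opp (b := false) z (orbit_regular_even hG f); rewrite expr0 mul1r.
Qed.

Lemma plane_to_orbit_regular : regular_map plane_to_orbit.
Proof.
move=> f hf; have := even_fun_poly (orbit_regular_even hG (Sub f (asboolT hf))).
rewrite SubK; congr regular; apply/funext => z /=.
by have := plane_to_orbit_pi (Sub f (asboolT hf)) z; rewrite SubK.
Qed.

(** Pulled back to the plane, both rings become the ring of even polynomial functions; injectivity
    holds because [orbpt] is surjective. *)
Lemma coordring_plane_iso :
  exists f : {rmorphism coordring (orbit_variety C G) -> coordring (plane_mod_sign C)},
    bijective f /\ forall c, f (cst_coord _ c) = cst_coord _ c.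
Proof.
exists (pullback plane_to_orbit_regular); split; last by move=> c; exact: val_inj.
have inj : injective (pullback plane_to_orbit_regular).
  move=> f g e; apply: (coordring_orbit_inj hG) => p.
  rewrite -(plane_to_orbit_pi f) -(plane_to_orbit_pi g).
  have E : val (pullback plane_to_orbit_regular f) (\pi_plane p) =
           val (pullback plane_to_orbit_regular g) (\pi_plane p) by rewrite e.
  exact: E.
have surj (g : coordring (plane_mod_sign C)) : exists f, pullback plane_to_orbit_regular f = g.
  have pN z : \pi_plane (- z) = \pi_plane z :> plane.
    by apply/eqmodP; rewrite /= /sign_equiv opprK eqxx orbT.
  have hg := coordringP g.
  have [|f hf] := orbit_even_regular hG (even_poly_fun hg _).
    by move=> z /=; rewrite pN.
  exists f; apply: val_inj; apply/funext => q.
  rewrite -[q](reprK (q : plane)) -[LHS]/(val f (plane_to_orbit _)) plane_to_orbit_pi hf.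
  by [].
have /choice[h hh] := surj; exists h => // f.
by apply: inj; rewrite hh.
Qed.
End PlaneModSign.

(** * The inertial group *)

Section InertialGroup.
Variables (C : numClosedFieldType) (F : fieldType) (v : F -> int) (chi : F -> C).
Hypotheses (chi_smooth : smooth_char v chi) (chi_quadratic : quadratic_char v chi).
Hypothesis chi_ramified : ~ unramified v chi.

(** An element with matrix m sends chi (x) chi to the powers of chi given by the row sums of m; for
    a quadratic chi only their parities matter. The twelve matrices are checked by computation. *)
Lemma klein_row w : (w \in klein) =
  odd `|((val w).1.1 + (val w).1.2)%R|%N && odd `|((val w).2.1 + (val w).2.2)%R|%N.
Proof.
have /allP h : all (fun m => [|| m == val (1%g : weylG2), m == val weyl_a, m == val weyl_r3 |
    m == val (weyl_a * weyl_r3)%g] == odd `|(m.1.1 + m.1.2)%R|%N && odd `|(m.2.1 + m.2.2)%R|%N)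
  weyl_mats by vm_compute.
have /eqP <- := h _ (valP w).
by rewrite !inE -!orbA !val_eqE.
Qed.

Lemma quadratic_expz x (n : int) : x != 0 -> chi x ^ n = if odd `|n|%N then chi x else 1.
Proof.
move=> x0; have [_ h2 _] := chi_quadratic; have e := h2 x x0.
have n0 : chi x != 0 by case: chi_smooth => h _ _; exact: h.
have en (m : nat) : chi x ^+ m = if odd m then chi x else 1.
  by rewrite -[in LHS](odd_double_half m) exprD -muln2 mulnC exprM e expr1n mulr1; case: odd.
case: n => n; first by rewrite -exprnP en.
rewrite NegzE abszN absz_nat -exprnN -exprVn.
have -> : (chi x)^-1 = chi x by apply: (mulfI n0); rewrite mulfV // -expr2 e.
exact: en.
Qed.

Lemma unramified1 : unramified v (fun _ : F => 1 : C).
Proof.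
split=> //; split; first by move=> x _; rewrite oner_eq0.
  by move=> x y _ _; rewrite mulr1.
by exists 0%N.
Qed.

(** For even n the left side is 1, so chi would be trivial wherever the unramified t is. *)
Lemma unramified_odd (t : F -> C) (n : int) : unramified v t ->
  (forall x, x != 0 -> chi x ^ n = chi x * t x) -> odd `|n|%N.
Proof.
move=> [_ ht] h; apply: contrapT => on; apply: chi_ramified; split=> // x x0 vx.
by have := h x x0; rewrite ht // mulr1 quadratic_expz // (negPf (introN idP on)).
Qed.

Lemma inertial_group_klein : inertial_group chi_smooth = klein :> {set weylG2}.
Proof.
apply/setP => w; rewrite finset.in_set klein_row; apply/asboolP/idP.
  move=> [t1 [t2 [u1 u2 e]]]; have n0 x : x != 0 -> chi x != 0.
    by case: chi_smooth => h _ _; exact: h.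
  apply/andP; split; [apply: (unramified_odd u1)|apply: (unramified_odd u2)] => x x0;
    by rewrite expfzDr ?n0 //; have [] := e x x0.
move=> /andP[o1 o2]; exists (fun=> 1), (fun=> 1); split; try exact: unramified1.
move=> x x0; have n0 : chi x != 0 by case: chi_smooth => h _ _; exact: h.
by rewrite /char_act /mat2_act /= -!expfzDr // !quadratic_expz // o1 o2 !mulr1.
Qed.
End InertialGroup.

(** Elementary abelian 2-groups are classified by their order. *)
Lemma klein_isog (G : {group weylG2}) : G = klein :> {set weylG2} ->
  (G \isog [set: 'Z_2 * 'Z_2]%SET)%g.
Proof.
move=> hG.
have sq w : w \in klein -> (w * w)%g = 1%g by move=> /kleinP[]->; apply: val_inj; vm_compute.
have aG : (2.-abelem G)%g.
  apply/abelemP => //; split; last by move=> w; rewrite hG expgS expg1; exact: sq.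
  by apply/centsP => x hx y hy; apply: klein_commute; rewrite -hG.
rewrite (isog_abelem_card _ aG); apply/andP; split.
  apply/abelemP => //; split.
    by apply/centsP => -[x1 x2] _ [y1 y2] _; congr (_, _); exact: addrC.
  by move=> [x y] _; congr (_, _); apply/eqP; move: x y; vm_compute; case=> [[|[|n]] hn] //; case=> [[|[|m]] hm].
rewrite hG cardsT card_prod !card_ord /klein -!finset.setUA !cardsU1 cards1 !inE.
by vm_compute.
Qed.

(** * Algebras over the extended quotient *)

(* The classes of (e, t), pt_*, the classes on the two lines, pt_1 and pt_2. *)
Inductive expt (C : Type) :=
| Plane of C * C
| Star
| Line of bool & C
| Point of bool.
Arguments Star {C}.
Arguments Point {C}.

(** Representations have the same size along the plane and along the lines, so their index type
    depends only on the kind. *)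
Definition kind (C : Type) (s : expt C) : nat :=
  match s with Plane _ => 0%N | Star => 1%N | Line _ _ => 2%N | Point _ => 3%N end.

(** The place in the filtration, whose ideals consist of the elements vanishing from a given level
    on. The plane and pt_* come first, so that vanishing from level 2 on cuts out the lowest
    cell. *)
Definition level (C : Type) (s : expt C) : nat :=
  match s with
  | Plane _ => 0%N
  | Star => 1%N
  | Line b _ => if b then 2%N else 3%N
  | Point b => if b then 4%N else 5%N
  end.

(* The image in T/W, in the coordinates (s + 1/s, u + 1/u) for (z1, z2) = (s u, s / u). *)
Definition base (C : numClosedFieldType) (s : expt C) : C * C :=
  match s with
  | Plane p => p
  | Star => 0
  | Line b x => if b then (x, -2) else (-2, x)
  | Point b => (2, (-1) ^+ b * 2)
  end.

Section Layered.
Variables (C : numClosedFieldType) (G : {group weylG2}).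
Hypothesis hG : G = klein :> {set weylG2}.
Local Notation k := (coordring (orbit_variety C G)).
Local Notation iota := (cst_morph (orbit_variety C G)).

Definition value (c : k) (s : expt C) : C := val c (orbpt G (base s)).

Lemma value_iota c s : value (iota c) s = c.
Proof. by []. Qed.

Lemma even_value f : even_fun f -> exists c : k, forall s, value c s = f (base s).
Proof. by move=> /(orbit_even_regular hG)[c hc]; exists c => s; exact: hc. Qed.

Lemma quad_value : exists zq : option bool -> k,
  (forall u s, value (zq u) s = quad u (base s)) /\
  zq (Some true) * zq (Some false) = zq None * zq None.
Proof.
have /choice[zq hq] u : exists c : k, forall p, val c (orbpt G p) = quad u p.
  exact/(orbit_even_regular hG)/even_quad.
exists zq; split=> [u s|]; first exact: hq.
apply: (coordring_orbit_inj hG) => p.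
have e u u' : val (zq u * zq u') (orbpt G p) = quad u p * quad u' p by rewrite -!hq.
by rewrite !e /=; ring.
Qed.

(** The other coordinate being -2, the even function -XY/2 restricts to the coordinate of the line;
    hence k maps onto all polynomials. *)
Lemma line_value b (P : {poly C}) : exists c : k, forall x, value c (Line b x) = P.[x].
Proof.
suff : exists f, even_fun f /\ forall x, f (base (Line b x)) = P.[x].
  by move=> [f [/even_value[c hc] hf]]; exists c => x; rewrite hc hf.
elim/poly_ind: P => [|P c [f [hf ef]]].
  by exists (fun=> 0); split; [exact: even_cst | move=> x; rewrite horner0].
exists (fun p => f p * (- 2^-1 * quad None p) + c); split; first by apply: evenD;
  [apply: evenM => //; apply: evenM; [exact: even_cst | exact: even_quad] | exact: even_cst].
move=> x; rewrite ef hornerMXaddC; congr (_ * _ + _).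
by case: b {ef} => /=; field.
Qed.

Section Structure.
Variables (r : nat) (A : kalg k) (T : nat -> finType).
Variables (rho : forall s : expt C, A -> T (kind s) -> T (kind s) -> C) (d : T 0%N -> bool).
Arguments rho : clear implicits.

Record graded_rep : Prop := GradedRep {
  gr_add : forall s x y i j, rho s (x + y) i j = rho s x i j + rho s y i j;
  gr_scale : forall s c x i j, rho s (c *: x) i j = value c s * rho s x i j;
  gr_mul : forall s x y i j, rho s (x ** y) i j = \sum_m rho s x i m * rho s y m j }.

Definition above (l : nat) : set A :=
  [set x | forall s, (l <= level s)%N -> forall i j, rho s x i j = 0].

(** The common shape of J, of O(T^vee // W^s) and of the algebra between them. The number r of
    layers is 6 for these, and 2 for the ideals of the lowest cell. Over the plane only matrices
    vanishing at the origin are prescribed; [ly_zero] describes the image at the origin, a proper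
    subalgebra in general. *)
Record layered : Prop := Layered {
  ly_graded : graded_rep;
  ly_index : forall l, inhabited (T l);
  ly_inj : forall x, (forall s i j, rho s x i j = 0) -> x = 0;
  ly_top : forall x, above r x;
  ly_par : forall x (i j : T 0%N), par (d i (+) d j) (fun p => rho (Plane p) x i j);
  ly_poly : forall x b (i j : T 2%N), exists P : {poly C}, forall c, rho (Line b c) x i j = P.[c];
  ly_plane : forall M : T 0%N -> T 0%N -> C * C -> C,
    (forall i j, par (d i (+) d j) (M i j)) -> (forall i j, M i j 0 = 0) ->
    exists x, above 1 x /\ forall p i j, rho (Plane p) x i j = M i j p;
  ly_zero : exists (T0 : finType) (rho0 : A -> T0 -> T0 -> C),
    [/\ mx_morph iota rho0, inhabited T0,
        forall M, exists x, above 1 x /\ forall i j, rho0 x i j = M i j &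
        forall x, above 1 x ->
          (forall i j, rho0 x i j = 0) <-> (forall i j, rho (Plane 0) x i j = 0)];
  ly_star : (1 < r)%N -> forall M : T 1%N -> T 1%N -> C,
    exists x, above 2 x /\ forall i j, rho Star x i j = M i j;
  ly_line : forall b, ((if b then 2 else 3) < r)%N -> forall P : T 2%N -> T 2%N -> {poly C},
    exists x, above (if b then 3%N else 4%N) x /\ forall c i j, rho (Line b c) x i j = (P i j).[c];
  ly_point : forall b, ((if b then 4 else 5) < r)%N -> forall M : T 3%N -> T 3%N -> C,
    exists x, above (if b then 5%N else 6%N) x /\ forall i j, rho (Point b) x i j = M i j }.

Section Ideals.
Hypothesis gr : graded_rep.

Lemma gr0 s i j : rho s 0 i j = 0.
Proof. by apply: (addrI (rho s 0 i j)); rewrite -(gr_add gr) !addr0. Qed.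

Lemma gr_sum s (I : Type) (t : seq I) P (F : I -> A) i j :
  rho s (\sum_(u <- t | P u) F u) i j = \sum_(u <- t | P u) rho s (F u) i j.
Proof.
apply: (big_morph (fun x => rho s x i j)); last exact: gr0.
by move=> x y; exact: gr_add.
Qed.

Lemma gr_morph s : mx_morph iota (rho s).
Proof.
split; [by move=> *; rewrite (gr_add gr) | | by move=> *; rewrite (gr_mul gr)].
by move=> c x i j; rewrite (gr_scale gr).
Qed.

Definition above_ideal (l : nat) : ideal A.
Proof.
apply: (@Ideal k A (above l)).
- by move=> s _ i j; exact: gr0.
- by move=> x y hx hy s hs i j; rewrite (gr_add gr) hx ?hy ?addr0.
- by move=> c x hx s hs i j; rewrite (gr_scale gr) hx ?mulr0.
- by move=> x y hy s hs i j; rewrite (gr_mul gr) big1 // => m _; rewrite hy ?mulr0.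
- by move=> x y hx s hs i j; rewrite (gr_mul gr) big1 // => m _; rewrite hx ?mul0r.
Defined.

Lemma aboveW l m x : (l <= m)%N -> above l x -> above m x.
Proof. by move=> lm h s hs; apply: h; exact: leq_trans lm hs. Qed.
End Ideals.

Hypothesis hA : layered.
Let gr := ly_graded hA.

Lemma above0 x : above 0 x -> x = 0.
Proof. by move=> h; apply: (ly_inj hA) => s i j; exact: h. Qed.

Lemma layered_filtration : filtration r (fun j => above_ideal gr j).
Proof.
split=> [||j x _]; last exact: aboveW.
  apply/seteqP; split=> x /=; first exact: above0.
  by move=> ->; exact: ideal0 (above_ideal gr 0).
by apply/seteqP; split=> x // _; exact: ly_top hA x.
Qed.

(** The quadratic factor in [plane_surj] makes the matrices vanish at the origin, as [ly_plane]
    demands. *)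
Lemma layered_plane_rep : exists zq,
  plane_rep iota (above_ideal gr 1) (above_ideal gr 0) d (fun x p => rho (Plane p) x) zq.
Proof.
have [zq [hq qq]] := quad_value; exists zq; split=> //.
- by move=> p; exact: (gr_morph gr (Plane p)).
- exact: ly_index hA 0%N.
- by move=> u x p i j; rewrite (gr_scale gr) hq.
- by move=> x _ i j; exact: ly_par hA x i j.
- move=> M hM u; apply: (ly_plane hA (M := fun i j p => quad u p * M i j p)) => i j.
    exact: par_quadM.
  by case: u => [[]|]; rewrite /= !mul0r.
- move=> x hx h0 [p||b c|b] _ i j; first exact: h0.
  + exact: hx.
  + by apply: hx; case: (b).
  + by apply: hx; case: (b).
- by move=> x /= /above0 -> p i j; exact: gr0.
- have [T0 [rho0 [h1 h2 h3 h4]]] := ly_zero hA; exists T0, rho0; split=> //.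
  split=> // x /above0 -> i j; have [hD _ _] := h1.
  by apply: (addrI (rho0 0 i j)); rewrite -hD !addr0.
Qed.

Lemma layered_line_rep b : ((if b then 2 else 3) < r)%N -> exists z,
  @line_rep _ _ iota A (above_ideal gr (if b then 3%N else 4%N)) (above_ideal gr (if b then 2%N else 3%N))
    (T 2%N) (fun x c => rho (Line b c) x) z.
Proof.
move=> hr; have [z hz] := line_value b 'X; exists z; split.
- by move=> c; exact: (gr_morph gr (Line b c)).
- exact: ly_index hA 2%N.
- by move=> x c i j; rewrite (gr_scale gr) hz hornerX.
- by move=> x _ i j; exact: ly_poly hA x b i j.
- by move=> P; exact: ly_line hA b hr P.
- move=> x hx h0 [p||b' c|b'] /= hs i j.
  + by case: (b) hs.
  + by case: (b) hs.
  + have [e|bb'] := eqVneq b b'; first by subst b'; exact: h0.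
    by apply: hx => /=; move: hs bb'; case: (b); case: (b').
  + by apply: hx => /=; move: hs; case: (b); case: (b').
- by move=> x hx c i j; apply: hx; case: (b).
Qed.

Lemma layered_point_rep b : ((if b then 4 else 5) < r)%N ->
  @full_rep _ _ iota A (above_ideal gr (if b then 5%N else 6%N)) (above_ideal gr (if b then 4%N else 5%N))
    (T 3%N) (rho (Point b)).
Proof.
move=> hr; split; [exact: (gr_morph gr (Point b)) | exact: ly_index hA 3%N | | exact: ly_point hA b hr].
by move=> x hx i j; apply: hx; case: (b).
Qed.

Lemma layered_star_rep : (1 < r)%N ->
  @full_rep _ _ iota A (above_ideal gr 2) (above_ideal gr 1) (T 1%N) (rho Star).
Proof.
move=> hr; split; [exact: (gr_morph gr Star) | exact: ly_index hA 1%N | | exact: ly_star hA hr].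
by move=> x hx i j; apply: hx.
Qed.

Lemma layered_point_bot b x : above (if b then 5%N else 6%N) x ->
  (forall i j, rho (Point b) x i j = 0) -> above (if b then 4%N else 5%N) x.
Proof.
move=> hx h0 [p||b' c|b'] /= hs i j; try by move: hs; case: (b) => //; case: (b').
have [e|bb'] := eqVneq b b'; first by subst b'; exact: h0.
by apply: hx => /=; move: hs bb'; case: (b); case: (b').
Qed.

Lemma layered_star_bot x : above 2 x -> (forall i j, rho Star x i j = 0) -> above 1 x.
Proof.
move=> hx h0 [p||b' c|b'] hs i j.
- by [].
- exact: h0.
- by apply: hx => /=; case: (b').
- by apply: hx => /=; case: (b').
Qed.

(** By parity the matrices at p and -p are conjugate under the diagonal signs (-1)^(d i). *)
Lemma layered_plane_opp (p : C * C) :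
  zero_locus (above_ideal gr 1) (fun x : A => rho (Plane p) x) =
  zero_locus (above_ideal gr 1) (fun x : A => rho (Plane (- p)) x).
Proof.
have e x i j : rho (Plane (- p)) x i j = (-1) ^+ (d i (+) d j) * rho (Plane p) x i j.
  exact: (par_opp p (ly_par hA x i j)).
apply/seteqP; split=> x [h1 h2]; split=> // i j; have := h2 i j; rewrite e.
  by move=> ->; rewrite mulr0.
by move/eqP; rewrite mulf_eq0 signr_eq0 => /eqP.
Qed.
End Structure.

Section Comparison.
Hypothesis C_uncountable : ~ countable [set: C].
Variables (r : nat) (A B : kalg k) (TA TB : nat -> finType).
Variables (rA : forall s : expt C, A -> TA (kind s) -> TA (kind s) -> C) (dA : TA 0%N -> bool).
Variables (rB : forall s : expt C, B -> TB (kind s) -> TB (kind s) -> C) (dB : TB 0%N -> bool).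
Arguments rA : clear implicits.
Arguments rB : clear implicits.
Hypotheses (hA : layered r rA dA) (hB : layered r rB dB).
Hypotheses (cA : countably_spanned iota A) (cB : countably_spanned iota B).
Variable f : A -> B.
Hypotheses (hf : kalg_morph f).
Hypothesis same_zeros : forall s x,
  (forall i j, rA s x i j = 0) <-> (forall i j, rB s (f x) i j = 0).
Hypothesis r6 : (r <= 6)%N.

Let gA := ly_graded hA.
Let gB := ly_graded hB.

Lemma above_morph l x : above rA l x <-> above rB l (f x).
Proof.
split=> h s hs.
  by apply/(same_zeros s x) => i j; exact: h.
by apply/(same_zeros s x) => i j; exact: h.
Qed.

Lemma zero_locus_morph l s x : above rA l x ->
  zero_locus (above_ideal gB l) (rB s) (f x) <-> zero_locus (above_ideal gA l) (rA s) x.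
Proof.
move=> hx; split=> -[h1 h2]; split=> //; try exact/same_zeros.
exact/above_morph.
Qed.

(** By [same_zeros] the inverse images of the ideals and of the zero loci in [B] are those in [A]
    with the same index, so the bijection of primitive ideals is the identity on parameters, up to
    sign on the plane. *)
Lemma layered_spectrum : filtered_spectrum_preserving iota f.
Proof.
split=> //; exists r, (fun j => above_ideal gA j), (fun j => above_ideal gB j).
split; [exact: layered_filtration | exact: layered_filtration | |].
  by move=> j x _ hx; exact/above_morph.
move=> j hj.
have line b : ((if b then 2 else 3) < r)%N -> spectrum_preserving iota f
    (above_ideal gA (if b then 3%N else 4%N)) (above_ideal gA (if b then 2%N else 3%N))
    (above_ideal gB (if b then 3%N else 4%N)) (above_ideal gB (if b then 2%N else 3%N)).
  move=> hr; have [zA lA] := layered_line_rep hA hr; have [zB lB] := layered_line_rep hB hr.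
  apply: spectrum_preservingP.
  - exact: line_primitive C_uncountable _ _ _ _ _ _ cA lA.
  - exact: line_primitive C_uncountable _ _ _ _ _ _ cB lB.
  - by move=> c x hx /(zero_locus_morph (Line b c) hx).
  - move=> c c' h; suff -> : c = c' by [].
    apply: (line_separated lA) => x [hx h0]; apply: h => //.
    by apply/(zero_locus_morph (Line b c) hx).
have point b : ((if b then 4 else 5) < r)%N -> spectrum_preserving iota f
    (above_ideal gA (if b then 5%N else 6%N)) (above_ideal gA (if b then 4%N else 5%N))
    (above_ideal gB (if b then 5%N else 6%N)) (above_ideal gB (if b then 4%N else 5%N)).
  move=> hr; have lA := layered_point_rep hA hr; have lB := layered_point_rep hB hr.
  apply: (@spectrum_preservingP _ _ _ _ _ f _ _ _ _ unit
    (fun=> zero_locus (above_ideal gA (if b then 5%N else 6%N)) (rA (Point b)))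
    (fun=> zero_locus (above_ideal gB (if b then 5%N else 6%N)) (rB (Point b)))) => //.
  - move=> Q; have -> := primitive_class1 lA (layered_point_bot (rho:=rA) (b:=b)) Q.
    by split=> [->|[_ ->]] //; exists tt.
  - move=> Q; have -> := primitive_class1 lB (layered_point_bot (rho:=rB) (b:=b)) Q.
    by split=> [->|[_ ->]] //; exists tt.
  - by move=> _ x hx /(zero_locus_morph (Point b) hx).
case: j hj => [hj|[hj|[hj|[hj|[hj|[hj|j hj]]]]]].
- have [zA lA] := layered_plane_rep hA; have [zB lB] := layered_plane_rep hB.
  apply: spectrum_preservingP.
  - exact: (plane_primitive C_uncountable lA cA).
  - exact: (plane_primitive C_uncountable lB cB).
  - by move=> c x hx /(zero_locus_morph (Plane c) hx).
  - move=> p q h; have [->|->] : q = p \/ q = - p.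
    + apply: (plane_separated lA) => x [hx h0]; apply: h => //.
      by apply/(zero_locus_morph (Plane p) hx).
    + by [].
    by split; exact: layered_plane_opp.
- have lA := layered_star_rep hA hj; have lB := layered_star_rep hB hj.
  apply: (@spectrum_preservingP _ _ _ _ _ f _ _ _ _ unit
    (fun=> zero_locus (above_ideal gA 2) (rA Star))
    (fun=> zero_locus (above_ideal gB 2) (rB Star))) => //.
  - move=> Q; have -> := primitive_class1 lA (layered_star_bot (rho:=rA)) Q.
    by split=> [->|[_ ->]] //; exists tt.
  - move=> Q; have -> := primitive_class1 lB (layered_star_bot (rho:=rB)) Q.
    by split=> [->|[_ ->]] //; exists tt.
  - by move=> _ x hx /(zero_locus_morph Star hx).
- exact: (line true).
- exact: (line false).
- exact: (point true).
- exact: (point false).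
- by have := leq_trans hj r6; rewrite ltnNge.
Qed.
End Comparison.
End Layered.

(** * Finite generation over k and countable dimension over C *)

Section FiniteFamilies.
Variables (C : numClosedFieldType) (G : {group weylG2}).
Hypothesis hG : G = klein :> {set weylG2}.
Local Notation k := (coordring (orbit_variety C G)).
Local Notation iota := (cst_morph (orbit_variety C G)).

Lemma finite_type_family (A : kalg k) (I : finType) (g : I -> A) :
  (forall x, exists c : I -> k, x = \sum_i c i *: g i) -> finite_type A.
Proof.
move=> h; exists (undup [seq g i | i : I]) => x; have [c ->] := h x.
(* Coefficients are attached to elements and not to indices, so those of coinciding generators are
   added. *)
exists (fun y => \sum_(i | g i == y) c i).
under [RHS]eq_bigr do rewrite scaler_suml big_mkcond.
rewrite exchange_big /=; apply: eq_bigr => i _.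
rewrite (bigD1_seq (g i)) /= ?eqxx; last exact: undup_uniq; last first.
  by rewrite mem_undup; apply: map_f; rewrite mem_enum.
by rewrite big1 ?addr0 // => y; rewrite eq_sym => /negPf ->.
Qed.

Lemma countably_spanned_family (A : kalg k) (T : countType) (b : T -> A) :
  (forall x, exists s : seq (C * T), x = \sum_(y <- s) iota y.1 *: b y.2) ->
  countably_spanned iota A.
Proof.
move=> h; exists (fun n => if unpickle n is Some u then b u else 0) => x.
have [s ->] := h x; exists (\max_(y <- s) (pickle y.2).+1)%N.
exists (fun n => \sum_(y <- s | pickle y.2 == n) y.1).
transitivity (\sum_(y <- s) \sum_(i < (\max_(y <- s) (pickle y.2).+1)%N)
   (if pickle y.2 == i then iota y.1 *: b y.2 else 0)).
  rewrite big_seq [RHS]big_seq; apply: eq_bigr => y hy.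
  have hlt : (pickle y.2 < \max_(y <- s) (pickle y.2).+1)%N.
    by rewrite (big_rem y) //= leq_maxl.
  rewrite (bigD1 (Ordinal hlt)) //= eqxx big1 ?addr0 // => i /negPf hi.
  by rewrite ifN // eq_sym; apply/negbT.
rewrite exchange_big /=; apply: eq_bigr => i _.
rewrite rmorph_sum scaler_suml [RHS]big_mkcond.
by apply: eq_bigr => y _; case: eqVneq => // <-; rewrite pickleK.
Qed.

Lemma coordring_spanned : exists b : nat * nat * nat -> k, forall c : k,
  exists s : seq (C * (nat * nat * nat)), c = \sum_(y <- s) iota y.1 * b y.2.
Proof.
have [zq [hq _]] := @quad_value C G hG.
pose b (m : nat * nat * nat) : k :=
  zq (Some true) ^+ m.1.1 * zq (Some false) ^+ m.1.2 * zq None ^+ m.2.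
exists b; apply: (coordring_orbit_ind hG) => [c|u f hf|f g [s ->] [t ->]|f g [s ->] [t ->]].
- by exists [:: (c, (0, 0, 0))%N]; rewrite big_seq1 /b /= !expr0 !mulr1.
- have -> : f = zq u by apply: (coordring_orbit_inj hG) => p; rewrite hf; exact/esym/(hq u (Plane p)).
  exists [:: (1, if u is Some v then if v then (1, 0, 0)%N else (0, 1, 0)%N else (0, 0, 1)%N)].
  by rewrite big_seq1 /b rmorph1 mul1r; case: u {hf} => [[]|] /=;
    rewrite !expr0 expr1 ?mulr1 ?mul1r.
- by exists (s ++ t); rewrite big_cat.
- exists [seq (x.1 * y.1, (x.2.1.1 + y.2.1.1, x.2.1.2 + y.2.1.2, x.2.2 + y.2.2)%N) | x <- s, y <- t].
  rewrite big_distrlr /= big_allpairs_dep /=.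
  apply: eq_bigr => x _; apply: eq_bigr => y _; rewrite rmorphM mulrACA; congr (_ * _).
  by rewrite /b /= !exprD; ring.
Qed.

Lemma finite_type_countable (A : kalg k) : finite_type A -> countably_spanned iota A.
Proof.
move=> [s hs]; have [b hb] := coordring_spanned.
have /choice[e he] := hb.
apply: (@countably_spanned_family _ (nat * nat * nat * nat)%type
  (fun y => b y.1 *: nth 0 s y.2)) => x.
have [c ->] := hs x.
exists [seq (u.1, (u.2, index y s)) | y <- s, u <- e (c y)].
rewrite big_allpairs_dep /= [LHS]big_seq [RHS]big_seq; apply: eq_bigr => y hy.
rewrite {1}[c y]he scaler_suml; apply: eq_bigr => u _ /=.
by rewrite nth_index // scalerA.
Qed.

(** Generators, over the even functions, of the functions of parity b vanishing at the origin: X and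
    Y, or the quadratic monomials. The remaining labels give 0, so that one label type serves both
    parities. *)
Definition par_gen (b : bool) (v : bool + option bool) : C * C -> C :=
  match v with
  | inl s => if b then coordinate s else fun=> 0
  | inr u => if b then fun=> 0 else quad u
  end.

Lemma par_gen_par b v : par b (par_gen b v).
Proof.
case: v => [s|u]; case: b => /=; try exact: par0; first exact: par_coordinate.
exact: even_quad.
Qed.

Lemma par_gen0 b v : par_gen b v 0 = 0.
Proof. by case: v => [[]|[[]|]]; case: b => //=; rewrite mulr0. Qed.

Lemma par_gen_expand b f : par b f -> f 0 = 0 -> exists F : bool + option bool -> C * C -> C,
  (forall v, even_fun (F v)) /\ forall z, f z = \sum_v F v z * par_gen b v z.
Proof.
case: b => hf f0.
  have [g [h [hg hh e]]] := hf.
  exists (fun v => if v is inl s then (if s then g else h) else fun=> 0).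
  split=> [[[]|u]|z] //; first exact: even_cst.
  rewrite big_sumType /= big_bool /= [X in _ + X]big1 ?addr0 => [|u _]; last by rewrite mul0r.
  by rewrite e mulrC [_ * h z]mulrC.
have [F [hF e]] := even_vanish0 hf f0.
exists (fun v => if v is inr u then F u else fun=> 0); split=> [[s|u]|z] //; first exact: even_cst.
rewrite big_sumType /= [X in X + _]big1 ?add0r => [|s _]; last by rewrite mul0r.
by rewrite e; apply: eq_bigr => u _; rewrite mulrC.
Qed.

Section Layered.
Variables (r : nat) (A : kalg k) (T : nat -> finType).
Variables (rho : forall s : expt C, A -> T (kind s) -> T (kind s) -> C) (d : T 0%N -> bool).
Arguments rho : clear implicits.
Hypothesis hA : layered r rho d.
Hypothesis r6 : (r <= 6)%N.
Let gr := ly_graded hA.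
Local Notation above := (above rho).

Lemma gr_sub s x y i j : rho s (x - y) i j = rho s x i j - rho s y i j.
Proof.
rewrite (gr_add gr); congr (_ + _); apply/eqP; rewrite -addr_eq0 -(gr_add gr) addNr.
by rewrite (gr0 gr).
Qed.

Lemma layer_generators l (I : finType) (g : I -> A) :
  (forall i, above l.+1 (g i)) -> (forall x, above l.+1 x -> exists c : I -> k,
    forall s, level s = l -> forall i j, rho s x i j = \sum_u value (c u) s * rho s (g u) i j) ->
  forall x, above l.+1 x -> exists c : I -> k, above l (x - \sum_u c u *: g u).
Proof.
move=> hg h x hx; have [c hc] := h x hx; exists c => s hs i j.
rewrite gr_sub (gr_sum gr); under eq_bigr do rewrite (gr_scale gr).
move: hs; rewrite leq_eqVlt => /orP[/eqP hs|hs]; first by rewrite -hc ?subrr.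
by rewrite hx // big1 ?subr0 // => u _; rewrite (hg u s hs) mulr0.
Qed.

Lemma star_generators : (1 < r)%N -> exists (I : finType) (g : I -> A),
  forall x, above 2 x -> exists c : I -> k, above 1 (x - \sum_u c u *: g u).
Proof.
move=> hr.
have /choice[g hg] (ij : T 1%N * T 1%N) : exists x, above 2 x /\
    forall m n, rho Star x m n = ((m, n) == ij)%:R.
  exact: ly_star hA hr (fun m n => ((m, n) == ij)%:R).
exists (T 1%N * T 1%N)%type, g; apply: layer_generators => [ij|x hx]; first by case: (hg ij).
exists (fun ij => iota (rho Star x ij.1 ij.2)) => -[p||b c|b] // hl; try by case: b hl.
move=> i j; rewrite (bigD1 (i, j)) //= big1 => [|u /negPf hu]; last first.
  by rewrite (proj2 (hg u)) eq_sym hu mulr0.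
by rewrite (proj2 (hg _)) eqxx mulr1 addr0.
Qed.

Lemma line_generators b : ((if b then 2 else 3) < r)%N -> exists (I : finType) (g : I -> A),
  forall x, above (if b then 2%N else 3%N).+1 x ->
  exists c : I -> k, above (if b then 2%N else 3%N) (x - \sum_u c u *: g u).
Proof.
move=> hr.
have /choice[g hg] (ij : T 2%N * T 2%N) : exists x, above (if b then 2%N else 3%N).+1 x /\
    forall c m n, rho (Line b c) x m n = ((m, n) == ij)%:R.
  have := ly_line hA hr (fun m n => (((m, n) == ij)%:R)%:P).
  move=> [x [hx ex]]; exists x; split; first by case: (b) hx.
  by move=> c m n; rewrite ex hornerC.
exists (T 2%N * T 2%N)%type, g; apply: layer_generators => [ij|x hx]; first by case: (hg ij).
have /choice[c hc] (ij : T 2%N * T 2%N) : exists c : k, forall z,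
    value c (Line b z) = rho (Line b z) x ij.1 ij.2.
  have [P hP] := ly_poly hA x b ij.1 ij.2; have [c hc] := line_value hG b P.
  by exists c => z; rewrite hc hP.
exists c => -[p||b' z|b'] hl; try by (case: (b) hl).
  2: by case: (b) hl; case: (b').
have e : b' = b by case: (b) hl; case: (b').
subst b' => i j; rewrite (bigD1 (i, j)) //= big1 => [|u /negPf hu]; last first.
  by rewrite (proj2 (hg u)) eq_sym hu mulr0.
by rewrite (proj2 (hg _)) eqxx mulr1 addr0 hc.
Qed.

Lemma point_generators b : ((if b then 4 else 5) < r)%N -> exists (I : finType) (g : I -> A),
  forall x, above (if b then 4%N else 5%N).+1 x ->
  exists c : I -> k, above (if b then 4%N else 5%N) (x - \sum_u c u *: g u).
Proof.
move=> hr.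
have /choice[g hg] (ij : T 3%N * T 3%N) : exists x, above (if b then 4%N else 5%N).+1 x /\
    forall m n, rho (Point b) x m n = ((m, n) == ij)%:R.
  have := ly_point hA hr (fun m n => ((m, n) == ij)%:R).
  by move=> [x [hx ex]]; exists x; split; first by case: (b) hx.
exists (T 3%N * T 3%N)%type, g; apply: layer_generators => [ij|x hx]; first by case: (hg ij).
exists (fun ij => iota (rho (Point b) x ij.1 ij.2)) => -[p||b' z|b'] hl; try by (case: (b) hl).
  by case: (b) hl; case: (b').
have e : b' = b by case: (b) hl; case: (b').
subst b' => i j; rewrite (bigD1 (i, j)) //= big1 => [|u /negPf hu]; last first.
  by rewrite (proj2 (hg u)) eq_sym hu mulr0.
by rewrite (proj2 (hg _)) eqxx mulr1 addr0.
Qed.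

(** Constant multiples of the lifted matrix units of [rho0] first correct the value at the origin;
    the entries of the remainder then vanish there and are expanded in [par_gen]. *)
Lemma plane_generators : exists (I : finType) (g : I -> A),
  forall x, above 1 x -> exists c : I -> k, above 0 (x - \sum_u c u *: g u).
Proof.
have [T0 [rho0 [hr0 _ surj0 ker0]]] := ly_zero hA.
have [r0D r0Z _] := hr0.
have /choice[g0 hg0] (ij : T0 * T0) : exists x, above 1 x /\
    forall m n, rho0 x m n = ((m, n) == ij)%:R.
  exact: surj0 (fun m n => ((m, n) == ij)%:R).
pose S := (T 0%N * T 0%N * (bool + option bool))%type.
have /choice[g1 hg1] (u : S) : exists x, above 1 x /\ forall p m n,
    rho (Plane p) x m n = if (m, n) == u.1 then par_gen (d m (+) d n) u.2 p else 0.
  apply: (ly_plane hA (M := fun m n p => if (m, n) == u.1 then par_gen (d m (+) d n) u.2 p else 0)).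
    by move=> m n; case: eqP => _; [exact: par_gen_par | exact: par0].
  by move=> m n; case: eqP => _ //; exact: par_gen0.
exists ((T0 * T0) + S)%type, (fun v => match v with inl u => g0 u | inr u => g1 u end).
move=> x hx; pose y := x - \sum_u iota (rho0 x u.1 u.2) *: g0 u.
have hy : above 1 y.
  move=> s hs i j; rewrite gr_sub hx // (gr_sum gr) big1 ?subr0 // => u _.
  by rewrite (gr_scale gr) (proj1 (hg0 u) s hs) mulr0.
have y0 i j : rho (Plane 0) y i j = 0.
  have r0N u m n : rho0 (- u) m n = - rho0 u m n.
    by apply/eqP; rewrite -addr_eq0 -r0D addNr -(scaler0 _ (iota 0)) r0Z mul0r.
  move: i j; apply/(ker0 y hy) => m n.
  rewrite r0D r0N (mx_morph_sum _ _ _ _ hr0) (bigD1 (m, n)) //= r0Z (proj2 (hg0 _)) eqxx mulr1.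
  rewrite big1 ?addr0 ?subrr // => u /negPf hu.
  by rewrite r0Z (proj2 (hg0 _)) eq_sym hu mulr0.
have /choice[F hF] (ij : T 0%N * T 0%N) := par_gen_expand (ly_par hA y ij.1 ij.2) (y0 ij.1 ij.2).
have /choice[c hc] (u : S) : exists c : k, forall s, value c s = F u.1 u.2 (base s).
  exact: (even_value hG (proj1 (hF u.1) u.2)).
exists (fun v => match v with inl u => iota (rho0 x u.1 u.2) | inr u => c u end).
rewrite big_sumType /= opprD addrA -/y => s _ i j.
rewrite gr_sub (gr_sum gr); have [hs|hs] := leqP 1 (level s).
  by rewrite hy // big1 ?subr0 // => u _; rewrite (gr_scale gr) (proj1 (hg1 u) s hs) mulr0.
case: s hs i j => [p||b z|b] // hs; try by (case: b hs).
move=> i j.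
rewrite (proj2 (hF (i, j))) /=.
have -> : \sum_(u : S) rho (Plane p) (c u *: g1 u) i j =
    \sum_ij \sum_v (if (i, j) == ij then F ij v p * par_gen (d i (+) d j) v p else 0).
  rewrite pair_bigA; apply: eq_bigr => -[ij v] _ /=.
  by rewrite (gr_scale gr) (proj2 (hg1 _)) hc /=; case: eqP; rewrite ?mulr0.
rewrite (bigD1 (i, j)) //= eqxx [X in _ - (_ + X)]big1 ?addr0 ?subrr // => ij.
by rewrite eq_sym => /negPf ->; rewrite big1.
Qed.

Lemma layered_finite_type : finite_type A.
Proof.
have step l : (l < r)%N -> exists (I : finType) (g : I -> A),
    forall x, above l.+1 x -> exists c : I -> k, above l (x - \sum_u c u *: g u).
  case: l => [|[|[|[|[|[|l]]]]]] hl.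
  - exact: plane_generators.
  - exact: star_generators.
  - exact: (@line_generators true).
  - exact: (@line_generators false).
  - exact: (@point_generators true).
  - exact: (@point_generators false).
  - by have := leq_trans hl r6.
have gen l : (l <= r)%N -> exists (I : finType) (g : I -> A),
    forall x, above l x -> exists c : I -> k, x = \sum_u c u *: g u.
  elim: l => [_|l IH hl].
    exists void, (fun=> 0) => x /(above0 hA) ->; exists (fun=> 0).
    by rewrite big1 // => u; rewrite scale0r.
  have [I [g hg]] := step l hl; have [I' [g' hg']] := IH (ltnW hl).
  exists (I + I')%type, (fun v => match v with inl u => g u | inr u => g' u end) => x.
  move=> /hg[c /hg'[c' e]].
  exists (fun v => match v with inl u => c u | inr u => c' u end).
  by rewrite big_sumType /= -e addrC subrK.
have [I [g hg]] := gen r (leqnn r).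
by apply: (@finite_type_family A I g) => x; apply/hg/(ly_top hA).
Qed.
End Layered.
End FiniteFamilies.

(** * Geometrical equivalence of layered algebras and of their ideals *)

Section Comparisons.
Variables (C : numClosedFieldType) (G : {group weylG2}).
Hypothesis hG : G = klein :> {set weylG2}.
Hypothesis C_uncountable : ~ countable [set: C].
Local Notation k := (coordring (orbit_variety C G)).
Local Notation iota := (cst_morph (orbit_variety C G)).

Lemma layered_geom_equiv (r : nat) (A B : kalg k) (TA TB : nat -> finType)
    (rA : forall s : expt C, A -> TA (kind s) -> TA (kind s) -> C) (dA : TA 0%N -> bool)
    (rB : forall s : expt C, B -> TB (kind s) -> TB (kind s) -> C) (dB : TB 0%N -> bool)
    (f : A -> B) :
  (r <= 6)%N -> layered r rA dA -> layered r rB dB -> kalg_morph f ->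
  (forall s x, (forall i j, @rA s x i j = 0) <-> (forall i j, @rB s (f x) i j = 0)) ->
  geom_equiv iota A B.
Proof.
move=> r6 hA hB hf h0.
have fA := layered_finite_type hG hA r6; have fB := layered_finite_type hG hB r6.
apply: (geom_spectrum (f := f)) => //.
apply: (layered_spectrum hG C_uncountable hA hB) => //; exact: finite_type_countable.
Qed.

Section PullbackLayers.
Variables (r l : nat) (A A' : kalg k) (T : nat -> finType).
Variables (rho : forall s : expt C, A -> T (kind s) -> T (kind s) -> C) (d : T 0%N -> bool).
Arguments rho : clear implicits.
Hypothesis hA : layered r rho d.
Variable e : A' -> A.
Hypotheses (he : kalg_morph e) (e_inj : injective e).
Hypothesis e_image : forall x, above rho l x <-> exists x', e x' = x.
Hypotheses (l0 : (0 < l)%N) (lr : (l <= r)%N).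

Definition pullback_rho (s : expt C) (x : A') := rho s (e x).
Arguments pullback_rho : clear implicits.

Lemma pullback_lift (m : nat) (P : A -> Prop) : (m <= l)%N ->
  (exists x, above rho m x /\ P x) -> exists x : A', above pullback_rho m x /\ P (e x).
Proof.
move=> ml [x [hx Px]]; have /e_image[x' ex] : above rho l x by exact: aboveW hx.
by exists x'; rewrite ex; split=> // s hs i j; rewrite /pullback_rho ex; exact: hx.
Qed.

Lemma pullback_layered : layered l pullback_rho d.
Proof.
have gr := ly_graded hA; have [eD eZ eM] := he.
split.
- split.
  + by move=> s x y i j; rewrite /pullback_rho eD (gr_add gr).
  + by move=> s c x i j; rewrite /pullback_rho eZ (gr_scale gr).
  + by move=> s x y i j; rewrite /pullback_rho eM (gr_mul gr).
- exact: ly_index hA.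
- move=> x h; apply: e_inj; rewrite -[RHS]/(e 0) (_ : e 0 = 0); first exact: (ly_inj hA).
  by apply: (addrI (e 0)); rewrite -eD !addr0.
- by move=> x; apply/e_image; exists x.
- by move=> x i j; exact: ly_par hA (e x) i j.
- by move=> x b i j; exact: ly_poly hA (e x) b i j.
- move=> M h1 h2.
  exact: (pullback_lift (P := fun x => forall p i j, rho (Plane p) x i j = M i j p) l0
    (ly_plane hA h1 h2)).
- have [T0 [rho0 [[h1 h2 h3] i0 h4 h5]]] := ly_zero hA.
  exists T0, (fun x => rho0 (e x)); split=> //.
  + split=> [x y i j|c x i j|x y i j]; first by rewrite eD h1.
      by rewrite eZ h2.
    by rewrite eM h3.
  + by move=> M; exact: (pullback_lift (P := fun x => forall i j, rho0 x i j = M i j) l0 (h4 M)).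
  + by move=> x hx; exact: (h5 (e x)).
- move=> h M; exact: (pullback_lift (P := fun x => forall i j, rho Star x i j = M i j) h
    (ly_star hA (leq_trans h lr) M)).
- move=> b h P; apply: (pullback_lift (P := fun x => forall c i j, rho (Line b c) x i j = (P i j).[c])
    _ (ly_line hA (leq_trans h lr) P)).
  by case: (b) h.
- move=> b h M; apply: (pullback_lift (P := fun x => forall i j, rho (Point b) x i j = M i j)
    _ (ly_point hA (leq_trans h lr) M)).
  by case: (b) h.
Qed.
End PullbackLayers.

(** For the lowest cell: [A'] and [B'] are copies of the ideals of elements vanishing from level l
    on, and f restricts to them because it preserves zeros. *)
Lemma pullback_geom_equiv (r l : nat) (A B A' B' : kalg k) (TA TB : nat -> finType)
    (rA : forall s : expt C, A -> TA (kind s) -> TA (kind s) -> C) (dA : TA 0%N -> bool)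
    (rB : forall s : expt C, B -> TB (kind s) -> TB (kind s) -> C) (dB : TB 0%N -> bool)
    (f : A -> B) (eA : A' -> A) (eB : B' -> B) :
  (r <= 6)%N -> layered r rA dA -> layered r rB dB -> kalg_morph f ->
  (forall s x, (forall i j, @rA s x i j = 0) <-> (forall i j, @rB s (f x) i j = 0)) ->
  (0 < l)%N -> (l <= r)%N ->
  kalg_morph eA -> injective eA -> (forall x, above rA l x <-> exists x', eA x' = x) ->
  kalg_morph eB -> injective eB -> (forall x, above rB l x <-> exists x', eB x' = x) ->
  geom_equiv iota A' B'.
Proof.
move=> r6 hA hB [fD fZ fM] h0 l0 lr mA injA imA mB injB imB.
have [[aD aZ aM] [bD bZ bM]] := (mA, mB).
have /choice[g gE] x : exists y, eB y = f (eA x).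
  apply/imB => s hs; apply/(h0 s) => i j.
  by have /imA : exists x', eA x' = eA x by [exists x]; apply.
apply: (@layered_geom_equiv l _ _ _ _ _ _ _ _ g _
  (pullback_layered hA mA injA imA l0 lr) (pullback_layered hB mB injB imB l0 lr)).
- exact: leq_trans lr r6.
- split=> [x y|c x|x y]; apply: injB.
  + by rewrite bD !gE aD fD.
  + by rewrite bZ !gE aZ fZ.
  + by rewrite bM !gE aM fM.
- by move=> s x; rewrite /pullback_rho gE; exact: h0.
Qed.

Lemma ideal_val_morph (A : kalg k) (I : ideal A) :
  kalg_morph (val : kalg_of_ideal I -> A) /\ injective (val : kalg_of_ideal I -> A).
Proof.
by split; [split=> [x y|c x|x y]; rewrite ?raddfD ?linearZ | exact: val_inj].
Qed.

Lemma ideal_val_image (A : kalg k) (I : ideal A) (x : A) :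
  I x <-> exists x' : kalg_of_ideal I, val x' = x.
Proof.
split=> [hx|[x' <-]]; last exact/set_mem/(valP x').
by exists (Sub x (mem_set hx)); rewrite SubK.
Qed.
End Comparisons.

(** * The layers of the algebra of functions on the extended quotient *)

Section ExtendedQuotientAlgebra.
Variables (C : numClosedFieldType) (G : {group weylG2}).
Hypothesis hG : G = klein :> {set weylG2}.
Local Notation k := (coordring (orbit_variety C G)).
Local Notation iota := (cst_morph (orbit_variety C G)).
Local Notation O := (ext_coord C G).

Definition expt_class (s : expt C) : ext_quot [set: torus C] G :=
  match s with
  | Plane p => ext_plane G p
  | Star => ext_star C G
  | Line b x => ext_line G b x
  | Point b => ext_point C G b
  end.

Lemma expt_class_surj y : exists s, y = expt_class s.
Proof.
have [[p ->]|[b [x ->]]|[b ->]|->] := ext_cases hG y;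
  [by exists (Plane p)|by exists (Line b x)|by exists (Point b)|by exists Star].
Qed.

Lemma ext_proj_class s : ext_proj (expt_class s) = orbpt G (base s).
Proof.
case: s => [p||b x|b] /=; [exact: ext_proj_plane | exact: ext_proj_star |
  exact: ext_proj_line | exact: ext_proj_point].
Qed.

Definition piece_number (s : expt C) : nat :=
  match s with
  | Plane _ => 4%N
  | Star => 5%N
  | Line b _ => if b then 2%N else 3%N
  | Point b => if b then 1%N else 0%N
  end.

Lemma pieces_class u (s : expt C) :
  pieces (G := G) u (expt_class s : ext_variety C G) <-> piece_number s \in u.
Proof.
have [L2 L3] := (@in_component2V C G, @in_component3V C G).
have e : val (tag (ext_to_sum (expt_class s))) = piece_number s.
  case: s => [p||b x|b] /=; rewrite /ext_to_sum.
  - by rewrite (stratum_plane hG _ _ _ _ L2 L3).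
  - by rewrite (stratum_star hG _ _ _ _ L2 L3).
  - by rewrite (stratum_line hG _ _ _ _ L2 L3); case: b.
  - by rewrite (stratum_point hG _ _ _ _ L2 L3); case: b.
split=> [[w [z [h]]]|h]; first by rewrite (ext_to_sum_piece hG h) e.
have [p hp] : exists p, expt_class s = \pi_(ext_quot [set: torus C] G) p.
  by exists (generic_quotient.repr (expt_class s)); rewrite reprK.
have hc : is_class (expt_class s) (pair_elt p) (coords (pair_pt p)) by exists p.
by exists (pair_elt p), (coords (pair_pt p)); split=> //; rewrite (ext_to_sum_piece hG hc) e.
Qed.

Definition fun_rho (s : expt C) (f : O) (i j : unit) : C :=
  (val f : ext_quot [set: torus C] G -> C) (expt_class s).

Lemma fun_prescribe (e : expt C -> C) : even_fun (fun p => e (Plane p)) ->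
  (forall b, exists P : {poly C}, forall x, e (Line b x) = P.[x]) ->
  exists f : O, forall s i j, fun_rho s f i j = e s.
Proof.
move=> he /choice[P hP].
have [h [hr h1 h2 h3 h4]] := ext_function hG P (fun b => e (Point b)) (e Star) he.
exists (Sub (h : ext_variety C G -> C) (asboolT hr)) => s i j; rewrite /fun_rho SubK.
by case: s => [p||b x|b] //=; rewrite h2 hP.
Qed.

Lemma fun_layered : @layered C G 6 O (fun=> unit) fun_rho (fun=> false).
Proof.
split.
- split=> //.
  + by move=> s c x i j; rewrite /fun_rho /value -ext_proj_class.
  + by move=> s x y i j; rewrite (big_pred1 tt) // => -[].
- by move=> _; split; exact: tt.
- move=> x h; apply: val_inj; apply/funext => y.
  by have [s ->] := expt_class_surj y; exact: h s tt tt.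
- by move=> x [p||b c|b] //; case: b.
- move=> x i j; have := coordringP (x : coordring (ext_variety C G)).
  by move=> /(ext_regular_components hG)[].
- move=> x b i j; have := coordringP (x : coordring (ext_variety C G)).
  by move=> /(ext_regular_components hG)[_]; exact.
- move=> M hM _.
  have [||f hf] := @fun_prescribe (fun s => if s is Plane p then M tt tt p else 0).
  + exact: hM tt tt.
  + by move=> b; exists 0 => x; rewrite horner0.
  by exists f; split=> [[p||b c|b] // _ i j|p [] []]; rewrite hf.
- exists unit, (fun_rho (Plane 0)); split.
  + split=> //.
    by move=> x y i j; rewrite (big_pred1 tt) // => -[].
  + by split; exact: tt.
  + move=> M; have [||f hf] := @fun_prescribe (fun s => if s is Plane p then M tt tt else 0).
    * exact: even_cst.
    * by move=> b; exists 0 => x; rewrite horner0.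
    by exists f; split=> [[p||b c|b] // _ i j|[] []]; rewrite hf.
  + by [].
- move=> _ M; have [||f hf] := @fun_prescribe (fun s => if s is Star then M tt tt else 0).
  + exact: even_cst.
  + by move=> b; exists 0 => x; rewrite horner0.
  by exists f; split=> [[p||b c|b] // _ i j|[] []]; rewrite hf.
- move=> b _ P; have [||f hf] := @fun_prescribe
    (fun s => if s is Line b' c then (if b' == b then (P tt tt).[c] else 0) else 0).
  + exact: even_cst.
  + move=> b'; case: eqP => _; first by exists (P tt tt).
    by exists 0 => x; rewrite horner0.
  exists f; split=> [[p||b' c|b'] hl i j|c [] []]; rewrite hf ?eqxx //.
  by case: eqP hl => // -> /=; case: (b).
- move=> b _ M; have [||f hf] := @fun_prescribe
    (fun s => if s is Point b' then (if b' == b then M tt tt else 0) else 0).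
  + exact: even_cst.
  + by move=> b'; exists 0 => x; rewrite horner0.
  exists f; split=> [[p||b' c|b'] hl i j|[] []]; rewrite hf ?eqxx //.
  by case: eqP hl => // -> /=; case: (b).
Qed.
End ExtendedQuotientAlgebra.

(** * The algebra of matrix functions on the extended quotient *)

Section TargetAlgebra.
Variables (C : numClosedFieldType) (G : {group weylG2}).
Hypothesis hG : G = klein :> {set weylG2}.
Local Notation k := (coordring (orbit_variety C G)).
Local Notation iota := (cst_morph (orbit_variety C G)).

(** The first two bits are the index of the representations of J of dimension 4; the last bit,
    [tdeg], carries the parity, independently of them. *)
Definition tidx : finType := (bool * bool * bool)%type.
Definition tdeg (i : tidx) : bool := i.2.

Definition tfun := expt C -> tidx * tidx -> C.

(* At the origin of the plane the matrix has two equal diagonal blocks and no other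
   entries, so that this point, where the representation of J splits, still gives one
   primitive ideal. *)
Definition target_cond (f : tfun) : Prop :=
  [/\ forall i j, par (tdeg i (+) tdeg j) (fun p => f (Plane p) (i, j)),
      forall b i j, exists P : {poly C}, forall c, f (Line b c) (i, j) = P.[c] &
      exists N : bool * bool -> bool * bool -> C, forall i j,
        f (Plane 0) (i, j) = if i.2 == j.2 then N i.1 j.1 else 0].

Definition target_pred : pred tfun := fun f => `[< target_cond f >].

Lemma target_zmod : zmod_closed target_pred.
Proof.
split.
  apply/asboolP; split=> [i j|b i j|]; first exact: par0.
    by exists 0 => c; rewrite horner0.
  by exists (fun=> fun=> 0) => i j; case: ifP.
move=> f g /asboolP[f1 f2 [N fN]] /asboolP[g1 g2 [M gM]]; apply/asboolP; split.
- move=> i j; apply: (par_ext _ (parD (f1 i j) (par_scale (-1) (g1 i j)))) => p.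
  by rewrite mulN1r.
- move=> b i j; have [P hP] := f2 b i j; have [Q hQ] := g2 b i j.
  by exists (P - Q) => c; rewrite hornerD hornerN -hP -hQ.
- exists (fun i j => N i j - M i j) => i j.
  transitivity (f (Plane 0) (i, j) - g (Plane 0) (i, j)); first by [].
  by rewrite fN gM; case: ifP; rewrite ?subrr.
Qed.

Definition target_car := {f : tfun | target_pred f}.
HB.instance Definition _ := [isSub of target_car for sval].
HB.instance Definition _ := [Choice of target_car by <:].
HB.instance Definition _ :=
  GRing.SubChoice_isSubZmodule.Build tfun target_pred target_car target_zmod.

Lemma targetP (x : target_car) : target_cond (val x).
Proof. exact/asboolP/(valP x). Qed.

Lemma value_even (c : k) : even_fun (fun p => value c (Plane p)).
Proof. exact: (@orbit_regular_even C G hG c). Qed.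

Lemma value_line (c : k) b : exists P : {poly C}, forall x, value c (Line b x) = P.[x].
Proof.
have := value_even c; set f := (X in even_fun X) => hf.
suff : exists P : {poly C}, forall x, f (base (Line b x)) = P.[x] by [].
elim: hf => {f} [a|u|f g _ [P hP] _ [Q hQ]|f g _ [P hP] _ [Q hQ]].
- by exists a%:P => x; rewrite hornerC.
- case: u => [s|].
    exists (if s == b then 'X * 'X else 4%:P) => x.
    by case: s; case: b => /=; rewrite ?hornerM ?hornerX ?hornerC //; ring.
  by exists (-2 *: 'X) => x; rewrite hornerZ hornerX; case: b => /=; ring.
- by exists (P + Q) => x; rewrite hornerD hP hQ.
- by exists (P * Q) => x; rewrite hornerM hP hQ.
Qed.

Lemma target_scale_cond (c : k) (x : target_car) :
  target_cond (fun s ij => value c s * val x s ij).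
Proof.
have [h1 h2 [N h3]] := targetP x; split.
- by move=> i j; exact: (parM (value_even c : par false _) (h1 i j)).
- move=> b i j; have [P hP] := value_line c b; have [Q hQ] := h2 b i j.
  by exists (P * Q) => z; rewrite hornerM hP hQ.
- by exists (fun i j => value c (Plane 0) * N i j) => i j; rewrite h3; case: ifP; rewrite ?mulr0.
Qed.

Definition target_scale (c : k) (x : target_car) : target_car :=
  Sub (fun s ij => value c s * val x s ij : C) (asboolT (target_scale_cond c x)).

Lemma target_scaleE c x s ij : val (target_scale c x) s ij = value c s * val x s ij.
Proof. by rewrite SubK. Qed.

Lemma target_addE (x y : target_car) s ij : val (x + y) s ij = val x s ij + val y s ij.
Proof. by rewrite raddfD. Qed.

Lemma target_eq (x y : target_car) : (forall s ij, val x s ij = val y s ij) -> x = y.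
Proof. by move=> h; apply: val_inj; apply/funext => s; apply/funext => ij. Qed.

Lemma target_scaleA a b x : target_scale a (target_scale b x) = target_scale (a * b) x.
Proof. by apply: target_eq => s ij; rewrite !target_scaleE mulrA. Qed.
Lemma target_scale1 : left_id 1 target_scale.
Proof. by move=> x; apply: target_eq => s ij; rewrite target_scaleE mul1r. Qed.
Lemma target_scaleDr : right_distributive target_scale +%R.
Proof.
by move=> c x y; apply: target_eq => s ij; rewrite target_addE !target_scaleE target_addE mulrDr.
Qed.
Lemma target_scaleDl x : {morph target_scale^~ x : a b / a + b}.
Proof.
by move=> a b; apply: target_eq => s ij; rewrite target_addE !target_scaleE mulrDl.
Qed.
HB.instance Definition _ := GRing.Zmodule_isLmodule.Build k target_car
  target_scaleA target_scale1 target_scaleDr target_scaleDl.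

Lemma target_mul_cond (x y : target_car) :
  target_cond (fun s ij => \sum_m val x s (ij.1, m) * val y s (m, ij.2)).
Proof.
have [h1 h2 [N h3]] := targetP x; have [g1 g2 [M g3]] := targetP y; split.
- move=> i j; apply: par_sum => m _.
  have := parM (h1 i m) (g1 m j).
  by rewrite -addbA [tdeg m (+) _]addbA addbb.
- move=> b i j; have /choice[P hP] := h2 b i; have /choice[Q hQ] := fun m => g2 b m j.
  exists (\sum_m P m * Q m) => c; rewrite horner_sum.
  by apply: eq_bigr => m _; rewrite hornerM hP hQ.
- exists (fun i j => \sum_m N i m * M m j) => i j /=.
  transitivity (\sum_a \sum_e val x (Plane 0) (i, (a, e)) * val y (Plane 0) ((a, e), j)).
    by rewrite pair_bigA; apply: eq_bigr => -[].
  rewrite exchange_big /= (bigD1 i.2) //= [X in _ + X]big1 ?addr0 => [|e /negPf he]; last first.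
    by rewrite big1 // => a _; rewrite h3 eq_sym he mul0r.
  case: eqP => hij; last first.
    by rewrite big1 // => a _; rewrite g3 /=; case: eqP => //; rewrite mulr0.
  by apply: eq_bigr => a _; rewrite h3 g3 /= eqxx hij eqxx.
Qed.

Definition target_mul (x y : target_car) : target_car :=
  Sub (fun s ij => \sum_m val x s (ij.1, m) * val y s (m, ij.2) : C) (asboolT (target_mul_cond x y)).

Lemma target_mulE x y s i j : val (target_mul x y) s (i, j) = \sum_m val x s (i, m) * val y s (m, j).
Proof. by rewrite SubK. Qed.

Lemma target_mulA : associative target_mul.
Proof.
move=> x y z; apply: target_eq => s [i j]; rewrite !target_mulE.
under eq_bigr do rewrite target_mulE mulr_sumr.
rewrite exchange_big; apply: eq_bigr => m _; rewrite target_mulE mulr_suml.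
by apply: eq_bigr => m' _; rewrite mulrA.
Qed.
Lemma target_mulDl : left_distributive target_mul +%R.
Proof.
move=> x y z; apply: target_eq => s [i j]; rewrite target_addE !target_mulE -big_split.
by apply: eq_bigr => m _; rewrite target_addE mulrDl.
Qed.
Lemma target_mulDr : right_distributive target_mul +%R.
Proof.
move=> x y z; apply: target_eq => s [i j]; rewrite target_addE !target_mulE -big_split.
by apply: eq_bigr => m _; rewrite target_addE mulrDr.
Qed.
Lemma target_mulZl (c : k) x y : target_mul (c *: x) y = c *: target_mul x y.
Proof.
apply: target_eq => s [i j]; rewrite [RHS]target_scaleE !target_mulE mulr_sumr.
by apply: eq_bigr => m _; rewrite target_scaleE mulrA.
Qed.
Lemma target_mulZr (c : k) x y : target_mul x (c *: y) = c *: target_mul x y.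
Proof.
apply: target_eq => s [i j]; rewrite [RHS]target_scaleE !target_mulE mulr_sumr.
by apply: eq_bigr => m _; rewrite target_scaleE mulrCA.
Qed.

Definition target : kalg k :=
  Kalg target_mulA target_mulDl target_mulDr target_mulZl target_mulZr.

Definition target_rho (s : expt C) (x : target) (i j : tidx) : C := val (x : target_car) s (i, j).

Lemma target_lift (f : tfun) : target_cond f -> exists x : target, forall s i j,
  target_rho s x i j = f s (i, j).
Proof. by move=> hf; exists (Sub f (asboolT hf)) => s i j; rewrite /target_rho SubK. Qed.

Lemma target_layered : @layered C G 6 target (fun=> tidx) target_rho tdeg.
Proof.
split.
- split.
  + by move=> s x y i j; exact: target_addE.
  + by move=> s c x i j; exact: target_scaleE.
  + by move=> s x y i j; exact: target_mulE.
- by move=> _; split; exact: (false, false, false).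
- by move=> x h; apply: target_eq => s [i j]; exact: h.
- by move=> x [p||b c|b] //; case: b.
- by move=> x i j; have [h _ _] := targetP x; exact: h.
- by move=> x b i j; have [_ h _] := targetP x; exact: h.
- move=> M h1 h2.
  have [|x hx] := @target_lift (fun s ij => if s is Plane p then M ij.1 ij.2 p else 0).
    split=> [i j|b i j|]; first exact: h1.
      by exists 0 => c; rewrite horner0.
    by exists (fun=> fun=> 0) => i j; rewrite h2; case: ifP.
  by exists x; split=> [[p||b c|b] // _ i j|p i j]; rewrite hx.
(* At the origin the two diagonal blocks coincide, so the one with last bit [false] is the whole
   representation. *)
- exists (bool * bool)%type, (fun x i j => target_rho (Plane 0) x (i, false) (j, false)).
  have N0 (x : target) : exists N : bool * bool -> bool * bool -> C, forall i j,
      target_rho (Plane 0) x i j = if i.2 == j.2 then N i.1 j.1 else 0.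
    by have [_ _] := targetP x.
  split.
  + split=> [x y i j|c x i j|x y i j]; [exact: target_addE | exact: target_scaleE | ].
    rewrite [LHS]target_mulE.
    transitivity (\sum_a \sum_e target_rho (Plane 0) x (i, false) (a, e) *
        target_rho (Plane 0) y (a, e) (j, false)).
      by rewrite pair_bigA; apply: eq_bigr => -[].
    apply: eq_bigr => a _; rewrite big_bool /= [X in X + _](_ : _ = 0) ?add0r //.
    by have [N hN] := N0 x; rewrite hN /= mul0r.
  + by split; exact: (false, false).
  + move=> M; have [|x hx] := @target_lift (fun s ij =>
      if s is Plane p then (if ij.1.2 == ij.2.2 then M ij.1.1 ij.2.1 else 0) else 0).
      split=> [i j|b i j|].
      * rewrite /tdeg /=; case: eqP => [->|_]; last exact: par0.
        by rewrite addbb; exact: even_cst.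
      * by exists 0 => c; rewrite horner0.
      * by exists M.
    by exists x; split=> [[p||b c|b] // _ i j|i j]; rewrite hx //= eqxx.
  + move=> x hx; have [N hN] := N0 x; split=> h0 i j; last exact: h0.
    by rewrite hN; case: eqP => // _; have := h0 i.1 j.1; rewrite hN.
- move=> _ M; have [|x hx] := @target_lift (fun s ij => if s is Star then M ij.1 ij.2 else 0).
    split=> [i j|b i j|]; first exact: par0.
      by exists 0 => c; rewrite horner0.
    by exists (fun=> fun=> 0) => i j; case: ifP.
  by exists x; split=> [[p||b c|b] // _ i j|i j]; rewrite hx.
- move=> b _ P; have [|x hx] := @target_lift (fun s ij =>
      if s is Line b' c then (if b' == b then (P ij.1 ij.2).[c] else 0) else 0).
    split=> [i j|b' i j|]; first exact: par0.
      case: eqP => _; first by exists (P i j).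
      by exists 0 => c; rewrite horner0.
    by exists (fun=> fun=> 0) => i j; case: ifP.
  exists x; split=> [[p||b' c|b'] hl i j|c i j]; rewrite hx ?eqxx //.
  by case: eqP hl => // -> /=; case: (b).
- move=> b _ M; have [|x hx] := @target_lift (fun s ij =>
      if s is Point b' then (if b' == b then M ij.1 ij.2 else 0) else 0).
    split=> [i j|b' i j|]; first exact: par0.
      by exists 0 => c; rewrite horner0.
    by exists (fun=> fun=> 0) => i j; case: ifP.
  exists x; split=> [[p||b' c|b'] hl i j|i j]; rewrite hx ?eqxx //.
  by case: eqP hl => // -> /=; case: (b).
Qed.

Definition diagonal (f : ext_coord C G) : tfun := fun s ij =>
  if ij.1 == ij.2 then fun_rho s f tt tt else 0.

Lemma diagonal_cond f : target_cond (diagonal f).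
Proof.
have hO := @fun_layered C G hG; rewrite /diagonal; split=> /=.
- move=> i j; case: eqP => [->|_]; last exact: par0.
  by rewrite addbb; exact: (ly_par hO f tt tt).
- move=> b i j; case: eqP => _; last by exists 0 => c; rewrite horner0.
  exact: (ly_poly hO f b tt tt).
- exists (fun i j => if i == j then fun_rho (Plane 0) f tt tt else 0).
  by move=> [i e] [j e'] /=; rewrite xpair_eqE andbC; case: eqP.
Qed.

Definition ext_to_target (f : ext_coord C G) : target := Sub (diagonal f) (asboolT (diagonal_cond f)).

Lemma ext_to_targetE f s i j :
  target_rho s (ext_to_target f) i j = if i == j then fun_rho s f tt tt else 0.
Proof. by rewrite /target_rho SubK. Qed.

Lemma ext_to_target_morph : kalg_morph ext_to_target.
Proof.
have hO := ly_graded (@fun_layered C G hG).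
split=> [x y|c x|x y]; apply: target_eq => s [i j].
- rewrite target_addE -!/(target_rho _ _ _ _) !ext_to_targetE (gr_add hO).
  by case: eqP => // _; rewrite addr0.
- rewrite target_scaleE -!/(target_rho _ _ _ _) !ext_to_targetE (gr_scale hO).
  by case: eqP => // _; rewrite mulr0.
- rewrite target_mulE.
  under eq_bigr do rewrite -[X in X * _]/(target_rho _ _ _ _) -[X in _ * X]/(target_rho _ _ _ _)
    !ext_to_targetE.
  rewrite (bigD1 i) //= eqxx big1 => [|m /negPf hm]; last by rewrite eq_sym hm mul0r.
  rewrite addr0 /= /diagonal /= (gr_mul hO) (big_pred1 tt) => [|[]//].
  by case: eqP => // _; rewrite mulr0.
Qed.

Lemma ext_to_target_zeros s f : (forall i j : unit, fun_rho s f i j = 0) <->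
  (forall i j, target_rho s (ext_to_target f) i j = 0).
Proof.
split=> [h i j|h [] []]; first by rewrite ext_to_targetE h; case: ifP.
by have := h (false, false, false) (false, false, false); rewrite ext_to_targetE eqxx.
Qed.
End TargetAlgebra.

(** * Functions on a union of pieces *)

Section Pieces.
Variables (C : numClosedFieldType) (G : {group weylG2}).
Hypothesis hG : G = klein :> {set weylG2}.
Local Notation k := (coordring (orbit_variety C G)).
Local Notation O := (ext_coord C G).
Variable u : seq nat.
Local Notation P := (piece_coord C G u).

Definition piece_pt (s : expt C) (h : piece_number s \in u) :
    set_type (pieces (G := G) u : set (ext_variety C G)) :=
  exist (fun y => y \in (pieces (G := G) u : set (ext_variety C G))) (expt_class G s)
    (mem_set (proj2 (pieces_class hG u s) h)).

Lemma piece_pt_surj y : exists s (h : piece_number s \in u), y = piece_pt h.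
Proof.
have [s hs] := expt_class_surj hG (set_val y : ext_quot [set: torus C] G).
have h : piece_number s \in u.
  by apply/(pieces_class hG); rewrite -hs; exact: set_mem (valP y).
by exists s, h; apply: val_inj.
Qed.

Definition piece_val (x : P) (y : set_type (pieces (G := G) u : set (ext_variety C G))) : C :=
  val x y.

Lemma piece_extension_ex (x : P) : exists f : O,
  (forall s (h : piece_number s \in u), fun_rho s f tt tt = piece_val x (piece_pt h)) /\
  (forall s, piece_number s \notin u -> fun_rho s f tt tt = 0).
Proof.
have [g [hg eg]] := coordringP (x : coordring (sub_variety (pieces (G := G) u : set (ext_variety C G)))).
have [g1 g2] := proj1 (ext_regular_components hG _) hg.
have [||f hf] := @fun_prescribe C G hG (fun s => if piece_number s \in u then g (expt_class G s) else 0).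
- by rewrite /=; case: (4%N \in u); [exact: g1 | exact: even_cst].
- move=> b; rewrite /=; case: (_ \in u); first exact: g2.
  by exists 0 => z; rewrite horner0.
exists f; split=> [s h|s /negPf h]; rewrite hf h //.
Qed.

(** Extension by zero, which stays regular because the components of a regular function are
    independent. It identifies the functions on a union of pieces with an ideal of O(T^vee //
    W^s). *)
Definition piece_extension (x : P) : O := projT1 (cid (piece_extension_ex x)).

Lemma piece_extensionE x s (h : piece_number s \in u) :
  fun_rho s (piece_extension x) tt tt = piece_val x (piece_pt h).
Proof. by rewrite /piece_extension; case: cid => f /= [hf _]. Qed.

Lemma piece_extension0 x s : piece_number s \notin u -> fun_rho s (piece_extension x) tt tt = 0.
Proof. by rewrite /piece_extension; case: cid => f /= [_ hf]; exact: hf. Qed.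

Lemma fun_eq (f g : O) : (forall s, fun_rho s f tt tt = fun_rho s g tt tt) -> f = g.
Proof.
move=> h; apply: val_inj; apply/funext => y.
by have [s ->] := expt_class_surj hG y; exact: h.
Qed.

Lemma piece_eq (x y : P) :
  (forall s (h : piece_number s \in u), piece_val x (piece_pt h) = piece_val y (piece_pt h)) -> x = y.
Proof.
move=> e; apply: val_inj; apply/funext => z.
by have [s [h ->]] := piece_pt_surj z; exact: e.
Qed.

Lemma piece_extension_morph : kalg_morph piece_extension.
Proof.
have gO := ly_graded (@fun_layered C G hG).
split=> [x y|c x|x y]; apply: fun_eq => s; have [h|h] := boolP (piece_number s \in u).
- by rewrite (gr_add gO) !(piece_extensionE _ h).
- by rewrite (gr_add gO) !piece_extension0 ?addr0.
- rewrite (gr_scale gO) !(piece_extensionE _ h); congr (_ * _).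
  by rewrite /value -ext_proj_class.
- by rewrite (gr_scale gO) !piece_extension0 ?mulr0.
- by rewrite (gr_mul gO) (big_pred1 tt) => [|[]//]; rewrite !(piece_extensionE _ h).
- by rewrite (gr_mul gO) (big_pred1 tt) => [|[]//]; rewrite !piece_extension0 ?mulr0.
Qed.

Lemma piece_extension_inj : injective piece_extension.
Proof. by move=> x y e; apply: piece_eq => s h; rewrite -!piece_extensionE e. Qed.

Lemma piece_extension_image f : (forall s, piece_number s \notin u -> fun_rho s f tt tt = 0) <->
  exists x, piece_extension x = f.
Proof.
split=> [h0|[x <-] s]; last exact: piece_extension0.
pose g (y : set_type (pieces (G := G) u : set (ext_variety C G))) : C :=
  val (f : coordring (ext_variety C G)) (set_val y).
have hg : @regular C (sub_variety (pieces (G := G) u : set (ext_variety C G))) g.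
  by exists (val (f : coordring (ext_variety C G))); split=> //; exact: coordringP.
exists (Sub (g : sub_variety (pieces (G := G) u : set (ext_variety C G)) -> C) (asboolT hg)).
apply: fun_eq => s; have [h|h] := boolP (piece_number s \in u).
  by rewrite (piece_extensionE _ h) /piece_val SubK.
by rewrite piece_extension0 ?h0.
Qed.
End Pieces.

(** * Kazhdan-Lusztig theory of the extended affine Weyl group *)

Section FiniteSupport.
Variables (I : choiceType) (R : pzRingType).
Implicit Types c : fsfunc I R.

Lemma coeff_sum (J : Type) (s : seq J) P (F : J -> fsfunc I R) i :
  coeff (\sum_(j <- s | P j) F j) i = \sum_(j <- s | P j) coeff (F j) i.
Proof. by apply: (big_morph (fun c => coeff c i)) => //; move=> c d; exact: coeffD. Qed.

Lemma coeffZ (a : R) c i : coeff (a *: c) i = a * coeff c i.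
Proof. by []. Qed.

Lemma coeffN c i : coeff (- c) i = - coeff c i.
Proof. by []. Qed.

Lemma coeff0 i : coeff (0 : fsfunc I R) i = 0.
Proof. by []. Qed.

Definition fdelta_fun (i : I) (a : R) (j : I) : R := if j == i then a else 0.

Lemma fdelta_finsupp i a : finsupp (fdelta_fun i a).
Proof.
apply: (@sub_finite_set _ _ [set i]); last exact: finite_set1.
by move=> j /=; rewrite /fdelta_fun; case: ifP => [/eqP|_ /eqP].
Qed.

Definition fdelta (i : I) (a : R) : fsfunc I R := mk_fsfunc (fdelta_finsupp i a).

Lemma coeff_fdelta i a j : coeff (fdelta i a) j = if j == i then a else 0.
Proof. by rewrite /fdelta mk_fsfuncE. Qed.

Lemma fs_cover c : exists s : seq I, uniq s /\ forall i, i \notin s -> coeff c i = 0.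
Proof.
have /finite_seqP[s hs] := coeffP c; exists (undup s); split; first exact: undup_uniq.
move=> i; rewrite mem_undup => his; apply/eqP; apply: contraNT his => fi.
by have : [set i | coeff c i != 0] i by []; rewrite hs.
Qed.

Lemma fs_sum_delta c s : uniq s -> (forall i, i \notin s -> coeff c i = 0) ->
  c = \sum_(i <- s) fdelta i (coeff c i).
Proof.
move=> us hs; apply: coeff_inj; apply/funext => j; rewrite coeff_sum.
have [hj|hj] := boolP (j \in s); last first.
  rewrite hs // big_seq big1 // => i hi; rewrite coeff_fdelta.
  by case: eqP => // e; rewrite e hi in hj.
rewrite (bigD1_seq j) //= coeff_fdelta eqxx big1 ?addr0 // => i; rewrite coeff_fdelta eq_sym.
by move=> /negPf ->.
Qed.

Lemma fs_ind (P : fsfunc I R -> Prop) : P 0 -> (forall i a, P (fdelta i a)) ->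
  (forall c d, P c -> P d -> P (c + d)) -> forall c, P c.
Proof.
move=> P0 Pd PD c; have [s [us hs]] := fs_cover c; rewrite (fs_sum_delta us hs).
by elim: s {us hs} => [|i s IH]; rewrite ?big_nil ?big_cons //; exact: PD.
Qed.

Section Combination.
Variables (V : lmodType R) (F : I -> V).

Definition fcomb c : V := \sum_(i \in setT) coeff c i *: F i.

Lemma fcomb_seq c s : uniq s -> (forall i, i \notin s -> coeff c i = 0) ->
  fcomb c = \sum_(i <- s) coeff c i *: F i.
Proof.
move=> us hs; rewrite /fcomb (fsbigE s) //=; last by move=> i _ /hs ->; rewrite scale0r.
by apply: eq_bigl => i; rewrite in_setT.
Qed.

Lemma fcombD c d : fcomb (c + d) = fcomb c + fcomb d.
Proof.
have [s [us hs]] := fs_cover c; have [t [ut ht]] := fs_cover d.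
have hst e : (forall i, i \notin s -> i \notin t -> coeff e i = 0) ->
    fcomb e = \sum_(i <- undup (s ++ t)) coeff e i *: F i.
  move=> h; apply: fcomb_seq => [|i]; first exact: undup_uniq.
  by rewrite mem_undup mem_cat negb_or => /andP[] /h; exact.
rewrite !hst => [|i _ /ht//|i /hs//|i /hs + /ht]; last by rewrite coeffD => -> ->; rewrite addr0.
by rewrite -big_split; apply: eq_bigr => i _; rewrite coeffD scalerDl.
Qed.

Lemma fcombZ a c : fcomb (a *: c) = a *: fcomb c.
Proof.
have [s [us hs]] := fs_cover c.
rewrite (fcomb_seq us hs) (fcomb_seq us) => [|i /hs h]; last by rewrite coeffZ h mulr0.
by rewrite scaler_sumr; apply: eq_bigr => i _; rewrite coeffZ scalerA.
Qed.

Lemma fcomb0 : fcomb 0 = 0.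
Proof. by rewrite -(scale0r 0) fcombZ scale0r. Qed.

Lemma fcombB c d : fcomb (c - d) = fcomb c - fcomb d.
Proof. by apply: (addIr (fcomb d)); rewrite -fcombD !subrK. Qed.

Lemma fcomb_sum (J : Type) (s : seq J) P (c : J -> fsfunc I R) :
  fcomb (\sum_(j <- s | P j) c j) = \sum_(j <- s | P j) fcomb (c j).
Proof. by apply: (big_morph fcomb fcombD); exact: fcomb0. Qed.

Lemma fcomb_delta i a : fcomb (fdelta i a) = a *: F i.
Proof.
rewrite (@fcomb_seq _ [:: i]) ?big_seq1 ?coeff_fdelta ?eqxx // => j.
by rewrite inE coeff_fdelta => /negPf ->.
Qed.
End Combination.

Section Basis.
Variables (V : lmodType R) (b : I -> V).
Hypothesis hb : is_basis b.

Definition basis_coord (x : V) : fsfunc I R := projT1 (cid (hb x)).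

Lemma basis_expand x : x = fcomb b (basis_coord x).
Proof. by rewrite /basis_coord; case: cid => c /= []. Qed.

Lemma basis_uniq x c : x = fcomb b c -> basis_coord x = c.
Proof. by rewrite /basis_coord; case: cid => d /= [_ h] /h. Qed.

Lemma basis_coordK c : basis_coord (fcomb b c) = c.
Proof. exact: basis_uniq. Qed.

Lemma basis_coordD x y : basis_coord (x + y) = basis_coord x + basis_coord y.
Proof. by apply: basis_uniq; rewrite fcombD -!basis_expand. Qed.

Lemma basis_coordZ a x : basis_coord (a *: x) = a *: basis_coord x.
Proof. by apply: basis_uniq; rewrite fcombZ -basis_expand. Qed.

Lemma basis_coord_basis i : basis_coord (b i) = fdelta i 1.
Proof. by apply: basis_uniq; rewrite fcomb_delta scale1r. Qed.

Lemma basis_ind (P : V -> Prop) : P 0 -> (forall i a, P (a *: b i)) ->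
  (forall x y, P x -> P y -> P (x + y)) -> forall x, P x.
Proof.
move=> P0 Pb PD x; rewrite (basis_expand x); elim/fs_ind: (basis_coord x).
- by rewrite fcomb0.
- by move=> i a; rewrite fcomb_delta.
- by move=> c d; rewrite fcombD; exact: PD.
Qed.
End Basis.
End FiniteSupport.

(** * Laurent polynomials and their value at tau = 1 *)

Section LaurentLemmas.
Variable C : numClosedFieldType.
Local Notation L := (laurent C).
Implicit Types f g : L.

Lemma coeff_lmul f g n : coeff (f * g) n = \sum_(i \in setT) coeff f i * coeff g (n - i).
Proof. by rewrite /GRing.mul /= /lmul mk_fsfuncE. Qed.

Lemma lmonomE (a : C) m : lmonom a m = fdelta m a :> fsfunc int C.
Proof. by apply: coeff_inj; apply/funext => n; rewrite /lmonom mk_fsfuncE coeff_fdelta. Qed.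

Lemma coeff_lmonom (a : C) m n : coeff (lmonom a m) n = if n == m then a else 0.
Proof. by rewrite lmonomE coeff_fdelta. Qed.

Lemma coeff_lmonom_mul (a : C) m f n : coeff (lmonom a m * f) n = a * coeff f (n - m).
Proof.
rewrite coeff_lmul (fsbigE [:: m]) //=; last first.
  by move=> i _; rewrite inE coeff_lmonom => /negPf ->; rewrite mul0r.
by rewrite big_cons big_nil in_setT addr0 coeff_lmonom eqxx.
Qed.

Lemma lmonomM (a b : C) m n : lmonom a m * lmonom b n = lmonom (a * b) (m + n).
Proof.
apply: coeff_inj; apply/funext => i; rewrite coeff_lmonom_mul !coeff_lmonom.
by rewrite subr_eq [n + m]addrC; case: eqP; rewrite ?mulr0.
Qed.

Lemma lmonom1 : lmonom (1 : C) 0 = 1.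
Proof. by []. Qed.

Lemma lmonomD (a b : C) m : lmonom (a + b) m = lmonom a m + lmonom b m.
Proof.
by apply: coeff_inj; apply/funext => i; rewrite coeffD !coeff_lmonom; case: eqP; rewrite ?addr0.
Qed.

Lemma lmonom0 m : lmonom (0 : C) m = 0.
Proof. by apply: coeff_inj; apply/funext => i; rewrite coeff_lmonom; case: eqP. Qed.

Lemma at_oneD f g : at_one (f + g) = at_one f + at_one g.
Proof.
have h (e : L) : at_one e = fcomb (fun=> 1 : C^o) e.
  by apply: eq_fsbigr => i _; rewrite /GRing.scale /= mulr1.
by rewrite !h fcombD.
Qed.

Lemma at_one_lmonom (a : C) m : at_one (lmonom a m) = a.
Proof.
rewrite /at_one (fsbigE [:: m]) //=; last by move=> i _; rewrite inE coeff_lmonom => /negPf ->.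
by rewrite big_cons big_nil in_setT addr0 coeff_lmonom eqxx.
Qed.

Lemma at_one0 : at_one (0 : L) = 0.
Proof. by rewrite -(lmonom0 0) at_one_lmonom. Qed.

Lemma at_oneM f g : at_one (f * g) = at_one f * at_one g.
Proof.
elim/fs_ind: f => [|m a|f f' IH IH'].
- by rewrite -[0]/(0 : L) mul0r at_one0 mul0r.
- rewrite -lmonomE; elim/fs_ind: g => [|n b|g g' IH IH'].
  + by rewrite -[0]/(0 : L) mulr0 at_one0 mulr0.
  + by rewrite -lmonomE lmonomM !at_one_lmonom.
  + by rewrite -[g + g']/((g : L) + g') mulrDr !at_oneD mulrDr IH IH'.
- by rewrite -[f + f']/((f : L) + f') mulrDl !at_oneD mulrDl IH IH'.
Qed.

Lemma at_one1 : at_one (1 : L) = 1.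
Proof. by rewrite -lmonom1 at_one_lmonom. Qed.

Lemma at_one_sum (J : Type) (s : seq J) P (F : J -> L) :
  at_one (\sum_(j <- s | P j) F j) = \sum_(j <- s | P j) at_one (F j).
Proof. by apply: (big_morph (@at_one C) at_oneD); exact: at_one0. Qed.

(** Membership in tau^-1 C[tau^-1], the condition on the off-diagonal coefficients of
    Kazhdan-Lusztig elements without integrality. *)
Definition negative f := forall n, 0 <= n -> coeff f n = 0.

Lemma negative0 : negative 0. Proof. by []. Qed.
Lemma negativeD f g : negative f -> negative g -> negative (f + g).
Proof. by move=> hf hg n n0; rewrite coeffD hf ?hg ?addr0. Qed.
Lemma negativeN f : negative f -> negative (- f).
Proof. by move=> hf n n0; rewrite coeffN hf ?oppr0. Qed.
Lemma negativeM f g : negative f -> negative g -> negative (f * g).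
Proof.
move=> hf hg n n0; rewrite coeff_lmul fsbig1 // => i _.
have [i0|i0] := lerP 0 i; first by rewrite hf ?mul0r.
by rewrite hg ?mulr0 // subr_ge0; exact: le_trans (ltW i0) n0.
Qed.
Lemma negative_lmonom (a : C) m : m < 0 -> negative (lmonom a m).
Proof. by move=> m0 n n0; rewrite coeff_lmonom; case: eqP => // e; move: m0; rewrite -e ltNge n0. Qed.
End LaurentLemmas.

(** * Uniqueness of Kazhdan-Lusztig elements *)

Section Triangular.
Variables (C : numClosedFieldType) (W : choiceType) (len : W -> nat).
Local Notation L := (laurent C).
Variables (H : lmodType L) (T : W -> H).
Hypothesis hT : is_basis T.
Variables (bar : H -> H).
Hypotheses (barD : forall x y, bar (x + y) = bar x + bar y)
  (barZ : forall f g x, is_laurent_bar f g -> bar (f *: x) = g *: bar x).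

(* Kazhdan-Lusztig elements are determined by bar invariance and triangularity. *)
Variables (Cc : W -> H) (ex : W -> seq (L * W)).
Hypotheses (Cc_bar : forall w, bar (Cc w) = Cc w)
  (Cc_expand : forall w, Cc w = T w + \sum_(u <- ex w) u.1 *: T u.2)
  (ex_neg : forall w u, u \in ex w -> negative u.1)
  (ex_len : forall w u, u \in ex w -> (len u.2 < len w)%N).

Lemma coord_Cc w : basis_coord hT (Cc w) = fdelta w 1 + \sum_(u <- ex w) fdelta u.2 u.1.
Proof.
apply: basis_uniq; rewrite fcombD fcomb_sum fcomb_delta scale1r Cc_expand.
by congr (_ + _); apply: eq_bigr => u _; rewrite fcomb_delta.
Qed.

(** The elements are unitriangular with respect to length: the coefficients vanish by descending
    induction, starting above the longest element of the support. *)
Lemma Cc_independent : injective (fcomb Cc).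
Proof.
suff h c : fcomb Cc c = 0 -> c = 0.
  by move=> c d e; apply/eqP; rewrite -subr_eq0; apply/eqP/h; rewrite fcombB e subrr.
move=> c0; have [s [us hs]] := fs_cover c.
pose M := (\max_(v <- s) (len v).+1)%N.
suff h n w : (M <= len w + n)%N -> coeff c w = 0.
  apply: coeff_inj; apply/funext => w; rewrite coeff0.
  exact: (h M w (leq_addl _ _)).
elim: n w => [|n IH] w hw; have [ws|/hs//] := boolP (w \in s).
  suff : (len w < M)%N by rewrite ltnNge -(addn0 (len w)) hw.
  by rewrite /M (big_rem w) //= leq_maxl.
have coord0 v : v != w -> coeff c v * coeff (basis_coord hT (Cc v)) w = 0.
  move=> vw; rewrite coord_Cc coeffD coeff_sum coeff_fdelta eq_sym (negPf vw) add0r.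
  rewrite mulr_sumr big_seq big1 // => u hu; rewrite coeff_fdelta.
  case: eqP => [e|]; last by rewrite mulr0.
  by rewrite IH ?mul0r //; have := ex_len hu; rewrite -e; lia.
have := congr1 (fun x => coeff (basis_coord hT x) w) c0.
rewrite (fcomb_seq _ us hs).
have -> : basis_coord hT (\sum_(i <- s) coeff c i *: Cc i) =
    \sum_(i <- s) coeff c i *: basis_coord hT (Cc i).
  apply: basis_uniq; rewrite fcomb_sum; apply: eq_bigr => v _.
  by rewrite fcombZ -basis_expand.
rewrite coeff_sum (bigD1_seq w) //= big1 ?addr0 => [|v]; last by rewrite coeffZ; exact: coord0.
have -> : basis_coord hT 0 = 0 by apply: basis_uniq; rewrite fcomb0.
rewrite coeffZ coord_Cc coeffD coeff_fdelta eqxx coeff_sum big_seq big1 ?addr0 ?mulr1 // => u hu.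
by rewrite coeff_fdelta; case: eqP => // e; have := ex_len hu; rewrite -e ltnn.
Qed.

Let neg_span (z : H) := exists r : fsfunc W L, (forall v, negative (coeff r v)) /\ z = fcomb Cc r.

Lemma neg_spanD x y : neg_span x -> neg_span y -> neg_span (x + y).
Proof.
move=> [r [hr ->]] [t [ht ->]]; exists (r + t); rewrite fcombD; split=> // v.
by rewrite coeffD; exact: negativeD.
Qed.

Lemma neg_span_sum (J : eqType) (s : seq J) (F : J -> H) :
  (forall j, j \in s -> neg_span (F j)) -> neg_span (\sum_(j <- s) F j).
Proof.
move=> h; rewrite big_seq; elim/big_ind : _ => //; last exact: neg_spanD.
by exists 0; rewrite fcomb0; split=> // v; rewrite coeff0; exact: negative0.
Qed.

(** T_w is C_w minus negative multiples of shorter T_u: induction on the length. *)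
Lemma neg_span_T w f : negative f -> neg_span (f *: T w).
Proof.
elim: {w}_.+1 {-2}w (ltnSn (len w)) f => // n IH w hw f hf.
have -> : f *: T w = f *: Cc w + \sum_(u <- ex w) (- (f * u.1)) *: T u.2.
  rewrite Cc_expand scalerDr -addrA scaler_sumr -big_split big1 ?addr0 // => u _.
  by rewrite /= scalerA scaleNr subrr.
apply: neg_spanD; last first.
  apply: neg_span_sum => u hu; apply: IH; first exact: leq_trans (ex_len hu) hw.
  by apply/negativeN/negativeM => //; exact: ex_neg hu.
exists (fdelta w f); rewrite fcomb_delta; split=> // v; rewrite coeff_fdelta.
by case: eqP => // _; exact: negative0.
Qed.

Lemma laurent_bar_ex (f : L) : exists g, is_laurent_bar f g.
Proof.
elim/fs_ind: f => [|m a|f g [f' hf] [g' hg]].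
- by exists 0 => i.
- exists (lmonom a (- m)) => i; rewrite coeff_lmonom coeff_fdelta.
  by rewrite -eqr_oppLR.
- by exists (f' + g') => i; rewrite !coeffD hf hg.
Qed.

(** x - C_w is a combination of the C_v with coefficients in tau^-1 C[tau^-1]. By independence bar
    invariance passes to the coefficients, and a bar-invariant element of tau^-1 C[tau^-1] is 0. *)
Lemma kl_unique (P : fsfunc W L) (x : H) w : x = fcomb T P -> coeff P w = 1 ->
  (forall v, v != w -> negative (coeff P v)) -> bar x = x ->
  x = Cc w /\ P = basis_coord hT (Cc w).
Proof.
move=> xP Pw Pneg barx; suff e : x = Cc w.
  by split=> //; rewrite -e xP basis_coordK.
pose d := P - basis_coord hT (Cc w).
have dneg v : negative (coeff d v).
  rewrite /d coeffD coeffN coord_Cc coeffD coeff_fdelta.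
  have hn : negative (- coeff (\sum_(u <- ex w) fdelta u.2 u.1) v).
    apply: negativeN; rewrite coeff_sum big_seq; elim/big_ind: _ => [||u hu].
    - exact: negative0.
    - by move=> f g; exact: negativeD.
    - by rewrite coeff_fdelta; case: eqP => _; [exact: ex_neg hu | exact: negative0].
  rewrite opprD addrA; apply: negativeD hn.
  case: eqVneq => [->|vw]; first by rewrite Pw subrr; exact: negative0.
  by rewrite subr0; exact: Pneg.
have xd : x - Cc w = fcomb T d by rewrite fcombB -xP -basis_expand.
have [r [rneg er]] : neg_span (x - Cc w).
  rewrite xd; have [s [us hs]] := fs_cover d; rewrite (fcomb_seq _ us hs).
  by apply: neg_span_sum => v _; exact: neg_span_T.
have bar0 : bar 0 = 0 by apply: (addrI (bar 0)); rewrite -barD !addr0.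
have barN y : bar (- y) = - bar y.
  by apply/eqP; rewrite -addr_eq0 -barD addNr bar0.
have [r' [hr' br]] : exists r' : fsfunc W L, (forall v, is_laurent_bar (coeff r v) (coeff r' v)) /\
    bar (fcomb Cc r) = fcomb Cc r'.
  elim/fs_ind: {rneg er} r => [|v f|r1 r2 [t1 [h1 e1]] [t2 [h2 e2]]].
  - by exists 0; rewrite !fcomb0.
  - have [g hg] := laurent_bar_ex f; exists (fdelta v g); split.
      by move=> u i; rewrite !coeff_fdelta; case: eqP.
    by rewrite !fcomb_delta (barZ _ hg) Cc_bar.
  - exists (t1 + t2); rewrite !fcombD barD e1 e2; split=> // v i.
    by rewrite !coeffD h1 h2.
have rr : r' = r.
  by apply: Cc_independent; rewrite -br -er barD barN barx Cc_bar.
have r0 : r = 0.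
  apply: coeff_inj; apply/funext => v; rewrite coeff0; apply: coeff_inj; apply/funext => i.
  rewrite coeff0; have [i0|i0] := lerP 0 i; first exact: rneg.
  by rewrite -rr hr' rneg // oppr_ge0 ltW.
by apply/eqP; rewrite -subr_eq0 er r0 fcomb0.
Qed.
End Triangular.

(* (i, n) is the alternating word of length n + 1 starting with s_i, in an
   infinite dihedral group. *)
Definition dword := option (bool * nat).

Definition dlen (x : dword) : nat := if x is Some (_, n) then n.+1 else 0.

(** Left multiplication by s_i. *)
Definition dstep (i : bool) (x : dword) : dword :=
  match x with
  | None => Some (i, 0%N)
  | Some (j, n) => if i == j then (if n is m.+1 then Some (~~ i, m) else None) else Some (i, n.+1)
  end.

Definition dtwist (e : bool) (x : dword) : dword :=
  if x is Some (i, n) then Some (e (+) i, n) else None.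

(** The length, with the first letter as sign. In this coordinate left multiplication by s_i is the
    reflection z -> 1 - z or z -> -1 - z ([intd_step]), which links words to the affine action on a
    line. *)
Definition dint (x : dword) : int :=
  match x with
  | None => 0
  | Some (i, n) => if i then Posz n.+1 else Negz n
  end.

Definition intd (z : int) : dword :=
  match z with
  | Posz 0 => None
  | Posz n.+1 => Some (true, n)
  | Negz n => Some (false, n)
  end.

Lemma dintK : cancel dint intd. Proof. by case=> [[[] n]|]. Qed.
Lemma intdK : cancel intd dint. Proof. by case=> [[|n]|n]. Qed.
Lemma abs_dint x : `|dint x|%N = dlen x. Proof. by case: x => [[[] n]|]. Qed.

Lemma intd_step i x : intd ((if i then 1 else -1) - dint x) = dstep i x.
Proof.
rewrite -[RHS]dintK; congr intd.
by case: x => [[[] n]|]; case: i => //=; rewrite ?NegzE; case: n => [|n] //=; rewrite ?NegzE; lia.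
Qed.

Lemma intd_opp x : intd (- dint x) = dtwist true x.
Proof.
rewrite -[RHS]dintK; congr intd.
by case: x => [[[] n]|] //=; rewrite ?NegzE; lia.
Qed.

Lemma odd_absD (x y : int) : odd `|(x + y)%R|%N = odd `|x|%N (+) odd `|y|%N.
Proof. lia. Qed.

(** [flip_p] and [flip_q] tell whether w reverses l.1 + l.2 and l.1 - l.2. *)
Definition flip_p (w : weylG2) : bool := (w == (weyl_a * weyl_r3)%g) || (w == weyl_r3).
Definition flip_q (w : weylG2) : bool := (w == weyl_a) || (w == weyl_r3).

Lemma flipM v w : v \in klein -> w \in klein ->
  flip_p (v * w)%g = flip_p v (+) flip_p w /\ flip_q (v * w)%g = flip_q v (+) flip_q w.
Proof. by move=> /kleinP[] -> /kleinP[] ->; vm_compute. Qed.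

Lemma flip_inj v w : v \in klein -> w \in klein -> flip_p v = flip_p w -> flip_q v = flip_q w -> v = w.
Proof. by move=> /kleinP[] -> /kleinP[] -> //; vm_compute. Qed.

Lemma latt_act_klein w (l : int * int) : w \in klein ->
  (latt_act w l).1 + (latt_act w l).2 = (if flip_p w then -1 else 1) * (l.1 + l.2) /\
  (latt_act w l).1 - (latt_act w l).2 = (if flip_q w then -1 else 1) * (l.1 - l.2).
Proof.
have [e1 e2 e3 e4] : [/\ val (1^-1 : weylG2)%g = ((1, 0), (0, 1)) :> mat2,
    val (weyl_a^-1)%g = ((0, 1), (1, 0)) :> mat2, val (weyl_r3^-1)%g = ((-1, 0), (0, -1)) :> mat2
    & val ((weyl_a * weyl_r3)^-1)%g = ((0, -1), (-1, 0)) :> mat2].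
  by split; vm_compute.
have [f1 f2 f3 f4] : [/\ flip_p 1%g = false, flip_p weyl_a = false, flip_p weyl_r3 &
    flip_p (weyl_a * weyl_r3)%g] by split; vm_compute.
have [g1 g2 g3 g4] : [/\ flip_q 1%g = false, flip_q weyl_a, flip_q weyl_r3 &
    flip_q (weyl_a * weyl_r3)%g = false] by split; vm_compute.
by rewrite /latt_act => /kleinP[] ->;
  rewrite ?e1 ?e2 ?e3 ?e4 ?f1 ?f2 ?f3 ?f4 ?g1 ?g2 ?g3 ?g4 /=; split; ring.
Qed.

(** * The extended affine Weyl group as two dihedral groups and an involution *)

Section NormalForm.
Variable G : {group weylG2}.
Hypothesis hG : G = klein :> {set weylG2}.
Local Notation W := (ext_affine G).
Implicit Types x y : W.

Lemma lin_klein x : sgval x.2 \in klein.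
Proof. by rewrite -hG; exact: subgP. Qed.

(* The dihedral groups act on the lines with coordinates l.1 + l.2 and l.1 - l.2. *)
Definition coord_p x : int := x.1.1 + x.1.2 - (flip_p (sgval x.2))%:Z.
Definition coord_q x : int := x.1.1 - x.1.2 - (flip_q (sgval x.2))%:Z.
(** The class of the translation modulo the root lattice, which is spanned by (1, -1) and (1, 1). It
    becomes the exponent of [omega]. *)
Definition coord_e x : bool := odd `|(x.1.1 + x.1.2)%R|%N.

Lemma coord_eq x : coord_e x = odd `|(x.1.1 - x.1.2)%R|%N.
Proof. by rewrite /coord_e !odd_absD abszN. Qed.

Lemma ea_lengthE x : ea_length x = (`|coord_p x| + `|coord_q x|)%N.
Proof.
rewrite /ea_length /pos_roots !big_cons big_nil addn0 addnC.
have [e1 e2] : (latt_act (sgval x.2)^-1%g (g2_coroot (1, 0)) \notin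
    [seq g2_coroot g' | g' <- [:: (1, 0); (3, 2)]]) = flip_q (sgval x.2) /\
    (latt_act (sgval x.2)^-1%g (g2_coroot (3, 2)) \notin
    [seq g2_coroot g' | g' <- [:: (1, 0); (3, 2)]]) = flip_p (sgval x.2).
  by case: (kleinP (lin_klein x)) => ->; split; vm_compute.
rewrite e1 e2 /coord_p /coord_q /g2_eval /=; congr (_ + _)%N; congr (absz _); ring.
Qed.

Lemma coord_mul x y : let sp := if flip_p (sgval x.2) then -1 else 1 in
  let sq := if flip_q (sgval x.2) then -1 else 1 in
  [/\ coord_p (x * y)%g = coord_p x + sp * coord_p y,
      coord_q (x * y)%g = coord_q x + sq * coord_q y &
      coord_e (x * y)%g = coord_e x (+) coord_e y].
Proof.
have [hx hy] := (lin_klein x, lin_klein y).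
have [fp fq] := flipM hx hy; have [lp lq] := latt_act_klein y.1 hx.
have -> : (x * y)%g = (x.1 + latt_act (sgval x.2) y.1, (x.2 * y.2)%g) by [].
rewrite /coord_p /coord_q /coord_e /=.
have ep : (x.1 + latt_act (sgval x.2) y.1).1 + (x.1 + latt_act (sgval x.2) y.1).2 =
    x.1.1 + x.1.2 + (if flip_p (sgval x.2) then -1 else 1) * (y.1.1 + y.1.2).
  by rewrite -lp /=; ring.
have eq : (x.1 + latt_act (sgval x.2) y.1).1 - (x.1 + latt_act (sgval x.2) y.1).2 =
    x.1.1 - x.1.2 + (if flip_q (sgval x.2) then -1 else 1) * (y.1.1 - y.1.2).
  by rewrite -lq /=; ring.
rewrite ep eq fp fq; split.
- by case: (flip_p _); case: (flip_p _) => /=; ring.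
- by case: (flip_q _); case: (flip_q _) => /=; ring.
- by rewrite odd_absD; congr (_ (+) _); case: (flip_p _); rewrite ?mul1r ?mulN1r ?abszN.
Qed.

(** [coord_e] is the parity of both l.1 + l.2 and l.1 - l.2, so the parities of [coord_p] and
    [coord_q] reveal the two flips and hence the linear part. *)
Lemma coord_inj x y : coord_p x = coord_p y -> coord_q x = coord_q y -> coord_e x = coord_e y -> x = y.
Proof.
move=> ep eq ee.
have hp : flip_p (sgval x.2) = flip_p (sgval y.2).
  move: ee (congr1 (fun z : int => odd `|z|%N) ep); rewrite /coord_e /coord_p !odd_absD !abszN => ->.
  by case: (flip_p _); case: (flip_p _) => //=; case: (odd _); case: (odd _).
have hq : flip_q (sgval x.2) = flip_q (sgval y.2).
  move: ee (congr1 (fun z : int => odd `|z|%N) eq); rewrite !coord_eq /coord_q !odd_absD !abszN => ->.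
  by case: (flip_q _); case: (flip_q _) => //=; case: (odd _); case: (odd _).
move: ep eq; rewrite /coord_p /coord_q hp hq => /addIr ep /addIr eq.
case: x y hp hq ep eq {ee} => [[l1 l2] v] [[m1 m2] w] /= hp hq ep eq.
congr (_, _); last by apply: val_inj; apply: flip_inj => //; rewrite -hG; exact: subgP.
by congr (_, _); lia.
Qed.

Definition lin_elt (sp sq : bool) : weylG2 :=
  if sp then (if sq then weyl_r3 else (weyl_a * weyl_r3)%g) else (if sq then weyl_a else 1%g).

Lemma lin_elt_in sp sq : lin_elt sp sq \in G.
Proof. by rewrite hG; case: sp; case: sq; rewrite !inE eqxx ?orbT. Qed.

Lemma flip_lin_elt sp sq : flip_p (lin_elt sp sq) = sp /\ flip_q (lin_elt sp sq) = sq.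
Proof. by case: sp; case: sq; vm_compute. Qed.

Definition aff (l : int * int) (sp sq : bool) : W := (l, Subg (lin_elt_in sp sq)).

Lemma coord_aff l sp sq : [/\ coord_p (aff l sp sq) = l.1 + l.2 - sp%:Z,
  coord_q (aff l sp sq) = l.1 - l.2 - sq%:Z & coord_e (aff l sp sq) = odd `|(l.1 + l.2)%R|%N].
Proof.
by have [h1 h2] := flip_lin_elt sp sq; rewrite /coord_p /coord_q /coord_e /= h1 h2.
Qed.

Lemma coord_surj (m n : int) (e : bool) :
  exists x, [/\ coord_p x = m, coord_q x = n & coord_e x = e].
Proof.
(* The flips are chosen so that both coordinates of the translation get the parity e. *)
pose sp := odd `|m|%N (+) e; pose sq := odd `|n|%N (+) e.
pose p := m + sp%:Z; pose q := n + sq%:Z.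
have op : odd `|p|%N = e by rewrite /p odd_absD /sp; case: (odd _); case: (e).
have oq : odd `|q|%N = e by rewrite /q odd_absD /sq; case: (odd _); case: (e).
have [l hl] : exists l : int, p + q = l + l.
  have : ~~ odd `|(p + q)%R|%N by rewrite odd_absD op oq addbb.
  by exists ((p + q) %/ 2)%Z; lia.
exists (aff (l, p - l) sp sq); have [-> -> ->] := coord_aff (l, p - l) sp sq.
by rewrite /= [l + _]addrC subrK op; split=> //; rewrite /p /q in hl *; lia.
Qed.

Definition hidx := (dword * dword * bool)%type.

Definition nf x : hidx := (intd (coord_p x), intd (coord_q x), coord_e x).

Lemma nf_surj (h : hidx) : exists x, nf x = h.
Proof.
case: h => [[a b] e]; have [x [h1 h2 h3]] := coord_surj (dint a) (dint b) e.
by exists x; rewrite /nf h1 h2 h3 !dintK.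
Qed.

Lemma nf_inj : injective nf.
Proof.
move=> x y [/(can_inj intdK) h1 /(can_inj intdK) h2 h3]; exact: coord_inj.
Qed.

(** The product of the word a in the first dihedral group, the word b in the second one and omega^e,
    as [s1_mul], [s2_mul] and [om_mul] show. *)
Definition wel (a b : dword) (e : bool) : W := projT1 (cid (nf_surj (a, b, e))).

Lemma nf_wel a b e : nf (wel a b e) = (a, b, e).
Proof. by rewrite /wel; case: cid. Qed.

Lemma wel_nf x : x = wel (nf x).1.1 (nf x).1.2 (nf x).2.
Proof. by apply: nf_inj; rewrite nf_wel; case: (nf x) => [[]]. Qed.

Lemma wel_inj a b e a' b' e' : wel a b e = wel a' b' e' -> (a, b, e) = (a', b', e').
Proof. by move=> /(congr1 nf); rewrite !nf_wel. Qed.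

Lemma welE a b e x : coord_p x = dint a -> coord_q x = dint b -> coord_e x = e -> x = wel a b e.
Proof. by move=> h1 h2 h3; apply: nf_inj; rewrite nf_wel /nf h1 h2 h3 !dintK. Qed.

Lemma coord_wel a b e : [/\ coord_p (wel a b e) = dint a, coord_q (wel a b e) = dint b &
  coord_e (wel a b e) = e].
Proof.
have [h1 h2 h3] := nf_wel a b e.
by rewrite -(intdK (coord_p _)) h1 -(intdK (coord_q _)) h2.
Qed.

Lemma wel_cases x : exists a b e, x = wel a b e.
Proof. by exists (nf x).1.1, (nf x).1.2, (nf x).2; exact: wel_nf. Qed.

Lemma ea_length_wel a b e : ea_length (wel a b e) = (dlen a + dlen b)%N.
Proof. by have [h1 h2 _] := coord_wel a b e; rewrite ea_lengthE h1 h2 !abs_dint. Qed.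

Lemma wel1 : wel None None false = 1%g.
Proof.
have f1 : flip_p 1%g = false /\ flip_q 1%g = false by split; vm_compute.
by apply/esym/welE; rewrite /coord_p /coord_q /coord_e /= ?(proj1 f1) ?(proj2 f1).
Qed.

Definition refl_p (i : bool) : W := wel (Some (i, 0%N)) None false.
Definition refl_q (i : bool) : W := wel None (Some (i, 0%N)) false.
(** The non-trivial element of length 0. It exchanges the two simple reflections in both dihedral
    groups at once. *)
Definition omega : W := wel None None true.

Lemma s1E i : refl_p i = aff (if i then (1, 1) else 0) true false.
Proof.
by have [h1 h2 h3] := coord_aff (if i then (1, 1) else 0) true false;
  apply/esym/welE; rewrite ?h1 ?h2 ?h3; case: i {h1 h2 h3}.
Qed.

Lemma s2E i : refl_q i = aff (if i then (1, -1) else 0) false true.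
Proof.
by have [h1 h2 h3] := coord_aff (if i then (1, -1) else 0) false true;
  apply/esym/welE; rewrite ?h1 ?h2 ?h3; case: i {h1 h2 h3}.
Qed.

Lemma omE : omega = aff (1, 0) true true.
Proof. by have [h1 h2 h3] := coord_aff (1, 0) true true; apply/esym/welE; rewrite ?h1 ?h2 ?h3. Qed.

Lemma s1_mul i a b e : (refl_p i * wel a b e)%g = wel (dstep i a) b e.
Proof.
have [h1 h2 h3] := coord_mul (refl_p i) (wel a b e); have [w1 w2 w3] := coord_wel a b e.
have [c1 c2 c3] := coord_wel (Some (i, 0%N)) None false.
have [f1 f2] := flip_lin_elt true false.
apply: nf_inj; rewrite nf_wel /nf h1 h2 h3 w1 w2 w3 c1 c2 c3.
rewrite s1E -[sgval _]/(lin_elt true false) f1 f2 mulN1r mul1r add0r dintK; congr (_, _, _).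
by rewrite -intd_step; case: (i).
Qed.

Lemma s2_mul i a b e : (refl_q i * wel a b e)%g = wel a (dstep i b) e.
Proof.
have [h1 h2 h3] := coord_mul (refl_q i) (wel a b e); have [w1 w2 w3] := coord_wel a b e.
have [c1 c2 c3] := coord_wel None (Some (i, 0%N)) false.
have [f1 f2] := flip_lin_elt false true.
apply: nf_inj; rewrite nf_wel /nf h1 h2 h3 w1 w2 w3 c1 c2 c3.
rewrite s2E -[sgval _]/(lin_elt false true) f1 f2 mulN1r mul1r add0r dintK; congr (_, _, _).
by rewrite -intd_step; case: (i).
Qed.

Lemma om_mul a b e : (omega * wel a b e)%g = wel (dtwist true a) (dtwist true b) (~~ e).
Proof.
have [h1 h2 h3] := coord_mul omega (wel a b e); have [w1 w2 w3] := coord_wel a b e.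
have [c1 c2 c3] := coord_wel None None true.
have [f1 f2] := flip_lin_elt true true.
apply: nf_inj; rewrite nf_wel /nf h1 h2 h3 w1 w2 w3 c1 c2 c3.
by rewrite omE -[sgval _]/(lin_elt true true) f1 f2 /= !mulN1r !add0r !intd_opp.
Qed.

Lemma s1_simple i : simple_reflections (refl_p i).
Proof.
split; last by rewrite ea_length_wel.
rewrite s1E /affine_weyl /= g2_coroot_alpha g2_coroot_3alpha2beta.
by exists 0, (i%:Z); case: i.
Qed.

Lemma s2_simple i : simple_reflections (refl_q i).
Proof.
split; last by rewrite ea_length_wel.
rewrite s2E /affine_weyl /= g2_coroot_alpha g2_coroot_3alpha2beta.
by exists (i%:Z), 0; case: i.
Qed.
End NormalForm.

(** * The Kazhdan-Lusztig basis of an infinite dihedral group *)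

Section DihedralHecke.
Variable C : numClosedFieldType.
Local Notation L := (laurent C).
Local Notation q1 := (tau_pow C 1).
Local Notation qm := (tau_pow C (-1)).

Definition lint (z : int) : L := lmonom z%:~R 0.

Lemma lintD x y : lint (x + y) = lint x + lint y.
Proof. by rewrite /lint intrD lmonomD. Qed.
Lemma lintM x y : lint (x * y) = lint x * lint y.
Proof. by rewrite /lint intrM lmonomM addr0. Qed.
Lemma lint0 : lint 0 = 0. Proof. exact: lmonom0. Qed.
Lemma lint1 : lint 1 = 1. Proof. by []. Qed.
Lemma lintN x : lint (- x) = - lint x.
Proof. by apply/eqP; rewrite -addr_eq0 -lintD addNr lint0. Qed.

Lemma qm1 : qm * q1 = 1. Proof. by rewrite /tau_pow lmonomM mulr1 addNr. Qed.

Definition two_q : L := q1 + qm.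

Section KLRecursion.
Variables (H : algType L) (c : bool -> H).

(** For c_i = C_(s_i) this is C_w, where w is the alternating word of n > 0 letters beginning with
    s_i. The value 0 at n = 0 is not C_1; it makes the recursion valid from the start. *)
Fixpoint klv (i : bool) (n : nat) : H :=
  match n with
  | 0 => 0
  | m.+1 => if m is m'.+1 then c i * klv (~~ i) m - klv i m' else c i
  end.

Arguments klv : simpl never.

Lemma klv0 i : klv i 0 = 0. Proof. by []. Qed.
Lemma klv1 i : klv i 1 = c i. Proof. by []. Qed.
Lemma klvSS i n : klv i n.+2 = c i * klv (~~ i) n.+1 - klv i n. Proof. by []. Qed.

Lemma nat_ind2 (P : nat -> Prop) : P 0%N -> P 1%N -> (forall n, P n -> P n.+1 -> P n.+2) -> forall n, P n.
Proof.
move=> P0 P1 PS n; suff : P n /\ P n.+1 by case.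
by elim: n => [|n [IH1 IH2]]; split=> //; exact: PS.
Qed.

Definition kld (x : dword) : H := if x is Some (i, n) then klv i n.+1 else 1.

Hypothesis cc : forall i, c i * c i = two_q *: c i.

Lemma c_klv i n : c i * klv i n.+1 = two_q *: klv i n.+1.
Proof.
elim/nat_ind2: n => [|| n IH _]; first exact: cc.
  by rewrite klvSS klv0 subr0 klv1 mulrA cc scalerAl.
by rewrite klvSS mulrBr mulrA cc -scalerAl IH -scalerBr.
Qed.

Lemma c_klvN i n : c i * klv (~~ i) n.+1 = klv i n.+2 + klv i n.
Proof. by rewrite klvSS subrK. Qed.

(** The Chebyshev dictionary: cheb_k stands for the word of k + 1 letters beginning with s_i.
    Multiplication by C_(s_i) from the opposite first letter becomes multiplication by X
    ([c_klpolyN]). *)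
Definition klpoly (i : bool) (f : {poly int}) : H :=
  \sum_(k < size f) lint (cheb_coef f k) *: klv i k.+1.

Lemma klpoly_widen n i (f : {poly int}) : (size f <= n)%N ->
  klpoly i f = \sum_(k < n) lint (cheb_coef f k) *: klv i k.+1.
Proof.
move=> h; rewrite /klpoly (big_ord_widen n (fun k => lint (cheb_coef f k) *: klv i k.+1)) //.
rewrite big_mkcond; apply: eq_bigr => k _; case: ltnP => // hk.
by rewrite cheb_coef_small // lint0 scale0r.
Qed.

Lemma klpolyD i (f g : {poly int}) : klpoly i (f + g) = klpoly i f + klpoly i g.
Proof.
have [hf hg] := (leq_maxl (size f) (size g), leq_maxr (size f) (size g)).
rewrite (klpoly_widen i hf) (klpoly_widen i hg) (klpoly_widen i (size_polyD f g)) -big_split.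
by apply: eq_bigr => k _; rewrite cheb_coefD lintD scalerDl.
Qed.

Lemma klpolyZ i a f : klpoly i (a *: f) = lint a *: klpoly i f.
Proof.
rewrite (klpoly_widen i (size_scale_leq a f)) scaler_sumr.
by apply: eq_bigr => k _; rewrite cheb_coefZ lintM scalerA.
Qed.

Lemma klpolyN i f : klpoly i (- f) = - klpoly i f.
Proof. by rewrite -scaleN1r klpolyZ lintN lint1 scaleN1r. Qed.

Lemma klpoly_sum i (J : Type) (s : seq J) P (F : J -> {poly int}) :
  klpoly i (\sum_(j <- s | P j) F j) = \sum_(j <- s | P j) klpoly i (F j).
Proof.
by apply: (big_morph (klpoly i) (klpolyD i)); rewrite /klpoly size_poly0 big_ord0.
Qed.

Lemma klpoly_cheb i n : klpoly i (cheb int n) = klv i n.+1.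
Proof.
rewrite /klpoly size_cheb (bigD1 ord_max) //= cheb_coef_cheb eqxx lint1 scale1r.
rewrite big1 ?addr0 // => k; rewrite -val_eqE /= => /negPf hk.
by rewrite cheb_coef_cheb hk lint0 scale0r.
Qed.

Lemma c_klpolyN i (f : {poly int}) : c i * klpoly (~~ i) f = klpoly i ('X * f).
Proof.
have -> : klpoly i ('X * f) = \sum_(k < size f) lint (cheb_coef f k) *: klpoly i ('X * cheb int k).
  rewrite {1}(cheb_expand f) mulr_sumr klpoly_sum; apply: eq_bigr => k _.
  by rewrite -scalerAr klpolyZ.
rewrite mulr_sumr; apply: eq_bigr => k _; rewrite -scalerAr; congr (_ *: _).
case: (k : nat) => [|n].
  by rewrite cheb0 mulr1 -cheb1 klpoly_cheb c_klvN klv0 addr0.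
have -> : 'X * cheb int n.+1 = cheb int n.+2 + cheb int n by rewrite chebSS subrK.
by rewrite klpolyD !klpoly_cheb c_klvN.
Qed.

(** The last letter of the first word is [i (+) odd m]. If it equals the first letter of the second
    word, the product is tau + tau^-1 times a Clebsch-Gordan sum; otherwise there is no such factor
    and X enters instead. *)
Lemma klv_mul i m j n : klv i m.+1 * klv j n.+1 =
  if i (+) odd m == j then two_q *: klpoly i (cheb int m * cheb int n)
  else klpoly i ('X * cheb int m * cheb int n).
Proof.
elim/nat_ind2: m i => [i||m IH1 IH2 i].
- rewrite addbF cheb0 mul1r mulr1 klv1; case: eqP => [<-|/eqP ij].
    by rewrite klpoly_cheb c_klv.
  have -> : j = ~~ i by case: (i) (j) ij => [] [].
  by rewrite -c_klpolyN klpoly_cheb.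
- move=> i; rewrite klvSS klv0 subr0 klv1 -mulrA cheb1 [odd 1]/= addbT; case: eqP => [<-|/eqP ij].
    by rewrite c_klv -scalerAr -klpoly_cheb c_klpolyN.
  have {1}-> : j = ~~ ~~ i by case: (i) (j) ij => [] [].
  by rewrite -klpoly_cheb c_klpolyN c_klpolyN mulrA.
- rewrite (klvSS i m.+1) mulrBl -(mulrA (c i)) IH2 IH1 chebSS.
  have -> : ~~ i (+) odd m.+1 = i (+) odd m by rewrite /= addbN addNb negbK.
  rewrite oddS oddS negbK; case: eqP => _.
    by rewrite -scalerAr c_klpolyN -scalerBr -klpolyN -klpolyD; congr (_ *: klpoly _ _); ring.
  by rewrite c_klpolyN -klpolyN -klpolyD; congr (klpoly _ _); ring.
Qed.

Definition dmul (x x' : dword) : seq (L * dword) :=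
  match x, x' with
  | None, _ => [:: (1, x')]
  | _, None => [:: (1, x)]
  | Some (i, m), Some (j, n) =>
    if i (+) odd m == j then
      [seq (two_q * lint (cheb_coef (cheb int m * cheb int n)%R k), Some (i, k)) | k <- iota 0 (m + n).+2]
    else [seq (lint (cheb_coef ('X * cheb int m * cheb int n)%R k), Some (i, k)) | k <- iota 0 (m + n).+2]
  end.

Lemma size_cheb_mul m n : (size (cheb int m * cheb int n)%R <= (m + n).+2)%N.
Proof.
apply: leq_trans (size_polyMleq _ _) _; rewrite !size_cheb; lia.
Qed.

Lemma size_chebX_mul m n : (size ('X * cheb int m * cheb int n)%R <= (m + n).+2)%N.
Proof.
rewrite -mulrA; apply: leq_trans (size_polyMleq _ _) _.
have := size_polyMleq (cheb int m) (cheb int n); rewrite !size_cheb size_polyX; lia.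
Qed.

Lemma kld_mul x x' : kld x * kld x' = \sum_(u <- dmul x x') u.1 *: kld u.2.
Proof.
case: x x' => [[i m]|] [[j n]|]; rewrite /dmul ?big_seq1 ?scale1r ?mul1r ?mulr1 //.
rewrite /kld klv_mul; case: ifP => _; rewrite big_map.
  rewrite (klpoly_widen i (size_cheb_mul m n)) scaler_sumr -(big_mkord xpredT
    (fun k => two_q *: (lint (cheb_coef (cheb int m * cheb int n)%R k) *: klv i k.+1))).
  by rewrite /index_iota subn0; apply: eq_bigr => k _; rewrite scalerA.
rewrite (klpoly_widen i (size_chebX_mul m n)) -(big_mkord xpredT
  (fun k => lint (cheb_coef ('X * cheb int m * cheb int n)%R k) *: klv i k.+1)).
by rewrite /index_iota subn0; apply: eq_bigr => k _.
Qed.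
End KLRecursion.

Definition dcoef (x x' x'' : dword) : L := \sum_(u <- dmul x x' | u.2 == x'') u.1.

Lemma dcoefE x x' x'' : dcoef x x' x'' =
  match x, x' with
  | None, _ => (x' == x'')%:R
  | _, None => (x == x'')%:R
  | Some (i, m), Some (j, n) =>
    if x'' is Some (i', k) then
      if i == i' then
        if i (+) odd m == j then two_q * lint (cheb_coef (cheb int m * cheb int n)%R k)
        else lint (cheb_coef ('X * cheb int m * cheb int n)%R k)
      else 0
    else 0
  end.
Proof.
have iotaE (i i' : bool) k N (F : nat -> L) : (forall l, (N <= l)%N -> F l = 0) ->
    \sum_(u <- [seq (F l, Some (i, l)) | l <- iota 0 N] | u.2 == Some (i', k)) u.1 =
    if i == i' then F k else 0.
  move=> hF; rewrite big_map /=.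
  transitivity (\sum_(l <- iota 0 N | l == k) if i == i' then F l else 0).
    rewrite big_mkcond [RHS]big_mkcond; apply: eq_bigr => l _.
    rewrite -[Some (i, l) == _]/((i, l) == (i', k)) xpair_eqE.
    by case: (i == i'); case: (l == k).
  case: (i == i'); last by rewrite big1.
  have [hk|hk] := ltnP k N.
    by rewrite -big_filter (@filter_pred1_uniq _ _ k) ?big_seq1 ?mem_iota ?iota_uniq.
  rewrite hF // big_seq_cond big1 // => l /andP[]; rewrite mem_iota => /andP[_ hl] /eqP e.
  by move: hl; rewrite e ltnNge hk.
case: x x' => [[i m]|] [[j n]|]; rewrite /dcoef /dmul ?big_cons ?big_nil ?addr0;
  try by (case: eqP).
case: x'' => [[i' k]|]; last first.
  by case: ifP => _; rewrite big_map big_pred0.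
case: ifP => _; rewrite iotaE // => l hl; rewrite cheb_coef_small ?lint0 ?mulr0 //.
- exact: leq_trans (size_cheb_mul m n) hl.
- exact: leq_trans (size_chebX_mul m n) hl.
Qed.

Definition dtail (i : bool) (n : nat) : dword := if n is m.+1 then Some (~~ i, m) else None.

(** In a dihedral group C_w is the sum of tau^(l(y) - l(w)) T_y over y <= w. The list contains the y
    < w: two words of every smaller positive length, and the empty word. *)
Fixpoint dlows (i : bool) (n : nat) : seq (L * dword) :=
  (qm, dtail i n) ::
  if n is m.+1 then (qm, Some (i, m)) :: [seq (qm * u.1, u.2) | u <- dlows i m] else [::].

Definition dlow (x : dword) : seq (L * dword) := if x is Some (i, n) then dlows i n else [::].

Lemma dlow_neg x u : u \in dlow x -> negative u.1.
Proof.
have nq : negative qm by exact: negative_lmonom.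
case: x => [[i n]|] //=; elim: n u => [|n IH] u; rewrite !inE; first by move=> /eqP ->.
move=> /or3P[/eqP -> //|/eqP -> //|/mapP[v hv ->]] /=.
by apply: negativeM nq _; exact: IH.
Qed.

Lemma dlow_len x u : u \in dlow x -> (dlen u.2 < dlen x)%N.
Proof.
case: x => [[i n]|] //=; elim: n u => [|n IH] u; rewrite !inE; first by move=> /eqP ->.
move=> /or3P[/eqP -> //|/eqP -> //|/mapP[v hv ->]] /=.
by apply: leq_trans (IH v hv) _.
Qed.

Section Expansion.
Variables (H : algType L) (g : bool -> H) (X : dword -> H).
Hypotheses (X0 : X None = 1)
  (X_step : forall i x, (dlen x < dlen (dstep i x))%N -> g i * X x = X (dstep i x))
  (g_quad : forall i, (g i - q1%:A) * (g i + qm%:A) = 0).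
Let c i := g i + qm%:A.

Lemma g_c i : g i * c i = q1 *: c i.
Proof. by have /eqP := g_quad i; rewrite mulrBl subr_eq0 -scalerAl mul1r => /eqP. Qed.

Lemma c_sqr i : c i * c i = two_q *: c i.
Proof. by rewrite {1}/c mulrDl g_c -scalerAl mul1r -scalerDl. Qed.

Lemma X_head i n : X (Some (i, n)) = g i * X (dtail i n).
Proof.
have e : dstep i (dtail i n) = Some (i, n) by case: n => [|n] //=; case: (i).
by rewrite X_step ?e //; case: n {e}.
Qed.

Lemma c_X i n : c i * X (Some (i, n)) = q1 *: X (Some (i, n)) + X (dtail i n).
Proof.
have gg : g i * g i = (q1 - qm) *: g i + 1.
  have := g_c i; rewrite /c mulrDr -scalerAr mulr1 scalerDr scalerA mulrC qm1 scale1r => e.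
  by rewrite scalerBl addrAC -e addrK.
rewrite X_head mulrA mulrDl gg mulrDl -[qm%:A * _]scalerAl mul1r -scalerAl mulrDl mul1r.
by rewrite -scalerAl addrAC -scalerDl subrK scalerAl.
Qed.

Lemma klv_expand i n : klv c i n.+1 =
  X (Some (i, n)) + (qm *: X (dtail i n) + qm *: klv c i n).
Proof.
elim/nat_ind2: n i => [i||n IH1 IH2 i].
- by rewrite klv1 klv0 scaler0 addr0 X_head /= X0 mulr1.
- move=> i; rewrite klvSS klv0 subr0 !klv1 X_head /= X_head /= X0 mulr1.
  rewrite {1}/c mulrDl mulrDr -scalerAr mulr1 -scalerAl mul1r.
  rewrite -addrA; congr (_ + _); rewrite /c !scalerDr scalerA.
  by rewrite -[qm * qm]/(qm * qm); rewrite addrCA.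
rewrite klvSS IH2 mulrDr mulrDr -2!scalerAr -[dtail (~~ i) n.+1]/(Some (~~ ~~ i, n)) negbK c_X.
rewrite mulrDl X_step; last by rewrite /=; case: (i).
rewrite (_ : dstep i (Some (~~ i, n.+1)) = Some (i, n.+2)); last by case: (i).
rewrite -[qm%:A * _]scalerAl mul1r c_klvN {1}(IH1 i) -[dtail i n.+2]/(Some (~~ i, n.+1)).
move: (klv c i n) (klv c i n.+2) => v v'.
rewrite !scalerDr scalerA qm1 scale1r.
have -> : X (Some (i, n)) + qm *: X (dtail i n) + (qm *: v' + qm *: v) =
    qm *: v' + (X (Some (i, n)) + (qm *: X (dtail i n) + qm *: v)) by rewrite addrCA -!addrA.
by rewrite [X in X - _]addrA addrK -addrA.
Qed.

Lemma kld_expand x : kld c x = X x + \sum_(u <- dlow x) u.1 *: X u.2.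
Proof.
case: x => [[i n]|]; last by rewrite big_nil addr0 X0.
rewrite /kld /dlow; elim: n => [|n IH]; rewrite klv_expand.
  by rewrite big_seq1 klv0 scaler0 addr0.
rewrite [dlows _ _]/= !big_cons IH big_map !scalerDr scaler_sumr /=.
by do 3!congr (_ + _); apply: eq_bigr => u _; rewrite scalerA.
Qed.
End Expansion.
End DihedralHecke.

(** * The Kazhdan-Lusztig basis and structure constants of the whole group *)

Section KLDatum.
Variables (C : numClosedFieldType) (G : {group weylG2}).
Hypothesis hG : G = klein :> {set weylG2}.
Variable D : kl_datum C G.
Local Notation L := (laurent C).
Local Notation W := (ext_affine G).
Local Notation H := (dH D).
Local Notation T := (@dT C G D).
Local Notation bar := (@dbar C G D).
Local Notation q1 := (tau_pow C 1).
Local Notation qm := (tau_pow C (-1)).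
Local Notation wel := (wel hG).
Local Notation s1 := (refl_p hG).
Local Notation s2 := (refl_q hG).
Local Notation om := (omega hG).

Let hT := hecke_basis (dT_hecke D).

Lemma T_mul x y : ea_length (x * y)%g = (ea_length x + ea_length y)%N -> T x * T y = T (x * y)%g.
Proof. exact: hecke_mul (dT_hecke D) x y. Qed.

Lemma length1 : ea_length (1%g : W) = 0%N.
Proof. by rewrite -(wel1 hG) ea_length_wel. Qed.

Lemma T1 : T 1%g = 1.
Proof.
have h z : T 1%g * z = z.
  elim/(basis_ind hT): z => [|w a|x y hx hy]; first by rewrite mulr0.
    by rewrite -scalerAr T_mul mul1g ?length1.
  by rewrite mulrDr hx hy.
by rewrite -[LHS]mulr1 h.
Qed.

Definition T_p (x : dword) : H := T (wel x None false).
Definition T_q (y : dword) : H := T (wel None y false).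
Definition gen_p (i : bool) : H := T (s1 i).
Definition gen_q (i : bool) : H := T (s2 i).
Definition gen_om : H := T om.
Definition om_pow (e : bool) : H := if e then gen_om else 1.
Definition cgen_p (i : bool) : H := gen_p i + qm%:A.
Definition cgen_q (i : bool) : H := gen_q i + qm%:A.

Lemma dstep_len i x : (dlen x < dlen (dstep i x))%N -> dlen (dstep i x) = (dlen x).+1.
Proof. by case: x => [[j [|n]]|] //=; case: eqP => //= _; rewrite ltnNge leqnSn. Qed.

Lemma g1_T i x y e : (dlen x < dlen (dstep i x))%N -> gen_p i * T (wel x y e) = T (wel (dstep i x) y e).
Proof. by move=> /dstep_len h; rewrite T_mul s1_mul // !ea_length_wel h. Qed.

Lemma g2_T i x y e : (dlen y < dlen (dstep i y))%N -> gen_q i * T (wel x y e) = T (wel x (dstep i y) e).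
Proof. by move=> /dstep_len h; rewrite T_mul s2_mul // !ea_length_wel h /= add1n addnS. Qed.

Lemma dtwist_len e x : dlen (dtwist e x) = dlen x.
Proof. by case: x => [[]|]. Qed.

Lemma oo_T x y e : gen_om * T (wel x y e) = T (wel (dtwist true x) (dtwist true y) (~~ e)).
Proof. by rewrite T_mul om_mul // !ea_length_wel !dtwist_len. Qed.

Lemma X1_0 : T_p None = 1. Proof. by rewrite /T_p wel1 T1. Qed.
Lemma X2_0 : T_q None = 1. Proof. by rewrite /T_q wel1 T1. Qed.
Lemma X1_step i x : (dlen x < dlen (dstep i x))%N -> gen_p i * T_p x = T_p (dstep i x).
Proof. exact: g1_T. Qed.
Lemma X2_step i x : (dlen x < dlen (dstep i x))%N -> gen_q i * T_q x = T_q (dstep i x).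
Proof. exact: g2_T. Qed.
Lemma g1_quad i : (gen_p i - q1%:A) * (gen_p i + qm%:A) = 0.
Proof. have h := hecke_quad (dT_hecke D) (s1_simple hG i). exact h. Qed.
Lemma g2_quad i : (gen_q i - q1%:A) * (gen_q i + qm%:A) = 0.
Proof. have h := hecke_quad (dT_hecke D) (s2_simple hG i). exact h. Qed.

Lemma dtail_step i n : Some (i, n) = dstep i (dtail i n) /\
  (dlen (dtail i n) < dlen (dstep i (dtail i n)))%N.
Proof. by case: n => [|n] //=; case: (i). Qed.

Lemma dword_ind (P : dword -> Prop) : P None ->
  (forall i x, (dlen x < dlen (dstep i x))%N -> P x -> P (dstep i x)) -> forall x, P x.
Proof.
move=> P0 PS [[i n]|] //; elim: n i => [|n IH] i.
  by have [-> h] := dtail_step i 0; apply: PS.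
by have [-> h] := dtail_step i n.+1; apply: PS => //=.
Qed.

Lemma T_wel x y e : T (wel x y e) = T_p x * T_q y * om_pow e.
Proof.
have h2 : T (wel None y e) = T_q y * om_pow e.
  elim/dword_ind: y => [|i y hy IH]; last by rewrite -X2_step // -mulrA -IH g2_T.
  by rewrite X2_0 mul1r /om_pow; case: e; rewrite // wel1 T1.
rewrite -mulrA -h2; elim/dword_ind: x => [|i x hx IH]; first by rewrite X1_0 mul1r.
by rewrite -X1_step // -mulrA -IH g1_T.
Qed.

Lemma g1g2 i j : gen_p i * gen_q j = gen_q j * gen_p i.
Proof. by rewrite /gen_q /refl_q g1_T // -[T (wel _ _ _)]/(T _) /gen_p /refl_p g2_T. Qed.

Lemma c1c2 i j : cgen_p i * cgen_q j = cgen_q j * cgen_p i.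
Proof.
rewrite /cgen_p /cgen_q !mulrDl !mulrDr g1g2 -!scalerAl -!scalerAr !mul1r !mulr1.
by rewrite -!addrA; congr (_ + _); rewrite addrCA.
Qed.

Lemma oo_sqr : gen_om * gen_om = 1.
Proof. by rewrite /gen_om {2}/omega oo_T wel1 T1. Qed.

Lemma oo_c1 i : gen_om * cgen_p i = cgen_p (~~ i) * gen_om.
Proof.
rewrite /cgen_p mulrDl mulrDr -scalerAl -scalerAr mul1r mulr1; congr (_ + _).
by rewrite /gen_p {1}/refl_p oo_T T_wel X2_0 mulr1 /om_pow.
Qed.

Lemma oo_c2 i : gen_om * cgen_q i = cgen_q (~~ i) * gen_om.
Proof.
rewrite /cgen_q mulrDl mulrDr -scalerAl -scalerAr mul1r mulr1; congr (_ + _).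
by rewrite /gen_q {1}/refl_q oo_T T_wel X1_0 mul1r /om_pow.
Qed.

Definition kl_p (x : dword) : H := kld cgen_p x.
Definition kl_q (x : dword) : H := kld cgen_q x.

Lemma klv_twist (c : bool -> H) i n : (forall j, gen_om * c j = c (~~ j) * gen_om) ->
  gen_om * klv c i n = klv c (~~ i) n * gen_om.
Proof.
move=> hc; elim/nat_ind2: n i => [i|i|n IH1 IH2 i]; first by rewrite !klv0 mulr0 mul0r.
  exact: hc.
by rewrite !klvSS mulrBr mulrBl mulrA hc -mulrA IH2 IH1 mulrA.
Qed.

Lemma kld_twist (c : bool -> H) e x : (forall j, gen_om * c j = c (~~ j) * gen_om) ->
  om_pow e * kld c x = kld c (dtwist e x) * om_pow e.
Proof.
move=> hc; case: e; last by rewrite mulr1 mul1r; case: x => [[]|].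
by case: x => [[i n]|]; rewrite /om_pow /kld /dtwist ?mulr1 ?mul1r // klv_twist.
Qed.

Lemma klv_comm (c : bool -> H) (z : H) i n : (forall j, z * c j = c j * z) ->
  z * klv c i n = klv c i n * z.
Proof.
move=> hc; elim/nat_ind2: n i => [i|i|n IH1 IH2 i]; first by rewrite !klv0 mulr0 mul0r.
  exact: hc.
by rewrite !klvSS mulrBr mulrBl mulrA hc -mulrA IH2 IH1 mulrA.
Qed.

Lemma A1A2 x y : kl_p x * kl_q y = kl_q y * kl_p x.
Proof.
rewrite /kl_p /kl_q; case: y => [[j n]|]; last by rewrite mulr1 mul1r.
case: x => [[i m]|]; last by rewrite mulr1 mul1r.
apply: klv_comm => l; apply/esym; apply: klv_comm => l'; exact/esym/c1c2.
Qed.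

(** The candidate for the Kazhdan-Lusztig element: a product over the two commuting factors,
    followed by the length-zero element. *)
Definition Cel (x y : dword) (e : bool) : H := kl_p x * kl_q y * om_pow e.

Lemma bar1 : bar 1 = 1.
Proof.
have [h _] := bar_T (dbar_bar D) 1%g; move: h.
by rewrite invg1 T1 mulr1.
Qed.

Lemma barD x y : bar (x + y) = bar x + bar y. Proof. exact: bar_add (dbar_bar D) x y. Qed.
Lemma barM x y : bar (x * y) = bar x * bar y. Proof. exact: bar_mul (dbar_bar D) x y. Qed.
Lemma bar0 : bar 0 = 0. Proof. by apply: (addrI (bar 0)); rewrite -barD !addr0. Qed.
Lemma barN x : bar (- x) = - bar x.
Proof. by apply/eqP; rewrite -addr_eq0 -barD addNr bar0. Qed.

Lemma bar_qm x : bar (qm *: x) = q1 *: bar x.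
Proof.
apply: (bar_scale (dbar_bar D)) => i; rewrite /tau_pow !coeff_lmonom.
by rewrite eqr_opp.
Qed.

(** The quadratic relation gives g^-1 = g - (tau - tau^-1). Since g = T_w with w^2 = 1, bar sends g
    to g^-1, and g + tau^-1 to g^-1 + tau = g + tau^-1. *)
Lemma bar_gen (g : H) w : g = T w -> T w^-1%g = g -> (g - q1%:A) * (g + qm%:A) = 0 ->
  bar (g + qm%:A) = g + qm%:A.
Proof.
move=> gT gV hq; have [h1 h2] := bar_T (dbar_bar D) w.
rewrite gV -gT in h1 h2.
have hr : g * (g - (q1 - qm)%:A) = 1.
  have e : g * g - q1 *: g + qm *: g - 1 = 0.
    rewrite -[RHS]hq mulrBl !mulrDr -!scalerAr !mulr1 -!scalerAl mul1r scalerA qm1.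
    by rewrite scale1r opprD addrACA addrA.
  apply/eqP; rewrite -subr_eq0 -[X in _ == X]e mulrBr -scalerAr mulr1 scalerBl opprB.
  by rewrite [qm *: g - _]addrC addrA.
have -> : bar (g + qm%:A) = bar g + q1%:A by rewrite barD bar_qm bar1.
have -> : bar g = g - (q1 - qm)%:A.
  by have := congr1 (fun z => bar g * z) hr; rewrite mulrA h1 mul1r mulr1.
by rewrite scalerBl opprB addrA subrK.
Qed.

Lemma s1V i : ((s1 i)^-1 = s1 i)%g.
Proof.
by apply: (mulgI (s1 i)); rewrite mulgV {2}/refl_p s1_mul /= eqxx wel1.
Qed.

Lemma s2V i : ((s2 i)^-1 = s2 i)%g.
Proof.
by apply: (mulgI (s2 i)); rewrite mulgV {2}/refl_q s2_mul /= eqxx wel1.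
Qed.

Lemma omV : (om^-1 = om)%g.
Proof. by apply: (mulgI om); rewrite mulgV {2}/omega om_mul /= wel1. Qed.

Lemma bar_c1 i : bar (cgen_p i) = cgen_p i.
Proof. by apply: (@bar_gen _ (s1 i)); rewrite ?s1V //; exact: g1_quad. Qed.

Lemma bar_c2 i : bar (cgen_q i) = cgen_q i.
Proof. by apply: (@bar_gen _ (s2 i)); rewrite ?s2V //; exact: g2_quad. Qed.

Lemma bar_oo : bar gen_om = gen_om.
Proof.
have [h _] := bar_T (dbar_bar D) om; rewrite omV in h.
by rewrite -[LHS]mulr1 -[X in _ * X]oo_sqr mulrA h mul1r.
Qed.

Lemma bar_klv (c : bool -> H) i n : (forall j, bar (c j) = c j) -> bar (klv c i n) = klv c i n.
Proof.
move=> hc; elim/nat_ind2: n i => [i|i|n IH1 IH2 i]; first by rewrite klv0 bar0.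
  exact: hc.
by rewrite klvSS barD barN barM hc IH2 IH1.
Qed.

Lemma bar_Cel x y e : bar (Cel x y e) = Cel x y e.
Proof.
have hk c z : (forall j, bar (c j) = c j) -> bar (kld c z) = kld c z.
  by move=> hc; case: z => [[i n]|]; [exact: bar_klv | exact: bar1].
rewrite /Cel !barM /kl_p /kl_q !hk; [|exact: bar_c2|exact: bar_c1].
by congr (_ * _); rewrite /om_pow; case: e; [exact: bar_oo | exact: bar1].
Qed.

Definition kl_lower (x y : dword) (e : bool) : seq (L * W) :=
  [seq (v.1, wel x v.2 e) | v <- dlow C y] ++
  [seq (u.1 * v.1, wel u.2 v.2 e) | u <- dlow C x, v <- (1, y) :: dlow C y].

Lemma Cel_expand x y e : Cel x y e = T (wel x y e) + \sum_(u <- kl_lower x y e) u.1 *: T u.2.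
Proof.
rewrite /Cel /kl_p /kl_q (kld_expand X1_0 X1_step g1_quad) mulrDl mulrDl.
rewrite /kl_lower big_cat addrA; congr (_ + _).
  rewrite (kld_expand X2_0 X2_step g2_quad) mulrDr mulrDl -T_wel; congr (_ + _).
  rewrite mulr_sumr mulr_suml big_map; apply: eq_bigr => v _.
  by rewrite T_wel -scalerAr -scalerAl.
rewrite mulr_suml mulr_suml big_allpairs_dep; apply: eq_bigr => u _.
have -> : kld cgen_q y = \sum_(v <- (1, y) :: dlow C y) v.1 *: T_q v.2.
  by rewrite (kld_expand X2_0 X2_step g2_quad) big_cons scale1r.
rewrite mulr_sumr mulr_suml; apply: eq_bigr => v _.
by rewrite T_wel -scalerAr -!scalerAl scalerA mulrC.
Qed.

Lemma ex_neg x y e u : u \in kl_lower x y e -> negative u.1.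
Proof.
rewrite mem_cat => /orP[/mapP[v hv ->]|/allpairsP[[v w] [hv hw ->]]] /=; first exact: dlow_neg hv.
move: hw; rewrite [_.2]/= inE => /orP[/eqP ->|hw]; first by rewrite mulr1; exact: dlow_neg hv.
by apply: negativeM; [exact: dlow_neg hv | exact: dlow_neg hw].
Qed.

Lemma ex_len x y e u : u \in kl_lower x y e -> (ea_length u.2 < ea_length (wel x y e))%N.
Proof.
rewrite mem_cat => /orP[/mapP[v hv ->]|/allpairsP[[v w] [hv hw ->]]] /=; rewrite !ea_length_wel.
  by rewrite ltn_add2l; exact: dlow_len hv.
have := dlow_len hv; move: hw; rewrite [(v, w).2]/= inE => /orP[/eqP -> /=|/dlow_len /= hw] hv';
  by rewrite -addSn leq_add // ltnW.
Qed.

Let Cw (w : W) := Cel (nf w).1.1 (nf w).1.2 (nf w).2.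
Let exw (w : W) := kl_lower (nf w).1.1 (nf w).1.2 (nf w).2.

Lemma Cw_expand w : Cw w = T w + \sum_(u <- exw w) u.1 *: T u.2.
Proof. by rewrite /Cw Cel_expand -wel_nf. Qed.

Lemma exw_neg w u : u \in exw w -> negative u.1. Proof. exact: ex_neg. Qed.
Lemma exw_len w u : u \in exw w -> (ea_length u.2 < ea_length w)%N.
Proof. by move=> /ex_len; rewrite -wel_nf. Qed.

Lemma KL_P w : dKL D w = Cw w /\ dP D w = basis_coord hT (Cw w).
Proof.
have hK := dKL_basis D.
have barZ : forall f g x, is_laurent_bar f g -> bar (f *: x) = g *: bar x.
  exact: bar_scale (dbar_bar D).
have Cbar v : bar (Cw v) = Cw v by exact: bar_Cel.
apply: (kl_unique hT barD barZ Cbar Cw_expand exw_neg exw_len).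
- exact: (kl_expand hK).
- exact: (kl_diag hK).
- by move=> v vw n n0; have [_ h] := kl_offdiag hK vw; apply: h; lia.
- exact: (kl_bar hK).
Qed.

Lemma KL_wel x y e : dKL D (wel x y e) = Cel x y e.
Proof. by have [-> _] := KL_P (wel x y e); rewrite /Cw nf_wel. Qed.

Lemma P_wel x y e : dP D (wel x y e) = fdelta (wel x y e) 1 + \sum_(u <- kl_lower x y e) fdelta u.2 u.1.
Proof.
have [_ ->] := KL_P (wel x y e).
by rewrite (coord_Cc hT Cw_expand) /exw nf_wel.
Qed.

Lemma KL_independent : injective (fcomb (dKL D)).
Proof.
have e : dKL D = Cw by apply/funext => w; have [] := KL_P w.
by rewrite e; exact: (Cc_independent hT Cw_expand exw_len).
Qed.

Lemma c1_sqr i : cgen_p i * cgen_p i = two_q C *: cgen_p i. Proof. exact: c_sqr g1_quad i. Qed.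
Lemma c2_sqr i : cgen_q i * cgen_q i = two_q C *: cgen_q i. Proof. exact: c_sqr g2_quad i. Qed.

(** Moving omega^e to the right twists both words of the second element; the two commuting factors
    then multiply separately. *)
Lemma Cel_mul x y e x' y' e' : Cel x y e * Cel x' y' e' =
  \sum_(u <- dmul C x (dtwist e x')) \sum_(v <- dmul C y (dtwist e y'))
    (u.1 * v.1) *: Cel u.2 v.2 (e (+) e').
Proof.
have oe : om_pow e * om_pow e' = om_pow (e (+) e').
  by case: e; case: e'; rewrite /= ?mulr1 ?mul1r ?oo_sqr.
rewrite /Cel -!mulrA -oe.
rewrite [om_pow e * _]mulrA (kld_twist e x' oo_c1) -!mulrA [om_pow e * _]mulrA (kld_twist e y' oo_c2) -!mulrA.
rewrite [kl_q y * _]mulrA -[kld cgen_p (dtwist e x')]/(kl_p _) -A1A2 -!mulrA.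
rewrite [kl_p x * _]mulrA [kl_q y * _]mulrA /kl_p /kl_q (kld_mul c1_sqr) (kld_mul c2_sqr).
rewrite mulr_suml; apply: eq_bigr => u _; rewrite mulr_suml mulr_sumr; apply: eq_bigr => v _.
by rewrite -!scalerAl -!scalerAr scalerA -!mulrA.
Qed.

Lemma h_wel x y e x' y' e' x'' y'' e'' :
  coeff (dh D (wel x y e) (wel x' y' e')) (wel x'' y'' e'') =
  if e'' == e (+) e' then dcoef C x (dtwist e x') x'' * dcoef C y (dtwist e y') y'' else 0.
Proof.
have -> : dh D (wel x y e) (wel x' y' e') =
    \sum_(u <- dmul C x (dtwist e x')) \sum_(v <- dmul C y (dtwist e y'))
      fdelta (wel u.2 v.2 (e (+) e')) (u.1 * v.1).
  apply: KL_independent; rewrite -[LHS](dh_h D) !KL_wel Cel_mul fcomb_sum.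
  apply: eq_bigr => u _; rewrite fcomb_sum; apply: eq_bigr => v _.
  by rewrite fcomb_delta KL_wel.
rewrite coeff_sum /dcoef.
under eq_bigr do rewrite coeff_sum.
under eq_bigr do under eq_bigr do rewrite coeff_fdelta.
have welE a b f : (wel x'' y'' e'' == wel a b f) = [&& a == x'', b == y'' & e'' == f].
  apply/eqP/and3P => [/wel_inj[-> -> ->]|[/eqP -> /eqP -> /eqP ->]] //.
under eq_bigr do under eq_bigr do rewrite welE.
case: (e'' == _); last first.
  by rewrite big1 // => u _; rewrite big1 // => v _; rewrite !andbF.
rewrite big_distrlr /= [RHS]big_mkcond; apply: eq_bigr => u _.
case: eqP => [_|_]; last by rewrite big1.
by rewrite [RHS]big_mkcond; apply: eq_bigr => v _; rewrite andbT.
Qed.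
End KLDatum.

(** * Integrality and leading coefficients of the structure constants *)

Section TauIntegrality.
Variable C : numClosedFieldType.
Local Notation L := (laurent C).
Implicit Types f g : L.

Lemma in_tauZ_mul n m f g : in_tauZ n f -> in_tauZ m g -> in_tauZ (n + m) (f * g).
Proof.
move=> [f1 f2] [g1 g2]; split=> [i|i hi].
  have [s [us hs]] := fs_cover f.
  have -> : f = \sum_(j <- s) lmonom (coeff f j) j.
    by rewrite {1}(fs_sum_delta us hs); apply: eq_bigr => j _; rewrite lmonomE.
  rewrite mulr_suml coeff_sum; elim: s {us hs} => [|j s [z IH]].
    by exists 0; rewrite big_nil.
  rewrite big_cons IH coeff_lmonom_mul.
  have [[a ->] [b ->]] := (f1 j, g1 (i - j)).
  by exists (a * b + z); rewrite intrD intrM.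
rewrite coeff_lmul fsbig1 // => j _.
have [hj|hj] := ltrP n j; first by rewrite f2 ?mul0r.
by rewrite g2 ?mulr0 //; lia.
Qed.

Lemma coeff_top n m f g : (forall i, n < i -> coeff f i = 0) -> (forall i, m < i -> coeff g i = 0) ->
  coeff (f * g) (n + m) = coeff f n * coeff g m.
Proof.
move=> hf hg; rewrite coeff_lmul (fsbigE [:: n]) //=; last first.
  move=> i _; rewrite inE => hi; have [h|h] := ltrP n i; first by rewrite hf ?mul0r.
  by rewrite hg ?mulr0 //; lia.
by rewrite big_cons big_nil in_setT addr0 [n + m]addrC addrK.
Qed.

Lemma in_tauZ_lint z : in_tauZ 0 (lint C z).
Proof.
split=> [i|i hi]; rewrite /lint coeff_lmonom.
  by case: eqP => _; [exists z | exists 0].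
by case: eqP => // e; move: hi; rewrite e ltxx.
Qed.

Lemma in_tauZW n m f : n <= m -> in_tauZ n f -> in_tauZ m f.
Proof. by move=> nm [h1 h2]; split=> // i hi; apply: h2; exact: le_lt_trans hi. Qed.

Lemma in_tauZ_two : in_tauZ 1 (two_q C).
Proof.
split=> [i|i hi]; rewrite /two_q /tau_pow coeffD !coeff_lmonom.
  by exists ((i == 1)%:Z + (i == -1)%:Z); rewrite intrD; do 2!case: eqP => _.
by do 2!(case: eqP => [e|_]; first by move: hi; rewrite e); rewrite addr0.
Qed.

Lemma in_tauZ_bool (b : bool) : in_tauZ 0 (b%:R : L).
Proof. by case: b; [exact: in_tauZ_lint 1 | rewrite -[_%:R](lint0 C); exact: in_tauZ_lint]. Qed.

(** The constants gamma of one dihedral group: the coefficient in [dcoef] of tau if x'' is not empty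
    and of 1 if it is, according to the value of the a-function. *)
Definition dtop (x x' x'' : dword) : int :=
  match x'' with
  | None => ((x == None) && (x' == None))%:Z
  | Some (i', k) =>
    match x, x' with
    | Some (i, m), Some (j, n) =>
      if (i == i') && (i (+) odd m == j) then cheb_coef (cheb int m * cheb int n) k else 0
    | _, _ => 0
    end
  end.

Lemma dcoef_int x x' x'' : in_tauZ (isSome x'')%:Z (dcoef C x x' x'').
Proof.
have w f : in_tauZ 0 f -> in_tauZ (isSome x'')%:Z f by apply: in_tauZW; case: (x'').
have b0 : in_tauZ 0 (0 : L) by exact: (in_tauZ_bool false).
rewrite dcoefE; case: x x' => [[i m]|] [[j n]|]; try by apply: w; exact: in_tauZ_bool.
case: x'' w => [[i' k]|] w; last exact: w.
case: eqP => _; last exact: w.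
case: eqP => _; last by apply: w; exact: in_tauZ_lint.
by rewrite /= -[1%:Z]addr0; apply: in_tauZ_mul; [exact: in_tauZ_two | exact: in_tauZ_lint].
Qed.

Lemma dcoef_top x x' x'' : coeff (dcoef C x x' x'') (isSome x'')%:Z = (dtop x x' x'')%:~R.
Proof.
have b1 (b : bool) : coeff (b%:R : L) 1 = 0 by have [_ h] := in_tauZ_bool b; exact: h.
have b0 (b : bool) : coeff (b%:R : L) 0 = b%:R.
  by case: b; rewrite // -[1%:R]/(lmonom (1 : C) 0) coeff_lmonom.
rewrite dcoefE; case: x'' => [[i' k]|]; case: x x' => [[i m]|] [[j n]|] //=;
  rewrite ?b1 ?b0 //.
case: (i == i') => //=; case: eqP => _; last by have [_ ->] := in_tauZ_lint (cheb_coef ('X * cheb int m * cheb int n)%R k).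
have [_ h2] := in_tauZ_two; have [_ hz] := in_tauZ_lint (cheb_coef (cheb int m * cheb int n)%R k).
have := coeff_top h2 hz; rewrite addr0 => ->.
by rewrite /two_q /tau_pow coeffD /lint !coeff_lmonom /= addr0 mul1r.
Qed.

Lemma dtop_self x : exists x1 x2, dtop x1 x2 x = 1.
Proof.
case: x => [[i k]|]; last by exists None, None.
(* A word times its own last letter gives tau + tau^-1 times itself. *)
exists (Some (i, k)), (Some (i (+) odd k, 0%N)).
by rewrite /dtop !eqxx /= mulr1 cheb_coef_cheb eqxx.
Qed.
End TauIntegrality.

(** * The a-function and the two-sided cells *)

Section Asymptotics.
Variables (C : numClosedFieldType) (G : {group weylG2}).
Hypothesis hG : G = klein :> {set weylG2}.
Variable D : kl_datum C G.
Local Notation L := (laurent C).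
Local Notation W := (ext_affine G).
Local Notation wel := (wel hG).

Definition nS (x : dword) : nat := isSome x.

Lemma h_int w1 w2 x y e : in_tauZ (nS x + nS y)%N (coeff (dh D w1 w2) (wel x y e)).
Proof.
have [x1 [y1 [e1 ->]]] := wel_cases hG w1; have [x2 [y2 [e2 ->]]] := wel_cases hG w2.
rewrite h_wel; case: eqP => _.
  by rewrite PoszD; apply: in_tauZ_mul; exact: dcoef_int.
by apply: (@in_tauZW _ 0) => //; exact: (in_tauZ_bool _ false).
Qed.

Lemma h_top x1 y1 e1 x2 y2 e2 x y e :
  coeff (coeff (dh D (wel x1 y1 e1) (wel x2 y2 e2)) (wel x y e)) (nS x + nS y)%N =
  (if e == e1 (+) e2 then dtop x1 (dtwist e1 x2) x * dtop y1 (dtwist e1 y2) y else 0)%:~R.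
Proof.
rewrite h_wel; case: eqP => _ //.
have [_ h1] := dcoef_int C x1 (dtwist e1 x2) x; have [_ h2] := dcoef_int C y1 (dtwist e1 y2) y.
by rewrite PoszD (coeff_top h1 h2) intrM !dcoef_top.
Qed.

(** [h_int] bounds the degrees from above; the words of [dtop_self] attain the bound in both factors
    simultaneously. *)
Lemma a_wel x y e : da D (wel x y e) = (nS x + nS y)%N.
Proof.
have [h1 h2] := da_a D (wel x y e).
apply/eqP; rewrite eqn_leq; apply/andP; split.
  by apply: h2 => w1 w2; exact: h_int.
have [x1 [x2 hx]] := dtop_self x; have [y1 [y2 hy]] := dtop_self y.
rewrite leqNgt; apply/negP => ha.
have [_ /(_ (nS x + nS y)%N)] := h1 (wel x1 y1 false) (wel x2 y2 e).
rewrite h_top addFb eqxx (_ : dtwist false x2 = x2); last by case: (x2) => [[]|].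
rewrite (_ : dtwist false y2 = y2); last by case: (y2) => [[]|].
rewrite hx hy mulr1 ltz_nat => /(_ ha)/eqP.
by rewrite oner_eq0.
Qed.

Lemma gamma_wel x1 y1 e1 x2 y2 e2 x y e :
  gamma (dh D) (da D) (wel x1 y1 e1) (wel x2 y2 e2) (wel x y e) =
  (if e == e1 (+) e2 then dtop x1 (dtwist e1 x2) x * dtop y1 (dtwist e1 y2) y else 0)%:~R.
Proof. by rewrite /gamma a_wel h_top. Qed.

(** Which of the two words is not empty. The a-function depends only on this, and the four values
    separate the two-sided cells. *)
Definition typ (w : W) : bool * bool := (isSome (nf w).1.1, isSome (nf w).1.2).

Lemma typ_wel x y e : typ (wel x y e) = (isSome x, isSome y).
Proof. by rewrite /typ nf_wel. Qed.

Definition typ_le (t t' : bool * bool) : bool := (t.1 ==> t'.1) && (t.2 ==> t'.2).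

Lemma dcoef_some x x' x'' : dcoef C x x' x'' != 0 -> (isSome x || isSome x') ==> isSome x''.
Proof.
by rewrite dcoefE; case: x x' x'' => [[i m]|] [[j n]|] [[i' k]|] //=; rewrite eqxx.
Qed.

Lemma dtwist_some e x : isSome (dtwist e x) = isSome x. Proof. by case: x => [[]|]. Qed.

Lemma lr_step_typ w w' : lr_step (dh D) w w' -> typ_le (typ w') (typ w).
Proof.
have [x1 [y1 [e1 ->]]] := wel_cases hG w; have [x2 [y2 [e2 ->]]] := wel_cases hG w'.
rewrite !typ_wel /typ_le /= => -[u]; have [x3 [y3 [e3 ->]]] := wel_cases hG u.
rewrite !h_wel => -[]; case: ifP => _; rewrite ?eqxx // => h.
  have [h1 h2] : dcoef C x3 (dtwist e3 x2) x1 != 0 /\ dcoef C y3 (dtwist e3 y2) y1 != 0.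
    by split; apply: contraNN h => /eqP ->; rewrite ?mul0r ?mulr0.
  have := dcoef_some h1; have := dcoef_some h2; rewrite !dtwist_some.
  by case: (isSome x1); case: (isSome x2); case: (isSome y1); case: (isSome y2); rewrite ?orbT.
have [h1 h2] : dcoef C x2 (dtwist e2 x3) x1 != 0 /\ dcoef C y2 (dtwist e2 y3) y1 != 0.
  by split; apply: contraNN h => /eqP ->; rewrite ?mul0r ?mulr0.
have := dcoef_some h1; have := dcoef_some h2; rewrite !dtwist_some.
by case: (isSome x1); case: (isSome x2); case: (isSome y1); case: (isSome y2); rewrite ?orbT.
Qed.

Lemma le_lr_typ w w' : le_lr (dh D) w w' -> typ_le (typ w') (typ w).
Proof.
elim=> {w w'} [w w' /lr_step_typ //|w|w1 w2 w3 _ h1 _ h2].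
  by rewrite /typ_le !implybb.
move: h1 h2; rewrite /typ_le => /andP[/implyP a1 /implyP a2] /andP[/implyP b1 /implyP b2].
by apply/andP; split; apply/implyP => h; [exact/a1/b1 | exact/a2/b2].
Qed.

Lemma le_lr_trans w1 w2 w3 : le_lr (dh D) w1 w2 -> le_lr (dh D) w2 w3 -> le_lr (dh D) w1 w3.
Proof. exact: rt_trans. Qed.

Lemma le_lr_refl w : le_lr (dh D) w w. Proof. exact: rt_refl. Qed.

Lemma bool_neq0 : (true%:R : L) != 0.
Proof. by apply/eqP => /(congr1 (fun f : L => coeff f 0))/eqP; rewrite -[1%:R]/(lmonom (1 : C) 0) coeff_lmonom oner_eq0. Qed.

(** A step inside one factor with coefficient exactly 1, so that the structure constant of the whole
    group, a product, is visibly non-zero. *)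
Definition dreach (x x'' : dword) :=
  exists u, (dcoef C u x x'' = 1) \/ (dcoef C x u x'' = 1).

Lemma dcoefN x : dcoef C None x x = 1.
Proof. by rewrite dcoefE eqxx. Qed.

Lemma dcoefxN x : dcoef C x None x = 1.
Proof. by rewrite dcoefE; case: x => [[i n]|]; rewrite eqxx. Qed.

Lemma reach_step1 x x'' y e : dreach x x'' -> le_lr (dh D) (wel x'' y e) (wel x y e).
Proof.
have f1 : (1 : L) != 0 by exact: bool_neq0.
have fN z : dtwist false z = z by case: z => [[]|].
move=> [u [hu|hu]]; apply: rt_step.
  by exists (wel u None false); left; rewrite h_wel addFb eqxx !fN hu dcoefN mul1r.
exists (wel (dtwist e u) None false); right; rewrite h_wel addbF eqxx.
have -> : dtwist e (dtwist e u) = u by case: (u) => [[i n]|] //=; rewrite addbA addbb.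
by rewrite hu dcoefxN mul1r.
Qed.

Lemma reach_step2 x y y'' e : dreach y y'' -> le_lr (dh D) (wel x y'' e) (wel x y e).
Proof.
have f1 : (1 : L) != 0 by exact: bool_neq0.
have fN z : dtwist false z = z by case: z => [[]|].
move=> [u [hu|hu]]; apply: rt_step.
  by exists (wel None u false); left; rewrite h_wel addFb eqxx !fN hu dcoefN mul1r.
exists (wel None (dtwist e u) false); right; rewrite h_wel addbF eqxx.
have -> : dtwist e (dtwist e u) = u by case: (u) => [[i n]|] //=; rewrite addbA addbb.
by rewrite hu dcoefxN mul1r.
Qed.

Inductive dreachs : dword -> dword -> Prop :=
| dreachs_refl x : dreachs x x
| dreachs_step x y z : dreachs x y -> dreach y z -> dreachs x z.

Lemma dreachs_trans x y z : dreachs x y -> dreachs y z -> dreachs x z.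
Proof. by move=> h1 h2; elim: h2 h1 => // u v w _ IH hw /IH h; exact: dreachs_step h hw. Qed.

Lemma cheb_shift_coef m k : cheb_coef ('X * cheb int m * cheb int 0) k =
  (k == m.+1)%:R + (if m is n.+1 then (k == n)%:R else 0).
Proof.
rewrite cheb0 mulr1; case: m => [|n].
  by rewrite cheb0 mulr1 -cheb1 cheb_coef_cheb addr0.
have -> : 'X * cheb int n.+1 = cheb int n.+2 + cheb int n by rewrite chebSS subrK.
by rewrite cheb_coefD !cheb_coef_cheb.
Qed.

Lemma reach_right i m k : (k == m.+1) || (m == k.+1) -> dreach (Some (i, m)) (Some (i, k)).
Proof.
move=> h; exists (Some (~~ (i (+) odd m), 0%N)); right.
rewrite dcoefE eqxx ifN; last by case: (_ (+) _).
rewrite cheb_shift_coef -[RHS](lint1 C); congr lint.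
case: m h => [|m] /=; first by rewrite orbF => ->; rewrite addr0.
rewrite eqSS => /orP[/eqP ->|/eqP ->]; rewrite eqxx.
  by rewrite gtn_eqF ?addr0.
by rewrite ltn_eqF ?add0r // ltnS.
Qed.

Lemma reach_left i : dreach (Some (i, 0%N)) (Some (~~ i, 1%N)).
Proof.
exists (Some (~~ i, 0%N)); left; rewrite dcoefE eqxx ifN; last by case: (i).
by rewrite cheb_shift_coef -[RHS](lint1 C).
Qed.

(** Right multiplication lengthens or shortens a word by one letter, left multiplication changes its
    first letter, and any one-letter word is reached from the empty word. *)
Lemma reachs_all x z : isSome z -> dreachs x z.
Proof.
have down i m : dreachs (Some (i, m)) (Some (i, 0%N)).
  elim: m => [|m IH]; first exact: dreachs_refl.
  apply: dreachs_trans IH; apply: dreachs_step (dreachs_refl _) _.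
  by apply: reach_right; rewrite eqxx orbT.
have up i m : dreachs (Some (i, 0%N)) (Some (i, m)).
  elim: m => [|m IH]; first exact: dreachs_refl.
  by apply: dreachs_step IH _; apply: reach_right; rewrite eqxx.
have swap i j : dreachs (Some (i, 0%N)) (Some (j, 0%N)).
  have [->|ij] := eqVneq i j; first exact: dreachs_refl.
  have -> : j = ~~ i by case: (i) (j) ij => [] [].
  apply: dreachs_trans (down _ 1%N); apply: dreachs_step (dreachs_refl _) _.
  exact: reach_left.
case: z => [[j n]|] // _; case: x => [[i m]|].
  exact: dreachs_trans (dreachs_trans (down i m) (swap i j)) (up j n).
apply: dreachs_trans (up j n); apply: dreachs_step (dreachs_refl _) _.
by exists (Some (j, 0%N)); left; exact: dcoefxN.
Qed.

Lemma reachs1 x x'' y e : dreachs x x'' -> le_lr (dh D) (wel x'' y e) (wel x y e).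
Proof.
elim=> [z|u v w _ IH h]; first exact: le_lr_refl.
by apply: le_lr_trans IH; exact: reach_step1.
Qed.

Lemma reachs2 x y y'' e : dreachs y y'' -> le_lr (dh D) (wel x y'' e) (wel x y e).
Proof.
elim=> [z|u v w _ IH h]; first exact: le_lr_refl.
by apply: le_lr_trans IH; exact: reach_step2.
Qed.

Lemma le_lrP w w' : le_lr (dh D) w w' <-> typ_le (typ w') (typ w).
Proof.
split; first exact: le_lr_typ.
have [x1 [y1 [e1 ->]]] := wel_cases hG w; have [x2 [y2 [e2 ->]]] := wel_cases hG w'.
rewrite !typ_wel /typ_le /= => /andP[hx hy].
have same a b x y x' y' : isSome x' = a -> isSome y' = b -> (isSome x ==> a) -> (isSome y ==> b) ->
    forall e, le_lr (dh D) (wel x' y' e) (wel x y e).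
  move=> <- <- hx' hy' e; apply: (@le_lr_trans _ (wel x' y e)).
    case: y' hy' => [y'|]; last by case: y => // _; exact: le_lr_refl.
    by move=> _; apply: reachs2; exact: reachs_all.
  case: x' hx' => [x'|]; last by case: x => // _; exact: le_lr_refl.
  by move=> _; apply: reachs1; exact: reachs_all.
have [->|ne] := eqVneq e1 e2; first exact: same.
have -> : e1 = ~~ e2 by case: (e1) (e2) ne => [] [].
apply: (@le_lr_trans _ (wel (dtwist true x2) (dtwist true y2) (~~ e2))).
  by apply: same => //; rewrite dtwist_some.
apply: rt_step; exists (wel None None true); left.
rewrite h_wel addTb eqxx !dcoefN mul1r; exact: bool_neq0.
Qed.

Lemma two_sided_cellE c : two_sided_cell (dh D) c -> exists t, c = [set w | typ w = t].
Proof.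
move=> [w ->]; exists (typ w); apply/seteqP; split=> v /=.
  move=> [/le_lrP + /le_lrP]; rewrite /typ_le; case: (typ v) (typ w) => [a b] [a' b'] /=.
  by case: a; case: b; case: a'; case: b'.
by move=> e; split; apply/le_lrP; rewrite e /typ_le !implybb.
Qed.

(** Length zero determines the type of [ee] and minimality that of [e0]. The two remaining types
    belong to [e1] and [e1'] in an order left open, recorded by b. *)
Lemma cell_labelsE ee e1 e1' e0 : cell_labels D ee e1 e1' e0 ->
  [/\ ee = [set w | typ w = (false, false)], e0 = [set w | typ w = (true, true)] &
   exists b : bool, e1 = [set w | typ w = (b, ~~ b)] /\ e1' = [set w | typ w = (~~ b, b)]].
Proof.
move=> [he c0 c1 c1' c2 low [d1 d2 d3 d4 d5]].
have eeE : ee = [set w | typ w = (false, false)].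
  rewrite he; apply/seteqP; split=> w /=; have [x [y [e ->]]] := wel_cases hG w;
    rewrite ea_length_wel typ_wel; case: x => [[]|]; case: y => [[]|] //.
have [t0 e0E] := two_sided_cellE c2.
have [x0 [y0 t0E]] : exists x0 y0, typ (wel x0 y0 false) = t0.
  by case: (t0) => [[] []];
    [exists (Some (true, 0%N)), (Some (true, 0%N))|exists (Some (true, 0%N)), None|
     exists None, (Some (true, 0%N))|exists None, None]; rewrite typ_wel.
have t0T : t0 = (true, true).
  have h : e0 (wel x0 y0 false) by rewrite e0E.
  have /le_lrP := low _ (wel (Some (true, 0%N)) (Some (true, 0%N)) false) h.
  by rewrite t0E typ_wel /typ_le /=; case: (t0) => [[] []].
rewrite t0T in e0E; split=> //.
have [t1 e1E] := two_sided_cellE c1; have [t2 e2E] := two_sided_cellE c1'.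
have n1 : t1 != (false, false) by apply/eqP => e; apply: d1; rewrite eeE e1E e.
have n2 : t2 != (false, false) by apply/eqP => e; apply: d2; rewrite eeE e2E e.
have n3 : t1 != t2 by apply/eqP => e; apply: d3; rewrite e1E e2E e.
have n4 : t1 != (true, true) by apply/eqP => e; apply: d4; rewrite e0E e1E e.
have n5 : t2 != (true, true) by apply/eqP => e; apply: d5; rewrite e0E e2E e.
exists t1.1; rewrite e1E e2E.
by case: t1 t2 n1 n2 n3 n4 n5 {e1E e2E} => [[] []] [[] []].
Qed.
End Asymptotics.

(** * The asymptotic algebra *)

(** The product t_x t_x' in the asymptotic algebra of one dihedral group. Words compose like matrix
    units: the last letter of the first must be the first letter of the second. *)
Definition djmul (x x' : dword) : seq (int * dword) :=
  match x, x' with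
  | None, None => [:: (1, None)]
  | Some (i, m), Some (j, n) =>
    if i (+) odd m == j then
      [seq (cheb_coef (cheb int m * cheb int n)%R k, Some (i, k)) | k <- iota 0 (m + n).+2]
    else [::]
  | _, _ => [::]
  end.

Lemma sum_iota_word (R : nmodType) (i i' : bool) k N (F : nat -> R) :
  (forall l, (N <= l)%N -> F l = 0) ->
  \sum_(u <- [seq (F l, Some (i, l)) | l <- iota 0 N] | u.2 == Some (i', k)) u.1 =
  if i == i' then F k else 0.
Proof.
move=> hF; rewrite big_map /=.
transitivity (\sum_(l <- iota 0 N | l == k) if i == i' then F l else 0).
  rewrite big_mkcond [RHS]big_mkcond; apply: eq_bigr => l _.
  rewrite -[Some (i, l) == _]/((i, l) == (i', k)) xpair_eqE.
  by case: (i == i'); case: (l == k).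
case: (i == i'); last by rewrite big1.
have [hk|hk] := ltnP k N.
  by rewrite -big_filter (@filter_pred1_uniq _ _ k) ?big_seq1 ?mem_iota ?iota_uniq.
rewrite hF // big_seq_cond big1 // => l /andP[]; rewrite mem_iota => /andP[_ hl] /eqP e.
by move: hl; rewrite e ltnNge hk.
Qed.

Lemma djmulE x x' x'' : \sum_(u <- djmul x x' | u.2 == x'') u.1 = dtop x x' x''.
Proof.
case: x x' => [[i m]|] [[j n]|]; rewrite /djmul /dtop ?big_nil //; last first.
- by rewrite big_cons big_nil addr0; case: x'' => [[]|].
- by case: x'' => [[]|].
- by case: x'' => [[]|].
case: ifP => h; last by case: x'' => [[i' k]|]; rewrite big_nil // andbF.
case: x'' => [[i' k]|]; last by rewrite big_map big_pred0.
rewrite sum_iota_word ?andbT // => l hl; rewrite cheb_coef_small //.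
exact: leq_trans (size_cheb_mul m n) hl.
Qed.

Lemma cheb_coef_parity m n k : odd k != odd (m + n) -> cheb_coef (cheb int m * cheb int n) k = 0.
Proof.
have h0 l : odd l != odd n -> cheb_coef (cheb int n) l = 0.
  by move=> h; rewrite cheb_coef_cheb; case: eqP => // e; rewrite e eqxx in h.
have shift p a : (forall l, odd l != a -> cheb_coef p l = 0) ->
    forall l, odd l != ~~ a -> cheb_coef (p * 'X) l = 0 :> int.
  move=> hp l hl; rewrite cheb_coefMX /cheb_shift hp; last first.
    by move: hl => /=; case: (odd l); case: a {hp}.
  case: l hl => [|l] hl; first by rewrite addr0.
  by rewrite hp ?addr0 //; move: hl => /=; case: (odd l); case: a {hp}.
elim/nat_ind2: m k => [k|k|m IH1 IH2 k].
- by rewrite cheb0 mul1r; exact: h0.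
- by rewrite cheb1 mulrC; exact: shift.
- have -> : cheb int m.+2 * cheb int n = (cheb int m.+1 * cheb int n) * 'X - cheb int m * cheb int n.
    by rewrite chebSS; ring.
  move=> h; rewrite cheb_coefD cheb_coefN (shift _ _ IH2) ?IH1 ?subr0 //.
  by move: h; rewrite /= negbK.
Qed.

(* The terms of phi (C_x) in one dihedral factor. *)
Definition dphi (x : dword) : seq (int * dword) :=
  match x with
  | None => [:: (1, None); (1, Some (false, 0%N)); (1, Some (true, 0%N))]
  | Some (i, m) => (2, Some (i, m)) :: (1, Some (i, m.+1)) ::
      (if m is n.+1 then [:: (1, Some (i, n))] else [::])
  end.

(** The distinguished elements of one factor: the identity and the two simple reflections. *)
Definition unit_words : seq dword := [:: None; Some (false, 0%N); Some (true, 0%N)].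

(** * Representations of one dihedral factor *)

Section Representations.
Variable C : numClosedFieldType.

Lemma at_one_lint z : at_one (lint C z) = z%:~R.
Proof. exact: at_one_lmonom. Qed.

Lemma at_one_two : at_one (two_q C) = 2.
Proof. by rewrite /two_q at_oneD !at_one_lmonom. Qed.

Lemma at_one_bool (b : bool) : at_one (b%:R : laurent C) = b%:R.
Proof. by case: b; [exact: at_one1 | exact: at_one0]. Qed.

(** Of the two distinguished reflections, the one that after the twist is the last letter of x
    contributes 2 x, since tau + tau^-1 is 2 at tau = 1; the other contributes the two neighbours of
    x. *)
Lemma dphiE x e x'' :
  \sum_(u <- dphi x | u.2 == x'') (u.1%:~R : C) =
  \sum_(d <- unit_words | isSome d == isSome x'') at_one (dcoef C x (dtwist e d) x'').
Proof.
have tw : dtwist e None = None /\ forall j, dtwist e (Some (j, 0%N)) = Some (e (+) j, 0%N) by [].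
rewrite /unit_words !big_cons big_nil (proj1 tw) !(proj2 tw) !dcoefE.
case: x => [[i m]|]; last first.
  rewrite !at_one_bool /dphi !big_cons big_nil.
  by case: x'' => [[i' [|k]]|]; case: e {tw} => //; try case: i'; rewrite /= ?addr0 ?add0r.
case: x'' => [[i' k]|]; last first.
  by rewrite at_one_bool /dphi !big_cons; case: m => [|m]; rewrite ?big_cons big_nil /= addr0.
rewrite [isSome _ == _]/= [isSome (Some (false, _)) == _]/= [isSome (Some (true, _)) == _]/=.
rewrite !cheb_shift_coef cheb0 mulr1 cheb_coef_cheb.
have -> : \sum_(u <- dphi (Some (i, m)) | u.2 == Some (i', k)) (u.1%:~R : C) =
    if i == i' then ((m == k)%:R * 2 + (m.+1 == k)%:R + (m == k.+1)%:R) else 0.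
  have so (a b : bool * nat) : (Some a == Some b) = (a == b) by [].
  have cond (b : bool) (x : C) : (if b then x else 0) = b%:R * x.
    by case: b; rewrite ?mul1r ?mul0r.
  rewrite big_mkcond /dphi !big_cons !so !xpair_eqE /=.
  case hii : (i == i'); last first.
    by rewrite /= !add0r; case: m => [|m]; rewrite ?big_seq1 ?big_nil // so xpair_eqE hii.
  rewrite /= !cond mulr1 -addrA; congr (_ + (_ + _)).
  case: m => [|m]; first by rewrite big_nil.
  by rewrite big_seq1 so xpair_eqE hii cond mulr1 eqSS.
rewrite (_ : (false == true) = false) // !eqxx addr0.
case: (i == i'); last by rewrite !at_one0 !addr0.
have key (b : bool) : at_one (if b then two_q C * lint C (k == m)%:R
    else lint C ((k == m.+1)%:R + match m with 0 => 0 | n.+1 => (k == n)%:R end)) =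
    if b then (m == k)%:R * 2 else (m.+1 == k)%:R + (m == k.+1)%:R.
  case: b; first by rewrite at_oneM at_one_two at_one_lint eq_sym mulrC; case: (m == k).
  rewrite at_one_lint eq_sym intrD; congr (_ + _); first by case: (_ == k).
  by case: m => [|m] //; rewrite eqSS eq_sym; case: (m == k).
rewrite !key.
by case: (odd m); case: i; case: e {tw} => /=; ring.
Qed.

(* The simple modules of one factor: the family with parameter z attached to
   the lowest cell, and the sign characters of the highest one. *)
Inductive factor := FS of C | FN of bool.

(** In [FS z] a word with n + 1 letters followed by omega^e is cheb_n (z) times the matrix unit with
    row the first letter and column the last letter twisted by e. [FN b] has dimension 1 and is
    stored in the entry (false, false), to share the index type. *)
Definition thf (f : factor) (x : dword) (e i j : bool) : C :=
  match f, x with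
  | FS z, Some (i', n) => if (i == i') && (j == i' (+) odd n (+) e) then cheb_val z n else 0
  | FN b, None => if ~~ i && ~~ j then (-1) ^+ (b && e) else 0
  | _, _ => 0
  end.

Lemma cheb_val_mul (z : C) m n N : (m + n < N)%N ->
  \sum_(k <- iota 0 N) (cheb_coef (cheb int m * cheb int n)%R k)%:~R * cheb_val z k =
  cheb_val z m * cheb_val z n.
Proof.
move=> hN; rewrite /cheb_val -hornerM -!(map_cheb (intr : {rmorphism int -> C})) -rmorphM.
have hs : (size (cheb int m * cheb int n)%R <= N)%N.
  apply: leq_trans (size_polyMleq _ _) _; rewrite !size_cheb; lia.
rewrite [in RHS](cheb_expand_widen hs) rmorph_sum horner_sum -(big_mkord xpredT (fun k =>
  (map_poly intr (cheb_coef (cheb int m * cheb int n) k *: cheb int k)).[z])).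
rewrite /index_iota subn0; apply: eq_bigr => k _.
by rewrite map_polyZ hornerZ map_cheb.
Qed.

Lemma thf_mul f x1 e1 x2 e2 i j :
  \sum_m thf f x1 e1 i m * thf f x2 e2 m j =
  \sum_(u <- djmul x1 (dtwist e1 x2)) u.1%:~R * thf f u.2 (e1 (+) e2) i j.
Proof.
rewrite big_bool /=; case: f => [z|b]; last first.
  case: x1 x2 => [[i1 m]|] [[i2 n]|]; rewrite /djmul /dtwist.
  - rewrite !mul0r addr0; case: ifP => _; rewrite ?big_nil // big_map /= big1 // => k _.
    by rewrite mulr0.
  - by rewrite big_nil !mul0r addr0.
  - by rewrite big_nil !mulr0 addr0.
  - rewrite big_seq1 mul1r /= andbF mul0r add0r.
    case: i; case: j; rewrite /= ?mul0r ?mulr0 //.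
    by case: b; case: e1; case: e2; rewrite /= ?expr0 ?expr1 ?mulr1 ?mul1r // mulrNN mulr1.
case: x1 x2 => [[i1 m]|] [[i2 n]|]; rewrite /djmul /dtwist;
  try by rewrite ?big_nil ?big_seq1 /= ?mul0r ?mulr0 ?addr0.
case: (eqVneq (i1 (+) odd m) (e1 (+) i2)) => h; last first.
  rewrite big_nil /thf.
  have [i2E|i2E] := eqVneq i2 (i1 (+) odd m (+) e1).
    by move: h; rewrite i2E -!addbA [e1 (+) _]addbCA addbA [in X in _ != X]addbC addbC; case: (i1); case: (odd m); case: (e1).
  by case: (i == i1) => /=; rewrite ?mul0r ?addr0 //; case: (i2) (i1 (+) odd m (+) e1) i2E => [] [] //=;
    rewrite ?mul0r ?mulr0 ?addr0.
have i2E : i2 = i1 (+) odd m (+) e1 by rewrite h addbAC addbb.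
rewrite big_map /=.
have -> : \sum_(k <- iota 0 (m + n).+2) (cheb_coef (cheb int m * cheb int n)%R k)%:~R *
      (if (i == i1) && (j == i1 (+) odd k (+) (e1 (+) e2)) then cheb_val z k else 0) =
    if (i == i1) && (j == i1 (+) odd (m + n) (+) (e1 (+) e2)) then cheb_val z m * cheb_val z n else 0.
  rewrite -(@cheb_val_mul z m n (m + n).+2) //.
  transitivity (\sum_(k <- iota 0 (m + n).+2)
    if (i == i1) && (j == i1 (+) odd (m + n) (+) (e1 (+) e2))
    then (cheb_coef (cheb int m * cheb int n)%R k)%:~R * cheb_val z k else 0).
    apply: eq_bigr => k _; have [ek|ek] := eqVneq (odd k) (odd (m + n)).
      by rewrite ek; case: ifP => _; rewrite ?mulr0.
    by rewrite cheb_coef_parity // !mul0r; case: ifP.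
  by case: (_ && _) => //; rewrite big1.
rewrite /thf i2E oddD.
by case: i; case: (i1); case: (j); case: (odd m); case: (odd n); case: (e1); case: (e2);
  rewrite /= ?mul0r ?mulr0 ?addr0 ?add0r.
Qed.

(** The value of s + 1/s at the central character of the factor. For [FN b] both reflections act by
    -1 and omega by the sign (-1)^b, which gives -2 or 2. *)
Definition cval (f : factor) : C := match f with FS z => z | FN b => if b then 2 else -2 end.
Definition idf (f : factor) (i j : bool) : C :=
  match f with FS _ => (i == j)%:R | FN _ => (~~ i && ~~ j)%:R end.

(** Combinations of elements C_x that at tau = 1 become 1, s_0 + s_1 ([KX]) and s_0 s_1 + s_1 s_0 +
    2 ([KXX]). Followed by omega the second acts as s + 1/s on the factor, and the third acts as its
    square. *)
Definition KN : seq (int * dword) := [:: (1, None)].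
Definition KX : seq (int * dword) := [:: (1, Some (false, 0%N)); (1, Some (true, 0%N)); (-2, None)].
Definition KXX : seq (int * dword) := [:: (1, Some (false, 1%N)); (1, Some (true, 1%N));
  (-2, Some (false, 0%N)); (-2, Some (true, 0%N)); (4, None)].

Definition evl (K : seq (int * dword)) (f : factor) (e i j : bool) : C :=
  \sum_(a <- K) a.1%:~R * \sum_(u <- dphi a.2) u.1%:~R * thf f u.2 e i j.

Lemma evl_KN f i j : evl KN f false i j = idf f i j.
Proof.
rewrite /evl /KN big_seq1 /= !big_cons big_nil /= /idf; case: f => [z|b];
  case: i; case: j; rewrite /= ?cheb_val0 ?andbF ?expr0 ?mulr0 ?mulr1 ?mul1r ?addr0 ?add0r //.
Qed.

Lemma evl_KX f i j : evl KX f true i j = cval f * idf f i j.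
Proof.
rewrite /evl /KX !big_cons !big_nil /= /idf; case: f => [z|b];
  case: i; case: j; rewrite /= ?cheb_val0 ?cheb_val1; try ring.
case: b; rewrite /= ?expr1 ?expr0; ring.
Qed.

Lemma evl_KXX f i j : evl KXX f false i j = cval f * cval f * idf f i j.
Proof.
rewrite /evl /KXX !big_cons !big_nil /= /idf; case: f => [z|b];
  case: i; case: j; rewrite /= ?cheb_valSS ?cheb_val0 ?cheb_val1; try ring.
case: b; rewrite /= ?expr1 ?expr0; ring.
Qed.

(** [Star] has the same factors as the origin of the plane; [block] selects its summand. For
    [Point false] the values [cval] are (-2, -2), which is [base] up to sign and so
    indistinguishable for even functions. *)
Definition factors (s : expt C) : factor * factor :=
  match s with
  | Plane p => (FS p.1, FS p.2)
  | Star => (FS 0, FS 0)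
  | Line b x => if b then (FS x, FN false) else (FN false, FS x)
  | Point b => (FN b, FN false)
  end.

(** Only XY carries omega: X and Y need it separately, and it is shared by the two factors, so
    neither is available alone. *)
Definition Kquad (u : option bool) : seq (int * dword) * seq (int * dword) * bool :=
  match u with
  | None => (KX, KX, true)
  | Some true => (KXX, KN, false)
  | Some false => (KN, KXX, false)
  end.

Lemma evl_quad u s i j :
  evl (Kquad u).1.1 (factors s).1 (Kquad u).2 i.1 j.1 * evl (Kquad u).1.2 (factors s).2 (Kquad u).2 i.2 j.2 =
  quad u (base s) * (idf (factors s).1 i.1 j.1 * idf (factors s).2 i.2 j.2).
Proof.
have -> : quad u (base s) = match u with
    | None => cval (factors s).1 * cval (factors s).2
    | Some true => cval (factors s).1 * cval (factors s).1
    | Some false => cval (factors s).2 * cval (factors s).2 end.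
  by case: u => [[]|]; case: s => [p||b x|b] /=; try case: b; rewrite /= ?expr0 ?expr1; ring.
case: u => [[]|]; rewrite /Kquad /= ?evl_KN ?evl_KX ?evl_KXX; ring.
Qed.
End Representations.

Lemma fcomb_supp (I : choiceType) (R : pzRingType) (V : lmodType R) (F : I -> V) (c : fsfunc I R)
    (s : seq I) : uniq s -> (forall i, i \notin s -> coeff c i = 0 \/ F i = 0) ->
  fcomb F c = \sum_(i <- s) coeff c i *: F i.
Proof.
move=> us h; rewrite /fcomb (fsbigE s) //=; last first.
  by move=> i _ /h[] ->; rewrite ?scale0r ?scaler0.
by apply: eq_bigl => i; rewrite in_setT.
Qed.

Lemma cheb_val_odd0 (C : numClosedFieldType) n : odd n -> cheb_val (0 : C) n = 0.
Proof.
elim/nat_ind2: n => [||n IH _] //; first by rewrite cheb_val1.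
by rewrite /= negbK => h; rewrite cheb_valSS IH // mul0r subr0.
Qed.

Definition TJ (n : nat) : finType :=
  match n with
  | 0 => (bool * bool)%type
  | 1 | 2 => bool
  | _ => unit
  end.

(** * Representations of J and their joint faithfulness *)

Section Asymptotic.
Variables (C : numClosedFieldType) (G : {group weylG2}).
Hypothesis hG : G = klein :> {set weylG2}.
Variable D : kl_datum C G.
Local Notation W := (ext_affine G).
Local Notation wel := (wel hG).
Local Notation k := (coordring (orbit_variety C G)).
Local Notation iota := (cst_morph (orbit_variety C G)).

Definition emb (s : expt C) : TJ (kind s) -> bool * bool :=
  match s with
  | Plane _ => fun i => i
  | Star => fun b => (b, ~~ b)
  | Line b _ => fun i => if b then (i, false) else (false, i)
  | Point _ => fun _ => (false, false)
  end.

(** The indices among the four on which the representation at s lives. At the origin the parity of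
    i.1 + i.2 is preserved; pt_* takes the odd part, and the even part is left to the plane. *)
Definition block (s : expt C) (i : bool * bool) : bool :=
  match s with
  | Plane _ => true
  | Star => i.1 (+) i.2
  | Line b _ => if b then ~~ i.2 else ~~ i.1
  | Point _ => ~~ i.1 && ~~ i.2
  end.

Lemma emb_block s i : block s (@emb s i).
Proof. by case: s i => [p||b x|b] //=; [case | case: b]. Qed.

Lemma sum_block s (F : bool * bool -> C) : (forall i, ~~ block s i -> F i = 0) ->
  \sum_i F i = \sum_(m : TJ (kind s)) F (@emb s m).
Proof.
have e : \sum_i F i = (F (true, true) + F (true, false)) + (F (false, true) + F (false, false)).
  transitivity (\sum_a \sum_b F (a, b)); last by rewrite !big_bool.
  by rewrite pair_bigA; apply: eq_bigr => -[].
move=> h; case: s h => [p||b x|b] h //.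
- by rewrite e big_bool /= (h (true, true)) // (h (false, false)) // addr0 add0r.
- rewrite e; case: b h => h; rewrite big_bool /=.
    by rewrite (h (true, true)) // (h (false, true)) // !add0r.
  by rewrite (h (true, true)) // (h (true, false)) // !add0r.
- rewrite e (h (true, true)) // (h (true, false)) // (h (false, true)) // !add0r.
  by rewrite (big_pred1 tt) // => -[].
Qed.

Definition ths (s : expt C) (w : W) (i j : bool * bool) : C :=
  thf (factors s).1 (nf w).1.1 (nf w).2 i.1 j.1 * thf (factors s).2 (nf w).1.2 (nf w).2 i.2 j.2.

Lemma ths_wel s x y e i j : ths s (wel x y e) i j =
  thf (factors s).1 x e i.1 j.1 * thf (factors s).2 y e i.2 j.2.
Proof. by rewrite /ths nf_wel. Qed.

(** For pt_*: leaving the odd indices requires an odd Chebyshev polynomial in one of the two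
    factors, and these vanish at 0. *)
Lemma ths_block s w i j : block s i -> ~~ block s j -> ths s w i j = 0.
Proof.
have [x [y [e ->]]] := wel_cases hG w; rewrite ths_wel.
case: s => [p||b z|b] //=.
- case: x => [[i1 m]|] /=; last by rewrite mul0r.
  case: y => [[i2 n]|] /=; last by rewrite mulr0.
  case: i j => [a a'] [c c'] /= h1 h2.
  do 2!(case: ifP => [/andP[/eqP ? /eqP ?]|_]; last by rewrite ?mul0r ?mulr0).
  subst; have [on|on] : odd m \/ odd n.
    by case: (odd m) h2; case: (odd n); case: (i1) h1; case: (i2); case: (e); by [left|right|].
  by rewrite (cheb_val_odd0 C on) mul0r.
  by rewrite (cheb_val_odd0 C on) mulr0.
- case: b => /=.
    by case: y => [[i2 n]|] /=; rewrite ?mulr0 // negbK => /negPf; case: (j.2) => //; rewrite andbF mulr0.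
  by case: x => [[i2 n]|] /=; rewrite ?mul0r // negbK => /negPf; case: (j.1) => //; rewrite andbF mul0r.
- case: x => [[i1 m]|] /=; last case: y => [[i2 n]|] /=; rewrite ?mul0r ?mulr0 //.
  move=> _; rewrite negb_and !negbK => /orP[] ->; rewrite andbF ?mul0r ?mulr0 //.
Qed.

Variables (J : kalg k) (t : W -> restr iota J) (Dist : set W).
Variable phi : {linear fsfunc W C -> restr iota J}.
Hypothesis hJ : asymptotic_algebra D t Dist phi.

Let hb := asym_basis hJ.
Definition coordJ (x : J) : fsfunc W C := basis_coord hb (x : restr iota J).

Lemma coordJD x y : coordJ (x + y) = coordJ x + coordJ y.
Proof. exact: basis_coordD. Qed.
Lemma coordJZ c x : coordJ (iota c *: x) = c *: coordJ x.
Proof. exact: (basis_coordZ hb c x). Qed.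
Lemma coordJ_t w : coordJ (t w) = fdelta w 1.
Proof. exact: basis_coord_basis. Qed.
Lemma coordJ_fcomb c : coordJ (fcomb t c) = c.
Proof. exact: basis_coordK. Qed.
Lemma coordJ_expand (x : J) : (x : restr iota J) = fcomb t (coordJ x).
Proof. exact: basis_expand. Qed.

Lemma t_mul x1 y1 e1 x2 y2 e2 : restr_mul (t (wel x1 y1 e1)) (t (wel x2 y2 e2)) =
  \sum_(u <- djmul x1 (dtwist e1 x2)) \sum_(v <- djmul y1 (dtwist e1 y2))
    (u.1%:~R * v.1%:~R : C) *: t (wel u.2 v.2 (e1 (+) e2)).
Proof.
rewrite (asym_mul hJ); set c : fsfunc W C :=
  \sum_(u <- djmul x1 (dtwist e1 x2)) \sum_(v <- djmul y1 (dtwist e1 y2))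
    fdelta (wel u.2 v.2 (e1 (+) e2)) (u.1%:~R * v.1%:~R).
transitivity (fcomb t c); last first.
  rewrite fcomb_sum; apply: eq_bigr => u _; rewrite fcomb_sum; apply: eq_bigr => v _.
  by rewrite fcomb_delta.
apply: eq_fsbigr => w _; congr (_ *: _).
have [x [y [e ->]]] := wel_cases hG w; rewrite gamma_wel /c coeff_sum -!djmulE.
under [RHS]eq_bigr do rewrite coeff_sum.
under [RHS]eq_bigr do under eq_bigr do rewrite coeff_fdelta.
have weE a b f : (wel x y e == wel a b f) = [&& a == x, b == y & e == f].
  by apply/eqP/and3P => [/wel_inj[-> -> ->]|[/eqP -> /eqP -> /eqP ->]].
under [RHS]eq_bigr do under eq_bigr do rewrite weE.
case: (e == _); last first.
  by rewrite big1 // => u _; rewrite big1 // => v _; rewrite !andbF.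
rewrite intrM !rmorph_sum big_distrlr /= [LHS]big_mkcond; apply: eq_bigr => u _.
case: eqP => [_|_]; last by rewrite big1.
by rewrite [LHS]big_mkcond; apply: eq_bigr => v _; rewrite andbT.
Qed.

Definition rep (s : expt C) (x : J) (i j : bool * bool) : C :=
  fcomb (fun w => ths s w i j : C^o) (coordJ x).

Lemma repD s x y i j : rep s (x + y) i j = rep s x i j + rep s y i j.
Proof. by rewrite /rep coordJD fcombD. Qed.
Lemma repZ s c x i j : rep s (iota c *: x) i j = c * rep s x i j.
Proof. by rewrite /rep coordJZ fcombZ. Qed.
Lemma rep_t s w i j : rep s (t w) i j = ths s w i j.
Proof. by rewrite /rep coordJ_t fcomb_delta scale1r. Qed.
Lemma rep0 s i j : rep s 0 i j = 0.
Proof. by apply: (addrI (rep s 0 i j)); rewrite -repD !addr0. Qed.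
Lemma rep_sum s (I : Type) (r : seq I) (F : I -> J) i j :
  rep s (\sum_(u <- r) F u) i j = \sum_(u <- r) rep s (F u) i j.
Proof. by elim: r => [|u r IH]; rewrite ?big_nil ?rep0 // !big_cons repD IH. Qed.

Lemma J_ind (P : J -> Prop) : P 0 -> (forall w c, P (iota c *: (t w : J))) ->
  (forall x y, P x -> P y -> P (x + y)) -> forall x, P x.
Proof. by move=> P0 Pt PD x; exact: (basis_ind hb P0 (fun w c => Pt w c) PD). Qed.

Lemma rep_mul s x y i j : rep s (x ** y) i j = \sum_m rep s x i m * rep s y m j.
Proof.
elim/J_ind: x => [|w c|x x' IH IH'].
- by rewrite kmul0l rep0 big1 // => m _; rewrite rep0 mul0r.
- elim/J_ind: y => [|w' c'|y y' IH IH'].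
  + by rewrite kmul0r rep0 big1 // => m _; rewrite rep0 mulr0.
  + rewrite kmulZl kmulZr !repZ.
    under eq_bigr do rewrite !repZ !rep_t mulrACA.
    rewrite -mulr_sumr mulrA; congr (_ * _).
    have [x1 [y1 [e1 ->]]] := wel_cases hG w; have [x2 [y2 [e2 ->]]] := wel_cases hG w'.
    rewrite -[kmul _ _]/(restr_mul (t (wel x1 y1 e1)) (t (wel x2 y2 e2))) t_mul.
    under [RHS]eq_bigr do rewrite !ths_wel mulrACA.
    rewrite -(pair_bigA _ (fun a b => thf (factors s).1 x1 e1 i.1 a * thf (factors s).1 x2 e2 a j.1 *
      (thf (factors s).2 y1 e1 i.2 b * thf (factors s).2 y2 e2 b j.2))) /=.
    under [RHS]eq_bigr do rewrite -mulr_sumr.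
    rewrite -mulr_suml !thf_mul.
    rewrite rep_sum mulr_suml; apply: eq_bigr => u _; rewrite rep_sum mulr_sumr.
    apply: eq_bigr => v _.
    by rewrite -[_ *: t _]/(iota (u.1%:~R * v.1%:~R) *: (t _ : J)) repZ rep_t ths_wel mulrACA.
  + rewrite kmulDr !repD IH IH' -big_split; apply: eq_bigr => m _.
    by rewrite repD mulrDr.
- rewrite kmulDl !repD IH IH' -big_split; apply: eq_bigr => m _.
  by rewrite repD mulrDl.
Qed.

Definition rhoJ (s : expt C) (x : J) (i j : TJ (kind s)) : C := rep s x (@emb s i) (@emb s j).

Lemma rep_block s x i j : block s i -> ~~ block s j -> rep s x i j = 0.
Proof.
move=> h1 h2; elim/J_ind: x => [|w c|x y hx hy]; first exact: rep0.
  by rewrite repZ rep_t ths_block ?mulr0.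
by rewrite repD hx hy addr0.
Qed.

Lemma rhoJ_mul s x y i j : @rhoJ s (x ** y) i j = \sum_m @rhoJ s x i m * @rhoJ s y m j.
Proof.
rewrite /rhoJ rep_mul (@sum_block s) // => m hm.
by rewrite rep_block ?mul0r ?emb_block.
Qed.

(** A polynomial with more roots than its degree is 0; distinct natural numbers provide enough
    points in characteristic 0. *)
Lemma cheb_independent (a : nat -> C) N : (forall z, \sum_(n <- index_iota 0 N) a n * cheb_val z n = 0) ->
  forall n, (n < N)%N -> a n = 0.
Proof.
move=> h n hn; pose P : {poly C} := \sum_(m <- index_iota 0 N) a m *: cheb C m.
have P0 : P = 0.
  apply/eqP; apply: contraT => Pn0.
  have [s [us hs]] : exists s : seq C, uniq s /\ size s = size P.
    exists [seq (m%:R : C) | m <- seq.iota 0 (size P)]; rewrite size_map size_iota; split=> //.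
    by rewrite map_inj_uniq ?iota_uniq // => m m' /eqP; rewrite eqr_nat => /eqP.
  have : (size s < size P)%N.
    apply: max_poly_roots Pn0 _ us; apply/allP => z _; apply/rootP.
    rewrite /P horner_sum -[RHS](h z); apply: eq_bigr => m _; by rewrite hornerZ.
  by rewrite hs ltnn.
have := congr1 (fun p : {poly C} => cheb_coef p n) P0; rewrite /= cheb_coef0 => <-.
have cs : {morph (fun p : {poly C} => cheb_coef p n) : p q / p + q} by move=> p q; exact: cheb_coefD.
rewrite /P (big_morph _ cs (cheb_coef0 C n)) (bigD1_seq n) ?mem_index_iota ?iota_uniq //=.
rewrite cheb_coefZ cheb_coef_cheb eqxx mulr1 big1 ?addr0 // => m hm.
by rewrite cheb_coefZ cheb_coef_cheb eq_sym (negPf hm) mulr0.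
Qed.

Lemma coord_bound (c : fsfunc W C) : exists N, forall x y e, coeff c (wel x y e) != 0 ->
  (dlen x <= N)%N /\ (dlen y <= N)%N.
Proof.
have [s [us hs]] := fs_cover c; exists (\max_(w <- s) ea_length w)%N => x y e h.
have ws : wel x y e \in s by apply: contraNT h => /hs ->.
suff : (dlen x + dlen y <= \max_(w <- s) ea_length w)%N by lia.
by rewrite -(ea_length_wel hG x y e) (big_rem _ ws) /= leq_maxl.
Qed.

(** The two characters of the group generated by omega separate its two elements. *)
Lemma faithful_points x : (forall b i j, @rhoJ (Point b) x i j = 0) ->
  forall e, coeff (coordJ x) (wel None None e) = 0.
Proof.
move=> h; pose c e := coeff (coordJ x) (wel None None e).
have hc (b : bool) : c false + (-1) ^+ b * c true = 0.
  rewrite -[RHS](h b tt tt) /rhoJ /rep.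
  rewrite (@fcomb_supp _ _ _ _ _ [:: wel None None false; wel None None true]).
  - by rewrite big_cons big_seq1 !ths_wel /= /GRing.scale /= andbT !andbF expr0 !mulr1 [X in _ + X]mulrC.
  - by rewrite /= inE andbT; apply/eqP => /wel_inj.
  - move=> w; have [a [a' [e ->]]] := wel_cases hG w => hw; right; rewrite ths_wel.
    case: a hw => [[i0 n0]|] hw; first by rewrite /= mul0r.
    case: a' hw => [[i0 n0]|] hw; first by rewrite /= mulr0.
    by move: hw; rewrite !inE; case: e; rewrite eqxx ?orbT.
have h0 := hc false; have h1 := hc true; rewrite expr0 mul1r in h0; rewrite expr1 mulN1r in h1.
have c1 : c true = 0.
  have : c true *+ 2 = 0 by rewrite -[RHS](subrr (c false + c true)) {2}h0 -h1 mulr2n; ring.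
  by move/eqP; rewrite mulrn_eq0 => /eqP.
by case; rewrite -/(c _) //; move: h0; rewrite c1 addr0.
Qed.

Definition lword (b : bool) (x : dword) (e : bool) : W := if b then wel x None e else wel None x e.

(** A fixed entry (i, j) sees only the words beginning with i, with the exponent [E m] of omega
    forced by the length. As a function of z it is a combination of Chebyshev polynomials, whose
    coefficients therefore vanish. *)
Lemma faithful_lines b x : (forall z i j, @rhoJ (Line b z) x i j = 0) ->
  forall i n e, coeff (coordJ x) (lword b (Some (i, n)) e) = 0.
Proof.
move=> h i n e; pose j := i (+) odd n (+) e; pose E (m : nat) := i (+) j (+) odd m.
have [N hN] := coord_bound (coordJ x).
pose w m := lword b (Some (i, m)) (E m).
have En : E n = e by rewrite /E /j; case: (i); case: (odd n); case: (e).
have [hn|hn] := ltnP n N.+1; last first.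
  apply/eqP; apply: contraT; rewrite /lword; case: (b) => /hN[] /= h1 h2.
    by have := leq_ltn_trans h1 hn; rewrite ltnNge leqnSn.
  by have := leq_ltn_trans h2 hn; rewrite ltnNge leqnSn.
rewrite -En -/(w n).
apply: (@cheb_independent (fun m => coeff (coordJ x) (w m)) N.+1) => // z.
rewrite -[RHS](h z i j) /rhoJ /rep (@fcomb_supp _ _ _ _ _ [seq w m | m <- index_iota 0 N.+1]).
- rewrite big_map; apply: eq_bigr => m _; rewrite /GRing.scale /=; congr (_ * _).
  have jE : j = i (+) odd m (+) E m by rewrite /E; case: (i); case: (j); case: (odd m).
  by rewrite /w /lword; case: (b); rewrite ths_wel /= !eqxx -jE eqxx ?expr0 ?mulr1 ?mul1r.
- rewrite map_inj_uniq ?iota_uniq // => m m'.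
  by rewrite /w /lword; case: (b) => /wel_inj[].
- move=> v; have [x1 [y1 [f ->]]] := wel_cases hG v => hv.
  have [c0|c0] := eqVneq (coeff (coordJ x) (wel x1 y1 f)) 0; [by left | right].
  have [b1 b2] := hN _ _ _ c0; rewrite ths_wel.
  move: hv; rewrite /w /lword; case: (b) => hv.
    case: y1 b2 hv c0 => [[i0 n0]|] b2 hv c0; rewrite /= ?mulr0 //.
    case: x1 b1 hv c0 => [[i1 m]|] b1 hv c0; rewrite /= ?mul0r //.
    case: ifP => [/andP[/eqP ei /eqP ej]|_]; last by rewrite mul0r.
    case/negP: hv; apply/mapP; exists m; first by rewrite mem_index_iota /=; apply: leq_trans b1 _.
    rewrite ei; congr (wel _ _ _).
    by rewrite /E ei ej; case: (i1); case: (odd m); case: (f).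
  case: x1 b1 hv c0 => [[i0 n0]|] b1 hv c0; rewrite /= ?mul0r //.
  case: y1 b2 hv c0 => [[i1 m]|] b2 hv c0; rewrite /= ?mulr0 //.
  case: ifP => [/andP[/eqP ei /eqP ej]|_]; last by rewrite mulr0.
  case/negP: hv; apply/mapP; exists m; first by rewrite mem_index_iota /=; apply: leq_trans b2 _.
  rewrite ei; congr (wel _ _ _).
  by rewrite /E ei ej; case: (i1); case: (odd m); case: (f).
Qed.

(** The argument for a line, applied in each of the two variables. The first factor already fixes
    the exponent of omega, so the second one only imposes the compatibility [cd]. *)
Lemma faithful_plane x : (forall p i j, @rhoJ (Plane p) x i j = 0) ->
  forall i1 n1 i2 n2 e, coeff (coordJ x) (wel (Some (i1, n1)) (Some (i2, n2)) e) = 0.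
Proof.
move=> h i1 n1 i2 n2 e.
pose j1 := i1 (+) odd n1 (+) e; pose j2 := i2 (+) odd n2 (+) e.
pose E (m : nat) := i1 (+) j1 (+) odd m.
have [N hN] := coord_bound (coordJ x).
pose w m m' := wel (Some (i1, m)) (Some (i2, m')) (E m).
have En : E n1 = e by rewrite /E /j1; case: (i1); case: (odd n1); case: (e).
have [c0|c0] := eqVneq (coeff (coordJ x) (wel (Some (i1, n1)) (Some (i2, n2)) e)) 0 => //.
have [hn1 hn2] := hN _ _ _ c0.
pose cd m m' := j2 == i2 (+) odd m' (+) E m.
have e0 : coeff (coordJ x) (wel (Some (i1, n1)) (Some (i2, n2)) e) =
    if cd n1 n2 then coeff (coordJ x) (w n1 n2) else 0 by rewrite /cd /w En eqxx.
rewrite e0 => {e0 c0}; move: n2 hn2 @j2 @cd => n2' hn2 j2 cd.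
apply: (@cheb_independent (fun m' => if cd n1 m' then coeff (coordJ x) (w n1 m') else 0) N.+1);
  last by apply: leq_trans hn2 _.
move=> z2.
apply: (@cheb_independent (fun m => \sum_(m' <- index_iota 0 N.+1)
  (if cd m m' then coeff (coordJ x) (w m m') else 0) * cheb_val z2 m') N.+1); last by apply: leq_trans hn1 _.
move=> z1; rewrite -[RHS](h (z1, z2) (i1, i2) (j1, j2)) /rhoJ /rep.
rewrite (@fcomb_supp _ _ _ _ _ [seq w m m' | m <- index_iota 0 N.+1, m' <- index_iota 0 N.+1]).
- rewrite big_allpairs_dep; apply: eq_bigr => m _; rewrite mulr_suml; apply: eq_bigr => m' _.
  have jE : j1 = i1 (+) odd m (+) E m by rewrite /E; case: (i1); case: (j1); case: (odd m).
  rewrite /GRing.scale /= /w ths_wel /= !eqxx -jE eqxx /= /cd.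
  by case: ifP => _; ring.
- apply: allpairs_uniq; rewrite ?iota_uniq // => -[m m'] [l l'] _ _ /=.
  by move=> /wel_inj[-> ->].
- move=> v; have [x1 [y1 [f ->]]] := wel_cases hG v => hv.
  have [c0|c0] := eqVneq (coeff (coordJ x) (wel x1 y1 f)) 0; [by left | right].
  have [b1 b2] := hN _ _ _ c0; rewrite ths_wel.
  case: x1 b1 hv c0 => [[i m]|] b1 hv c0; rewrite /= ?mul0r //.
  case: y1 b2 hv c0 => [[i' m']|] b2 hv c0; rewrite /= ?mulr0 //.
  case: ifP => [/andP[/eqP ei /eqP ej]|_]; last by rewrite mul0r.
  case: ifP => [/andP[/eqP ei' /eqP ej']|_]; last by rewrite mulr0.
  case/negP: hv; apply/allpairsP; exists (m, m'); rewrite !mem_index_iota /=; split.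
  + by apply: leq_trans b1 _.
  + by apply: leq_trans b2 _.
  rewrite /w ei ei'; congr (wel _ _ _).
  by rewrite /E ei ej; case: (i); case: (odd m); case: (f).
Qed.

Lemma rhoJ_faithful x : (forall s i j, @rhoJ s x i j = 0) -> x = 0.
Proof.
move=> h; have c0 : coordJ x = 0.
  apply: coeff_inj; apply/funext => w; rewrite coeff0.
  have [a [b [e ->]]] := wel_cases hG w.
  case: a b => [[i m]|] [[i' m']|].
  - by apply: faithful_plane => p; exact: h.
  - by apply: (@faithful_lines true) => z; exact: h.
  - by apply: (@faithful_lines false) => z; exact: h.
  - by apply: faithful_points => b; exact: h.
by have := coordJ_expand x; rewrite c0 fcomb0.
Qed.

Lemma rhoJD s x y i j : @rhoJ s (x + y) i j = @rhoJ s x i j + @rhoJ s y i j.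
Proof. exact: repD. Qed.

Lemma rhoJ_eq x y : (forall s i j, @rhoJ s x i j = @rhoJ s y i j) -> x = y.
Proof.
move=> h; apply/eqP; rewrite -subr_eq0; apply/eqP/rhoJ_faithful => s i j.
have : @rhoJ s (x - y + y) i j = @rhoJ s y i j by rewrite subrK h.
by rewrite rhoJD => /eqP; rewrite -subr_eq0 addrK => /eqP.
Qed.

Lemma idf_emb s i j :
  idf (factors s).1 (@emb s i).1 (@emb s j).1 * idf (factors s).2 (@emb s i).2 (@emb s j).2 = (i == j)%:R :> C.
Proof.
case: s i j => [p||b x|b] /=.
- by move=> [a a'] [c c']; rewrite xpair_eqE /=; case: (a == c); rewrite ?mul1r ?mul0r.
- by move=> [] [] /=; rewrite ?mul1r ?mul0r.
- by case: b => i j /=; rewrite ?mulr1 ?mul1r.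
- by move=> [] []; rewrite mulr1.
Qed.

Definition unit_elts : seq W := [seq wel a b false | a <- unit_words, b <- unit_words].

Lemma rhoJ_unit s i j : @rhoJ s (\sum_(d <- unit_elts) t d) i j = (i == j)%:R.
Proof.
rewrite /rhoJ rep_sum big_allpairs_dep -idf_emb -!evl_KN /evl !big_seq1 !mul1r.
have eu f a b : \sum_(u <- dphi None) u.1%:~R * thf f u.2 false a b =
    \sum_(u <- unit_words) thf f u false a b :> C.
  by rewrite !big_cons !big_nil !mul1r.
rewrite !eu big_distrlr /=; apply: eq_bigr => a _; apply: eq_bigr => b _.
by rewrite rep_t ths_wel.
Qed.

Lemma unit_elts_unit : @is_kunit _ J (\sum_(d <- unit_elts) t d).
Proof.
move=> x; split; apply: rhoJ_eq => s i j; rewrite rhoJ_mul.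
  rewrite (bigD1 i) //= rhoJ_unit eqxx mul1r big1 ?addr0 // => m hm.
  by rewrite rhoJ_unit eq_sym (negPf hm) mul0r.
rewrite (bigD1 j) //= rhoJ_unit eqxx mulr1 big1 ?addr0 // => m hm.
by rewrite rhoJ_unit (negPf hm) mulr0.
Qed.

Lemma unit_elts_uniq : uniq unit_elts.
Proof. by apply: allpairs_uniq => // -[a b] [a' b'] _ _ /= /wel_inj[-> ->]. Qed.

(** The set [Dist] is only known through its sum being the unit. As the unit is unique and the t_w
    are independent, [Dist] consists of the nine products of [unit_words]. *)
Lemma dist_sum (V : nmodType) (F : W -> V) : \sum_(d \in Dist) F d = \sum_(d <- unit_elts) F d.
Proof.
have /finite_seqP[r0 hr0] := asym_finite hJ; pose r := undup r0.
have hr : Dist = [set` r] by rewrite hr0; apply/seteqP; split=> w /=; rewrite mem_undup.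
have us : uniq r by exact: undup_uniq.
have sumr (U : nmodType) (H : W -> U) : \sum_(d \in Dist) H d = \sum_(d <- r) H d.
  by rewrite hr -fsbig_seq // us.
have e := kunit_unique (asym_unit hJ) unit_elts_unit; rewrite sumr in e.
have cs (q : seq W) : coordJ (\sum_(d <- q) t d) = \sum_(d <- q) fdelta d 1.
  elim: q => [|d q IH]; last by rewrite !big_cons coordJD coordJ_t IH.
  by rewrite !big_nil; apply: (addrI (coordJ 0)); rewrite -coordJD !addr0.
have mem_coeff (q : seq W) w : uniq q -> coeff (\sum_(d <- q) fdelta d 1) w = (w \in q)%:R :> C.
  move=> uq; rewrite coeff_sum; have [wq|wq] := boolP (w \in q).
    rewrite (bigD1_seq w) //= coeff_fdelta eqxx big1 ?addr0 // => v hv.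
    by rewrite coeff_fdelta eq_sym (negPf hv).
  rewrite big_seq big1 // => v hv; rewrite coeff_fdelta; case: eqP => // e'.
  by rewrite e' hv in wq.
have pe : perm_eq r unit_elts.
  apply: (uniq_perm us unit_elts_uniq) => w.
  have := congr1 (fun z => coeff (coordJ z) w) e.
  rewrite !cs (mem_coeff r w us) (mem_coeff _ w unit_elts_uniq).
  by case: (w \in r); case: (w \in unit_elts) => // /eqP; rewrite ?oner_eq0 // eq_sym oner_eq0.
by rewrite sumr; exact: perm_big.
Qed.
End Asymptotic.

(** * The action of k on the representations of J *)

Section CenterAction.
Variables (C : numClosedFieldType) (G : {group weylG2}).
Hypothesis hG : G = klein :> {set weylG2}.
Variable D : kl_datum C G.
Local Notation W := (ext_affine G).
Local Notation wel := (wel hG).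
Local Notation k := (coordring (orbit_variety C G)).
Local Notation iota := (cst_morph (orbit_variety C G)).
Local Notation aff := (aff hG).

Definition klC (x y : dword) (e : bool) : fsfunc W C :=
  \sum_(p <- (1, x) :: dlow C x) \sum_(q <- (1, y) :: dlow C y)
    fdelta (wel p.2 q.2 e) (at_one p.1 * at_one q.1).

Lemma klC_at_one x y e : is_kl_at_one D (wel x y e) (klC x y e).
Proof.
move=> w; have h v (a : laurent C) : at_one (coeff (fdelta v a) w) = coeff (fdelta v (at_one a)) w.
  by rewrite !coeff_fdelta; case: eqP; rewrite ?at_one0.
rewrite /klC coeff_sum big_cons coeff_sum big_cons at_one1 mulr1.
rewrite (P_wel hG) coeffD coeff_sum at_oneD h at_one1 at_one_sum /kl_lower big_cat big_map big_allpairs_dep /=.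
rewrite -addrA; congr (_ + (_ + _)).
  by apply: eq_bigr => v _; rewrite h mul1r.
by apply: eq_bigr => u _; rewrite coeff_sum; apply: eq_bigr => v _; rewrite h at_oneM.
Qed.

Variables (J : kalg k) (t : W -> restr iota J) (Dist : set W).
Variable phi : {linear fsfunc W C -> restr iota J}.
Hypothesis hJ : asymptotic_algebra D t Dist phi.
Local Notation rep := (rep hJ).
Local Notation rJ s x i j := (@rhoJ _ _ _ _ _ _ _ hJ s x i j).

(** The condition a(z) = a(d) splits over the factors: where a structure constant is non-zero, z is
    at least as non-trivial as d in each factor, so equal sums force equality in both. Hence [phi]
    is a product of two copies of [dphi]. *)
Lemma phi_klC x y e : phi (klC x y e) = \sum_(u <- dphi x) \sum_(v <- dphi y)
  (u.1%:~R * v.1%:~R : C) *: t (wel u.2 v.2 e).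
Proof.
rewrite (asym_phi hJ (klC_at_one x y e)); set c : fsfunc W C :=
  \sum_(u <- dphi x) \sum_(v <- dphi y) fdelta (wel u.2 v.2 e) (u.1%:~R * v.1%:~R).
transitivity (fcomb t c); last first.
  rewrite fcomb_sum; apply: eq_bigr => u _; rewrite fcomb_sum; apply: eq_bigr => v _.
  by rewrite fcomb_delta.
apply: eq_fsbigr => w _; congr (_ *: _).
have [x' [y' [e' ->]]] := wel_cases hG w; rewrite /c coeff_sum.
under [RHS]eq_bigr do rewrite coeff_sum.
under [RHS]eq_bigr do under eq_bigr do rewrite coeff_fdelta.
have weE a b f : (wel x' y' e' == wel a b f) = [&& a == x', b == y' & e' == f].
  by apply/eqP/and3P => [/wel_inj[-> -> ->]|[/eqP -> /eqP -> /eqP ->]].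
under [RHS]eq_bigr do under eq_bigr do rewrite weE.
rewrite (dist_sum hG hJ) /unit_elts big_allpairs_dep.
have [->|ee] := eqVneq e' e; last first.
  rewrite big1 => [|a _]; last rewrite big1 // => b _.
    by rewrite big1 // => u _; rewrite big1 // => v _; rewrite !andbF.
  by rewrite h_wel addbF (negPf ee) at_one0 if_same.
transitivity ((\sum_(u <- dphi x | u.2 == x') (u.1%:~R : C)) * \sum_(v <- dphi y | v.2 == y') v.1%:~R).
  rewrite !(dphiE _ _ e) big_distrlr /= [RHS]big_mkcond; apply: eq_bigr => a _.
  case: ifP => ha.
    rewrite [RHS]big_mkcond.
    apply: eq_bigr => b _; rewrite h_wel addbF eqxx !a_wel at_oneM.
    have [->|/dcoef_some] := eqVneq (dcoef C y (dtwist e b) y') 0; first by rewrite at_one0 mulr0 !if_same.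
    by rewrite /nS (eqP ha) eqn_add2l eq_sym dtwist_some; case: (isSome b); case: (isSome y').
  rewrite big1 // => b _; rewrite h_wel addbF eqxx !a_wel at_oneM.
  have [->|/dcoef_some] := eqVneq (dcoef C y (dtwist e b) y') 0; first by rewrite at_one0 mulr0 !if_same.
  have [->|/dcoef_some] := eqVneq (dcoef C x (dtwist e a) x') 0; first by rewrite at_one0 mul0r !if_same.
  rewrite /nS !dtwist_some; move: ha.
  by case: (isSome a); case: (isSome x'); case: (isSome b); case: (isSome y'); rewrite ?orbT.
rewrite big_distrlr /= big_mkcond; apply: eq_bigr => u _.
case: eqP => [_|_]; last by rewrite big1.
by rewrite big_mkcond; apply: eq_bigr => v _; rewrite andbT.
Qed.

(* [K] is a combination of elements C_x, expanded in the standard basis at tau = 1. *)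
Definition std_expand (V : lmodType C) (K : seq (int * dword)) (F : dword -> V) : V :=
  \sum_(a <- K) (a.1%:~R : C) *: \sum_(p <- (1, a.2) :: dlow C a.2) at_one p.1 *: F p.2.

Definition quad_elt (u : option bool) : fsfunc W C :=
  std_expand (Kquad u).1.1 (fun p => std_expand (Kquad u).1.2
    (fun q => fdelta (wel p q (Kquad u).2) 1)).

Lemma quad_eltE u : quad_elt u = \sum_(a <- (Kquad u).1.1) \sum_(b <- (Kquad u).1.2)
  (a.1%:~R * b.1%:~R : C) *: klC a.2 b.2 (Kquad u).2.
Proof.
rewrite /quad_elt /std_expand; apply: eq_bigr => a _.
under eq_bigr do rewrite scaler_sumr.
rewrite exchange_big scaler_sumr; apply: eq_bigr => b _ /=.
rewrite -scalerA; congr (_ *: _); rewrite scaler_sumr; apply: eq_bigr => p _.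
rewrite !scaler_sumr; apply: eq_bigr => q _; apply: coeff_inj; apply/funext => w.
rewrite !coeffZ !coeff_fdelta; case: eqP => _; last by rewrite !mulr0.
by rewrite !mulr1; ring.
Qed.

Lemma rep_scale s (c : C) (x : restr iota J) i j : rep s (c *: x) i j = c * rep s x i j.
Proof. exact: (repZ hJ). Qed.

Lemma rep_phi_quad s u i j : rep s (phi (quad_elt u)) i j =
  quad u (base s) * (idf (factors s).1 i.1 j.1 * idf (factors s).2 i.2 j.2).
Proof.
have phiZ (c : C) v : phi (c *: v) = c *: phi v by exact: linearZ_LR.
have phi0 : phi 0 = 0 by exact: linear0.
have phiS (I : Type) (r : seq I) F : phi (\sum_(x <- r) F x) = \sum_(x <- r) phi (F x).
  by apply: (big_morph phi) => // x y; exact: linearD.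
rewrite -evl_quad quad_eltE phiS (rep_sum hJ) /evl big_distrlr /=.
apply: eq_bigr => a _; rewrite phiS (rep_sum hJ); apply: eq_bigr => b _.
rewrite phiZ rep_scale phi_klC (rep_sum hJ) mulrACA; congr (_ * _).
rewrite big_distrlr /=; apply: eq_bigr => x _; rewrite (rep_sum hJ); apply: eq_bigr => y _.
by rewrite rep_scale rep_t ths_wel mulrACA.
Qed.

Lemma std_expand_KN (V : lmodType C) (F : dword -> V) : std_expand KN F = F None.
Proof. by rewrite /std_expand /KN !big_seq1 at_one1 !scale1r. Qed.

Lemma std_expand_KX (F : dword -> fsfunc W C) :
  std_expand KX F = F (Some (false, 0%N)) + F (Some (true, 0%N)).
Proof.
have q1 : at_one (tau_pow C (-1)) = 1 by exact: at_one_lmonom.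
rewrite /std_expand /KX !big_cons !big_nil /= q1 at_one1 !scale1r !addr0.
apply: coeff_inj; apply/funext => w; rewrite !(coeffD, coeffZ) /=; ring.
Qed.

Lemma std_expand_KXX (F : dword -> fsfunc W C) :
  std_expand KXX F = F (Some (false, 1%N)) + F (Some (true, 1%N)) + (F None + F None).
Proof.
have q1 : at_one (tau_pow C (-1)) = 1 by exact: at_one_lmonom.
rewrite /std_expand /KXX !big_cons !big_nil /= !at_oneM q1 at_one1 !mulr1 !scale1r !addr0.
apply: coeff_inj; apply/funext => w; rewrite !(coeffD, coeffZ) /=; ring.
Qed.

Lemma wel_translation x y e (l : int * int) : dint x = l.1 + l.2 -> dint y = l.1 - l.2 ->
  odd `|(l.1 + l.2)%R|%N = e -> wel x y e = aff l false false.
Proof.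
move=> h1 h2 h3; have [c1 c2 c3] := coord_aff hG l false false.
by apply/esym/welE; rewrite ?c1 ?c2 ?c3 ?h1 ?h2 // subr0.
Qed.

(** At tau = 1 the element is a sum of four translations, and the sum of their characters is, for
    example, s^2 + s^-2 + 2 = (s + 1/s)^2. *)
Lemma quad_eltP u : exists (l0 l1 : int * int) (l2 : seq (int * int)),
  quad_elt u = \sum_(l <- l0 :: l1 :: l2) fdelta (aff l false false) 1 /\
  forall s w : C, s != 0 -> w != 0 ->
    \sum_(l <- l0 :: l1 :: l2) torus_char l (mkt (s * w) (s / w)) = quad u (s + s^-1, w + w^-1).
Proof.
have ch l (s w : C) : s != 0 -> w != 0 ->
    torus_char l (mkt (s * w) (s / w)) = (s * w) ^ l.1 * (s / w) ^ l.2.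
  by move=> s0 w0; rewrite /torus_char coords_mkt // mulf_neq0 ?invr_eq0.
have wt := wel_translation.
case: u => [[]|].
- exists (-1, -1), (1, 1), [:: (0, 0); (0, 0)]; split=> [|s w s0 w0].
    rewrite /quad_elt std_expand_KXX !std_expand_KN !big_cons big_nil addr0 -addrA.
    by congr (_ + (_ + (_ + _))); congr (fdelta _ _); apply: wt.
  rewrite !big_cons big_nil !ch //= !expr1z !expr0z /exprz /=; field; rewrite s0 w0 //.
- exists (-1, 1), (1, -1), [:: (0, 0); (0, 0)]; split=> [|s w s0 w0].
    rewrite /quad_elt std_expand_KN std_expand_KXX !big_cons big_nil addr0 -addrA.
    by congr (_ + (_ + (_ + _))); congr (fdelta _ _); apply: wt.
  rewrite !big_cons big_nil !ch //= !expr1z !expr0z /exprz /=; field; rewrite s0 w0 //.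
- exists (-1, 0), (0, -1), [:: (0, 1); (1, 0)]; split=> [|s w s0 w0].
    rewrite /quad_elt !std_expand_KX !big_cons big_nil addr0 -addrA.
    by congr (_ + (_ + (_ + _))); congr (fdelta _ _); apply: wt.
  rewrite !big_cons big_nil !ch //= !expr1z !expr0z /exprz /=; field; rewrite s0 w0 //.
Qed.

Lemma quad_elt_supp u x : coeff (quad_elt u) x != 0 -> x.2 = 1%g.
Proof.
have [l0 [l1 [l2 [-> _]]]] := quad_eltP u; rewrite coeff_sum => h.
have [//|x1] := eqVneq x.2 1%g; move/eqP: h; case; apply: big1 => l _.
rewrite coeff_fdelta; case: eqP => // e; move: x1; rewrite e => /eqP; case.
by apply: val_inj.
Qed.

Lemma quad_elt_char u (s w : C) : s != 0 -> w != 0 ->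
  \sum_(x \in setT) coeff (quad_elt u) x * torus_char x.1 (mkt (s * w) (s / w)) =
  quad u (s + s^-1, w + w^-1).
Proof.
move=> s0 w0; have [l0 [l1 [l2 [-> /(_ s w s0 w0) <-]]]] := quad_eltP u.
rewrite -[LHS]/(fcomb (fun x : W => torus_char x.1 (mkt (s * w) (s / w)) : C^o) _).
by rewrite fcomb_sum; apply: eq_bigr => l _; rewrite fcomb_delta scale1r.
Qed.

Lemma quad_scale u (f : k) : (forall p, val f (orbpt G p) = quad u p) ->
  forall j, f *: j = kmul (phi (quad_elt u) : J) j.
Proof.
move=> hf; apply: (asym_scale hJ); first exact: quad_elt_supp.
move=> x; rewrite (totXE x) -/(orb G _).
have [s [w [s0 w0 ->]]] := torus_st (set_val x).
by rewrite quad_elt_char // (orb_st hG) // hf.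
Qed.

(** The action of k is given through [phi] on translations; it is computed on the three generators
    of k and extended by [coordring_orbit_ind]. *)
Lemma rhoJ_scale s (f : k) x i j : rJ s (f *: x) i j = value f s * rJ s x i j.
Proof.
apply: (@coordring_orbit_ind C G hG (fun f => forall x i j, rJ s (f *: x) i j = value f s * rJ s x i j)) => {f x i j} [c|u f hf|f g hf hg|f g hf hg] x i j.
- exact: (repZ hJ).
- rewrite (quad_scale hf) (rhoJ_mul hG) (bigD1 i) //= big1 ?addr0 => [|m hm].
    by rewrite /rhoJ rep_phi_quad idf_emb eqxx mulr1 /value hf.
  by rewrite /rhoJ rep_phi_quad idf_emb eq_sym (negPf hm) mulr0 mul0r.
- by rewrite scalerDl (rhoJD hJ) hf hg -mulrDl.
- by rewrite -scalerA hf hg mulrA.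
Qed.

Lemma rhoJ_graded : graded_rep (@rhoJ _ _ _ _ _ _ _ hJ).
Proof. by split=> *; [exact: rhoJD | exact: rhoJ_scale | exact: (rhoJ_mul hG)]. Qed.
End CenterAction.

Lemma par_cheb (C : numClosedFieldType) b n : par (odd n) (fun z : C * C => cheb_val (coordinate b z) n).
Proof.
elim/nat_ind2: n => [||n IH1 IH2].
- by apply: (@par_ext C false (fun=> 1)); [move=> z; rewrite cheb_val0 | exact: par_cst].
- by apply: (@par_ext C true (coordinate b)); [move=> z; rewrite cheb_val1 | exact: par_coordinate].
- apply: (@par_ext C _ (fun z => coordinate b z * cheb_val (coordinate b z) n.+1 + -1 * cheb_val (coordinate b z) n)).
    by move=> z; rewrite cheb_valSS mulN1r.
  rewrite /= negbK; apply: parD; last by apply: par_scale; exact: IH1.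
  by have := parM (par_coordinate C b) IH2; rewrite addTb /= negbK.
Qed.

(** * The layers of the asymptotic algebra *)

Section AsymptoticLayers.
Variables (C : numClosedFieldType) (G : {group weylG2}).
Hypothesis hG : G = klein :> {set weylG2}.
Variable D : kl_datum C G.
Local Notation W := (ext_affine G).
Local Notation wel := (wel hG).
Local Notation lword := (lword hG).
Local Notation k := (coordring (orbit_variety C G)).
Local Notation iota := (cst_morph (orbit_variety C G)).
Variables (J : kalg k) (t : W -> restr iota J) (Dist : set W).
Variable phi : {linear fsfunc W C -> restr iota J}.
Hypothesis hJ : asymptotic_algebra D t Dist phi.
Local Notation rep := (rep hJ).
Local Notation rJ s x i j := (@rhoJ _ _ _ _ _ _ _ hJ s x i j).
Local Notation rhoJ := (@rhoJ _ _ _ _ _ _ _ hJ).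

Definition ddeg (i : TJ 0) : bool := i.1 (+) i.2.

Let gJ := rhoJ_graded hG hJ.

Lemma rhoJ_t s w i j : rJ s (t w) i j = ths s w (@emb C s i) (@emb C s j).
Proof. exact: rep_t. Qed.

(** An entry is cheb_m (X) cheb_n (Y) with a row and a column that differ by m and n in their two
    bits, up to a twist common to both, which cancels in [ddeg]. *)
Lemma rhoJ_par x (i j : TJ 0) : par (ddeg i (+) ddeg j) (fun p => rJ (Plane p) x i j).
Proof.
elim/(J_ind hJ): x => [|w c|x y hx hy].
- by apply: (par_ext _ (par0 _ _)) => p; rewrite (gr0 gJ).
- apply: (@par_ext C _ (fun p => c * ths (Plane p) w i j)).
    by move=> p; rewrite (gr_scale gJ) rhoJ_t value_iota.
  apply: par_scale; have [x [y [e ->]]] := wel_cases hG w.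
  apply: (@par_ext C _ (fun p => thf (FS p.1) x e i.1 j.1 * thf (FS p.2) y e i.2 j.2)).
    by move=> p; rewrite ths_wel.
  case: x => [[i1 m]|] /=; last by apply: (par_ext _ (par0 _ _)) => p; rewrite mul0r.
  case: y => [[i2 n]|] /=; last by apply: (par_ext _ (par0 _ _)) => p; rewrite mulr0.
  case: i j => [a1 a2] [b1 b2] /=.
  case h1: ((a1 == i1) && _); last by apply: (par_ext _ (par0 _ _)) => p; rewrite mul0r.
  case h2: ((a2 == i2) && _); last by apply: (par_ext _ (par0 _ _)) => p; rewrite mulr0.
  move/andP: h1 => [/eqP -> /eqP ->]; move/andP: h2 => [/eqP -> /eqP ->].
  rewrite /ddeg /= (_ : _ (+) _ = odd m (+) odd n).
    exact: (parM (par_cheb C true m) (par_cheb C false n)).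
  by case: (i1); case: (i2); case: (odd m); case: (odd n); case: (e).
- by apply: (par_ext _ (parD hx hy)) => p; rewrite (gr_add gJ).
Qed.

Lemma rhoJ_poly x b (i j : TJ 2) : exists P : {poly C}, forall c, rJ (Line b c) x i j = P.[c].
Proof.
elim/(J_ind hJ): x => [|w c|x y [P hP] [Q hQ]].
- by exists 0 => c; rewrite (gr0 gJ) horner0.
- suff [P hP] : exists P : {poly C}, forall z, ths (Line b z) w (@emb C (Line b z) i) (@emb C (Line b z) j) = P.[z].
    by exists (c *: P) => z; rewrite (gr_scale gJ) rhoJ_t value_iota hP hornerZ.
  have [x [y [e ->]]] := wel_cases hG w.
  pose Q (u : dword) : {poly C} := if u is Some (i', n) then
    (if (i == i') && (j == i' (+) odd n (+) e) then cheb C n else 0) else 0.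
  have hQ z u : thf (FS z) u e i j = (Q u).[z].
    by case: u => [[i' n]|] /=; rewrite /Q ?horner0 //; case: ifP; rewrite ?horner0.
  case: b.
    exists ((thf (FN C false) y e false false) *: Q x) => z; rewrite hornerZ mulrC -hQ.
    by rewrite ths_wel.
  exists ((thf (FN C false) x e false false) *: Q y) => z; rewrite hornerZ -hQ.
  by rewrite ths_wel.
- by exists (P + Q) => c; rewrite (gr_add gJ) hornerD hP hQ.
Qed.

Lemma rhoJ_sum_entries s (X : TJ (kind s) -> TJ (kind s) -> J) f :
  (forall i j a b, rJ s (X i j) a b = if (a == i) && (b == j) then f i j else 0) ->
  forall a b, rJ s (\sum_i \sum_j X i j) a b = f a b.
Proof.
move=> h a b; rewrite (gr_sum gJ) (bigD1 a) //= [X in _ + X]big1 ?addr0 => [|i ia]; last first.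
  by rewrite (gr_sum gJ) big1 // => j _; rewrite h eq_sym (negPf ia).
rewrite (gr_sum gJ) (bigD1 b) //= big1 ?addr0 => [|j jb]; first by rewrite h !eqxx.
by rewrite h [b == j]eq_sym (negPf jb) andbF.
Qed.

Lemma above_sum2 l (U : finType) (X : U -> U -> J) : (forall i j, above rhoJ l (X i j)) ->
  above rhoJ l (\sum_i \sum_j X i j).
Proof.
move=> h s hs a b; rewrite (gr_sum gJ) big1 // => i _; rewrite (gr_sum gJ) big1 // => j _.
exact: h.
Qed.

Lemma ths_plane (z1 z2 : C) i1 m i2 n e a b :
  thf (FS z1) (Some (i1, m)) e a.1 b.1 * thf (FS z2) (Some (i2, n)) e a.2 b.2 =
  if (a == (i1, i2)) && (b == (i1 (+) odd m (+) e, i2 (+) odd n (+) e))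
  then cheb_val z1 m * cheb_val z2 n else 0.
Proof.
case: a b => [a1 a2] [b1 b2]; rewrite /= !xpair_eqE.
by case: (a1 == i1); case: (a2 == i2); case: (b1 == _); case: (b2 == _); rewrite /= ?mul0r ?mulr0.
Qed.

(* The two-sided cell to which a family of simple modules belongs. *)
Definition stype (s : expt C) : bool * bool :=
  match s with
  | Plane _ | Star => (true, true)
  | Line b _ => (b, ~~ b)
  | Point _ => (false, false)
  end.

Lemma rhoJ_stype s c w a b : typ w != stype s -> rJ s (c *: (t w : J)) a b = 0.
Proof.
rewrite (gr_scale gJ) rhoJ_t; have [x [y [e ->]]] := wel_cases hG w; rewrite typ_wel ths_wel.
by case: s a b => [p||[] z|b'] a b; case: x => [[i1 m]|]; case: y => [[i2 n]|] //= _;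
  rewrite ?mul0r ?mulr0.
Qed.

Lemma lowest_level c i1 m i2 n e s : (1 < level s)%N ->
  forall a b, rJ s (c *: (t (wel (Some (i1, m)) (Some (i2, n)) e) : J)) a b = 0.
Proof. by move=> hs a b; rewrite rhoJ_stype // typ_wel; case: s hs {a b} => [p||[] z|b']. Qed.

(** One-letter words followed by a power of omega are the matrix units, and k supplies all
    polynomial coefficients by [line_value]. *)
Lemma rhoJ_line_elt b (P : bool -> bool -> {poly C}) : exists x,
  (forall s, stype s != (b, ~~ b) -> forall i j, rJ s x i j = 0) /\
  forall z i j, rJ (Line b z) x i j = (P i j).[z].
Proof.
have /choice[c hc] (ij : bool * bool) := line_value hG b (P ij.1 ij.2).
pose X i j := c (i, j) *: (t (lword b (Some (i, 0%N)) (i (+) j)) : J).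
exists (\sum_i \sum_j X i j); split.
  move=> s hs a a'; rewrite (gr_sum gJ) big1 // => i _; rewrite (gr_sum gJ) big1 // => j _.
  by rewrite rhoJ_stype // eq_sym /lword; case: (b) hs; rewrite typ_wel.
move=> z; apply: (@rhoJ_sum_entries (Line b z)) => i j a a'.
rewrite (gr_scale gJ) rhoJ_t hc /= /lword.
by case: (b); rewrite ths_wel /= addbF addKb !cheb_val0 ?expr0; case: ifP => _; rewrite ?mulr1 ?mulr0 ?mul0r ?mulr0.
Qed.

(** Fourier inversion on the group of order two generated by omega. *)
Lemma rhoJ_point_elt (v : bool -> C) : exists x,
  (forall s, stype s != (false, false) -> forall i j, rJ s x i j = 0) /\
  forall b i j, rJ (Point b) x i j = v b.
Proof.
exists (iota ((v false + v true) / 2) *: (t (wel None None false) : J) +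
    iota ((v false - v true) / 2) *: (t (wel None None true) : J)); split.
  by move=> s hs i j; rewrite (gr_add gJ) !rhoJ_stype ?addr0 // typ_wel eq_sym.
move=> b i j; rewrite (gr_add gJ) !(gr_scale gJ) !rhoJ_t !ths_wel !value_iota /= !andbF !expr0.
by case: (b) => /=; rewrite ?expr0 ?expr1; field.
Qed.

(** An even entry is a coefficient from k times a pair of one-letter words. For an odd entry X g + Y
    h a two-letter word in one of the factors supplies X or Y. In either case the value at pt_* is
    0, by f(0) = 0 or because odd Chebyshev polynomials vanish at 0. *)
Lemma rhoJ_plane_elt (i j : TJ 0) f : par (ddeg i (+) ddeg j) f -> f 0 = 0 ->
  exists x, above rhoJ 1 x /\
    forall p a b, rJ (Plane p) x a b = if (a == i) && (b == j) then f p else 0.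
Proof.
have star c i1 m i2 n e : (value c (Plane 0) = 0) \/ (odd m || odd n) ->
    above rhoJ 1 (c *: (t (wel (Some (i1, m)) (Some (i2, n)) e) : J)).
  move=> h s hs a b; have [h1|h1] := ltnP 1 (level s); first exact: lowest_level.
  case: s hs h1 a b => [p||[] z|[]] // _ _ a b; rewrite (gr_scale gJ) rhoJ_t ths_wel ths_plane.
  case: h => [h|/orP[] h].
  - by rewrite (_ : value c Star = 0) ?mul0r.
  - by rewrite (cheb_val_odd0 C h) mul0r if_same mulr0.
  - by rewrite (cheb_val_odd0 C h) mulr0 if_same mulr0.
case: i j => [i1 i2] [j1 j2]; rewrite /ddeg /=.
case hd : (_ (+) _) => /=.
  move=> [g [h [eg eh ef]]] _.
  have [cg hg] := even_value hG eg; have [ch hh] := even_value hG eh.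
  exists (cg *: (t (wel (Some (i1, 1%N)) (Some (i2, 0%N)) (i2 (+) j2)) : J) +
    ch *: (t (wel (Some (i1, 0%N)) (Some (i2, 1%N)) (i1 (+) j1)) : J)); split.
    by move=> s hs a b; rewrite (gr_add gJ) !star ?addr0 //; right.
  move=> p a b; rewrite (gr_add gJ) !(gr_scale gJ) !rhoJ_t !ths_wel !ths_plane hg hh.
  have -> : (i1 (+) odd 1 (+) (i2 (+) j2), i2 (+) odd 0 (+) (i2 (+) j2)) = (j1, j2).
    by move: hd; case: (i1); case: (i2); case: (j1); case: (j2).
  have -> : (i1 (+) odd 0 (+) (i1 (+) j1), i2 (+) odd 1 (+) (i1 (+) j1)) = (j1, j2).
    by move: hd; case: (i1); case: (i2); case: (j1); case: (j2).
  by case: ifP => _; rewrite ?mulr0 ?addr0 // ef !cheb_val0 !cheb_val1 mulr1 mul1r mulrC [_ * p.2]mulrC.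
move=> ef f0; have [c hc] := even_value hG ef.
exists (c *: (t (wel (Some (i1, 0%N)) (Some (i2, 0%N)) (i1 (+) j1)) : J)); split.
  by apply: star; left; rewrite hc.
move=> p a b; rewrite (gr_scale gJ) rhoJ_t ths_wel ths_plane hc.
have -> : (i1 (+) odd 0 (+) (i1 (+) j1), i2 (+) odd 0 (+) (i1 (+) j1)) = (j1, j2).
  by move: hd; case: (i1); case: (i2); case: (j1); case: (j2).
by case: ifP => _; rewrite ?mulr0 // !cheb_val0 !mulr1.
Qed.

Lemma rhoJ_layered : layered 6 rhoJ ddeg.
Proof.
split.
- exact: gJ.
- by case=> [|[|[|l]]]; split; [exact: (false, false)|exact: false|exact: false|exact: tt].
- exact: (rhoJ_faithful hG).
- by move=> x [p||b c|b] //; case: b.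
- exact: rhoJ_par.
- exact: rhoJ_poly.
- move=> M hM M0.
  have /choice[X hX] (ij : TJ 0 * TJ 0) := rhoJ_plane_elt (hM ij.1 ij.2) (M0 ij.1 ij.2).
  exists (\sum_i \sum_j X (i, j)); split; first by apply: above_sum2 => i j; exact: (proj1 (hX (i, j))).
  move=> p; apply: (@rhoJ_sum_entries (Plane p) (fun i j => X (i, j)) (fun i j => M i j p)) => i j a b.
  by rewrite (proj2 (hX (i, j))).
(* Entries between the two summands at the origin are odd functions, hence 0 there. *)
- have zb x b b' c : rep (Plane 0) x (b, b (+) c) (b', b' (+) ~~ c) = 0.
    have := rhoJ_par x (b, b (+) c) (b', b' (+) ~~ c); rewrite /ddeg /=.
    rewrite (_ : _ (+) _ = true); last by case: (b); case: (b'); case: (c).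
    exact: odd0.
  (* The summand of even indices. The odd one is the representation at pt_*, which vanishes on this
     layer. *)
  exists bool, (fun x b b' => rep (Plane 0) x (b, b) (b', b')); split.
  + split=> [x y i j|c x i j|x y i j].
    * exact: (repD hJ).
    * exact: (repZ hJ).
    * rewrite (rep_mul hG hJ) -(pair_bigA _ (fun a b => rep (Plane 0) x (i, i) (a, b) * rep (Plane 0) y (a, b) (j, j))) /=.
      apply: eq_bigr => a _; rewrite (bigD1 a) //= big1 ?addr0 // => b ba.
      have -> : b = a (+) ~~ false by case: (a) (b) ba => [] [].
      by have := zb x i a false; rewrite addbF => ->; rewrite mul0r.
  + by split; exact: false.
  + move=> M; pose X b b' := iota (M b b') *: (t (wel (Some (b, 0%N)) (Some (b, 0%N)) (b (+) b')) : J).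
    have hX b b' s a a' : (0 < level s)%N -> rJ s (X b b') a a' = 0.
      move=> hs; have [h1|h1] := ltnP 1 (level s); first exact: lowest_level.
      case: s hs h1 a a' => [p||[] z|[]] // _ _ a a'; rewrite (gr_scale gJ) rhoJ_t ths_wel ths_plane.
      by case: (a); case: (b); rewrite /= mulr0.
    exists (\sum_b \sum_b' X b b'); split; first by apply: above_sum2 => b b' s hs i j; exact: hX.
    move=> i j; rewrite (rep_sum hJ) (bigD1 i) //= [X in _ + X]big1 ?addr0 => [|b hb]; last first.
      rewrite (rep_sum hJ) big1 // => b' _; rewrite (repZ hJ) rep_t ths_wel ths_plane.
      by rewrite xpair_eqE eq_sym (negPf hb) mulr0.
    rewrite (rep_sum hJ) (bigD1 j) //= big1 ?addr0 => [|b hb]; last first.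
      rewrite (repZ hJ) rep_t ths_wel ths_plane !addbF addKb.
      by rewrite !xpair_eqE [j == b]eq_sym (negPf hb) !andbF mulr0.
    by rewrite (repZ hJ) rep_t ths_wel ths_plane !addbF addKb !eqxx !cheb_val0 !mulr1.
  + move=> x hx; split=> [h0 [i1 i2] [j1 j2]|h0 i j]; last exact: h0.
    have [d|d] := eqVneq (i1 (+) i2) (j1 (+) j2); last first.
      have -> : i2 = i1 (+) (i1 (+) i2) by rewrite addKb.
      have -> : j2 = j1 (+) ~~ (i1 (+) i2) by case: (i1) (i2) (j1) (j2) d => [] [] [] [].
      exact: zb.
    have [i12|i12] := eqVneq i1 i2.
      have -> : j2 = j1 by case: (i1) (i2) (j1) (j2) d i12 => [] [] [] [].
      by rewrite -i12; exact: h0.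
    have -> : j2 = ~~ j1 by case: (i1) (i2) (j1) (j2) d i12 => [] [] [] [].
    have -> : i2 = ~~ i1 by case: (i1) (i2) i12 => [] [].
    exact: (hx Star).
- move=> _ M; pose X b b' := iota (M b b') *: (t (wel (Some (b, 0%N)) (Some (~~ b, 0%N)) (b (+) b')) : J).
  exists (\sum_b \sum_b' X b b'); split.
    by apply: above_sum2 => b b' s hs i j; exact: lowest_level.
  apply: (@rhoJ_sum_entries Star) => i j a b.
  rewrite (gr_scale gJ) rhoJ_t ths_wel ths_plane !addbF addKb !cheb_val0 mulr1.
  rewrite value_iota /= !xpair_eqE !eqb_negLR.
  by case: (i) (j) (a) (b) => [] [] [] [] /=; rewrite ?mulr1 ?mulr0.
- move=> b hb P; have [x [h0 hx]] := rhoJ_line_elt b P; exists x; split=> // s hs.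
  by apply: h0; case: s hs => [p||b' z|b'] /=; case: (b); try case: b'.
- move=> b hb M; have [x [h0 hx]] := rhoJ_point_elt (fun b' => if b' == b then M tt tt else 0).
  exists x; split=> [s|[] []]; last by rewrite hx eqxx.
  case: s => [p||b' z|b'] hs i j; first by move: hs; case: (b).
  + by move: hs; case: (b).
  + by move: hs; case: (b); case: (b').
  + by rewrite hx; case: eqP hs => // ->; case: (b).
Qed.
End AsymptoticLayers.

(** * Geometrical and Morita equivalences *)

Section Amplification.
Variable C : pzRingType.

Lemma sum_tidx (F : tidx -> C) : \sum_m F m = \sum_a \sum_b \sum_e F ((a, b), e).
Proof.
transitivity (\sum_(ab : bool * bool) \sum_e F (ab, e)).
  by rewrite pair_bigA; apply: eq_bigr => -[].
by rewrite [RHS]pair_bigA; apply: eq_bigr => -[].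
Qed.

(** Four copies of [F], one for each value of the bits i.1.2 and i.2. *)
Definition amp_line (F : bool -> bool -> C) (i j : tidx) : C :=
  if (i.1.2 == j.1.2) && (i.2 == j.2) then F i.1.1 j.1.1 else 0.

Lemma amp_line_mul F F' i j :
  \sum_m amp_line F i m * amp_line F' m j = amp_line (fun a b => \sum_c F a c * F' c b) i j.
Proof.
rewrite sum_tidx /amp_line !big_bool.
by case: i j => [[i1 [] ] []] [[j1 []] []]; rewrite /= ?(mul0r, mulr0, addr0, add0r).
Qed.

(* Two copies of [F], one for each parity of the sum of i.2 and the degree of i.1, so
   that for odd entries of [F] the last index of the row and of the column differ. *)
Definition amp_plane (F : bool * bool -> bool * bool -> C) (i j : tidx) : C :=
  if i.2 (+) j.2 == ddeg i.1 (+) ddeg j.1 then F i.1 j.1 else 0.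

Lemma amp_plane_mul F F' i j :
  \sum_m amp_plane F i m * amp_plane F' m j = amp_plane (fun a b => \sum_c F a c * F' c b) i j.
Proof.
have e : \sum_c F i.1 c * F' c j.1 = \sum_a \sum_b F i.1 (a, b) * F' (a, b) j.1.
  by rewrite pair_bigA; apply: eq_bigr => -[].
rewrite sum_tidx /amp_plane e !big_bool.
by case: i j {e} => [[[] []] []] [[[] []] []]; rewrite /ddeg /= ?(mul0r, mulr0, addr0, add0r).
Qed.
End Amplification.

(** * The comparison of J with the algebra of matrix functions *)

Section AsymptoticTarget.
Variables (C : numClosedFieldType) (G : {group weylG2}).
Hypothesis hG : G = klein :> {set weylG2}.
Hypothesis C_uncountable : ~ countable [set: C].
Variable D : kl_datum C G.
Local Notation W := (ext_affine G).
Local Notation wel := (wel hG).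
Local Notation k := (coordring (orbit_variety C G)).
Local Notation iota := (cst_morph (orbit_variety C G)).
Variables (J : kalg k) (t : W -> restr iota J) (Dist : set W).
Variable phi : {linear fsfunc W C -> restr iota J}.
Hypothesis hJ : asymptotic_algebra D t Dist phi.
Local Notation rJ s x i j := (@rhoJ _ _ _ _ _ _ _ hJ s x i j).
Local Notation rhoJ := (@rhoJ _ _ _ _ _ _ _ hJ).
Local Notation target := (@target C G hG).

Let gJ := rhoJ_graded hG hJ.

Definition amplify (x : J) : tfun C := fun s ij =>
  match s with
  | Plane p => amp_plane (fun a b => rJ (Plane p) x a b) ij.1 ij.2
  | Star => amp_line (fun a b => rJ Star x a b) ij.1 ij.2
  | Line b z => amp_line (fun a b' => rJ (Line b z) x a b') ij.1 ij.2
  | Point b => if ij.1 == ij.2 then rJ (Point b) x tt tt else 0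
  end.

Lemma amplify_cond x : target_cond (amplify x).
Proof.
split=> [i j|b i j|].
- rewrite /amplify /amp_plane /= /tdeg; case: eqP => [->|_]; last exact: par0.
  exact: (rhoJ_par hG).
- rewrite /amplify /amp_line /=; case: (_ && _); last by exists 0 => c; rewrite horner0.
  exact: (rhoJ_poly hG).
(* At the origin the odd entries vanish; the others sit where i.2 = j.2, equally in both copies. *)
- exists (fun a b => if ddeg a == ddeg b then rJ (Plane 0) x a b else 0) => i j.
  have h := rhoJ_par hG hJ x i.1 j.1; rewrite /amplify /amp_plane /=.
  case: (eqVneq (ddeg i.1) (ddeg j.1)) h => [->|d] h.
    by rewrite addbb; case: (i.2); case: (j.2).
  rewrite if_same (@odd0 C (fun p => rJ (Plane p) x i.1 j.1)) ?if_same //.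
  by move: d h; case: (ddeg i.1); case: (ddeg j.1).
Qed.

Definition to_target (x : J) : target := Sub (amplify x) (asboolT (amplify_cond x)).

Lemma to_targetE s x i j : target_rho s (to_target x) i j = amplify x s (i, j).
Proof. by rewrite /target_rho SubK. Qed.

Lemma to_target_morph : kalg_morph to_target.
Proof.
split=> [x y|c x|x y]; apply: target_eq => s [i j].
- rewrite target_addE -!/(target_rho _ _ _ _) !to_targetE.
  by case: s => [p||b z|b]; rewrite /amplify /amp_plane /amp_line /=; case: ifP => _;
    rewrite ?addr0 // (gr_add gJ).
- rewrite target_scaleE -!/(target_rho _ _ _ _) !to_targetE.
  by case: s => [p||b z|b]; rewrite /amplify /amp_plane /amp_line /=; case: ifP => _;
    rewrite ?mulr0 // (gr_scale gJ).
- rewrite target_mulE.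
  under eq_bigr do rewrite -[X in X * _]/(target_rho _ _ _ _) -[X in _ * X]/(target_rho _ _ _ _)
    !to_targetE.
  rewrite -/(target_rho _ _ _ _) to_targetE.
  case: s => [p||b z|b]; rewrite /amplify [LHS]/=.
  + rewrite amp_plane_mul /amp_plane; case: ifP => // _; exact: (gr_mul gJ).
  + rewrite amp_line_mul /amp_line; case: ifP => // _; exact: (gr_mul gJ).
  + rewrite amp_line_mul /amp_line; case: ifP => // _; exact: (gr_mul gJ).
  + rewrite (bigD1 i) //= eqxx big1 => [|m /negPf hm]; last by rewrite eq_sym hm mul0r.
    rewrite addr0 (gr_mul gJ) (big_pred1 tt) => [|[]//].
    by case: eqP => // _; rewrite mulr0.
Qed.

Lemma to_target_zeros s x : (forall i j, rJ s x i j = 0) <->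
  (forall i j, target_rho s (to_target x) i j = 0).
Proof.
split=> [h i j|h].
  rewrite to_targetE; case: s h => [p||b z|b] h; rewrite /amplify /amp_plane /amp_line /=;
  by case: ifP => // _; exact: h.
case: s h => [p||b z|b] h i j.
(* The bit of the column is the one for which the entry (i, j) is displayed. *)
- have := h (i, false) (j, ddeg i (+) ddeg j).
  by rewrite to_targetE /amplify /amp_plane /= eqxx.
- by have := h ((i, false), false) ((j, false), false); rewrite to_targetE.
- by have := h ((i, false), false) ((j, false), false); rewrite to_targetE.
- by case: i j => -[]; have := h (false, false, false) (false, false, false); rewrite to_targetE.
Qed.

Lemma asymptotic_geom_equiv : geom_equiv iota J (ext_coord C G).
Proof.
apply: (geom_trans (B := target)).
  apply: (@layered_geom_equiv C G hG C_uncountable 6 J target _ _ _ _ _ _ to_target) => //.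
  - exact: (rhoJ_layered hG hJ).
  - exact: (@target_layered C G hG).
  - exact: to_target_morph.
  - exact: to_target_zeros.
apply: geom_sym.
apply: (@layered_geom_equiv C G hG C_uncountable 6 (ext_coord C G) target _ _ _ _ _ _ (@ext_to_target C G hG)) => //.
- exact: (@fun_layered C G hG).
- exact: (@target_layered C G hG).
- exact: ext_to_target_morph.
- exact: ext_to_target_zeros.
Qed.

Lemma cell_idealP c (I : ideal J) : is_cell_ideal t c I ->
  forall x, I x <-> forall w, coeff (coordJ hJ x) w != 0 -> c w.
Proof.
move=> hI x; rewrite hI; split=> [[u [hu ->]]|h].
  by rewrite -[\sum_(_ \in _) _]/(fcomb t u) coordJ_fcomb.
by exists (coordJ hJ x); split=> //; exact: coordJ_expand.
Qed.

(** A basis element acts by 0 in the representations of other types; conversely, the representations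
    of one type already detect the coefficients in their cell. *)
Lemma cell_idealE tp c (I : ideal J) : c = [set w | typ w = tp] -> is_cell_ideal t c I ->
  forall x, I x <-> forall s, stype s != tp -> forall i j, rJ s x i j = 0.
Proof.
move=> -> /cell_idealP hI x; rewrite hI; split=> [h s hs i j|h w].
  rewrite -[LHS]/(fcomb (fun w => ths s w _ _ : C^o) (coordJ hJ x)).
  rewrite (@fcomb_supp _ _ _ _ _ [::]) ?big_nil // => w _.
  have [c0|c0] := eqVneq (coeff (coordJ hJ x) w) 0; [by left | right].
  have := @rhoJ_stype C G hG D J t Dist phi hJ s 1 w i j; rewrite scale1r rhoJ_t; apply.
  by rewrite (h w c0) eq_sym.
rewrite /= => cw; apply/eqP; apply: contraNT cw => ht; apply/eqP; move: ht.
have [a [b [e ->]]] := wel_cases hG w; rewrite typ_wel.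
case: a b => [[i m]|] [[i' m']|] /= ht.
+ by apply: faithful_plane => p i0 j0; exact: h.
+ by apply: (@faithful_lines _ _ hG _ _ _ _ _ hJ true) => z i0 j0; exact: h.
+ by apply: (@faithful_lines _ _ hG _ _ _ _ _ hJ false) => z i0 j0; exact: h.
+ by apply: faithful_points => b i0 j0; exact: h.
Qed.

Lemma lowest_idealP c (I : ideal J) : c = [set w | typ w = (true, true)] -> is_cell_ideal t c I ->
  forall x, above rhoJ 2 x <-> I x.
Proof.
move=> hc hI x; rewrite (cell_idealE hc hI); split=> h s hs; apply: h;
  by case: s hs => [p||[] z|[]].
Qed.

Lemma lowest_geom_equiv c (I : ideal J) :
  c = [set w | typ w = (true, true)] -> is_cell_ideal t c I ->
  geom_equiv iota (kalg_of_ideal I) (piece_coord C G [:: 4; 5]%N).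
Proof.
move=> hc hI; have hT := @target_layered C G hG; have hO := @fun_layered C G hG.
pose B := kalg_of_ideal (above_ideal (ly_graded hT) 2).
have [mB injB] := ideal_val_morph (above_ideal (ly_graded hT) 2).
have imB := ideal_val_image (above_ideal (ly_graded hT) 2).
apply: (geom_trans (B := B)).
  have [mA injA] := ideal_val_morph I.
  apply: (@pullback_geom_equiv C G hG C_uncountable 6 2 J target (kalg_of_ideal I) B _ _ _ _ _ _
    to_target val val) => //.
  - exact: (rhoJ_layered hG hJ).
  - exact: hT.
  - exact: to_target_morph.
  - exact: to_target_zeros.
  - by move=> x; rewrite (lowest_idealP hc hI); exact: ideal_val_image.
  - exact: imB.
apply: geom_sym.
apply: (@pullback_geom_equiv C G hG C_uncountable 6 2 (ext_coord C G) target (piece_coord C G [:: 4; 5]%N) B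
  _ _ _ _ _ _ (@ext_to_target C G hG) (@piece_extension C G hG [:: 4; 5]%N) val) => //.
- exact: hO.
- exact: hT.
- exact: ext_to_target_morph.
- exact: ext_to_target_zeros.
- exact: piece_extension_morph.
- exact: piece_extension_inj.
- move=> f; rewrite -piece_extension_image; split=> [h s hs|h s hs [] []].
    by apply: h; case: s hs => [p||[] z|[]].
  by apply: h; case: s hs => [p||[] z|[]].
- exact: imB.
Qed.
End AsymptoticTarget.

Section MatrixAlgebra.
Variables (C : fieldType) (A B : kalg C) (Z : Type) (T : finType) (i0 : T).
Variables (good : (Z -> C) -> Prop) (r : A -> T -> T -> Z -> C) (v : B -> Z -> C).
Hypotheses (good_cst : forall c, good (fun=> c))
  (rD : forall x y i j z, r (x + y) i j z = r x i j z + r y i j z)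
  (rZ : forall c x i j z, r (c *: x) i j z = c * r x i j z)
  (rM : forall x y i j z, r (x ** y) i j z = \sum_m r x i m z * r y m j z)
  (r_inj : forall x y, (forall i j z, r x i j z = r y i j z) -> x = y)
  (r_good : forall x i j, good (r x i j))
  (r_lift : forall M : T -> T -> Z -> C, (forall i j, good (M i j)) ->
    exists x, forall i j z, r x i j z = M i j z)
  (vD : forall x y z, v (x + y) z = v x z + v y z)
  (vZ : forall c x z, v (c *: x) z = c * v x z)
  (vM : forall x y z, v (x ** y) z = v x z * v y z)
  (v_inj : forall x y, (forall z, v x z = v y z) -> x = y)
  (v_good : forall x, good (v x))
  (v_lift : forall f, good f -> exists x, forall z, v x z = f z).

(* If [A] consists of the matrices over the commutative algebra [B] of functions on [Z],
   the matrix unit at [i0] is a full idempotent with corner [B]. *)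
Lemma morita_matrix : morita A B.
Proof.
have /choice[j jE] (b : B) : exists x, forall m n z, r x m n z = if (m == i0) && (n == i0) then v b z else 0.
  by apply: r_lift => m n; case: (_ && _); [exact: v_good | exact: good_cst].
have [oneB oneBE] := v_lift (good_cst 1).
have [|oneA oneAE] := r_lift (M := fun m n _ => (m == n)%:R); first by move=> m n; exact: good_cst.
have /choice[U UE] (mn : T * T) : exists x, forall m n z, r x m n z = ((m, n) == mn)%:R.
  by apply: r_lift => m n; exact: good_cst.
have r0 m n z : r 0 m n z = 0 by rewrite -(scale0r 0) rZ mul0r.
have jU : j oneB = U (i0, i0).
  by apply: r_inj => m n z; rewrite jE UE xpair_eqE oneBE; case: ifP.
have UM x m n p q z : r (U (m, n) ** x) p q z = if p == m then r x n q z else 0.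
  rewrite rM (bigD1 n) //= big1 ?addr0 => [|l ln].
    by rewrite UE xpair_eqE eqxx andbT; case: eqP; rewrite ?mul1r ?mul0r.
  by rewrite UE xpair_eqE (negPf ln) andbF mul0r.
have MU x m n p q z : r (x ** U (m, n)) p q z = if q == n then r x p m z else 0.
  rewrite rM (bigD1 m) //= big1 ?addr0 => [|l lm].
    by rewrite UE xpair_eqE eqxx; case: eqP; rewrite ?mulr1 ?mulr0.
  by rewrite UE xpair_eqE (negPf lm) mulr0.
apply: (@morita_full_corner C A B j oneA oneB).
- split=> [x y|c x|x y]; apply: r_inj => m n z.
  + by rewrite rD !jE vD; case: ifP; rewrite ?addr0.
  + by rewrite rZ !jE vZ; case: ifP; rewrite ?mulr0.
  + rewrite rM jE (bigD1 i0) //= big1 ?addr0 => [|l li]; rewrite !jE ?eqxx ?andbT.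
      by rewrite vM; case: (m == i0); rewrite /= ?mul0r //; case: (n == i0); rewrite ?mulr0.
    by rewrite (negPf li) andbF mul0r.
- move=> x y e; apply: v_inj => z.
  by have := congr1 (fun a => r a i0 i0 z) e; rewrite /= !jE !eqxx.
- move=> x; split; apply: r_inj => m n z; rewrite rM.
    rewrite (bigD1 m) //= big1 ?addr0 => [|l lm]; first by rewrite oneAE eqxx mul1r.
    by rewrite oneAE eq_sym (negPf lm) mul0r.
  rewrite (bigD1 n) //= big1 ?addr0 => [|l lm]; first by rewrite oneAE eqxx mulr1.
  by rewrite oneAE (negPf lm) mulr0.
- by move=> b; split; apply: v_inj => z; rewrite vM oneBE ?mul1r ?mulr1.
- move=> x; rewrite jU => ex; have [b hb] := v_lift (r_good x i0 i0).
  exists b; apply: r_inj => m n z; rewrite jE hb -[in RHS]ex MU UM.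
  by case: (n == i0); rewrite ?andbF // andbT.
(* The unit is the sum of the products E_(m,i0) E_(i0,i0) E_(i0,m). *)
- exists [seq (U (m, i0), U (i0, m)) | m <- enum T]; apply: r_inj => m n z.
  rewrite big_map big_enum /= (big_morph (fun x => r x m n z) (id1 := 0) (op1 := +%R)) //.
  rewrite oneAE jU.
  transitivity (\sum_(l : T) (if n == l then (m == l)%:R else 0) : C).
    rewrite (bigD1 n) //= eqxx big1 ?addr0 // => l ln.
    by rewrite eq_sym (negPf ln).
  apply: eq_bigr => l _; rewrite MU MU eqxx UE xpair_eqE eqxx andbT.
  by case: eqP.
Qed.
End MatrixAlgebra.

(** * Morita equivalences for the other three cells *)

Section CellMorita.
Variables (C : numClosedFieldType) (G : {group weylG2}).
Hypothesis hG : G = klein :> {set weylG2}.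
Local Notation W := (ext_affine G).
Local Notation k := (coordring (orbit_variety C G)).
Local Notation iota := (cst_morph (orbit_variety C G)).

Section Piece.
Variable u : seq nat.
Local Notation P := (piece_coord C G u).

Definition piece_fun (x : P) (s : expt C) : C := fun_rho s (@piece_extension C G hG u x) tt tt.

Let gO := ly_graded (@fun_layered C G hG).

Lemma piece_funD x y s : piece_fun (x + y) s = piece_fun x s + piece_fun y s.
Proof. by have [h _ _] := @piece_extension_morph C G hG u; rewrite /piece_fun h (gr_add gO). Qed.

Lemma piece_funZ c x s : piece_fun (c *: x) s = value c s * piece_fun x s.
Proof. by have [_ h _] := @piece_extension_morph C G hG u; rewrite /piece_fun h (gr_scale gO). Qed.

Lemma piece_funM x y s : piece_fun (x ** y) s = piece_fun x s * piece_fun y s.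
Proof.
have [_ _ h] := @piece_extension_morph C G hG u.
by rewrite /piece_fun h (gr_mul gO) (big_pred1 tt) // => -[].
Qed.

Lemma piece_fun_inj x y : (forall s, piece_number s \in u -> piece_fun x s = piece_fun y s) -> x = y.
Proof.
move=> h; apply: (@piece_extension_inj C G hG u); apply: (fun_eq hG) => s.
by have [/h //|hs] := boolP (piece_number s \in u); rewrite !piece_extension0.
Qed.

Lemma piece_fun_lift (e : expt C -> C) : even_fun (fun p => e (Plane p)) ->
  (forall b, exists Q : {poly C}, forall x, e (Line b x) = Q.[x]) ->
  (forall s, piece_number s \notin u -> e s = 0) -> exists x, forall s, piece_fun x s = e s.
Proof.
move=> h1 h2 h3; have [f hf] := fun_prescribe hG h1 h2.
have [|x hx] := proj1 (@piece_extension_image C G hG u f); first by move=> s /h3; rewrite hf.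
by exists x => s; rewrite /piece_fun hx hf.
Qed.
End Piece.

Variable D : kl_datum C G.
Variables (J : kalg k) (t : W -> restr iota J) (Dist : set W).
Variable phi : {linear fsfunc W C -> restr iota J}.
Hypothesis hJ : asymptotic_algebra D t Dist phi.
Local Notation rJ s x i j := (@rhoJ _ _ _ _ _ _ _ hJ s x i j).

Let gJ := rhoJ_graded hG hJ.

Section Cell.
Variables (tp : bool * bool) (c : set W) (I : ideal J).
Hypotheses (hc : c = [set w | typ w = tp]) (hI : is_cell_ideal t c I).
Local Notation A := (kalg_of_ideal I).

Lemma cell_eq (x y : A) :
  (forall s, stype s = tp -> forall i j, rJ s (val x) i j = rJ s (val y) i j) -> x = y.
Proof.
move=> h; apply: val_inj; apply: (@rhoJ_eq _ _ hG _ _ _ _ _ hJ) => s i j.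
have [e|e] := eqVneq (stype s) tp; first exact: h.
have hx (z : A) : rJ s (val z) i j = 0.
  exact: (proj1 (cell_idealE hG hJ hc hI (val z)) (set_mem (valP z))).
by rewrite !hx.
Qed.

Lemma cell_lift (x : J) : (forall s, stype s != tp -> forall i j, rJ s x i j = 0) ->
  exists y : A, val y = x.
Proof. by move=> /(cell_idealE hG hJ hc hI)/ideal_val_image. Qed.
End Cell.

(** After restriction to C the position of the line over T^vee / W^s is forgotten, so either line
    serves for either intermediate cell: b and b' are independent. *)
Lemma line_cell_morita b b' c (I : ideal J) :
  c = [set w | typ w = (b, ~~ b)] -> is_cell_ideal t c I ->
  morita (restr_kalg iota (kalg_of_ideal I))
         (restr_kalg iota (piece_coord C G [:: if b' then 2 else 3]%N)).
Proof.
move=> hc hI.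
have sb (s : expt C) : stype s = (b, ~~ b) -> exists z, s = Line b z.
  by case: s => [p||b'' z|b''] //=; case: (b) => //; case: b'' => //; exists z.
have pb (s : expt C) : piece_number s \in [:: if b' then 2 else 3]%N -> exists z, s = Line b' z.
  by case: s => [p||b'' z|b''] /=; case: (b') => //; case: b'' => // _; exists z.
have := (@morita_matrix C (restr_kalg iota (kalg_of_ideal I)) (restr_kalg iota (piece_coord C G [:: if b' then 2 else 3]%N)) C bool false
  (fun f => exists Q : {poly C}, forall z, f z = Q.[z])
  (fun (x : kalg_of_ideal I) i j z => rJ (Line b z) (val x) i j)
  (fun (x : piece_coord C G _) z => piece_fun x (Line b' z))); apply.
- by move=> a; exists a%:P => z; rewrite hornerC.
- by move=> x y i j z; rewrite raddfD (gr_add gJ).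
- by move=> a x i j z; rewrite linearZ (gr_scale gJ).
- by move=> x y i j z; exact: (gr_mul gJ).
- by move=> x y h; apply: (cell_eq hc hI) => s /sb[z ->] i j; exact: h.
- by move=> x i j; exact: (rhoJ_poly hG).
- move=> M hM; have /choice[Q hQ] (ij : bool * bool) := hM ij.1 ij.2.
  have [x [h0 hx]] := rhoJ_line_elt hG hJ b (fun i j => Q (i, j)).
  have [y hy] := cell_lift hc hI h0.
  by exists y => i j z; rewrite hy hx -hQ.
- by move=> x y z; exact: piece_funD.
- by move=> a x z; exact: piece_funZ.
- by move=> x y z; exact: piece_funM.
- by move=> x y h; apply: piece_fun_inj => s /pb[z ->].
- by move=> x; exact: (ly_poly (@fun_layered C G hG)).
- move=> f [Q hQ].
  have [|b''|s|x hx] := @piece_fun_lift [:: if b' then 2 else 3]%N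
    (fun s => if s is Line b'' z then (if b'' == b' then f z else 0) else 0).
  + exact: even_cst.
  + by case: eqP => _; [exists Q | exists 0 => z; rewrite horner0].
  + by case: s => [p||[] z|b''] //=; case: (b').
  by exists x => z; rewrite hx eqxx.
Qed.

Lemma point_cell_morita c (I : ideal J) :
  c = [set w | typ w = (false, false)] -> is_cell_ideal t c I ->
  morita (restr_kalg iota (kalg_of_ideal I)) (restr_kalg iota (piece_coord C G [:: 0; 1]%N)).
Proof.
move=> hc hI.
have sb (s : expt C) : stype s = (false, false) -> exists b, s = Point b.
  by case: s => [p||[] z|b] //; exists b.
have pb (s : expt C) : piece_number s \in [:: 0; 1]%N -> exists b, s = Point b.
  by case: s => [p||[] z|b] //; exists b.
have := (@morita_matrix C (restr_kalg iota (kalg_of_ideal I)) (restr_kalg iota (piece_coord C G [:: 0; 1]%N)) bool unit tt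
  (fun f => True)
  (fun (x : kalg_of_ideal I) i j b => rJ (Point b) (val x) i j)
  (fun (x : piece_coord C G _) b => piece_fun x (Point b))); apply => //.
- by move=> x y i j z; rewrite raddfD (gr_add gJ).
- by move=> a x i j z; rewrite linearZ (gr_scale gJ).
- by move=> x y i j z; exact: (gr_mul gJ).
- by move=> x y h; apply: (cell_eq hc hI) => s /sb[z ->] i j; exact: h.
- move=> M _; have [x [h0 hx]] := rhoJ_point_elt hG hJ (M tt tt).
  have [y hy] := cell_lift hc hI h0.
  by exists y => -[] [] b; rewrite hy hx.
- by move=> x y z; exact: piece_funD.
- by move=> a x z; exact: piece_funZ.
- by move=> x y z; exact: piece_funM.
- by move=> x y h; apply: piece_fun_inj => s /pb[z ->].
- move=> f _; have [||s|x hx] := @piece_fun_lift [:: 0; 1]%N (fun s => if s is Point b then f b else 0).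
  + exact: even_cst.
  + by move=> b; exists 0 => z; rewrite horner0.
  + by case: s => [p||[] z|[]].
  by exists x => b; rewrite hx.
Qed.
End CellMorita.

(** * The compact torus *)

Section ContinuityLemmas.

Lemma sigT_map_continuous (I : choiceType) (X : I -> topologicalType) (Y : topologicalType)
  (F : {i : I & X i} -> Y) :
  (forall i, continuous (fun x : X i => F (existT _ i x))) -> continuous F.
Proof. by move=> H [i x] U nU; exact: (H i x U nU). Qed.

Lemma set_type_continuous (X Y : topologicalType) (A : set Y) (f : X -> set_type A) :
  continuous (fun x => set_val (f x)) -> continuous f.
Proof. exact: continuous_comp_initial. Qed.

Lemma set_val_continuous (Y : topologicalType) (A : set Y) : continuous (@set_val Y A).
Proof. exact: initial_continuous. Qed.

Lemma pair_continuous (X Y Z : topologicalType) (f : X -> Y) (g : X -> Z) :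
  continuous f -> continuous g -> continuous (fun x => (f x, g x)).
Proof. by move=> cf cg x; apply: cvg_pair; [exact: cf | exact: cg]. Qed.

Lemma locally_constant_continuous (X Y : topologicalType) (f : X -> Y) :
  (forall x, nbhs x [set y | f y = f x]) -> continuous f.
Proof.
move=> H x U nU; apply: filterS (H x) => y /= e.
by rewrite e; exact: nbhs_singleton.
Qed.

Lemma comp_continuous (X Y Z : topologicalType) (f : X -> Y) (g : Y -> Z) :
  continuous f -> continuous g -> continuous (fun x => g (f x)).
Proof. by move=> cf cg x; apply: continuous_comp; [exact: cf | exact: cg]. Qed.

Lemma eq_continuous (X Y : topologicalType) (f g : X -> Y) :
  f =1 g -> continuous f -> continuous g.
Proof. by move=> /funext ->. Qed.
End ContinuityLemmas.

Definition complexes (R : realType) : numClosedFieldType := R[i].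

Lemma normc_real (R : realType) (a : R) : `|(a%:C)%C| = (`|a|%:C)%C.
Proof. by rewrite normc_def /= expr0n /= addr0 sqrtr_sqr. Qed.

Lemma normc_i (R : realType) : `|'i%C : R[i]| = 1.
Proof. by rewrite normc_def /= expr0n expr1n add0r sqrtr1. Qed.

(** * Continuity of maps to the complex torus *)

Section ComplexTopology.
Variable R : realType.
Local Notation C := (complexes R).

Lemma complex_nbhsP (z : C) (A : set C) :
  nbhs z A <-> exists e : R, 0 < e /\ forall w : C, `|z - w| < (e%:C)%C -> A w.
Proof.
split=> [/nbhs_ballP[e e0 he]|[e [e0 he]]].
  (* In the partial order of [R[i]] a positive number is real. *)
  have er : e = ((complex.Re e)%:C)%C by rewrite complex.RRe_real // gtr0_real.
  exists (complex.Re e); split.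
    by have e0' : (0 : R[i]) < e := e0; move: e0'; rewrite ltcE /= => /andP[].
  by move=> w hw; apply: he; change (`|z - w| < e); rewrite er.
apply/nbhs_ballP; exists (e%:C)%C; first by rewrite /= ltcR.
by move=> w hw; exact: he.
Qed.

Lemma Re_continuous : continuous (fun z : C => complex.Re z : R).
Proof.
move=> z U /nbhs_ballP[e e0 he]; apply/complex_nbhsP; exists e; split=> // w hw.
apply: he; change (`|complex.Re z - complex.Re w| < e).
have := le_lt_trans (normc_ge_Re (z - w)) hw.
by rewrite ltcR raddfB.
Qed.

Lemma complex_continuous (X : topologicalType) (f : X -> C) :
  continuous (fun x => complex.Re (f x) : R) -> continuous (fun x => complex.Im (f x) : R) -> continuous f.
Proof.
move=> cR cI x U /complex_nbhsP[e [e0 he]].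
have e2 : 0 < e / 2 by rewrite divr_gt0.
have hR : nbhs x [set y | `|complex.Re (f x) - complex.Re (f y)| < e / 2].
  exact: cR x _ (nbhsx_ballx (complex.Re (f x) : R) _ e2).
have hI : nbhs x [set y | `|complex.Im (f x) - complex.Im (f y)| < e / 2].
  exact: cI x _ (nbhsx_ballx (complex.Im (f x) : R) _ e2).
change (nbhs x (f @^-1` U)).
apply: filterS2 hR hI => y h1 h2; apply: he.
rewrite [f x - f y]complexE.
apply: le_lt_trans (ler_normD _ _) _.
rewrite normrM !normc_real normc_i mul1r -rmorphD /= ltcR !raddfB /=.
by rewrite [e]splitr ltrD.
Qed.

Lemma coords_continuous :
  continuous (fun t : torus C => (coords t).1) /\ continuous (fun t : torus C => (coords t).2).
Proof.
by split; apply: comp_continuous; try exact: set_val_continuous; move=> z;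
  [exact: cvg_fst | exact: cvg_snd].
Qed.

Lemma torus_continuous (X : topologicalType) (f : X -> torus C) :
  continuous (fun x => (coords (f x)).1) -> continuous (fun x => (coords (f x)).2) ->
  continuous f.
Proof.
move=> c1 c2; apply: set_type_continuous.
apply: eq_continuous (pair_continuous c1 c2) => x.
by rewrite -surjective_pairing.
Qed.
End ComplexTopology.

Section CompactTorus.
Import numFieldNormedType.Exports.
Variables (R : realType) (G : {group weylG2}).
Hypothesis hG : G = klein :> {set weylG2}.
Local Notation C := (complexes R).
Local Notation X := (@compact_torus C).
Local Notation ext := (ext_quot X G).

Lemma circleP (z : R[i]) : `|z| = 1 <-> complex.Re z ^+ 2 + complex.Im z ^+ 2 = 1.
Proof.
rewrite normc_def; split=> [[/(congr1 (fun x => x ^+ 2))]|->]; last by rewrite sqrtr1.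
by rewrite sqr_sqrtr ?expr1n // addr_ge0 ?sqr_ge0.
Qed.

Lemma circle_neq0 (z : C) : `|z| = 1 -> z != 0.
Proof. by move=> h; rewrite -normr_gt0 h ltr01. Qed.

Lemma circleV (z : C) : `|z| = 1 -> `|z^-1| = 1.
Proof. by rewrite normfV => ->; rewrite invr1. Qed.

Lemma circle_inv (z : R[i]) : `|z| = 1 -> z^-1 = (complex.Re z -i* complex.Im z)%C.
Proof.
move=> h; have z0 := circle_neq0 h; apply: (mulfI z0); rewrite mulfV //.
case: z h {z0} => a b /circleP /= h; apply/eqP; rewrite eq_complex /=.
by apply/andP; split; apply/eqP; rewrite -?h; ring.
Qed.

Lemma torus1_compact : X (torus1 C).
Proof. by split; rewrite /= normr1. Qed.

Lemma compact_act v t : v \in klein -> X t -> X (torus_act v t).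
Proof.
move=> hv [h1 h2].
change (`|(coords (torus_act v t)).1| = 1 /\ `|(coords (torus_act v t)).2| = 1).
by case/kleinP: hv => ->; rewrite ?torus_act1 ?act_a ?act_r3 ?act_ar3 /= ?(circleV h1) ?(circleV h2).
Qed.

Definition compact_cls (w : weylG2) (t : torus C) : ext :=
  \pi_ext (match pselect (w \in G), pselect (X t), pselect (torus_act w t = t) with
           | left hw, left hX, left ht => mkpair hw hX ht
           | _, _, _ => mkpair (group1 G) torus1_compact (torus_act1 _)
           end).

Lemma compact_cls_mkpair w (hw : w \in G) t (hX : X t) (ht : torus_act w t = t) :
  compact_cls w t = \pi_ext (mkpair hw hX ht).
Proof.
rewrite /compact_cls; case: pselect => // hw'; case: pselect => // hX'; case: pselect => // ht'.
by rewrite (Prop_irrelevance hw' hw) (Prop_irrelevance ht' ht) (Prop_irrelevance hX' hX).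
Qed.

Lemma compact_cls_pair (p : fixed_pairs X G) v : v \in klein ->
  \pi_ext p = compact_cls (pair_elt p) (torus_act v (pair_pt p)).
Proof.
move=> hv; have hw : pair_elt p \in G by rewrite hG; exact: (pair_elt_in hG).
have hX := compact_act hv (set_mem (pair_pt_in p)).
have ht : torus_act (pair_elt p) (torus_act v (pair_pt p)) = torus_act v (pair_pt p).
  by rewrite -torus_actM -(klein_commute hv (pair_elt_in hG p)) torus_actM (pair_fixed p).
rewrite (compact_cls_mkpair hw hX ht); apply/(pair_class_eqP hG).
by split=> //; exists v.
Qed.

Lemma compact_cls_continuous (Y : topologicalType) w (h : Y -> torus C) : w \in klein ->
  (forall y, X (h y)) -> (forall y, torus_act w (h y) = h y) -> continuous h ->
  continuous (fun y => compact_cls w (h y) : ext_space X G).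
Proof.
move=> hw hX ht ch; have hwG : w \in G by rewrite hG.
pose F y : @fixed_points C X (sgval (Subg hwG)) :=
  exist (fun s => s \in [set s | X s /\ torus_act w s = s]) (h y) (mem_set (conj (hX y) (ht y))).
apply: (@eq_continuous _ _ (fun y => \pi_(ext_space X G) (existT _ (Subg hwG) (F y) : fixed_pairs X G))).
  by move=> y; rewrite (compact_cls_mkpair hwG (hX y) (ht y)).
apply: comp_continuous; last exact: pi_continuous.
apply: (@comp_continuous _ _ _ F (existT (fun w : subg_of G => fixed_points X (sgval w)) (Subg hwG))).
  exact: set_type_continuous.
by move=> y U nU; exact: nU.
Qed.

Local Notation unit_interval := (set_type (`[0, 1]%classic : set R)).

Lemma unit_interval0 : (0 : R) \in (`[0, 1]%classic : set R).
Proof. by apply/mem_set; rewrite /= in_itv /= lexx ler01. Qed.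

Definition to_interval (x : R) : unit_interval :=
  match pselect (x \in (`[0, 1]%classic : set R)) with
  | left h => exist (fun x => x \in (`[0, 1]%classic : set R)) x h
  | right _ => exist (fun x => x \in (`[0, 1]%classic : set R)) 0 unit_interval0
  end.

Lemma to_intervalE x : 0 <= x <= 1 -> set_val (to_interval x) = x.
Proof.
move=> h; rewrite /to_interval; case: pselect => // -[].
by apply/mem_set; rewrite /= in_itv.
Qed.

Lemma interval_bounds (x : unit_interval) : 0 <= set_val x <= 1.
Proof. by have := set_mem (valP x); rewrite /= in_itv. Qed.

(** Re z is a coordinate on the circle modulo z -> 1/z; it is rescaled from [-1, 1] to [0, 1]. *)
Definition arc_coord (t : torus C) : unit_interval :=
  to_interval ((complex.Re (coords t).1 + 1) / 2).

Lemma circle_bounds (z : C) : `|z| = 1 -> 0 <= (complex.Re z + 1) / 2 <= 1.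
Proof.
move=> /circleP h; have h2 : 0 <= complex.Im z ^+ 2 by exact: sqr_ge0.
have : `|complex.Re z| <= 1.
  by rewrite -(@ler_pXn2r _ 2) ?nnegrE // ?expr1n real_normK ?num_real // -h lerDl.
by rewrite ler_norml => /andP[h3 h4]; apply/andP; split; lra.
Qed.

Lemma arc_coordE t : X t -> set_val (arc_coord t) = (complex.Re (coords t).1 + 1) / 2.
Proof. by move=> [h _]; rewrite to_intervalE // circle_bounds. Qed.

Lemma arc_coordV t : X t -> arc_coord (torus_act weyl_r3 t) = arc_coord t.
Proof.
by move=> [h _]; rewrite /arc_coord act_r3 /= (circle_inv h).
Qed.

(** The upper half of the circle, a section of z -> (Re z + 1) / 2. *)
Definition arc (x : R) : R[i] := ((2 * x - 1) +i* Num.sqrt (1 - (2 * x - 1) ^+ 2))%C.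

Lemma arc_circle x : 0 <= x <= 1 -> `|arc x| = 1.
Proof.
move=> /andP[h0 h1]; apply/circleP => /=; rewrite sqr_sqrtr; first by rewrite addrC subrK.
by rewrite -[1](expr1n _ 2) subr_sqr mulr_ge0 //; lra.
Qed.

(** On the circle Re z determines z up to conjugation, which is inversion there. *)
Lemma arc_Re (z : C) : `|z| = 1 ->
  arc ((complex.Re z + 1) / 2) = z \/ arc ((complex.Re z + 1) / 2) = z^-1.
Proof.
move=> h; have e : 2 * ((complex.Re z + 1) / 2) - 1 = complex.Re z by field.
rewrite /arc e (circle_inv h); move/circleP: h => h.
have -> : 1 - complex.Re z ^+ 2 = complex.Im z ^+ 2 by rewrite -h addrC addKr.
rewrite sqrtr_sqr; case: z {e h} => a b /=.
by case: (ger0P b) => _; [left|right].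
Qed.

Definition arc_torus (b : bool) (z : C) : torus C := mkt z (if b then z else z^-1).

Lemma coords_arc_torus b z : `|z| = 1 -> coords (arc_torus b z) = (z, if b then z else z^-1).
Proof.
by move=> /circle_neq0 h; rewrite coords_mkt //; case: b; rewrite ?invr_eq0.
Qed.

Lemma arc_torus_compact b z : `|z| = 1 -> X (arc_torus b z).
Proof.
move=> h; rewrite /compact_torus /= coords_arc_torus //=; split=> //.
by case: b => //; exact: circleV.
Qed.

Lemma arc_torus_fixed b z : `|z| = 1 -> torus_act (line_elt b) (arc_torus b z) = arc_torus b z.
Proof.
move=> h; case: b; rewrite /line_elt; apply: coords_inj.
  by rewrite act_a coords_arc_torus.
by rewrite act_ar3 coords_arc_torus //= invrK.
Qed.

Lemma fixed_arc_torus b t : X t -> torus_act (line_elt b) t = t ->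
  t = arc_torus b (coords t).1.
Proof.
move=> [h _] ht; apply: coords_inj; rewrite coords_arc_torus // [LHS]surjective_pairing.
by case: b ht => [/fixed_a|/fixed_ar3] ->.
Qed.

Lemma sign_torus_compact e1 e2 : X (sign_torus C e1 e2).
Proof. by rewrite /compact_torus /= coords_sign_torus /= !normr_sign. Qed.

Definition compact_piece (n : nat) : topologicalType :=
  match n with
  | 2 | 3 => unit_interval
  | 4 => orbit_space X G
  | _ => discrete_topology unit
  end.

Local Notation sum := {i : 'I_6 & compact_component R G i}.

Definition in_piece n (hn : (n < 6)%N) (x : compact_piece n) : sum :=
  existT (fun i => compact_component R G i) (Ordinal hn) x.

Lemma in_piece_continuous n (hn : (n < 6)%N) : continuous (@in_piece n hn).
Proof. by move=> x U nU; exact: nU. Qed.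

Definition compact_to_sum : ext -> sum :=
  stratum (fun y : orbit_quot X G => @in_piece 4 isT y)
    (fun t => @in_piece 2 isT (arc_coord t)) (fun t => @in_piece 3 isT (arc_coord t))
    (@in_piece 0 isT tt) (@in_piece 1 isT tt) (@in_piece 5 isT tt).

Lemma in_piece2V t : X t ->
  @in_piece 2 isT (arc_coord (torus_act weyl_r3 t)) = @in_piece 2 isT (arc_coord t).
Proof. by move=> h; rewrite arc_coordV. Qed.

Lemma in_piece3V t : X t ->
  @in_piece 3 isT (arc_coord (torus_act weyl_r3 t)) = @in_piece 3 isT (arc_coord t).
Proof. by move=> h; rewrite arc_coordV. Qed.

Definition piece_to_compact n : compact_piece n -> ext :=
  match n return compact_piece n -> ext with
  | 0 => fun=> compact_cls weyl_r3 (sign_torus C false false)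
  | 1 => fun=> compact_cls weyl_r3 (sign_torus C true true)
  | 2 => fun x => compact_cls (line_elt true) (arc_torus true (arc (set_val x)))
  | 3 => fun x => compact_cls (line_elt false) (arc_torus false (arc (set_val x)))
  | 4 => fun y => compact_cls 1%g (set_val (generic_quotient.repr (y : orbit_quot X G)))
  | _ => fun=> compact_cls weyl_r3 (sign_torus C false true)
  end.

Definition sum_to_compact (s : sum) : ext := piece_to_compact (n := val (tag s)) (tagged s).

Lemma compact_to_sumE (p : fixed_pairs X G) : compact_to_sum (\pi_ext p) =
  pair_stratum (fun y : orbit_quot X G => @in_piece 4 isT y)
    (fun t => @in_piece 2 isT (arc_coord t)) (fun t => @in_piece 3 isT (arc_coord t))
    (@in_piece 0 isT tt) (@in_piece 1 isT tt) (@in_piece 5 isT tt) p.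
Proof. exact: (stratumE hG _ _ _ _ in_piece2V in_piece3V). Qed.

Lemma compact_to_sumK : cancel compact_to_sum sum_to_compact.
Proof.
move=> y; have [p ->] : exists p : fixed_pairs X G, y = \pi_ext p.
  by exists (generic_quotient.repr y); rewrite reprK.
rewrite compact_to_sumE /pair_stratum; have Xp := set_mem (pair_pt_in p).
have fp := pair_fixed p; have kp := pair_elt_in hG p.
have line b : pair_elt p = line_elt b ->
    compact_cls (line_elt b) (arc_torus b (arc ((complex.Re (coords (pair_pt p)).1 + 1) / 2))) =
    \pi_ext p.
  move=> e; rewrite e in fp; have h := proj1 Xp.
  have et := fixed_arc_torus Xp fp.
  case: (arc_Re h) => ->.
    by rewrite -et (compact_cls_pair p klein1) torus_act1 e.
  rewrite (compact_cls_pair p klein_r3) e; congr compact_cls.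
  apply: coords_inj; rewrite act_r3 et !coords_arc_torus ?circleV //=.
  by case: (b).
have [w1|w1] := eqVneq (pair_elt p) 1%g.
  rewrite /sum_to_compact /= ext_projE.
  set s := exist _ _ _; set s' := generic_quotient.repr _.
  have /eqmodP/asboolP[v [hv e]] : s = s' %[mod orbit_quot X G] by rewrite reprK.
  have hv' : v \in klein by rewrite -hG.
  by rewrite e -[set_val s]/(pair_pt p) -w1 -(compact_cls_pair p hv').
have [wa|wa] := eqVneq (pair_elt p) weyl_a.
  rewrite /sum_to_compact /= -(line true) //; congr (compact_cls _ (arc_torus _ (arc _))).
  exact: arc_coordE.
have [war|war] := eqVneq (pair_elt p) (weyl_a * weyl_r3)%g.
  rewrite /sum_to_compact /= -(line false) //; congr (compact_cls _ (arc_torus _ (arc _))).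
  exact: arc_coordE.
have wr : pair_elt p = weyl_r3.
  by case/kleinP: kp => h //; rewrite h eqxx in w1 wa war.
rewrite wr in fp.
have n11 : (-1 == 1 :> C) = false.
  by rewrite eq_sym -subr_eq0 opprK -[_ == 0]/(2%:R == 0) pnatr_eq0.
have E (e1 e2 : bool) : coords (pair_pt p) = ((-1) ^+ e1, (-1) ^+ e2) ->
    compact_cls weyl_r3 (sign_torus C e1 e2) = \pi_ext p.
  move=> e; rewrite (compact_cls_pair p klein1) torus_act1 wr; congr compact_cls.
  by apply: coords_inj; rewrite coords_sign_torus.
have [[h1|h1] [h2|h2]] := fixed_r3 fp; have e := surjective_pairing (coords (pair_pt p));
  rewrite h1 h2 in e; rewrite e !xpair_eqE ?eqxx ?n11 ?[1 == -1]eq_sym ?n11 /= /sum_to_compact /=.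
- exact: E.
- exact: E.
- rewrite (compact_cls_pair p klein_a) wr; congr compact_cls.
  by apply: coords_inj; rewrite act_a coords_sign_torus e.
- exact: E.
Qed.

Lemma sum_to_compactK : cancel sum_to_compact compact_to_sum.
Proof.
have hK w : w \in klein -> w \in G by rewrite hG.
have [[d1 d2 d3] [d4 d5 d6]] := klein_distinct.
have n11 : (-1 == 1 :> C) = false.
  by rewrite eq_sym -subr_eq0 opprK -[_ == 0]/(2%:R == 0) pnatr_eq0.
have sgn e1 e2 : compact_to_sum (compact_cls weyl_r3 (sign_torus C e1 e2)) =
    if ((-1) ^+ e1, (-1) ^+ e2) == (1, 1) :> C * C then @in_piece 0 isT tt
    else if ((-1) ^+ e1, (-1) ^+ e2) == (-1, -1) :> C * C then @in_piece 1 isT tt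
    else @in_piece 5 isT tt.
  rewrite (compact_cls_mkpair (hK _ klein_r3) (sign_torus_compact e1 e2) (sign_torus_fixed C e1 e2)).
  rewrite compact_to_sumE /pair_stratum.
  rewrite -[pair_elt _]/weyl_r3 -[pair_pt _]/(sign_torus C e1 e2).
  by rewrite (negPf d2) (negPf d4) (negPf d6) coords_sign_torus.
have line b (x : unit_interval) :
    compact_to_sum (compact_cls (line_elt b) (arc_torus b (arc (set_val x)))) =
    if b then @in_piece 2 isT x else @in_piece 3 isT x.
  have h := arc_circle (interval_bounds x).
  have E : arc_coord (arc_torus b (arc (set_val x))) = x.
    apply: val_inj; rewrite [LHS]arc_coordE; last exact: arc_torus_compact.
    rewrite coords_arc_torus //=.
    by rewrite subrK mulrC mulKf // pnatr_eq0.
  rewrite (compact_cls_mkpair (hK _ (line_elt_in b)) (arc_torus_compact b h) (arc_torus_fixed b h)).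
  rewrite compact_to_sumE /pair_stratum.
  rewrite -[pair_elt _]/(line_elt b) -[pair_pt _]/(arc_torus b (arc (set_val x))) E.
  by case: (b); rewrite /line_elt ?(negPf d1) ?(negPf d3) ?(negPf d5) !eqxx.
move=> [[[|[|[|[|[|[|n]]]]]] hn] x] //; rewrite /sum_to_compact /=.
- by rewrite sgn eqxx (bool_irrelevance hn isT); case: x.
- by rewrite sgn !xpair_eqE !expr1 n11 !eqxx (bool_irrelevance hn isT); case: x.
- rewrite -[LHS]/(compact_to_sum (compact_cls (line_elt true) (arc_torus true (arc (set_val (x : unit_interval)))))).
  by rewrite line (bool_irrelevance hn isT).
- rewrite -[LHS]/(compact_to_sum (compact_cls (line_elt false) (arc_torus false (arc (set_val (x : unit_interval)))))).
  by rewrite line (bool_irrelevance hn isT).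
- set s := generic_quotient.repr _.
  have hs : X (set_val s) := set_mem (valP s).
  rewrite (compact_cls_mkpair (group1 G) hs (torus_act1 _)) compact_to_sumE /pair_stratum.
  rewrite -[pair_elt _]/(1%g : weylG2) eqxx ext_projE (bool_irrelevance hn isT).
  congr (@in_piece 4 isT _); rewrite -[RHS]reprK -/s; congr (\pi_(orbit_quot X G) _).
  exact: val_inj.
- have e1 : ((-1) ^+ false, (-1) ^+ true) == (1, 1) :> C * C = false.
    by rewrite xpair_eqE expr1 n11 andbF.
  have e2 : ((-1) ^+ false, (-1) ^+ true) == (-1, -1) :> C * C = false.
    by rewrite xpair_eqE expr0 eq_sym n11.
  by rewrite sgn e1 e2 (bool_irrelevance hn isT); case: x.
Qed.

Lemma affine_continuous (a b : R) : continuous (fun x : R => a * x + b).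
Proof.
by move=> x; apply: cvgD; [apply: cvgM; [exact: cvg_cst | exact: cvg_id] | exact: cvg_cst].
Qed.

Lemma arc_Im_continuous : continuous (fun x : R => Num.sqrt (1 - (2 * x - 1) ^+ 2)).
Proof.
apply: comp_continuous; last exact: sqrt_continuous.
move=> x; apply: cvgB; first exact: cvg_cst.
by rewrite expr2; apply: cvgM; exact: affine_continuous.
Qed.

Lemma arc_continuous : continuous (arc : R -> C).
Proof.
by apply: complex_continuous; [exact: affine_continuous | exact: arc_Im_continuous].
Qed.

Lemma sum_to_compact_continuous : continuous (sum_to_compact : sum -> ext_space X G).
Proof.
have cst (f : discrete_topology unit -> ext_space X G) : continuous f.
  by apply: locally_constant_continuous => x; apply: (filterS _ filterT) => -[] _; case: x.
have line b : continuous (fun x : unit_interval =>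
    compact_cls (line_elt b) (arc_torus b (arc (set_val x))) : ext_space X G).
  have h x : `|arc (set_val (x : unit_interval)) : C| = 1 := arc_circle (interval_bounds x).
  have ca : continuous (fun x : unit_interval => arc (set_val x) : C).
    apply: comp_continuous; [exact: set_val_continuous | exact: arc_continuous].
  (* On the circle the inverse is the conjugate, so its continuity is read off real and imaginary
     parts. *)
  have cV : continuous (fun x : unit_interval => (arc (set_val x) : C)^-1).
    apply: complex_continuous.
      apply: (@eq_continuous _ _ (fun x : unit_interval => complex.Re (arc (set_val x)))).
        by move=> x; rewrite (circle_inv (h x)).
      exact: (comp_continuous ca (@Re_continuous R)).
    apply: (@eq_continuous _ _ (fun x : unit_interval => - Num.sqrt (1 - (2 * set_val x - 1) ^+ 2))).
      by move=> x; rewrite (circle_inv (h x)).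
    apply: (comp_continuous (@set_val_continuous _ _)
      (g := fun x : R => - Num.sqrt (1 - (2 * x - 1) ^+ 2))) => x.
    by apply: cvgN; exact: arc_Im_continuous.
  apply: compact_cls_continuous; [exact: line_elt_in | | |].
  - by move=> x; apply: arc_torus_compact.
  - by move=> x; apply: arc_torus_fixed.
  apply: torus_continuous.
    by apply: eq_continuous ca => x; rewrite coords_arc_torus.
  case: b.
    by apply: eq_continuous ca => x; rewrite coords_arc_torus.
  by apply: eq_continuous cV => x; rewrite coords_arc_torus.
apply: sigT_map_continuous => -[[|[|[|[|[|[|n]]]]]] hn] //=; try exact: cst.
- exact: (line true).
- exact: (line false).
- apply/quotient_continuous.
  (* The chosen representative need not depend continuously on the orbit; the class does not change
     when it is replaced by the point itself. *)
  apply: (@eq_continuous _ _ (fun s : set_type X => compact_cls 1%g (set_val s) : ext_space X G)).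
    move=> s; rewrite /sum_to_compact /=; set s' := generic_quotient.repr _.
    have /eqmodP/asboolP[v [hv e]] : s = s' %[mod orbit_quot X G] by rewrite reprK.
    have hs : X (set_val s) := set_mem (valP s).
    rewrite e (compact_cls_mkpair (group1 G) hs (torus_act1 _)) (@compact_cls_pair _ v) //.
    by rewrite -hG.
  apply: compact_cls_continuous; [exact: klein1 | | |exact: set_val_continuous].
  + by move=> s; exact: set_mem (valP s).
  + by move=> s; exact: torus_act1.
Qed.

Lemma compact_to_sum_continuous : continuous (compact_to_sum : ext_space X G -> sum).
Proof.
apply/quotient_continuous; apply: sigT_map_continuous => w.
have hw : sgval w \in klein by rewrite -hG; exact: subgP.
pose pt (x : @fixed_points C X (sgval w)) : torus C := set_val x.
have cpt : continuous pt by exact: set_val_continuous.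
have Xpt x : X (pt x) by have [] := set_mem (valP x).
have [[d1 d2 d3] [d4 d5 d6]] := klein_distinct.
have E x : (compact_to_sum \o \pi_(ext_space X G)) (existT _ w x : fixed_pairs X G) =
    pair_stratum (fun y : orbit_quot X G => @in_piece 4 isT y)
      (fun t => @in_piece 2 isT (arc_coord t)) (fun t => @in_piece 3 isT (arc_coord t))
      (@in_piece 0 isT tt) (@in_piece 1 isT tt) (@in_piece 5 isT tt)
      (existT _ w x : fixed_pairs X G).
  exact: compact_to_sumE.
have ca : continuous (fun x => arc_coord (pt x)).
  apply: set_type_continuous.
  apply: (@eq_continuous _ _ (fun x => (complex.Re (coords (pt x)).1 + 1) / 2)).
    by move=> x; rewrite arc_coordE.
  apply: (@comp_continuous _ _ _ (fun x => complex.Re (coords (pt x)).1) (fun y : R => (y + 1) / 2)); last first.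
    apply: (@eq_continuous _ _ (fun y : R => 2^-1 * y + 2^-1)) (@affine_continuous _ _) => y.
    by rewrite mulrDl mul1r mulrC.
  apply: (@comp_continuous _ _ _ (fun x => (coords (pt x)).1) (fun z : C => complex.Re z)).
    exact: (comp_continuous cpt (proj1 (@coords_continuous R))).
  exact: Re_continuous.
case/kleinP: hw => ew.
- pose F x : set_type X := exist (fun t => t \in X) (pt x) (mem_set (Xpt x)).
  apply: (@eq_continuous _ _ (fun x => @in_piece 4 isT (\pi_(orbit_space X G) (F x)))).
    move=> x; rewrite E /pair_stratum /pair_elt /= ew eqxx ext_projE; congr (in_piece _ _).
    by congr (\pi_(orbit_quot X G) _); exact: val_inj.
  apply: (@comp_continuous _ (orbit_space X G) _ (fun x => \pi_(orbit_space X G) (F x))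
    (@in_piece 4 isT)); last exact: (@in_piece_continuous 4 isT).
  apply: comp_continuous; last exact: pi_continuous.
  exact: set_type_continuous.
- apply: (@eq_continuous _ _ (fun x => @in_piece 2 isT (arc_coord (pt x)))).
    by move=> x; rewrite E /pair_stratum /pair_elt /= ew (negPf d1) eqxx.
  exact: (comp_continuous ca (@in_piece_continuous 2 isT)).
- have ft x : torus_act weyl_r3 (pt x) = pt x.
    have ftw : torus_act (sgval w) (pt x) = pt x by have [_] := set_mem (valP x).
    by move: (pt x) ftw => t; rewrite ew.
  (* The fixed points of [weyl_r3] have coordinates 1 and -1, at distance 2, so they are isolated
     and the map is locally constant. *)
  have near1 (z : C) : z = 1 \/ z = -1 -> nbhs z [set w : C | w = 1 \/ w = -1 -> w = z].
    move=> hz; apply/complex_nbhsP; exists 1; split=> // w' hw' h'.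
    apply/eqP; rewrite eq_sym; move: hw'; case: hz => ->; case: h' => -> //.
    - by rewrite opprK -[X in `|X|]/(2%:R) normr_nat -[(1%:C)%C]/(1%:R : C) ltr_nat.
    - by rewrite -opprD normrN -[X in `|X|]/(2%:R) normr_nat -[(1%:C)%C]/(1%:R : C) ltr_nat.
  apply: locally_constant_continuous => x.
  have c1 := comp_continuous cpt (proj1 (@coords_continuous R)).
  have c2 := comp_continuous cpt (proj2 (@coords_continuous R)).
  have [f1 f2] := fixed_r3 (ft x).
  have n1 := c1 x _ (near1 _ f1); have n2 := c2 x _ (near1 _ f2).
  change (nbhs x [set y | (coords (pt y)).1 = 1 \/ (coords (pt y)).1 = -1 ->
    (coords (pt y)).1 = (coords (pt x)).1]) in n1.
  change (nbhs x [set y | (coords (pt y)).2 = 1 \/ (coords (pt y)).2 = -1 ->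
    (coords (pt y)).2 = (coords (pt x)).2]) in n2.
  apply: filterS2 n1 n2 => y h1 h2; have [g1 g2] := fixed_r3 (ft y).
  have e : pt y = pt x.
    apply: coords_inj; rewrite (surjective_pairing (coords (pt y))) h1 // h2 //.
    by rewrite -surjective_pairing.
  by change (compact_to_sum (\pi_ext (existT _ w y : fixed_pairs X G)) = compact_to_sum (\pi_ext (existT _ w x : fixed_pairs X G)));
    congr (compact_to_sum (\pi_ext (existT _ w _))); exact: val_inj.
- apply: (@eq_continuous _ _ (fun x => @in_piece 3 isT (arc_coord (pt x)))).
    by move=> x; rewrite E /pair_stratum /pair_elt /= ew (negPf d3) (negPf d5) eqxx.
  exact: (comp_continuous ca (@in_piece_continuous 3 isT)).
Qed.

Lemma compact_to_sum_homeomorphism :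
  @homeomorphism (ext_space X G) sum compact_to_sum.
Proof.
exists sum_to_compact; split; [exact: compact_to_sumK | exact: sum_to_compactK | |].
- exact: compact_to_sum_continuous.
- exact: sum_to_compact_continuous.
Qed.

Lemma compact_to_sum_piece (y : ext) w z : is_class y w z ->
  piece_index w z = tag (compact_to_sum y).
Proof.
move=> [p [-> <- <-]]; rewrite compact_to_sumE /pair_stratum /piece_index.
by do ![case: ifP => _].
Qed.

Lemma compact_to_sum_identity (y : ext) z : is_class y 1%g z ->
  compact_to_sum y = @in_piece 4 isT (ext_proj y).
Proof. by move=> [p [-> e _]]; rewrite compact_to_sumE /pair_stratum e eqxx. Qed.
End CompactTorus.

(** A countable set has Lebesgue measure 0, whereas the unit interval has measure 1. *)
Lemma complex_uncountable (R : realType) : ~ countable [set: R[i]].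
Proof.
move=> h.
have h1 : countable (`[0, 1]%classic : set R).
  apply/countable_injP; have /countable_injP[f hf] := h.
  exists (fun x => f (x%:C)%C) => x y _ _ e.
  have : (x%:C)%C = (y%:C)%C :> R[i] by apply: hf => //; rewrite in_setT.
  by case.
have := countable_lebesgue_measure0 h1.
rewrite lebesgue_measure_itv /= lte_fin ltr01 sube0 => /eqP.
by rewrite eqe oner_eq0.
Qed.

Theorem lemma8p1 (R : realType)
  (F : fieldType) (v : F -> int) (hF : local_field v)
  (p : nat) (hp : residue_char v p) (hp235 : p \notin [:: 2; 3; 5]%N)
  (chi : F -> R[i]) (chi_smooth : smooth_char v chi)
  (chi_quadratic : quadratic_char v chi) (chi_ramified : ~ unramified v chi) :
  let Ws : {group weylG2} := inertial_group chi_smooth in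
  [/\ (Ws = [set 1; weyl_a; weyl_r3; weyl_a * weyl_r3]%SET :> {set weylG2})%g,
      (Ws \isog [set: 'Z_2 * 'Z_2]%SET)%g,
      exists f : ext_variety R[i] Ws -> sum_variety (@dual_component R[i] Ws),
      [/\ variety_iso f,
          forall y w z, is_class y w z -> piece_index w z = tag (f y) &
          forall y z, is_class y 1%g z ->
            f y = existT _ (Ordinal (isT : (4 < 6)%N)) (ext_proj y)],
      exists f : ext_space (@compact_torus R[i]) Ws ->
                 {i : 'I_6 & compact_component R Ws i},
      [/\ homeomorphism f,
          forall y w z, is_class y w z -> piece_index w z = tag (f y) &
          forall y z, is_class y 1%g z ->
            f y = existT _ (Ordinal (isT : (4 < 6)%N)) (ext_proj y)] &
  [/\ exists f : {rmorphism coordring (orbit_variety R[i] Ws) ->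
                            coordring (plane_mod_sign R[i])},
        bijective f /\ forall c, f (cst_coord _ c) = cst_coord _ c &
      forall (D : kl_datum R[i] Ws) (J : kalg (coordring (orbit_variety R[i] Ws)))
        (t : ext_affine Ws -> restr (iota_ Ws) J) (Dist : set (ext_affine Ws))
        (phi : {linear fsfunc (ext_affine Ws) R[i] -> restr (iota_ Ws) J}),
      asymptotic_algebra D t Dist phi ->
      forall ee e1 e1' e0 : set (ext_affine Ws), cell_labels D ee e1 e1' e0 ->
      forall Jee J1 J1' J0 : ideal J,
      is_cell_ideal t ee Jee -> is_cell_ideal t e1 J1 ->
      is_cell_ideal t e1' J1' -> is_cell_ideal t e0 J0 ->
      [/\ geom_equiv (iota_ Ws) J (ext_coord R[i] Ws),
          morita (restr_kalg (iota_ Ws) (kalg_of_ideal Jee))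
                 (restr_kalg (iota_ Ws) (piece_coord R[i] Ws [:: 0; 1]%N)),
          morita (restr_kalg (iota_ Ws) (kalg_of_ideal J1))
                 (restr_kalg (iota_ Ws) (piece_coord R[i] Ws [:: 2]%N)),
          morita (restr_kalg (iota_ Ws) (kalg_of_ideal J1'))
                 (restr_kalg (iota_ Ws) (piece_coord R[i] Ws [:: 3]%N)) &
          geom_equiv (iota_ Ws) (kalg_of_ideal J0) (piece_coord R[i] Ws [:: 4; 5]%N)]]].
Proof.
move=> Ws; have hG : Ws = klein :> {set weylG2} := inertial_group_klein chi_smooth chi_quadratic chi_ramified.
split.
- exact: hG.
- exact: klein_isog.
- exists (@ext_to_sum R[i] Ws); split; first exact: ext_to_sum_iso.
    by move=> y w z; exact: ext_to_sum_piece.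
  by move=> y z h; rewrite (ext_to_sum_identity hG h); congr existT; exact: val_inj.
- exists (@compact_to_sum R Ws); split; first exact: compact_to_sum_homeomorphism.
    by move=> y w z; exact: compact_to_sum_piece.
  by move=> y z h; rewrite (compact_to_sum_identity hG h); congr existT; exact: val_inj.
split; first exact: coordring_plane_iso.
move=> D J t Dist phi hJ ee e1 e1' e0 hl Jee J1 J1' J0 hee h1 h1' h0.
have [eeE e0E [b [e1E e1'E]]] := cell_labelsE hG hl.
split.
- exact: (asymptotic_geom_equiv hG (@complex_uncountable R) hJ).
- exact: (point_cell_morita hG hJ eeE hee).
- exact: (line_cell_morita hG hJ true e1E h1).
- apply: (line_cell_morita (b := ~~ b) hG hJ false _ h1'); by rewrite negbK.
- exact: (lowest_geom_equiv hG (@complex_uncountable R) hJ e0E h0).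
Qed.
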